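(* Let $g$ be a Riemannian metric on $\mathbb{S}^3$ whose scalar curvature $R_g$ is positive and smooth, and let $K$ be a positive smooth function on $\mathbb{S}^3$. Consider the system $$\begin{cases} -\Delta_g u + \dfrac{R_g}{8}u = K u|\psi|^2, & \text{on } \mathbb{S}^3,\\ D_g\psi = K u^2\psi, & \text{on } \mathbb{S}^3,\end{cases}$$ where $u\in H^1(\mathbb{S}^3)$ is a positive scalar field and $\psi\in H^{1/2}(\Sigma\mathbb{S}^3)$ is a spinor field. There exist constants $c>0$ and $C>0$, depending only on $R_g$ and $K$ (for the given $(\mathbb{S}^3,g)$), such that every solution $(u,\psi)\not\equiv(0,0)$ satisfies $$\|u\|_{H^1}\ge c,\qquad \|\psi\|_{H^{1/2}}\ge c,$$ and $$\frac{c}{\|u\|_{H^1}}\le\|\psi\|_{H^{1/2}}\le C\,\|u\|_{H^1}^2 .$$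
   Context: $(\mathbb{S}^3,g)$ carries its unique spin structure with spinor bundle $\Sigma\mathbb{S}^3$; $\Delta_g$ is the (nonpositive) Laplace–Beltrami operator and $D_g\psi=\sum_{\alpha=1}^3 e_\alpha\cdot\nabla_{e_\alpha}\psi$ is the Dirac operator (with $X\cdot Y+Y\cdot X=-2g(X,Y)$). $H^1(\mathbb{S}^3)$ is the usual Sobolev space, where (since $R_g>0$) one may use the equivalent norm $\|u\|_{H^1}^2=\int_{\mathbb{S}^3}(|\nabla u|^2+\frac{R_g}{8}u^2)\,dv_g$. $H^{1/2}(\Sigma\mathbb{S}^3)$ is the domain in $L^2$ of $|D_g|^{1/2}$ with norm $\|\psi\|_{H^{1/2}}^2=\|\psi\|_{L^2}^2+\||D_g|^{1/2}\psi\|_{L^2}^2$. Solutions are understood in the weak sense. *)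

(* Defs.v *)
From mathcomp Require Import all_boot all_order all_algebra.
From mathcomp Require Import complex.
From mathcomp Require Import all_classical all_reals all_analysis.
Import numFieldNormedType.Exports.

Set Implicit Arguments.
Unset Strict Implicit.
Unset Printing Implicit Defensive.
Import Order.TTheory GRing.Theory Num.Theory.
Local Open Scope classical_set_scope.
Local Open Scope ring_scope.
Local Open Scope complex_scope.

(* The three-sphere is the Euclidean unit sphere of R^4.  A function, vector
   field or spinor field on it is represented by a function on the whole of
   R^4 of which only the values on the sphere matter: derivatives, smoothness
   and integrals all compose it with the radial projection first.  (The norm
   `|x| of the library on row vectors is the sup norm, hence enorm.) *)

Section Sphere.
Context {R : realType}.
Notation V := 'rV[R]_4.

Definition dot (x y : V) : R := (x *m y^T) 0 0.
Definition enorm (x : V) : R := Num.sqrt (dot x x).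
Definition S3 : set V := [set x | enorm x = 1].
Definition sproj (x : V) : V := (enorm x)^-1 *: x.

Definition radial {W : Type} (f : V -> W) : V -> W := f \o sproj.

Fixpoint Ck_off0 (k : nat) (f : V -> R) : Prop :=
  (forall x, x != 0 -> {for x, continuous f}) /\
  if k is k'.+1 then
    forall i : 'I_4,
      (forall x, x != 0 -> derivable f x (delta_mx 0 i)) /\
      Ck_off0 k' (fun x => 'D_(delta_mx 0 i) f x)
  else True.

(* f is smooth on the sphere iff its 0-homogeneous extension is smooth on
   R^4 \ {0}. *)
Definition smooth (f : V -> R) : Prop := forall k, Ck_off0 k (radial f).

(* The derivative of f along X, meaningful at points of the sphere where X is
   tangent. *)
Definition dalong {W : normedModType R} (X : V -> V) (f : V -> W) : V -> W :=
  fun x => 'D_(X x) (radial f) x.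

Definition tangent (X : V -> V) : Prop := forall x, S3 x -> dot x (X x) = 0.

Definition lie (X Y : V -> V) : V -> V :=
  fun x => dalong X Y x - dalong Y X x.

(* The frame x |-> x i, x j, x k, where R^4 is identified with the
   quaternions; it is orthonormal for the round metric. *)
Definition quat_frame (a : 'I_3) (x : V) : V :=
  let x0 := x 0 (inord 0) in let x1 := x 0 (inord 1) in
  let x2 := x 0 (inord 2) in let x3 := x 0 (inord 3) in
  \row_(i < 4) nth 0 (nth [::] [:: [:: - x1; x0; x3; - x2];
                                   [:: - x2; - x3; x0; x1];
                                   [:: - x3; x2; - x1; x0]] a) i.

(* The round measure of the sphere is four times the image of the Lebesgue
   measure of the punctured unit ball of R^4 under the radial projection
   (4 is the inverse of the integral of r^3 over [0, 1]). *)

Notation R4 := (measurableTypeR R * measurableTypeR R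
                * measurableTypeR R * measurableTypeR R)%type.

Definition leb4 : {measure set R4 -> \bar R} :=
  (@lebesgue_measure R \x @lebesgue_measure R
   \x @lebesgue_measure R \x @lebesgue_measure R)%E.

Definition pt4 (y : R4) : V :=
  let: (y0, y1, y2, y3) := y in \row_(i < 4) nth 0 [:: y0; y1; y2; y3] i.

Definition ball4 : set R4 := [set y | 0 < enorm (pt4 y) < 1].

Definition measurable_S3 (f : V -> R) : Prop :=
  measurable_fun ball4 (fun y => f (sproj (pt4 y))).

Definition ae_S3 (P : V -> Prop) : Prop :=
  {ae leb4, forall y, ball4 y -> P (sproj (pt4 y))}.

Definition integrable_round (f : V -> R) : Prop :=
  leb4.-integrable ball4 (fun y => (f (sproj (pt4 y)))%:E).

Definition int_round (f : V -> R) : R :=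
  4%:R * \int[leb4]_(y in ball4) f (sproj (pt4 y)).
End Sphere.

Section Riemannian.
Context {R : realType}.
Notation V := 'rV[R]_4.

(* A metric is given at x \in S3 by a 4 x 4 matrix, of which only the bilinear
   form induced on the tangent space (the orthogonal of x) is relevant. *)
Definition riemannian_metric (g : V -> 'M[R]_4) : Prop :=
  [/\ forall i j, smooth (fun x => g x i j),
      forall x, S3 x -> (g x)^T = g x &
      forall x v, S3 x -> dot x v = 0 -> v != 0 ->
        0 < (v *m g x *m v^T) 0 0].

Variable g : V -> 'M[R]_4.

Definition ip (X Y : V -> V) : V -> R :=
  fun x => (X x *m g x *m (Y x)^T) 0 0.

Definition normalize (X : V -> V) : V -> V :=
  fun x => (Num.sqrt (ip X X x))^-1 *: X x.

(* Gram-Schmidt orthonormalization of quat_frame: a global smooth g-orthonormal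
   frame of the tangent bundle. *)
Definition frame1 : V -> V := normalize (quat_frame 0).
Definition frame2 : V -> V :=
  let Y := quat_frame 1 in
  normalize (fun x => Y x - ip Y frame1 x *: frame1 x).
Definition frame3 : V -> V :=
  let Z := quat_frame 2%:R in
  normalize (fun x => Z x - ip Z frame1 x *: frame1 x
                          - ip Z frame2 x *: frame2 x).
Definition frame (a : 'I_3) : V -> V := nth 0 [:: frame1; frame2; frame3] a.

(* Koszul's formula for 2 g(nabla_X Y, Z). *)
Definition koszul (X Y Z : V -> V) : V -> R :=
  fun x => dalong X (ip Y Z) x + dalong Y (ip X Z) x - dalong Z (ip X Y) x
         + ip (lie X Y) Z x - ip (lie X Z) Y x - ip (lie Y Z) X x.

Definition levi_civita (X Y : V -> V) : V -> V :=
  fun x => \sum_a (koszul X Y (frame a) x / 2%:R) *: frame a x.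

Definition riemann (X Y Z : V -> V) : V -> V :=
  fun x => levi_civita X (levi_civita Y Z) x
         - levi_civita Y (levi_civita X Z) x
         - levi_civita (lie X Y) Z x.

Definition scalar_curvature : V -> R :=
  fun x => \sum_a \sum_b
    ip (riemann (frame a) (frame b) (frame b)) (frame a) x.

Definition gradient (f : V -> R) : V -> V :=
  fun x => \sum_a dalong (frame a) f x *: frame a x.

Definition vol_density : V -> R :=
  fun x => Num.sqrt (\det (\matrix_(a, b) ip (quat_frame a) (quat_frame b) x)).

Definition integrable_vol (f : V -> R) : Prop :=
  integrable_round (fun x => f x * vol_density x).

Definition int_vol (f : V -> R) : R :=
  int_round (fun x => f x * vol_density x).

Definition L2fun (u : V -> R) : Prop :=
  measurable_S3 u /\ integrable_vol (fun x => u x ^+ 2).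

Definition L2field (X : V -> V) : Prop :=
  [/\ tangent X, forall i, measurable_S3 (fun x => X x 0 i) &
      integrable_vol (ip X X)].

(* X is the weak gradient of u \in H^1, where H^1 is the completion of the
   smooth functions: u and X are the L^2-limits of smooth functions and of
   their gradients. *)
Definition h1_gradient (u : V -> R) (X : V -> V) : Prop :=
  [/\ L2fun u, L2field X &
      exists phi : nat -> V -> R,
        [/\ forall n, smooth (phi n),
            int_vol (fun x => (phi n x - u x) ^+ 2) @[n --> \oo] --> (0 : R) &
            int_vol (let Y := gradient (phi n) \- X in ip Y Y)
              @[n --> \oo] --> (0 : R)]].

Definition H1 (u : V -> R) : Prop := exists X, h1_gradient u X.

Definition wgrad (u : V -> R) : V -> V := xget 0 (h1_gradient u).

Definition H1norm (u : V -> R) : R :=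
  Num.sqrt (int_vol (fun x => ip (wgrad u) (wgrad u) x
                            + scalar_curvature x / 8%:R * u x ^+ 2)).
End Riemannian.

(* The frame trivializes the oriented orthonormal frame bundle, hence its
   unique spin structure, so that spinor fields are C^2-valued functions on
   which the a-th vector of the frame acts through the matrix cliff a. *)
Section Spinors.
Context {R : realType}.
Notation V := 'rV[R]_4.
Notation spinor := (V -> 'cV[R[i]]_2).

(* The unit quaternions i, j, k:
   cliff a *m cliff b + cliff b *m cliff a = - 2 delta_ab. *)
Definition cliff (a : 'I_3) : 'M[R[i]]_2 :=
  \matrix_(k < 2, l < 2)
    nth 0 (nth [::] (nth [::] [:: [:: [:: 'i; 0]; [:: 0; - 'i]];
                                  [:: [:: 0; 1]; [:: -1; 0]];
                                  [:: [:: 0; 'i]; [:: 'i; 0]]] a) k) l.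

Definition herm (s t : 'cV[R[i]]_2) : R[i] :=
  \sum_k s k 0 * conjc (t k 0).

Definition sqnorm (s : 'cV[R[i]]_2) : R := complex.Re (herm s s).

Definition re_comp (psi : spinor) (k : 'I_2) : V -> R :=
  fun x => complex.Re (psi x k 0).
Definition im_comp (psi : spinor) (k : 'I_2) : V -> R :=
  fun x => complex.Im (psi x k 0).

Definition smooth_spinor (psi : spinor) : Prop :=
  forall k, smooth (re_comp psi k) /\ smooth (im_comp psi k).

Definition sdalong (X : V -> V) (psi : spinor) : spinor :=
  fun x => \col_k (dalong X (re_comp psi k) x +i* dalong X (im_comp psi k) x).

Variable g : V -> 'M[R]_4.

(* The spin connection, the lift of the Levi-Civita connection. *)
Definition spin_nabla (X : V -> V) (psi : spinor) : spinor :=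
  fun x => sdalong X psi x +
    4%:R^-1 *: \sum_b \sum_c
      (ip g (levi_civita g X (frame g b)) (frame g c) x)%:C *:
        (cliff b *m cliff c *m psi x).

Definition dirac (psi : spinor) : spinor :=
  fun x => \sum_a cliff a *m spin_nabla (frame g a) psi x.

Definition cint_vol (f : V -> R[i]) : R[i] :=
  int_vol g (fun x => complex.Re (f x)) +i*
  int_vol g (fun x => complex.Im (f x)).

Definition L2spinor (psi : spinor) : Prop :=
  (forall k, measurable_S3 (re_comp psi k) /\ measurable_S3 (im_comp psi k)) /\
  integrable_vol g (fun x => sqnorm (psi x)).

Definition L2dot (psi phi : spinor) : R[i] :=
  cint_vol (fun x => herm (psi x) (phi x)).

Definition L2sqnorm (psi : spinor) : R := int_vol g (fun x => sqnorm (psi x)).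

(* Unbounded operators on L^2 are given by their graphs, which do not
   distinguish between fields that are equal almost everywhere. *)
Notation operator := (spinor -> spinor -> Prop).

(* The L^2-closure of the Dirac operator on smooth spinors. *)
Definition dirac_closure : operator := fun psi chi =>
  [/\ L2spinor psi, L2spinor chi &
      exists phi : nat -> spinor,
        [/\ forall n, smooth_spinor (phi n),
            L2sqnorm (phi n \- psi) @[n --> \oo] --> (0 : R) &
            L2sqnorm (dirac (phi n) \- chi) @[n --> \oo] --> (0 : R)]].

Definition op_comp (A B : operator) : operator := fun psi chi =>
  exists2 eta, B psi eta & A eta chi.

Definition densely_defined (A : operator) : Prop :=
  forall psi (e : R), L2spinor psi -> 0 < e ->
    exists phi eta, A phi eta /\ L2sqnorm (phi \- psi) < e.

(* A is densely defined and coincides with its adjoint. *)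
Definition self_adjoint (A : operator) : Prop :=
  densely_defined A /\
  forall psi chi, A psi chi <->
    [/\ L2spinor psi, L2spinor chi &
        forall phi eta, A phi eta -> L2dot chi phi = L2dot psi eta].

Definition nonneg_self_adjoint (A : operator) : Prop :=
  self_adjoint A /\ forall psi chi, A psi chi -> 0 <= L2dot chi psi.

(* The graph of the (unique) nonnegative self-adjoint square root of A. *)
Definition op_sqrt (A : operator) : operator := fun psi chi =>
  exists S : operator,
    [/\ nonneg_self_adjoint S,
        forall phi eta, A phi eta <-> op_comp S S phi eta &
        S psi chi].

Definition abs_dirac : operator :=
  op_sqrt (op_comp dirac_closure dirac_closure).
Definition sqrt_abs_dirac : operator := op_sqrt abs_dirac.

Definition H12 (psi : spinor) : Prop := exists chi, sqrt_abs_dirac psi chi.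

Definition H12norm (psi : spinor) : R :=
  Num.sqrt (L2sqnorm psi + L2sqnorm (xget 0 (sqrt_abs_dirac psi))).

(* - Delta_g u + R_g / 8 u = K u |psi|^2 in the weak sense. *)
Definition weak_scalar_eq (K u : V -> R) (psi : spinor) : Prop :=
  forall phi, smooth phi ->
    int_vol g (fun x => ip g (wgrad g u) (gradient g phi) x
                      + scalar_curvature g x / 8%:R * u x * phi x)
    = int_vol g (fun x => K x * u x * sqnorm (psi x) * phi x).

(* D_g psi = K u^2 psi in the weak sense. *)
Definition weak_dirac_eq (K u : V -> R) (psi : spinor) : Prop :=
  forall phi, smooth_spinor phi ->
    L2dot psi (dirac phi)
    = cint_vol (fun x => (K x * u x ^+ 2)%:C * herm (psi x) (phi x)).
End Spinors.

(* Main.v *)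
Require Import Defs.
From HB Require Import structures.
From mathcomp Require Import all_boot all_order all_algebra.
From mathcomp Require Import fingroup perm complex ring lra.
From mathcomp Require Import all_classical all_reals all_analysis.
From mathcomp Require Import measurable_realfun.
Import numFieldNormedType.Exports.

Set Implicit Arguments.
Unset Strict Implicit.
Unset Printing Implicit Defensive.
Import Order.TTheory GRing.Theory Num.Theory.
Local Open Scope classical_set_scope.
Local Open Scope ring_scope.

                                            

(** Write D for the closed Dirac operator, h for the H^1 norm of u and N0 = || |D|^(1/2) psi ||^2.
    The theorem rests on three facts. (i) Testing the scalar equation with u gives h^2 = int K u^2
    |psi|^2. (ii) Testing the Dirac equation with sign(D) psi gives N0 = Re int K u^2 <psi, sign(D)
    psi>, which Cauchy-Schwarz bounds by ||K u psi|| ||u sign(D) psi||. (iii) int u^2 |phi|^2 <= C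
    h^2 || |D|^(1/2) phi ||^2, applied to phi = psi and to phi = sign(D) psi, which have the same
    energy N0. By (i) and (iii), h^2 <= C h^2 N0. Since u is positive, h > 0, so N0 is bounded
    below. By (ii), (i) and (iii), N0 <= C h (h sqrt N0), that is N0 <= C h^4. Together these bound
    h below. A spectral gap of D gives ||psi||^2 <= C N0, so N0 is equivalent to the square of the
    full H^(1/2) norm. The bound c / h <= ||psi|| then follows from the two lower bounds. This is
    [solution_bounds], with [final_arithmetic] for the constants.

    Inequality (iii) stands in for the embedding of H^(1/2) into L^3, and is reached without
    interpolation or the spectral theorem. Hölder's inequality and the embedding of H^1 into L^6
    give ||f^2 phi|| <= C h^2 ||D phi|| for smooth f and phi ([dirac_product]). Heinz's inequality
    ([sqrt_form_bound]) halves the order: a bounded nonnegative multiplier M with ||M phi|| <= k ||D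
    phi|| satisfies <M phi, phi> <= k || |D|^(1/2) phi ||^2. It is proved by the Krein-Lax device:
    |D|^(-1) M is symmetric for the form of |D|, so its moments are log-convex, and their growth
    rate bounds the first ratio ([heinz_sequence]). The square roots are known only through
    self-adjointness and the relation |D|^2 = D^2, and sign(D) x is built as the preimage under D of
    |D| x ([sqrt_sign_test]). The multiplier is a truncation of u^2, and monotone convergence
    removes the truncation ([dominated_product]).

    Two geometric inputs remain. The first is the integrated Schrödinger-Lichnerowicz formula
    ([lichnerowicz]). With positive scalar curvature it gives the spectral gap and controls the H^1
    norm of phi by ||D phi|| ([dirac_lower]). It follows from a divergence theorem for the
    orthonormal frame ([frame_divergence]), which is reduced to the quaternionic frame and then to
    integration by parts in R^4. The second is the Sobolev inequality on the sphere ([sobolev]):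
    eight gnomonic charts reduce it to a cube, where the Gagliardo-Nirenberg argument runs through
    the Loomis-Whitney inequality. *)

Lemma quad_bound (R : realFieldType) (s a b e : R) : a <= e ->
  s ^+ 2 * b <= s ^+ 2 * e ->
  2%:R * a + 2%:R * (s * (s * b)) <= 2%:R * e * (1 + s ^+ 2).
Proof. by move=> h1 h2; lra. Qed.

Lemma sqr_sub_le (R : realFieldType) (a b A B : R) : a ^+ 2 <= A ->
  b ^+ 2 <= B -> (a - b) ^+ 2 <= 2%:R * (A + B).
Proof. by move=> h1 h2; have := sqr_ge0 (a + b); lra. Qed.

                                                                             
                               
(** If s 1 exceeded k * s 0, doubling the index with the Cauchy-Schwarz hypothesis would force s
    (2^j) to be at least (s 1 / s 0)^(2^j) * s 0, which outgrows c * k^(2^j). *)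
Lemma heinz_sequence (R : realType) (s : nat -> R) (c k : R) : 0 <= k ->
  (forall n, 0 <= s n.*2) ->
  (forall n m, s (n + m)%N ^+ 2 <= s n.*2 * s m.*2) ->
  (forall n, s n.*2 <= c * k ^+ n.*2) -> s 1 <= k * s 0.
Proof.
move=> k0 pos cs bnd; have s00 : 0 <= s 0 by exact: (pos 0).
have sq0 (x : R) : x ^+ 2 <= 0 -> x = 0.
  by move=> h; apply/eqP; rewrite -sqrf_eq0 eq_le h sqr_ge0.
have := cs 1 0; rewrite addn0 doubleS double0 => cs1.
move: s00; rewrite le_eqVlt => /orP[/eqP s0E|s00].
  by move: cs1; rewrite -s0E !mulr0 => /sq0 ->.
move: k0; rewrite le_eqVlt => /orP[/eqP k0E|k0].
  have s2 : s 2 = 0.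
    apply/eqP; rewrite eq_le (pos 1) andbT.
    by have := bnd 1; rewrite doubleS double0 -k0E expr0n mulr0.
  by move: cs1; rewrite s2 mul0r -k0E mul0r => /sq0 ->.
rewrite leNgt; apply/negP => lt1.
pose r := s 1 / (k * s 0).
have r1 : 1 < r by rewrite ltr_pdivlMr ?mulr_gt0// mul1r.
have grow j : r ^+ (2 ^ j) * k ^+ (2 ^ j) * s 0 <= s (2 ^ j)%N.
  elim: j => [|j IH].
    rewrite expn0 !expr1 /r le_eqVlt; apply/orP; left; apply/eqP.
    by field; rewrite !gt_eqF.
  rewrite expnS mul2n -addnn !exprD -(ler_pM2r s00).
  have := cs (2 ^ j)%N 0; rewrite addn0 double0 addnn => /(le_trans _); apply.
  have -> : r ^+ (2 ^ j) * r ^+ (2 ^ j) * (k ^+ (2 ^ j) * k ^+ (2 ^ j))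
    * s 0 * s 0 = (r ^+ (2 ^ j) * k ^+ (2 ^ j) * s 0) ^+ 2 by ring.
  rewrite ler_pXn2r ?nnegrE//; last first.
    apply: le_trans IH; rewrite !mulr_ge0 ?exprn_ge0 ?ltW//.
    by rewrite (lt_trans ltr01).
  by rewrite !mulr_ge0 ?exprn_ge0 ?ltW// (lt_trans ltr01).
(* The exponent is 2^(j+1), an even number, because the growth bound is assumed at even indices. *)
have rbnd j : r ^+ (2 ^ j.+1) * s 0 <= c.
  have kj : 0 < k ^+ (2 ^ j.+1) by rewrite exprn_gt0.
  rewrite -(ler_pM2r kj); apply: le_trans (_ : s (2 ^ j.+1)%N <= _).
    by apply: le_trans (grow j.+1); rewrite mulrAC.
  by rewrite expnS mul2n; exact: bnd.
(* A form of Bernoulli's inequality, which shows that the powers of r are unbounded. *)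
have lin n : n%:R * (r - 1) <= r ^+ n.
  elim: n => [|n IH]; first by rewrite mul0r expr0.
  have r1n : 1 <= r ^+ n by rewrite exprn_ege1// ltW.
  rewrite exprS -natr1 mulrDl mul1r; have r10 : 0 <= r - 1 by rewrite subr_ge0 ltW.
  by have := ler_wpM2l r10 r1n; rewrite mulr1; move: IH; lra.
pose j := Num.truncn (c / (s 0 * (r - 1))).
have d0 : 0 < s 0 * (r - 1) by rewrite mulr_gt0// subr_gt0.
have : c / (s 0 * (r - 1)) < (2 ^ j.+1)%:R.
  rewrite (lt_le_trans (truncnS_gt _))// ler_nat.
  by rewrite ltnW// ltn_expl.
rewrite ltr_pdivrMr// ltNge => /negP; apply.
apply: le_trans (rbnd j); rewrite mulrCA mulrC ler_pM2r//; exact: lin.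
Qed.

Lemma young_split (R : realFieldType) (a b c t : R) : 0 < t ->
  0 <= t ^+ 2 * a + 2%:R * t * b + c ->
  a - 2%:R * b + c <= (1 + t) * a + (1 + t^-1) * c.
Proof.
move=> t0 h; have : 0 <= t^-1 * (t ^+ 2 * a + 2%:R * t * b + c).
  by rewrite mulr_ge0// invr_ge0 ltW.
have -> : t^-1 * (t ^+ 2 * a + 2%:R * t * b + c) = t * a + 2%:R * b + t^-1 * c.
  by field; rewrite gt_eqF.
lra.
Qed.

Lemma half_bound (R : realFieldType) (a b c t : R) : a <= t * b ->
  0 <= b - 2%:R * c + a -> c <= (1 + t) / 2%:R * b.
Proof. by move=> h1 h2; lra. Qed.

(** * Self-adjoint operators given by graphs on a real Hilbert space *)

Section AbstractOperators.
Context {R : realType} {H : lmodType R[i]}.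
Variables (L : H -> Prop) (ip : H -> H -> R).
Hypothesis L0 : L 0.
Hypothesis LB : forall x y, L x -> L y -> L (x - y).
Hypothesis LZ : forall (t : R) x, L x -> L (t%:C%C *: x).
Hypothesis ipBl : forall x y z, L x -> L y -> L z ->
  ip (x - y) z = ip x z - ip y z.
Hypothesis ipZl : forall (t : R) x y, L x -> L y ->
  ip (t%:C%C *: x) y = t * ip x y.
Hypothesis ipC : forall x y, L x -> L y -> ip x y = ip y x.
Hypothesis ip_ge0 : forall x, L x -> 0 <= ip x x.
Local Notation N x := (ip x x).
Hypothesis complete : forall u : nat -> H, (forall n, L (u n)) ->
  (forall e, 0 < e -> exists n0, forall n m, (n0 <= n)%N -> (n0 <= m)%N ->
     N (u n - u m) < e) ->
  exists2 l, L l & forall e, 0 < e -> exists n0, forall n, (n0 <= n)%N ->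
     N (u n - l) < e.

Let LN x : L x -> L (- x).
Proof. by move=> Lx; rewrite -sub0r; apply: LB. Qed.

Let LD x y : L x -> L y -> L (x + y).
Proof. by move=> Lx Ly; rewrite -[y]opprK; apply: LB => //; apply: LN. Qed.

Let ipNl x z : L x -> L z -> ip (- x) z = - ip x z.
Proof.
by move=> Lx Lz; rewrite -sub0r ipBl// -[0 in LHS](subrr 0) ipBl// subrr sub0r.
Qed.

Let ipDl x y z : L x -> L y -> L z -> ip (x + y) z = ip x z + ip y z.
Proof.
by move=> Lx Ly Lz; rewrite -[y in LHS]opprK ipBl ?ipNl ?opprK//; apply: LN.
Qed.

Let ipBr x y z : L x -> L y -> L z -> ip z (x - y) = ip z x - ip z y.
Proof.
by move=> Lx Ly Lz; rewrite ipC ?ipBl// ?(ipC Lx)// ?(ipC Ly)//; apply: LB.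
Qed.

Let ipDr x y z : L x -> L y -> L z -> ip z (x + y) = ip z x + ip z y.
Proof.
by move=> Lx Ly Lz; rewrite ipC ?ipDl// ?(ipC Lx)// ?(ipC Ly)//; apply: LD.
Qed.

Let ipZr (t : R) x y : L x -> L y -> ip y (t%:C%C *: x) = t * ip y x.
Proof. by move=> Lx Ly; rewrite ipC ?ipZl// 1?ipC//; apply: LZ. Qed.

Let N0 : N 0 = 0. Proof. by rewrite -[X in ip X]subr0 ipBl// subrr. Qed.

Let ND x y : L x -> L y -> N (x + y) = N x + 2%:R * ip x y + N y.
Proof.
move=> Lx Ly; rewrite ipDl ?ipDr//; last exact: LD.
by rewrite (ipC Ly Lx); ring.
Qed.

Let NB x y : L x -> L y -> N (x - y) = N x - 2%:R * ip x y + N y.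
Proof.
move=> Lx Ly; rewrite ipBl ?ipBr//; last exact: LB.
by rewrite (ipC Ly Lx); ring.
Qed.

Let NC x y : L x -> L y -> N (x - y) = N (y - x).
Proof. by move=> Lx Ly; rewrite !NB// (ipC Ly Lx); ring. Qed.

Let NBle x y : L x -> L y -> N (x - y) <= 2%:R * N x + 2%:R * N y.
Proof.
move=> Lx Ly; have := ip_ge0 (LD Lx Ly); rewrite ND// NB//; lra.
Qed.

Lemma discriminant_le (a b c : R) : 0 <= c ->
  (forall t, 0 <= a + 2%:R * t * b + t ^+ 2 * c) -> b ^+ 2 <= a * c.
Proof.
rewrite le_eqVlt => /orP[/eqP <-|c0] q.
  have [->|b0] := eqVneq b 0; first by rewrite expr0n/= mulr0.
  (* With c = 0 the expression is affine in t, and this t makes it equal to -1. *)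
  have := q (- (a + 1) / (2%:R * b)).
  have -> : a + 2%:R * (- (a + 1) / (2%:R * b)) * b
            + (- (a + 1) / (2%:R * b)) ^+ 2 * 0 = -1 by field.
  by rewrite lerNr oppr0 ler10.
have := q (- b / c); have -> : a + 2%:R * (- b / c) * b + (- b / c) ^+ 2 * c
  = (a * c - b ^+ 2) / c by field; rewrite gt_eqF.
by rewrite pmulr_lge0 ?invr_gt0// subr_ge0.
Qed.

Lemma ip_cauchy_schwarz x y : L x -> L y -> ip x y ^+ 2 <= N x * N y.
Proof.
move=> Lx Ly; apply: discriminant_le; first exact: ip_ge0.
move=> t; have Lt := LZ t Ly; have := ip_ge0 (LD Lx Lt).
rewrite ND// !ipZr// ipZl//; congr (_ <= _); ring.
Qed.

Let scaleCr (a b : R) (v : H) :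
  a%:C%C *: (b%:C%C *: v) = b%:C%C *: (a%:C%C *: v).
Proof. by rewrite scalerA mulrC -scalerA. Qed.

Let small (c M : R) : 0 <= c -> 0 <= M ->
  (forall e, 0 < e -> c <= M * e) -> c = 0.
Proof.
move=> c0 M0 h; apply/eqP; rewrite eq_le c0 andbT; apply/ler_addgt0Pr => e e0.
rewrite add0r (le_trans (h (e / (M + 1)) _))//.
  by rewrite divr_gt0// ltr_pwDr.
by rewrite mulrCA ler_piMr ?(ltW e0)// ler_pdivrMr ?mul1r ?lerDl// ltr_pwDr.
Qed.

Local Notation operator := (H -> H -> Prop).

(** The scalar product may have null vectors, since fields are not identified almost everywhere. A
    graph therefore determines images only up to null vectors, and images are compared through their
    norms. *)
Definition selfadjoint (A : operator) := forall x y, A x y <->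
  [/\ L x, L y & forall x' y', A x' y' -> ip y x' = ip x y'].

Definition dense_domain (A : operator) := forall x (e : R), L x -> 0 < e ->
  exists x' y', A x' y' /\ N (x' - x) < e.

Section Selfadjoint.
Variable A : operator.
Hypothesis saA : selfadjoint A.

Let LA x y : A x y -> L x /\ L y. Proof. by move=> /saA[]. Qed.

Let symA x y x' y' : A x y -> A x' y' -> ip y x' = ip x y'.
Proof. by move=> /saA[_ _]; apply. Qed.

Lemma sa0 : A 0 0.
Proof.
apply/saA; split=> // x' y' /LA[Lx Ly].
by rewrite -[0](subrr 0) !ipBl// !subrr.
Qed.

Lemma saB x y x' y' : A x y -> A x' y' -> A (x - x') (y - y').
Proof.
move=> Axy Axy'; have [Lx Ly] := LA Axy; have [Lx' Ly'] := LA Axy'.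
apply/saA; split; [exact: LB|exact: LB|move=> z w Azw].
by have [Lz Lw] := LA Azw; rewrite !ipBl// (symA Axy Azw) (symA Axy' Azw).
Qed.

Lemma saZ (t : R) x y : A x y -> A (t%:C%C *: x) (t%:C%C *: y).
Proof.
move=> Axy; have [Lx Ly] := LA Axy.
apply/saA; split; [exact: LZ|exact: LZ|move=> z w Azw].
by have [Lz Lw] := LA Azw; rewrite !ipZl// (symA Axy Azw).
Qed.

Lemma saD x y x' y' : A x y -> A x' y' -> A (x + x') (y + y').
Proof.
move=> Axy Axy'; have := saB Axy (saB sa0 Axy').
by rewrite !sub0r !opprK.
Qed.

(** The defining pairing is continuous in both arguments, so the graph is closed. In particular it
    is stable under changing x or y by a null vector. *)
Lemma sa_closed x y : L x -> L y ->
  (forall e, 0 < e -> exists x' y',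
     [/\ A x' y', N (x' - x) < e & N (y' - y) < e]) -> A x y.
Proof.
move=> Lx Ly h; apply/saA; split=> // z w Azw; have [Lz Lw] := LA Azw.
apply/eqP; rewrite -subr_eq0 -sqrf_eq0; apply/eqP.
have M0 : 0 <= 2%:R * (N z + N w).
  by rewrite mulr_ge0// addr_ge0// ip_ge0.
apply: (small _ M0) => [|e e0]; first exact: sqr_ge0.
have [x' [y' [A' dx dy]]] := h e e0; have [Lx' Ly'] := LA A'.
have -> : ip y z - ip x w = ip (x' - x) w - ip (y' - y) z.
  by rewrite !ipBl// (symA A' Azw); ring.
have h1 := ip_cauchy_schwarz (LB Lx' Lx) Lw.
have h2 := ip_cauchy_schwarz (LB Ly' Ly) Lz.
have h3 : N (x' - x) * N w <= e * N w by rewrite ler_wpM2r ?ip_ge0// ltW.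
have h4 : N (y' - y) * N z <= e * N z by rewrite ler_wpM2r ?ip_ge0// ltW.
move: h1 h2 h3 h4; set a := ip _ w; set b := ip _ z => h1 h2 h3 h4.
have := sqr_ge0 (a + b); rewrite sqrrB sqrrD; nra.
Qed.

                                                                              
                                               
(** Least squares: minimize the norm of y + s x - f over the graph. Coercivity makes minimizing
    sequences converge. The residual at the minimum is orthogonal to the range of A + s, and
    self-adjointness with coercivity then forces it to be null. *)
Lemma sa_onto (s d : R) : 0 < d ->
  (forall x y, A x y -> d * (N x + N y) <= N (y + s%:C%C *: x)) ->
  forall f, L f -> exists x, A x (f - s%:C%C *: x).
Proof.
move=> d0 coer f Lf.
pose J (p : H * H) := N (p.2 + s%:C%C *: p.1 - f).
pose E := [set r | exists2 p : H * H, A p.1 p.2 & r = J p].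
have LJ x y : A x y -> L (y + s%:C%C *: x).
  by move=> /LA[Lx Ly]; apply: LD => //; apply: LZ.
have E0 : has_inf E.
  split; first by exists (J (0, 0)), (0, 0) => //; exact: sa0.
  by exists 0 => _ [[x y] /= Axy ->]; apply: ip_ge0; apply: LB => //; apply: LJ.
have infE x y : A x y -> inf E <= J (x, y).
  by move=> Axy; apply: ge_inf; [case: E0|exists (x, y)].
have /choice[p Hp] : forall n, exists p : H * H,
    A p.1 p.2 /\ J p < inf E + n.+1%:R^-1.
  move=> n; have n0 : 0 < n.+1%:R^-1 :> R by rewrite invr_gt0.
  by have [_ [q Aq ->] lt] := inf_adherent n0 E0; exists q.
pose z n := (p n).2 + s%:C%C *: (p n).1.
have Lz n : L (z n) by apply: LJ; exact: (Hp n).1.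
(* The midpoint of two points of the graph lies in the graph, so the parallelogram law turns
   near-minimality into a Cauchy estimate. *)
have half_ge n m : 4%:R * inf E <= N ((z n - f) + (z m - f)).
  have [An _] := Hp n; have [Am _] := Hp m.
  have := infE _ _ (saZ 2%:R^-1 (saD An Am)).
  rewrite /J /=.
  have -> : (2%:R^-1)%:C%C *: ((p n).2 + (p m).2)
     + s%:C%C *: ((2%:R^-1)%:C%C *: ((p n).1 + (p m).1)) - f
     = (2%:R^-1)%:C%C *: ((z n - f) + (z m - f)).
    rewrite scaleCr -scalerDr [in RHS]addrACA -opprD scalerBr.
    congr (_ *: _ - _); first by rewrite scalerDr addrACA.
    rewrite -mulr2n -(scaler_nat 2 f) scalerA -(rmorph_nat (@real_complex R)).
    by rewrite -rmorphM/= mulVf ?rmorph1 ?scale1r.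
  have Ln := LD (LB (Lz n) Lf) (LB (Lz m) Lf).
  rewrite ipZl ?ipZr//; last exact: LZ.
  by set q := ip _ _; lra.
have cauchy n m : d * (N ((p n).1 - (p m).1) + N ((p n).2 - (p m).2)) <=
    2%:R * n.+1%:R^-1 + 2%:R * m.+1%:R^-1.
  have [An Jn] := Hp n; have [Am Jm] := Hp m.
  have /le_trans : d * (N ((p n).1 - (p m).1) + N ((p n).2 - (p m).2)) <=
      N (z n - z m).
    rewrite (le_trans (coer _ _ (saB An Am)))// le_eqVlt; apply/orP; left.
    by apply/eqP; rewrite /z scalerBr addrACA opprD.
  apply; have -> : z n - z m = (z n - f) - (z m - f).
    by rewrite opprB addrA subrK.
  have := half_ge n m; move: Jn Jm; rewrite /J -/(z n) -/(z m).
  have Ln := LB (Lz n) Lf; have Lm := LB (Lz m) Lf.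
  rewrite (ND Ln Lm) (NB Ln Lm).
  set a := ip (z n - f) (z n - f); set b := ip (z m - f) (z m - f).
  set c := ip _ (z m - f); set u := n.+1%:R^-1; set v := m.+1%:R^-1.
  by lra.
have inv_small (e : R) : 0 < e -> exists n0, forall n, (n0 <= n)%N ->
    n.+1%:R^-1 < e.
  move=> e0; exists (Num.truncn e^-1) => n hn.
  rewrite invf_plt ?posrE//.
  by rewrite (lt_le_trans (truncnS_gt _))// ler_nat ltnS.
have cauchy1 (k : nat -> H) : (forall n, L (k n)) ->
    (forall n m, d * N (k n - k m) <= 2%:R * n.+1%:R^-1 + 2%:R * m.+1%:R^-1) ->
    exists2 l, L l & forall e, 0 < e -> exists n0, forall n, (n0 <= n)%N ->
     N (k n - l) < e.
  move=> Lk hk; apply: complete => // e e0.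
  have [n0 hn0] := inv_small (d * e / 4%:R) (divr_gt0 (mulr_gt0 d0 e0) (ltr0Sn _ _)).
  exists n0 => n m hn hm; rewrite -(ltr_pM2l d0).
  have := hk n m; have := hn0 n hn; have := hn0 m hm; set a := n.+1%:R^-1; set b := m.+1%:R^-1; lra.
have Lp n : L (p n).1 /\ L (p n).2 by exact: LA (Hp n).1.
have [x Lx cx] : exists2 l, L l & forall e, 0 < e -> exists n0, forall n,
    (n0 <= n)%N -> N ((p n).1 - l) < e.
  apply: cauchy1 => [n|n m]; first by case: (Lp n).
  apply: le_trans (cauchy n m); rewrite ler_pM2l// lerDl.
  by apply: ip_ge0; apply: LB; [case: (Lp n)|case: (Lp m)].
have [y Ly cy] : exists2 l, L l & forall e, 0 < e -> exists n0, forall n,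
    (n0 <= n)%N -> N ((p n).2 - l) < e.
  apply: cauchy1 => [n|n m]; first by case: (Lp n).
  apply: le_trans (cauchy n m); rewrite ler_pM2l// lerDr.
  by apply: ip_ge0; apply: LB; [case: (Lp n)|case: (Lp m)].
have Axy : A x y.
  apply: sa_closed => // e e0; have [n1 h1] := cx _ e0; have [n2 h2] := cy _ e0.
  exists (p (maxn n1 n2)).1, (p (maxn n1 n2)).2; split; first exact: (Hp _).1.
    exact/h1/leq_maxl.
  exact/h2/leq_maxr.
set r := y + s%:C%C *: x - f.
have Lr : L r by apply: LB => //; apply: LJ.
(* First variation: moving an almost minimal point by t * x' bounds the pairing of its residual
   through a discriminant, and the bound tends to 0. *)
have orth x' y' : A x' y' -> ip r (y' + s%:C%C *: x') = 0.
  move=> A'; have Lz' := LJ _ _ A'; set z' := _ + _ in Lz' *.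
  apply/eqP; rewrite -sqrf_eq0; apply/eqP.
  have M0 : 0 <= N z' * (2%:R + 4%:R * (1 + s ^+ 2)).
    by rewrite mulr_ge0 ?ip_ge0// addr_ge0// mulr_ge0// addr_ge0// sqr_ge0.
  apply: (small _ M0) => [|e e0]; first exact: sqr_ge0.
  have [n1 h1] := cx _ e0; have [n2 h2] := cy _ e0; have [n3 h3] := inv_small _ e0.
  pose n := maxn (maxn n1 n2) n3.
  have {}h1 : N ((p n).1 - x) < e.
    by apply: h1; rewrite (leq_trans (leq_maxl n1 n2))// leq_maxl.
  have {}h2 : N ((p n).2 - y) < e.
    by apply: h2; rewrite (leq_trans (leq_maxr n1 n2))// leq_maxl.
  have {}h3 : n.+1%:R^-1 < e by apply: h3; exact: leq_maxr.
  have [An Jn] := Hp n; have [Lp1 Lp2] := Lp n.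
  have Lzf := LB (Lz n) Lf.
  have disc : ip (z n - f) z' ^+ 2 <= (J (p n) - inf E) * N z'.
    apply: discriminant_le => [|t]; first exact: ip_ge0.
    have := infE _ _ (saD An (saZ t A')); rewrite /J/=.
    have -> : (p n).2 + t%:C%C *: y' + s%:C%C *: ((p n).1 + t%:C%C *: x') - f =
              (z n - f) + t%:C%C *: z'.
      rewrite /z /z' !scalerDr !scalerA (mulrC s%:C%C) -!addrA; congr (_ + _).
      rewrite addrCA; congr (_ + _); rewrite [RHS]addrCA; congr (_ + _).
      by rewrite addrC.
    have Ltz := LZ t Lz'; rewrite ND// !ipZr// ipZl// /z.
    by set a := ip _ _; set b := ip _ z'; set c := ip z' z'; lra.
  have LZp := LZ s (LB Lp1 Lx).
  have -> : r = (z n - f) - (((p n).2 - y) + s%:C%C *: ((p n).1 - x)).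
    apply/eqP; rewrite eq_sym subr_eq /r /z scalerBr [X in _ == X]addrAC.
    by rewrite addrACA (addrC y) subrK (addrC (_ *: x)) subrK.
  have Lq := LD (LB Lp2 Ly) LZp.
  rewrite ipBl//; have cs := ip_cauchy_schwarz Lq Lz'.
  have Nq : N ((p n).2 - y + s%:C%C *: ((p n).1 - x)) <=
      2%:R * e * (1 + s ^+ 2).
    have := NBle (LB Lp2 Ly) (LN LZp); rewrite opprK => /le_trans; apply.
    rewrite ipNl// ?(ipC LZp (LN LZp)) ?ipNl//; last exact: LN.
    have Lv := LB Lp1 Lx; rewrite opprK ipZl// ipZr//.
    exact: (quad_bound (ltW h2) (ler_wpM2l (sqr_ge0 s) (ltW h1))).
  have Jn' : J (p n) - inf E <= e by rewrite lerBlDl (le_trans (ltW Jn))// lerD2l ltW.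
  have h4 := ler_wpM2r (ip_ge0 Lz') Jn'.
  have h5 := ler_wpM2r (ip_ge0 Lz') Nq.
  apply: le_trans (sqr_sub_le (le_trans disc h4) (le_trans cs h5)) _.
  by rewrite le_eqVlt; apply/orP; left; apply/eqP; ring.
(* By self-adjointness, orthogonality to the range of A + s says that A r = - s r; coercivity at
   this point makes r null. *)
have Ar : A r (- (s%:C%C *: r)).
  have Lsr := LZ s Lr.
  apply/saA; split=> //; first exact: LN.
  move=> x' y' A'; have [Lx' Ly'] := LA A'; have := orth _ _ A'.
  rewrite ipDr ?ipZr ?ipNl ?ipZl//; last exact: LZ.
  by move=> /eqP; rewrite addrC addr_eq0 => /eqP ->; rewrite opprK.
have Nr0 : N r = 0.
  have Lsr := LZ s Lr; apply/eqP; rewrite eq_le ip_ge0// andbT.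
  have := coer _ _ Ar; rewrite addNr N0 pmulr_rle0// => /(le_trans _); apply.
  by rewrite lerDl; apply/ip_ge0/LN.
exists x; have Lsx := LZ s Lx; apply: sa_closed => //; first exact: LB.
move=> e e0; exists x, y; split=> //; first by rewrite subrr N0.
by rewrite opprB addrA -/r Nr0.
Qed.

Hypothesis dA : dense_domain A.
Hypothesis A_ge0 : forall x y, A x y -> 0 <= ip y x.

(** The domain of A^2 is a core. As A + 1 is onto, take f' in the domain of A close to A x + x and
    solve (A + 1) x' = f'. Then A x' = f' - x' lies in the domain again, and coercivity of A + 1
    controls both errors. *)
Lemma sa_core x y (e : R) : A x y -> 0 < e -> exists x' y' z',
  [/\ A x' y', A y' z', N (x' - x) < e & N (y' - y) < e].
Proof.
have coer v w : A v w -> 1 * (N v + N w) <= N (w + 1%:C%C *: v).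
  move=> Avw; have [Lv Lw] := LA Avw.
  by rewrite scale1r ND//; have := A_ge0 Avw; lra.
move=> Axy e0; have [Lx Ly] := LA Axy.
have [f' [g' [Af df]]] := dA (LD Ly Lx) e0; have [Lf' _] := LA Af.
have [x' A'] := sa_onto ltr01 coer Lf'; rewrite scale1r in A'.
have [Lx' Ly'] := LA A'.
have := coer _ _ (saB A' Axy); rewrite mul1r scale1r.
have -> : f' - x' - y + (x' - x) = f' - (y + x).
  by rewrite opprD !addrA; congr (_ - _); rewrite addrAC subrK.
have := ip_ge0 (LB Lx' Lx); have := ip_ge0 (LB Ly' Ly) => h1 h2 h3.
exists x', (f' - x'), (g' - (f' - x')); split=> //; first exact: saB.
  by rewrite (le_lt_trans _ df)// (le_trans _ h3)// lerDl.
by rewrite (le_lt_trans _ df)// (le_trans _ h3)// lerDr.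
Qed.

End Selfadjoint.

Let null_ip x y : L x -> L y -> N x = 0 -> ip x y = 0.
Proof.
move=> Lx Ly Nx; have := ip_cauchy_schwarz Lx Ly; rewrite Nx mul0r => h.
by apply/eqP; rewrite -sqrf_eq0 eq_le h sqr_ge0.
Qed.

Let null_N x y : L x -> L y -> N (x - y) = 0 -> N x = N y.
Proof.
move=> Lx Ly h; have := null_ip (LB Lx Ly) Lx h; have := null_ip (LB Lx Ly) Ly h.
by rewrite !ipBl// (ipC Ly Lx) => /eqP; rewrite subr_eq0 => /eqP ->;
   move=> /eqP; rewrite subr_eq0 => /eqP.
Qed.

(** Bounded nonnegative symmetric operators. Symmetry on all of [L] yields linearity under the
    pairing ([mulB], [mulZ]). *)
Definition multiplier (M : H -> H) := [/\ forall x, L x -> L (M x),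
  forall x y, L x -> L y -> ip (M x) y = ip x (M y),
  forall x, L x -> 0 <= ip (M x) x &
  exists2 C, 0 <= C & forall x, L x -> N (M x) <= C * N x].

Let form_bound (M : H -> H) : multiplier M ->
  exists2 C, 0 <= C & forall x, L x -> ip (M x) x <= C * N x.
Proof.
move=> [LM symM posM [C C0 bM]]; exists (C + 1); first by rewrite addr_ge0.
move=> x Lx; have := ip_ge0 (LB (LM x Lx) Lx); rewrite NB//; last exact: LM.
have := bM x Lx; have := posM x Lx; have := ip_ge0 Lx.
by rewrite mulrDl mul1r; lra.
Qed.

Let mulB (M : H -> H) x y z : multiplier M -> L x -> L y -> L z ->
  ip (M (x - y)) z = ip (M x) z - ip (M y) z.
Proof.
move=> [LM symM _ _] Lx Ly Lz; rewrite !symM//; last exact: LB.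
by rewrite ipBl//; apply: LM.
Qed.

Let mulZ (M : H -> H) (t : R) x z : multiplier M -> L x -> L z ->
  ip (M (t%:C%C *: x)) z = t * ip (M x) z.
Proof.
move=> [LM symM _ _] Lx Lz; rewrite !symM//; last exact: LZ.
by rewrite ipZl//; apply: LM.
Qed.

Let mulC (M : H -> H) x z : multiplier M -> L x -> L z ->
  ip (M x) z = ip (M z) x.
Proof. by move=> [LM symM _ _] Lx Lz; rewrite symM// ipC//; apply: LM. Qed.

(** Weighted Young inequality for the nonnegative form of M, with x written as x' - (x' - x). *)
Let form_split (M : H -> H) x x' (t : R) : multiplier M -> 0 < t ->
  L x -> L x' -> ip (M x) x <=
    (1 + t) * ip (M x') x' + (1 + t^-1) * ip (M (x' - x)) (x' - x).
Proof.
move=> mM t0 Lx Lx'; have [LM _ posM _] := mM.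
have [d Ld ->] : exists2 d, L d & x = x' - d.
  by exists (x' - x); [exact: LB|rewrite opprB addrCA subrr addr0].
have -> : x' - (x' - d) = d by rewrite opprB addrCA subrr addr0.
have Lt := LZ (- t) Lx'; have Ldt := LB Ld Lt; have Lxd := LB Lx' Ld.
have LMd := LM _ Ld; have LMx' := LM _ Lx'; have LMt := LM _ Lt.
have := posM _ Ldt; rewrite !mulB// !ipBr// !(mulZ _ mM)// !ipZr//.
rewrite (mulC mM Ld Lx'); set a := ip (M x') x'; set b := ip (M x') d; set c := ip (M d) d => h.
have -> : a - b - (b - c) = a - 2%:R * b + c by ring.
apply: young_split => //.
by apply: le_trans h _; rewrite le_eqVlt; apply/orP; left; apply/eqP; ring.
Qed.

(** Bounded forms are continuous, so a comparison that holds on approximating vectors survives in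
    the limit. Each replacement costs a factor 1 + t, and t tends to 0 last. *)
Lemma form_limit (M1 M2 : H -> H) x y : multiplier M1 -> multiplier M2 ->
  L x -> L y -> (forall e, 0 < e -> exists x' y',
    [/\ L x', L y', N (x' - x) < e, N (y' - y) < e &
        ip (M1 x') x' <= ip (M2 y') y']) ->
  ip (M1 x) x <= ip (M2 y) y.
Proof.
move=> m1 m2 Lx Ly h.
have [C1 C10 b1] := form_bound m1; have [C2 C20 b2] := form_bound m2.
have q1 : 0 <= ip (M1 x) x by case: m1 => _ _ + _; apply.
have q2 : 0 <= ip (M2 y) y by case: m2 => _ _ + _; apply.
have step t : 0 < t -> ip (M1 x) x <= (1 + t) * (1 + t) * ip (M2 y) y.
  move=> t0; have t0' : 0 < t^-1 by rewrite invr_gt0.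
  apply/ler_addgt0Pr => e e0.
  pose K := (1 + t^-1) * C1 + (1 + t) * (1 + t^-1) * C2.
  have K0 : 0 <= K by rewrite addr_ge0// !mulr_ge0// addr_ge0// ltW.
  have e'0 : 0 < e / (K + 1) by rewrite divr_gt0// ltr_pwDr.
  have [x' [y' [Lx' Ly' dx dy le']]] := h _ e'0.
  have Ke : K * (e / (K + 1)) <= e.
    by rewrite mulrCA ler_piMr ?(ltW e0)// ler_pdivrMr ?mul1r ?lerDl// ltr_pwDr.
  move: Ke dx dy; set e' := e / (K + 1) => Ke dx dy.
  have s1 := form_split m1 t0 Lx Lx'.
  have s2 := form_split m2 t0 Ly' Ly.
  have Lyd := LB Ly' Ly; have Lyd' := LB Ly Ly'; have Lxd := LB Lx' Lx.
  have s3 : ip (M1 (x' - x)) (x' - x) <= C1 * e'.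
    by rewrite (le_trans (b1 _ Lxd))// ler_wpM2l// ltW.
  have s4 : ip (M2 (y - y')) (y - y') <= C2 * e'.
    by rewrite (le_trans (b2 _ Lyd'))// ler_wpM2l// -NC// ltW.
  apply: (le_trans s1).
  apply: (@le_trans _ _ ((1 + t) * ((1 + t) * ip (M2 y) y
     + (1 + t^-1) * (C2 * e')) + (1 + t^-1) * (C1 * e'))).
    apply: lerD; apply: ler_wpM2l => //; try by rewrite addr_ge0// ltW.
    apply: (le_trans le'); apply: (le_trans s2); rewrite lerD2l.
    by apply: ler_wpM2l => //; rewrite addr_ge0// ltW.
  have -> : (1 + t) * ((1 + t) * ip (M2 y) y + (1 + t^-1) * (C2 * e')) +
    (1 + t^-1) * (C1 * e') = (1 + t) * (1 + t) * ip (M2 y) y + K * e'.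
    by rewrite /K; ring.
  by rewrite lerD2l.
apply/ler_addgt0Pr => e e0; set b := ip (M2 y) y in q2 step *.
(* For t at most 1, (1 + t)^2 - 1 is at most 3 t. *)
pose t := Num.min 1 (e / (3%:R * (b + 1))).
have d0 : 0 < e / (3%:R * (b + 1)) by rewrite divr_gt0// mulr_gt0// ltr_pwDr.
have t0 : 0 < t by rewrite lt_min ltr01.
have t1 : t <= 1 by rewrite ge_min lexx.
have te : t * (3%:R * (b + 1)) <= e.
  by rewrite -ler_pdivlMr ?mulr_gt0 ?ltr_pwDr// ge_min lexx orbT.
apply: le_trans (step t t0) _.
have : t * (t * b) <= 1 * (t * b) by rewrite ler_wpM2r// mulr_ge0// ltW.
by move: te; lra.
Qed.

Lemma multiplier_id : multiplier id.
Proof. by split=> //; exists 1 => // x Lx; rewrite mul1r. Qed.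

Lemma multiplierZ (c : R) M : 0 <= c -> multiplier M ->
  multiplier (fun x => c%:C%C *: M x).
Proof.
move=> c0 [LM symM posM [C C0 bM]]; split.
- by move=> x Lx; exact/LZ/LM.
- move=> x y Lx Ly; have Lmx := LM x Lx; have Lmy := LM y Ly.
  by rewrite ipZl// ipZr// symM.
- by move=> x Lx; have Lmx := LM x Lx; rewrite ipZl// mulr_ge0// posM.
- exists (c ^+ 2 * C); first by rewrite mulr_ge0// sqr_ge0.
  move=> x Lx; have Lmx := LM x Lx; have Lcx := LZ c Lmx.
  rewrite ipZl// ipZr// mulrA -expr2 -[leRHS]mulrA.
  by rewrite ler_wpM2l ?sqr_ge0//; exact: bM.
Qed.

Lemma multiplier_comp M : multiplier M -> multiplier (M \o M).
Proof.
move=> [LM symM posM [C C0 bM]]; split=> /=.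
- by move=> x Lx; exact/LM/LM.
- by move=> x y Lx Ly; rewrite symM ?symM//; exact: LM.
- by move=> x Lx; rewrite symM//; [exact/ip_ge0/LM|exact: LM].
- exists (C * C); first exact: mulr_ge0.
  move=> x Lx; apply: le_trans (bM _ (LM _ Lx)) _.
  by rewrite -mulrA ler_wpM2l//; exact: bM.
Qed.

                                                                           
                                           
(** * Heinz inequality and sign operator, given B^2 = D^2 and S^2 = B *)

Section SquareRoot.
Variables (D B S : operator) (d : R).
Hypothesis LD' : forall x y, D x y -> L x /\ L y.
Hypothesis symD : forall x y x' y', D x y -> D x' y' -> ip y x' = ip x y'.
Hypothesis DB : forall x y x' y', D x y -> D x' y' -> D (x - x') (y - y').
Hypothesis d0 : 0 < d.
Hypothesis gapD : forall x y, D x y -> d * N x <= N y.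
Hypothesis saB' : selfadjoint B.
Hypothesis dB : dense_domain B.
Hypothesis B_ge0 : forall x y, B x y -> 0 <= ip y x.
Hypothesis saS : selfadjoint S.
Hypothesis dS : dense_domain S.
Hypothesis S_ge0 : forall x y, S x y -> 0 <= ip y x.
Hypothesis SSB : forall x y, B x y <-> exists2 z, S x z & S z y.
Hypothesis BBDD : forall x y,
  (exists2 z, B x z & B z y) <-> (exists2 z, D x z & D z y).

Let LBx x y : B x y -> L x /\ L y. Proof. by move=> /saB'[]. Qed.
Let symB x y x' y' : B x y -> B x' y' -> ip y x' = ip x y'.
Proof. by move=> /saB'[_ _]; apply. Qed.

(** The difference of two images of x is orthogonal to the dense domain of B, hence null. *)
Let B_fun x y y' : B x y -> B x y' -> N y = N y'.
Proof.
move=> Bxy Bxy'; have [Lx Ly] := LBx Bxy; have [_ Ly'] := LBx Bxy'.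
apply: null_N => //; have Lv := LB Ly Ly'; set v := y - y' in Lv *.
apply/eqP; rewrite eq_le ip_ge0// andbT.
have B0v : B 0 v by rewrite -(subrr x); exact: saB.
have orth z w : B z w -> ip v z = 0.
  move=> Bzw; have [Lz Lw] := LBx Bzw.
  by rewrite (symB B0v Bzw) -(subrr x) ipBl// subrr.
rewrite leNgt; apply/negP => v0.
have [z [w [Bzw zv]]] := dB Lv v0; have [Lz Lw] := LBx Bzw.
have := zv; rewrite NB// ipC// (orth _ _ Bzw) mulr0 subr0 gtrDr.
by rewrite ltNge ip_ge0.
Qed.

(** On the common domain of B^2 and D^2, the squared norms of B x and D x both equal <D^2 x, x>. *)
Let BB_D x y z : B x y -> B y z ->
  exists y', [/\ D x y', D y' z & N y' = N y].
Proof.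
move=> Bxy Byz; have /BBDD[y' D1 D2] : exists2 z', B x z' & B z' z by exists y.
exists y'; split=> //; rewrite (symD D1 D2).
by rewrite -(symB Bxy Byz).
Qed.

Let DD_B x y z : D x y -> D y z -> forall b, B x b -> N b = N y.
Proof.
move=> Dxy Dyz b Bxb.
have /BBDD[b' B1 B2] : exists2 z', D x z' & D z' z by exists y.
by rewrite (B_fun Bxb B1) (symB B1 B2) (symD Dxy Dyz).
Qed.

(** B x and D x have equal norms on the domain of B^2, which is a core for B, and [form_limit]
    carries the bound from there to all of the domain of B. *)
Let bound_B (M : H -> H) (k : R) : multiplier M -> 0 <= k ->
  (forall x y, D x y -> N (M x) <= k * N y) ->
  forall x y, B x y -> N (M x) <= k * N y.
Proof.
move=> mM k0 bM x y Bxy; have [Lx Ly] := LBx Bxy.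
have [LM symM _ _] := mM.
rewrite -symM//; last exact: LM.
rewrite -ipZl//.
apply: (form_limit (M1 := M \o M) (M2 := fun x => k%:C%C *: x)) => //.
- exact: multiplier_comp.
- exact: (multiplierZ k0 multiplier_id).
move=> e e0; have [x' [y' [z' [B1 B2 dx dy]]]] := sa_core saB' dB B_ge0 Bxy e0.
have [Lx' Ly'] := LBx B1; exists x', y'; split=> //=.
have [v [D1 _ Nv]] := BB_D B1 B2.
rewrite symM//; last exact: LM.
by rewrite ipZl// -Nv; exact: bM.
Qed.

Let gapB x y : B x y -> d * N x <= N y.
Proof.
move=> Bxy; have := bound_B multiplier_id (_ : 0 <= d^-1) _ Bxy => /=.
rewrite invr_ge0 (ltW d0) => /(_ isT).
rewrite mulrC ler_pdivlMr// mulrC; apply=> v w Dvw.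
by rewrite mulrC ler_pdivlMr// mulrC; exact: gapD.
Qed.

Let B_onto f : L f -> exists x, B x f.
Proof.
move=> Lf; have [|x y Bxy|x] := @sa_onto _ saB' 0 (d / (1 + d)) _ _ f Lf.
- by rewrite divr_gt0// addr_gt0.
- have [Lx Ly] := LBx Bxy; have := gapB Bxy.
  have -> : (0 : R)%:C%C = 0 :> R[i] by [].
  rewrite scale0r addr0 mulrAC ler_pdivrMr ?addr_gt0//; have := ip_ge0 Ly.
  by lra.
have -> : (0 : R)%:C%C = 0 :> R[i] by [].
by rewrite scale0r subr0; exists x.
Qed.

(** Inverting B twice solves B^2 w = f, hence D^2 w = f, and D w is the preimage. *)
Let D_onto f : L f -> exists x, D x f.
Proof.
move=> Lf; have [w Bw] := B_onto Lf; have [w' Bw'] := B_onto (LBx Bw).1.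
by have [z [D1 D2 _]] := BB_D Bw' Bw; exists z.
Qed.

Let D_dense f e : L f -> 0 < e -> exists x y, D x y /\ N (x - f) < e.
Proof.
move=> Lf e0; have e40 : 0 < e / 4%:R by rewrite divr_gt0.
have [x [y [Bxy dx]]] := dB Lf e40.
have [x' [y' [z' [B1 B2 dx' _]]]] := sa_core saB' dB B_ge0 Bxy e40.
have [v [D1 _ _]] := BB_D B1 B2; exists x', v; split=> //.
have [Lx _] := LBx Bxy; have [Lx' _] := LBx B1.
have -> : x' - f = (x' - x) - (f - x) by rewrite opprB addrA subrK.
have := NBle (LB Lx' Lx) (LB Lf Lx); rewrite (NC Lf Lx); move: dx dx'.
set a := ip (x - f) _; set b := ip (x' - x) _.
set c := ip (_ - (f - x)) _; lra.
Qed.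

(** Approximate y = D x by v in the domain of D. The D-preimage of v lies in the domain of D^2 =
    B^2, where B and D have equal norms. The gap makes these preimages converge to x, their B-images
    form a Cauchy sequence, and B is closed. *)
Let D_dom x y : D x y -> exists2 y', B x y' & N y' = N y.
Proof.
move=> Dxy; have [Lx Ly] := LD' Dxy.
have /choice[q Hq] : forall n : nat, exists q : (H * H) * (H * H),
    [/\ D q.1.1 q.1.2, D q.1.2 q.2.1, B q.1.1 q.2.2 &
        N (q.1.2 - y) < n.+1%:R^-1].
  move=> n; have n0 : 0 < n.+1%:R^-1 :> R by rewrite invr_gt0.
  have [v [w [Dvw dv]]] := D_dense Ly n0; have [Lv _] := LD' Dvw.
  have [z Dz] := D_onto Lv.
  have /BBDD[b B1 _] : exists2 z', D z z' & D z' w by exists v.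
  by exists ((z, v), (w, b)).
have Lq n : [/\ L (q n).1.1, L (q n).1.2 & L (q n).2.2].
  have [D1 D2 B1 _] := Hq n.
  by split; [case: (LBx B1)|case: (LD' D2)|case: (LBx B1)].
have inv_small (e : R) : 0 < e -> exists n0, forall n, (n0 <= n)%N ->
    n.+1%:R^-1 < e.
  move=> e0; exists (Num.truncn e^-1) => n hn.
  rewrite invf_plt ?posrE//.
  by rewrite (lt_le_trans (truncnS_gt _))// ler_nat ltnS.
have [y' Ly' cy'] : exists2 l, L l & forall e, 0 < e -> exists n0, forall n,
    (n0 <= n)%N -> N ((q n).2.2 - l) < e.
  apply: complete => [n|e e0]; first by case: (Lq n).
  have e40 : 0 < e / 4%:R by rewrite divr_gt0.
  have [n0 hn0] := inv_small _ e40; exists n0 => n m hn hm.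
  have [Dn Dn' Bn yn] := Hq n; have [Dm Dm' Bm ym] := Hq m.
  rewrite (DD_B (DB Dn Dm) (DB Dn' Dm') (saB saB' Bn Bm)).
  have [_ Ln _] := Lq n; have [_ Lm _] := Lq m.
  have -> : (q n).1.2 - (q m).1.2 = ((q n).1.2 - y) - ((q m).1.2 - y).
    by rewrite opprB addrA subrK.
  have := NBle (LB Ln Ly) (LB Lm Ly).
  have := lt_trans yn (hn0 n hn); have := lt_trans ym (hn0 m hm).
  set a := N _; set b := N ((q m).1.2 - y); set c := N (_ - (_ - y)); lra.
have approx e : 0 < e -> exists n, [/\ N ((q n).1.1 - x) < e,
    N ((q n).1.2 - y) < e & N ((q n).2.2 - y') < e].
  move=> e0; have ed0 : 0 < d * e by rewrite mulr_gt0.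
  have [n1 h1] := inv_small _ ed0; have [n2 h2] := inv_small _ e0.
  have [n3 h3] := cy' _ e0; pose n := maxn (maxn n1 n2) n3.
  have [Dn Dn' Bn yn] := Hq n.
  exists n; split.
  - rewrite -(ltr_pM2l d0); apply: le_lt_trans (gapD (DB Dn Dxy)) _.
    apply: lt_trans yn _; apply: h1.
    by rewrite (leq_trans (leq_maxl n1 n2))// leq_maxl.
  - apply: lt_trans yn _; apply: h2.
    by rewrite (leq_trans (leq_maxr n1 n2))// leq_maxl.
  - exact/h3/leq_maxr.
have Nb n : N (q n).2.2 = N (q n).1.2.
  by have [Dn Dn' Bn _] := Hq n; exact: DD_B Dn Dn' _ Bn.
exists y'.
  apply: sa_closed => // e e0; have [n [h1 _ h3]] := approx e e0.
  by exists (q n).1.1, (q n).2.2; split=> //; case: (Hq n).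
apply/eqP; rewrite eq_le; apply/andP; split.
  apply: (form_limit multiplier_id multiplier_id) => // e e0.
  have [n [_ h2 h3]] := approx e e0; have [_ L1 L2] := Lq n.
  by exists (q n).2.2, (q n).1.2; split=> //; rewrite Nb.
apply: (form_limit multiplier_id multiplier_id) => // e e0.
have [n [_ h2 h3]] := approx e e0; have [_ L1 L2] := Lq n.
by exists (q n).1.2, (q n).2.2; split=> //; rewrite Nb.
Qed.

(** Krein-Lax argument. Formally x (n+1) = T (x n) with T symmetric for the form <B x, x>, while the
    norm of b n = B (x n) grows by a factor at most k at each step. The pairings <b n, x m> depend
    only on n + m: they are the moments of T, log-convex by Cauchy-Schwarz for the form of B. The
    gap of B bounds <b n, x n> by the squared norm of b n, and [heinz_sequence] compares the first
    two moments. *)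
Let heinz_iter (M : H -> H) (k : R) (x b u : nat -> H) : multiplier M -> 0 <= k ->
  (forall n, B (x n) (b n)) -> (forall n, L (u n)) ->
  (forall n m, ip (b n.+1) (x m) = ip (M (u n)) (u m)) ->
  (forall n, N (b n.+1) <= k ^+ 2 * N (b n)) ->
  ip (M (u 0)) (u 0) <= k * ip (b 0) (x 0).
Proof.
move=> mM k0 Bxb Lu rel bnd.
have Lx n : L (x n) by case: (LBx (Bxb n)).
have Lb n : L (b n) by case: (LBx (Bxb n)).
have sym n m : ip (b n) (x m) = ip (b m) (x n).
  by rewrite (symB (Bxb n) (Bxb m)) ipC.
have shift n m : ip (b n.+1) (x m) = ip (b n) (x m.+1).
  by rewrite rel mulC// -rel sym.
have sE n m : ip (b n) (x m) = ip (b (n + m)%N) (x 0).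
  by elim: m n => [|m IH] n; rewrite ?addn0// -shift IH addSnnS.
have -> : ip (M (u 0)) (u 0) = ip (b 1) (x 0) by rewrite rel.
apply: (@heinz_sequence R (fun n => ip (b n) (x 0))
          ((1 + d^-1) / 2%:R * N (b 0)) k k0).
- by move=> n; rewrite -addnn -sE; exact: B_ge0.
- move=> n m; rewrite -!addnn -!sE; apply: discriminant_le.
    exact: B_ge0.
  move=> t; have := B_ge0 (saD saB' (Bxb n) (saZ saB' t (Bxb m))).
  have Lbm := LZ t (Lb m); have Lxm := LZ t (Lx m).
  rewrite ipDl//; last exact: LD.
  rewrite !ipDr// !ipZl// !ipZr// (sym m n) => h; apply: le_trans h _.
  by rewrite le_eqVlt; apply/orP; left; apply/eqP; ring.
- move=> n; rewrite -addnn -sE.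
  have Nbn : N (b n) <= k ^+ n.*2 * N (b 0).
    elim: n => [|n IH]; first by rewrite expr0 mul1r.
    rewrite (le_trans (bnd n))// doubleS -[n.*2.+2]add2n exprD -mulrA.
    by rewrite ler_wpM2l// sqr_ge0.
  have gb := gapB (Bxb n); have := ip_ge0 (LB (Lb n) (Lx n)).
  rewrite NB// => h.
  apply: (@le_trans _ _ ((1 + d^-1) / 2%:R * N (b n))).
    have {}gb : N (x n) <= d^-1 * N (b n).
      by rewrite mulrC ler_pdivlMr// mulrC.
    by apply: half_bound gb h.
  rewrite -[leRHS]mulrA [N (b 0) * _]mulrC addnn ler_wpM2l//.
  by rewrite divr_ge0// addr_ge0// invr_ge0 ltW.
Qed.

(** The iteration is x (n+1) = B^(-1) M (x n), started at x, so that b (n+1) = M (x n). *)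
Let bound_BM (M : H -> H) (k : R) : multiplier M -> 0 <= k ->
  (forall x y, D x y -> N (M x) <= k ^+ 2 * N y) ->
  forall x y, B x y -> ip (M x) x <= k * ip y x.
Proof.
move=> mM k0 bM x y Bxy; have [LM _ _ _] := mM.
have bB := bound_B mM (sqr_ge0 k) bM.
have /choice[f Hf] : forall p : H * H, exists q : H * H,
    B p.1 p.2 -> B q.1 q.2 /\ q.2 = M p.1.
  move=> [v w]; have [Bvw|nB] := pselect (B v w); last by exists (v, w).
  have [z Bz] := B_onto (LM _ (LBx Bvw).1).
  by exists (z, M v).
pose p n := iter n f (x, y).
have Bp n : B (p n).1 (p n).2.
  by elim: n => [//|n IH]; exact: (Hf _ IH).1.
have bS n : (p n.+1).2 = M (p n).1 by exact: (Hf _ (Bp n)).2.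
apply: (@heinz_iter M k (fun n => (p n).1) (fun n => (p n).2) (fun n => (p n).1))
  => // n; rewrite ?bS//; first by case: (LBx (Bp n)).
exact: bB (Bp n).
Qed.

                                                    
(** The vector u is sign(D) x: with B z = x and u = D z, one has D u = D^2 z = B^2 z = B x. For the
    form bound the iteration is x (n+1) = D^(-1) M (u n) with u n = sign(D) (x n). Then B (x (n+1))
    has the norm of M (u n), because B and D have equal norms by [D_dom]. *)
Let sign_exists x y : B x y -> exists u, [/\ D u y & forall M k,
  multiplier M -> 0 <= k ->
  (forall x y, D x y -> N (M x) <= k ^+ 2 * N y) ->
  ip (M u) u <= k * ip y x].
Proof.
move=> Bxy.
have step v w : B v w -> exists z u, [/\ B z v, D z u & D u w].
  move=> Bvw; have [z Bz] := B_onto (LBx Bvw).1.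
  by have [u [D1 D2 _]] := BB_D Bz Bvw; exists z, u.
have /choice[g Hg] : forall p : H * H, exists zu : H * H,
    B p.1 p.2 -> [/\ B zu.1 p.1, D zu.1 zu.2 & D zu.2 p.2].
  move=> [v w]; have [Bvw|nB] := pselect (B v w); last by exists (v, w).
  by have [z [u h]] := step _ _ Bvw; exists (z, u).
exists (g (x, y)).2; split; first by case: (Hg (x, y) Bxy).
move=> M k mM k0 bM; have [LM _ _ _] := mM.
have /choice[f Hf] : forall p : H * H, exists q : H * H,
    B p.1 p.2 -> [/\ B q.1 q.2, D q.1 (M (g p).2) &
                     N q.2 = N (M (g p).2)].
  move=> [v w]; have [Bvw|nB] := pselect (B v w); last by exists (v, w).
  have [B1 D1 D2] := Hg (v, w) Bvw; have Lu := (LD' D2).1.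
  have [z Dz] := D_onto (LM _ Lu).
  by have [z' Bz Nz] := D_dom Dz; exists (z, z').
pose p n := iter n f (x, y).
have Bp n : B (p n).1 (p n).2.
  by elim: n => [//|n IH]; case: (Hf _ IH).
apply: (@heinz_iter M k (fun n => (p n).1) (fun n => (p n).2)
  (fun n => (g (p n)).2)) => //.
- by move=> n; have [_ _ D2] := Hg _ (Bp n); case: (LD' D2).
- move=> n m; have [Bn Dn _] := Hf _ (Bp n).
  have [B1 D1 D2] := Hg _ (Bp m).
  by rewrite (symB Bn (Bp m)) -(symD Dn D2).
- move=> n; have [Bn Dn Nn] := Hf _ (Bp n); have [B1 D1 D2] := Hg _ (Bp n).
  by rewrite Nn; exact: bM.
Qed.

Let S_core x y (e : R) : S x y -> 0 < e -> exists x' y' z',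
  [/\ S x' y', S y' z', N (x' - x) < e & N (y' - y) < e].
Proof. exact: sa_core saS dS S_ge0 x y e. Qed.

(** Heinz's inequality. On the domain of S^2 = B, the squared norm of S x is <B x, x> and [bound_BM]
    applies; this domain is a core for S. *)
Theorem sqrt_form_bound (M : H -> H) (k : R) : multiplier M -> 0 <= k ->
  (forall x y, D x y -> N (M x) <= k ^+ 2 * N y) ->
  forall x y, S x y -> ip (M x) x <= k * N y.
Proof.
move=> mM k0 bM x y Sxy; have [Lx Ly _] := (saS x y).1 Sxy.
rewrite -ipZl//.
apply: (form_limit (M2 := fun x => k%:C%C *: x)) => //.
  exact: (multiplierZ k0 multiplier_id).
move=> e e0; have [x' [y' [z' [S1 S2 dx dy]]]] := S_core Sxy e0.
have [Lx' Ly' s1] := (saS x' y').1 S1; exists x', y'; split=> //.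
rewrite ipZl//; have Bxz : B x' z' by apply/SSB; exists y'.
by apply: le_trans (bound_BM mM k0 bM Bxz) _; rewrite (s1 _ _ S2) ipC//;
   case: (LBx Bxz).
Qed.

(** An approximate sign(D) x: since x need not lie in the domain of B, it is replaced by a nearby x'
    in the domain of S^2 = B. With u = sign(D) x', <x, D u> = <x, B x'> = <S x, S x'>, which is
    close to the squared norm of S x. *)
Theorem sqrt_sign_test x y (e : R) : S x y -> 0 < e -> exists u v,
  [/\ D u v, `|ip x v - N y| <= e & forall M k, multiplier M -> 0 <= k ->
    (forall x y, D x y -> N (M x) <= k ^+ 2 * N y) ->
    ip (M u) u <= k * (N y + e)].
Proof.
move=> Sxy e0; have [Lx Ly s0] := (saS x y).1 Sxy.
have Ny0 := ip_ge0 Ly.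
(* The second entry keeps |<y, y' - y>| below e/4 by Cauchy-Schwarz, the first keeps the squared
   norm of y' - y below e/2; so the squared norm of y' is at most that of y plus e. *)
pose e' := Num.min (e / 2%:R) ((e / 4%:R) ^+ 2 / (N y + 1)).
have Ny1 : 0 < N y + 1 by rewrite ltr_wpDl.
have e'0 : 0 < e' by rewrite lt_min !divr_gt0// exprn_gt0// divr_gt0.
have [x' [y' [z' [S1 S2 dx dy]]]] := S_core Sxy e'0.
have [Lx' Ly' s1] := (saS x' y').1 S1.
have Bxz : B x' z' by apply/SSB; exists y'.
have [u [Du hu]] := sign_exists Bxz.
have Ld := LB Ly' Ly.
have cs : `|ip y (y' - y)| <= e / 4%:R.
  rewrite -ler_sqr ?nnegrE ?divr_ge0 ?(ltW e0)// real_normK ?num_real//.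
  apply: le_trans (ip_cauchy_schwarz Ly Ld) _.
  have h : N (y' - y) <= (e / 4%:R) ^+ 2 / (N y + 1).
    by apply: le_trans (ltW dy) _; rewrite ge_min lexx orbT.
  apply: le_trans (ler_wpM2l Ny0 h) _; rewrite mulrCA ler_piMr ?sqr_ge0//.
  by rewrite ler_pdivrMr// mul1r lerDl.
have dy' : N (y' - y) <= e / 2%:R.
  by apply: le_trans (ltW dy) _; rewrite ge_min lexx.
exists u, z'; split=> //.
  rewrite -(s0 _ _ S2) -[y'](subrK y) ipDr// addrK.
  by apply: le_trans cs _; rewrite ler_pdivrMr// ler_peMr ?(ltW e0)// ler1n.
move=> M k mM k0 bM; apply: le_trans (hu M k mM k0 bM) _.
rewrite ler_wpM2l// (ipC (LBx Bxz).2 Lx') -(s1 _ _ S2).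
rewrite -[y'](subrK y) [_ + y]addrC ND//; move: cs dy'; rewrite ler_norml => /andP[_].
by set a := ip y _; set b := ip (_ - _) _; lra.
Qed.

End SquareRoot.

End AbstractOperators.

                                           

(** * Measurability and finiteness of the unit ball of R^4 *)

Local Notation coordsR4 R := (measurableTypeR R * measurableTypeR R
                * measurableTypeR R * measurableTypeR R)%type.

Section MeasureR4.
Context {R : realType}.
Local Notation V := 'rV[R]_4.
Local Notation R4 := (coordsR4 R).
Local Notation mu := (@lebesgue_measure R).

Lemma ord4P (P : 'I_4 -> Prop) :
  P (inord 0) -> P (inord 1) -> P (inord 2) -> P (inord 3) -> forall i, P i.
Proof.
move=> h0 h1 h2 h3 i; have : i = inord i by rewrite inord_val.
by case: i => -[|[|[|[|//]]]] /= _ ->.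
Qed.

Lemma pt4_coord (y : R4) : [/\ pt4 y 0 (inord 0) = y.1.1.1,
  pt4 y 0 (inord 1) = y.1.1.2, pt4 y 0 (inord 2) = y.1.2 &
  pt4 y 0 (inord 3) = y.2].
Proof. by case: y => -[[y0 y1] y2] y3; rewrite /pt4 !mxE !inordK. Qed.

(** In the sup norm an open set is a countable union of boxes with rational centers and radii, and
    each box is a measurable product. *)
Lemma measurable_preimage_pt4 (O : set V) : open O -> measurable (@pt4 R @^-1` O).
Proof.
move=> oO.
pose box (q : rat * rat * rat * rat * rat) (y : R4) :=
  [/\ ball (ratr q.1.1.1.1 : R) (ratr q.2) y.1.1.1,
      ball (ratr q.1.1.1.2 : R) (ratr q.2) y.1.1.2,
      ball (ratr q.1.1.2 : R) (ratr q.2) y.1.2 &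
      ball (ratr q.1.2 : R) (ratr q.2) y.2].
pose P q := forall y, box q y -> O (pt4 y).
have -> : @pt4 R @^-1` O = \bigcup_(q : rat * rat * rat * rat * rat)
    (if `[< P q >] then box q else set0).
  apply/seteqP; split=> [y /= Oy|y [q _]]; last by case: asboolP => // + /=; apply.
  have /nbhs_ballP[e e0 be] : nbhs (pt4 y) O by apply: open_nbhs_nbhs.
  have /rat_in_itvoo[r] : 0 < e / 2%:R by rewrite divr_gt0.
  rewrite in_itv/= => /andP[r0 re].
  have near_rat (t : R) : exists q : rat, ball (ratr q : R) (ratr r) t.
    have /rat_in_itvoo[q] : t - ratr r < t + ratr r.
      by rewrite ltrD2l (lt_trans _ r0)// oppr_lt0.
    rewrite in_itv/= => /andP[h1 h2]; exists q.
    by rewrite /ball/= ltr_norml; apply/andP; split; lra.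
  have [q0 h0] := near_rat y.1.1.1; have [q1 h1] := near_rat y.1.1.2.
  have [q2 h2] := near_rat y.1.2; have [q3 h3] := near_rat y.2.
  exists (q0, q1, q2, q3, r) => //; case: asboolP => [_|]; first by split.
  case=> z [/= k0 k1 k2 k3]; apply: be; split=> // i j; rewrite ord1.
  have tri (a b c : R) : ball c (ratr r) a -> ball c (ratr r) b -> ball a e b.
    rewrite /ball/= !ltr_norml => /andP[? ?] /andP[? ?]; apply/andP; split; lra.
  have [a0 a1 a2 a3] := pt4_coord y; have [b0 b1 b2 b3] := pt4_coord z.
  by move: j; apply: ord4P; rewrite ?(a0, a1, a2, a3, b0, b1, b2, b3);
     [exact: tri h0 k0|exact: tri h1 k1|exact: tri h2 k2|exact: tri h3 k3].
apply: countable_bigcupT_measurable => // q; case: asboolP => // _.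
rewrite (_ : box q = (ball (ratr q.1.1.1.1 : R) (ratr q.2)
   `*` ball (ratr q.1.1.1.2 : R) (ratr q.2)
   `*` ball (ratr q.1.1.2 : R) (ratr q.2)
   `*` ball (ratr q.1.2 : R) (ratr q.2))); last first.
  by apply/seteqP; split=> [y [? ? ? ?]|y [[[? ?] ?] ?]]; split.
by do !apply: measurableX; exact: measurable_ball.
Qed.

Lemma measurable_pt4_nz : measurable [set y : R4 | pt4 y != 0].
Proof.
rewrite (_ : mkset _ = @pt4 R @^-1` [set x | x != 0])//.
apply: measurable_preimage_pt4.
rewrite (_ : mkset _ = ~` [set 0]); last first.
  by apply/seteqP; split=> x /eqP.
apply: closed_openC; apply: accessible_closed_set1.
exact/hausdorff_accessible/norm_hausdorff.
Qed.

Lemma measurable_off0 (F : V -> R) (D : set R4) : measurable D ->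
  (forall y, D y -> pt4 y != 0) ->
  (forall x, x != 0 -> {for x, continuous F}) ->
  measurable_fun D (fun y => F (pt4 y)).
Proof.
move=> mD D0 cF.
pose U := [set x : V | x != 0].
have oU : open U.
  rewrite (_ : U = ~` [set 0]); last by apply/seteqP; split=> x /eqP.
  apply: closed_openC; apply: accessible_closed_set1.
  exact/hausdorff_accessible/norm_hausdorff.
apply: (measurability _ (RGenOpens.measurableE R)).
move=> _ [_ [a [b ->] <-]].
rewrite (_ : _ `&` _ = D `&` @pt4 R @^-1` (U `&` F @^-1` `]a, b[%classic)).
  apply: measurableI => //; apply: measurable_preimage_pt4.
  rewrite openE => x [Ux Fx]; apply: filterI; first exact: open_nbhs_nbhs.
  by apply: (cF x Ux); apply: open_nbhs_nbhs; split=> //; exact: interval_open.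
by apply/seteqP; split=> y [Dy /=]; [split=> //; split=> //; exact: D0|case].
Qed.

Lemma measurable_pt4_continuous (F : V -> R) (D : set R4) : measurable D ->
  continuous F -> measurable_fun D (fun y => F (pt4 y)).
Proof.
move=> mD cF; apply: (measurability _ (RGenOpens.measurableE R)).
move=> _ [_ [a [b ->] <-]].
rewrite -[_ @^-1` _]/(@pt4 R @^-1` (F @^-1` `]a, b[%classic)).
apply: measurableI => //; apply: measurable_preimage_pt4.
by move/continuousP : cF; apply; exact: interval_open.
Qed.

Lemma dotE (x y : V) : dot x y = \sum_i x 0 i * y 0 i.
Proof. by rewrite /dot !mxE; apply: eq_bigr => i _; rewrite mxE. Qed.

Lemma sum4E (f : 'I_4 -> R) :
  \sum_i f i = f (inord 0) + f (inord 1) + f (inord 2) + f (inord 3).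
Proof.
have e (i : 'I_4) (k : nat) (h : (k < 4)%N) : i = Ordinal h :> nat ->
  i = inord k by move=> E; apply: val_inj; rewrite /= inordK.
rewrite !big_ord_recr big_ord0/= add0r.
by congr (f _ + f _ + f _ + f _); apply: val_inj; rewrite /= inordK.
Qed.

Lemma dot_ge0 (x : V) : 0 <= dot x x.
Proof. by rewrite dotE sumr_ge0// => i _; rewrite -expr2 sqr_ge0. Qed.

Lemma dot_eq0 (x : V) : (dot x x == 0) = (x == 0).
Proof.
apply/eqP/eqP => [|->]; last by rewrite /dot mul0mx mxE.
rewrite dotE => /eqP; rewrite psumr_eq0; last first.
  by move=> i _; rewrite -expr2 sqr_ge0.
move=> /allP h; apply/rowP => i; rewrite mxE; apply/eqP.
by have := h i (mem_index_enum _); rewrite /= mulf_eq0 orbb.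
Qed.

Lemma enorm_gt0 (x : V) : (0 < enorm x) = (x != 0).
Proof. by rewrite /enorm sqrtr_gt0 lt_neqAle dot_ge0 andbT eq_sym dot_eq0. Qed.

Lemma enorm_ge0 (x : V) : 0 <= enorm x. Proof. exact: sqrtr_ge0. Qed.

Lemma enorm_sqr (x : V) : enorm x ^+ 2 = dot x x.
Proof. by rewrite sqr_sqrtr// dot_ge0. Qed.

Lemma dotZ (a : R) (x : V) : dot (a *: x) (a *: x) = a ^+ 2 * dot x x.
Proof.
rewrite !dotE mulr_sumr; apply: eq_bigr => i _; rewrite !mxE; ring.
Qed.

Lemma enormZ (a : R) (x : V) : 0 <= a -> enorm (a *: x) = a * enorm x.
Proof.
by move=> a0; rewrite /enorm dotZ sqrtrM ?sqr_ge0// sqrtr_sqr ger0_norm.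
Qed.

Lemma S3_sproj (x : V) : x != 0 -> S3 (sproj x).
Proof.
rewrite -enorm_gt0 => x0; rewrite /S3/= /sproj enormZ ?invr_ge0 ?(ltW x0)//.
by rewrite mulVf ?gt_eqF.
Qed.

Lemma S3_nz (x : V) : S3 x -> x != 0.
Proof. by rewrite /S3/= -enorm_gt0 => ->. Qed.

Lemma sproj_S3 (x : V) : S3 x -> sproj x = x.
Proof. by rewrite /S3/= /sproj => ->; rewrite invr1 scale1r. Qed.

Lemma S3_dot (x : V) : S3 x -> dot x x = 1.
Proof. by rewrite -enorm_sqr => ->; rewrite expr1n. Qed.

Lemma ball4_nz (y : R4) : ball4 y -> pt4 y != 0.
Proof. by rewrite /ball4/= => /andP[+ _]; rewrite enorm_gt0. Qed.

Lemma ball4_S3 (y : R4) : ball4 y -> S3 (sproj (pt4 y)).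
Proof. by move/ball4_nz/S3_sproj. Qed.

Lemma continuous_dot : continuous (fun x : V => dot x x).
Proof.
move=> x; have h i : {for x, continuous (fun x : V => x 0 i * x 0 i)}.
  by apply: continuousM; exact: coord_continuous.
rewrite (_ : (fun x => _) = (fun x : V => x 0 (inord 0) * x 0 (inord 0))
  \+ (fun x : V => x 0 (inord 1) * x 0 (inord 1))
  \+ (fun x : V => x 0 (inord 2) * x 0 (inord 2))
  \+ (fun x : V => x 0 (inord 3) * x 0 (inord 3))).
  exact: continuousD (continuousD (continuousD (h _) (h _)) (h _)) (h _).
by apply/funext => z; rewrite dotE sum4E.
Qed.

Lemma continuous_enorm : continuous (@enorm R).
Proof.
move=> x.
exact: (continuous_comp (continuous_dot (x := x)) (@sqrt_continuous R _)).
Qed.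

Lemma measurable_ball4 : measurable (@ball4 R).
Proof.
rewrite (_ : ball4 = @pt4 R @^-1` (@enorm R @^-1` `]0, 1[%classic)).
  apply: measurable_preimage_pt4.
  move/continuousP : continuous_enorm; apply; exact: interval_open.
by apply/seteqP; split=> y; rewrite /ball4/= in_itv/=.
Qed.

Lemma coord_le_enorm (x : V) i : `|x 0 i| <= enorm x.
Proof.
rewrite -ler_sqr ?nnegrE ?enorm_ge0// real_normK ?num_real// enorm_sqr dotE.
rewrite (bigD1 i)//= -expr2 lerDl sumr_ge0// => j _.
by rewrite -expr2 sqr_ge0.
Qed.

Definition cube4 : set R4 := `[-1, 1]%classic `*` `[-1, 1]%classic
  `*` `[-1, 1]%classic `*` `[-1, 1]%classic.

Lemma measurable_cube4 : measurable cube4.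
Proof. by do !apply: measurableX. Qed.

Lemma cube4_fin : (leb4 cube4 < +oo)%E.
Proof.
pose I : set (measurableTypeR R) := `[(-1 : R), 1]%classic.
have m1 : measurable I by exact: measurable_itv.
have m2 := measurableX m1 m1; have m3 := measurableX m2 m1.
rewrite [leb4 _](product_measure1E _ _ m3 m1).
rewrite [X in (X * _)%E](product_measure1E _ _ m2 m1).
rewrite [X in (X * _ * _)%E](product_measure1E _ _ m1 m1).
have mI : mu I = (1 - -1)%:E.
  by rewrite [LHS]lebesgue_measure_itv/= lte_fin gtrN// EFinB.
apply: (@le_lt_trans _ _ (mu I * mu I * mu I * mu I)%E); first exact: lexx.
by rewrite !mI -!EFinM ltry.
Qed.

Lemma ball4_cube4 : @ball4 R `<=` cube4.
Proof.
move=> y /andP[_ /ltW y1]; have [h0 h1 h2 h3] := pt4_coord y.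
have h i : -1 <= pt4 y 0 i <= 1.
  by rewrite -ler_norml (le_trans (coord_le_enorm _ _)).
have := h (inord 0); have := h (inord 1); have := h (inord 2).
have := h (inord 3); rewrite h0 h1 h2 h3 => *.
by do 3!(split; last by rewrite /= in_itv/=); rewrite /= in_itv/=.
Qed.

Lemma ball4_fin : (leb4 (@ball4 R) < +oo)%E.
Proof.
apply: le_lt_trans cube4_fin; apply: le_measure; rewrite ?inE//.
- exact: measurable_ball4.
- exact: measurable_cube4.
- exact: ball4_cube4.
Qed.

End MeasureR4.

                                                                            
                                                                        
               
(** * Tonelli on R^4 and coordinate symmetries of Lebesgue measure *)

Section ProductMeasure.
Local Open Scope ereal_scope.
Context d1 d2 (T1 : measurableType d1) (T2 : measurableType d2) (R : realType).
Variables (m1 : {sigma_finite_measure set T1 -> \bar R})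
          (m2 : {sigma_finite_measure set T2 -> \bar R}).

(** A copy of the product measure that carries a sigma-finite structure, so that Tonelli applies
    again to products of more factors. *)
Definition prodm : set (T1 * T2)%type -> \bar R := m1 \x m2.

HB.instance Definition _ := Measure.copy prodm (m1 \x m2).

Let prodm_sigma_finite : sigma_finite setT prodm.
Proof.
have /sigma_finiteP[A [AT ndA finA]] := sigma_finiteT m1.
have /sigma_finiteP[B [BT ndB finB]] := sigma_finiteT m2.
exists (fun n => A n `*` B n).
  apply/seteqP; split=> // -[x y] _.
  have [i _ Ai] : (\bigcup_n A n) x by rewrite -AT.
  have [j _ Bj] : (\bigcup_n B n) y by rewrite -BT.
  exists (i + j)%N => //; split=> /=.
    by move: Ai; apply/subsetPset/ndA/leq_addr.
  by move: Bj; apply/subsetPset/ndB/leq_addl.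
move=> n; have [mA fA] := finA n; have [mB fB] := finB n.
split; first exact: measurableX.
by rewrite /prodm product_measure1E// lte_mul_pinfty// ge0_fin_numE.
Qed.

HB.instance Definition _ :=
  Measure_isSigmaFinite.Build _ _ _ prodm prodm_sigma_finite.

End ProductMeasure.

Section SwapR4.
Context {R : realType}.
Local Notation V := 'rV[R]_4.
Local Notation R4 := (coordsR4 R).
Local Notation mu := (@lebesgue_measure R).
Local Open Scope ereal_scope.

Definition mu2 : {sigma_finite_measure set
  (measurableTypeR R * measurableTypeR R)%type -> \bar R} := prodm mu mu.
Definition mu3 : {sigma_finite_measure set
  (measurableTypeR R * measurableTypeR R * measurableTypeR R)%type -> \bar R} :=
  prodm mu2 mu.

Lemma leb4_iter (H : R4 -> \bar R) : measurable_fun setT H ->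
  (forall y, 0 <= H y) -> \int[leb4]_y H y =
  \int[mu]_a \int[mu]_b \int[mu]_c \int[mu]_d H (a, b, c, d).
Proof.
move=> mH H0.
have E := fubini_tonelli1 (m1 := mu3) (m2 := mu) H mH H0.
have m1 := measurable_fun_fubini_tonelli_F (m2 := mu) H mH H0.
have p1 x : 0 <= fubini_F mu H x by exact: integral_ge0.
have E2 := fubini_tonelli1 (m1 := mu2) (m2 := mu) _ m1 p1.
have m2 := measurable_fun_fubini_tonelli_F (m2 := mu) _ m1 p1.
have p2 x : 0 <= fubini_F mu (fubini_F mu H) x by exact: integral_ge0.
have E3 := fubini_tonelli1 (m1 := mu) (m2 := mu) _ m2 p2.
transitivity (\int[mu3]_x fubini_F mu H x); first exact: E.
transitivity (\int[mu2]_x fubini_F mu (fubini_F mu H) x); first exact: E2.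
exact: E3.
Qed.

Definition preserves (s : R4 -> R4) := measurable_fun setT s /\
  forall H : R4 -> \bar R, measurable_fun setT H -> (forall y, 0 <= H y) ->
  \int[leb4]_y H (s y) = \int[leb4]_y H y.

Lemma preserves_comp s t : preserves s -> preserves t -> preserves (s \o t).
Proof.
move=> [ms hs] [mt ht]; split; first exact: measurableT_comp.
move=> H mH H0 /=; rewrite (ht (H \o s))//; last by move=> y /=.
by rewrite hs.
exact: measurableT_comp.
Qed.

Lemma preserves_integral s (f : R4 -> \bar R) : preserves s ->
  measurable_fun setT f -> \int[leb4]_y f (s y) = \int[leb4]_y f y.
Proof.
move=> [ms hs] mf; rewrite [LHS]integralE [RHS]integralE; congr (_ - _).
  transitivity (\int[leb4]_y f^\+ (s y)); first by apply: eq_integral => y _; rewrite ?(funeposE, funenegE).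
  by apply: hs; [exact: measurable_funepos|exact: funepos_ge0].
transitivity (\int[leb4]_y f^\- (s y)); first by apply: eq_integral => y _; rewrite ?(funeposE, funenegE).
by apply: hs; [exact: measurable_funeneg|exact: funeneg_ge0].
Qed.

Definition swap01 (y : R4) : R4 := (y.1.1.2, y.1.1.1, y.1.2, y.2).
Definition swap12 (y : R4) : R4 := (y.1.1.1, y.1.2, y.1.1.2, y.2).
Definition swap23 (y : R4) : R4 := (y.1.1.1, y.1.1.2, y.2, y.1.2).
Definition flip0 (y : R4) : R4 := (- y.1.1.1, y.1.1.2, y.1.2, y.2)%R.

Let mc0 : measurable_fun setT (fun y : R4 => y.1.1.1).
Proof. by apply: measurableT_comp => //; apply: measurableT_comp. Qed.
Let mc1 : measurable_fun setT (fun y : R4 => y.1.1.2).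
Proof. by apply: measurableT_comp => //; apply: measurableT_comp. Qed.
Let mc2 : measurable_fun setT (fun y : R4 => y.1.2).
Proof. by apply: measurableT_comp. Qed.
Let mc3 : measurable_fun setT (fun y : R4 => y.2).
Proof. exact: measurable_snd. Qed.

Let mquad d (T : measurableType d) (f0 f1 f2 f3 : T -> measurableTypeR R) :
  measurable_fun setT f0 -> measurable_fun setT f1 -> measurable_fun setT f2 ->
  measurable_fun setT f3 ->
  measurable_fun setT (fun y => (f0 y, f1 y, f2 y, f3 y) : R4).
Proof. by move=> *; do !apply: measurable_fun_pair. Qed.

Lemma preserves_swap01 : preserves swap01.
Proof.
have ms : measurable_fun setT swap01 by exact: mquad.
split=> // H mH H0; rewrite (leb4_iter mH H0).
have mHs := measurableT_comp mH ms; have H0s y : 0 <= (H \o swap01) y by exact: H0.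
rewrite [LHS](leb4_iter mHs H0s) /swap01/=.
pose K (p : measurableTypeR R * measurableTypeR R) :=
  \int[mu]_c \int[mu]_d H (p, c, d).
have m1 := measurable_fun_fubini_tonelli_F (m2 := mu) _ mH H0.
have p1 x : 0 <= \int[mu]_d H (x, d) by exact: integral_ge0.
have mK : measurable_fun setT K :=
  measurable_fun_fubini_tonelli_F (m2 := mu) _ m1 p1.
have K0 p : 0 <= K p by exact: integral_ge0.
exact: (esym (fubini_tonelli (m1 := mu) (m2 := mu) K mK K0)).
Qed.

Lemma preserves_swap12 : preserves swap12.
Proof.
have ms : measurable_fun setT swap12 by exact: mquad.
split=> // H mH H0; rewrite (leb4_iter mH H0).
have mHs := measurableT_comp mH ms; have H0s y : 0 <= (H \o swap12) y by exact: H0.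
rewrite [LHS](leb4_iter mHs H0s) /swap12/=; apply: eq_integral => a _.
have m1 := measurable_fun_fubini_tonelli_F (m2 := mu) _ mH H0.
pose K (p : measurableTypeR R * measurableTypeR R) :=
  \int[mu]_d H (a, p.1, p.2, d).
have mK : measurable_fun setT K.
  have mT : measurable_fun setT (fun p : measurableTypeR R * measurableTypeR R
     => (a, p.1, p.2) : measurableTypeR R * measurableTypeR R * measurableTypeR R).
    by do !apply: measurable_fun_pair.
  exact: (measurableT_comp m1 mT).
have K0 p : 0 <= K p by exact: integral_ge0.
exact: (esym (fubini_tonelli (m1 := mu) (m2 := mu) K mK K0)).
Qed.

Lemma preserves_swap23 : preserves swap23.
Proof.
have ms : measurable_fun setT swap23 by exact: mquad.
split=> // H mH H0; rewrite (leb4_iter mH H0).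
have mHs := measurableT_comp mH ms; have H0s y : 0 <= (H \o swap23) y by exact: H0.
rewrite [LHS](leb4_iter mHs H0s) /swap23/=; apply: eq_integral => a _.
apply: eq_integral => b _.
pose K (p : measurableTypeR R * measurableTypeR R) := H (a, b, p.1, p.2).
have mK : measurable_fun setT K.
  have mT : measurable_fun setT (fun p : measurableTypeR R * measurableTypeR R
     => (a, b, p.1, p.2) : R4) by exact: mquad.
  exact: (measurableT_comp mH mT).
have K0 p : 0 <= K p by exact: H0.
exact: (esym (fubini_tonelli (m1 := mu) (m2 := mu) K mK K0)).
Qed.

Lemma ge0_integral_oppr (f : R -> \bar R) : measurable_fun setT f ->
  (forall r, 0 <= f r) -> \int[mu]_r f (- r)%R = \int[mu]_r f r.
Proof.
move=> mf f0.
have mN : measurable_fun setT (-%R : measurableTypeR R -> measurableTypeR R).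
  exact: oppr_measurable.
rewrite -[LHS]/(\int[mu]_(r in (-%R : measurableTypeR R -> measurableTypeR R)
  @^-1` setT) (f \o -%R) r).
rewrite -(ge0_integral_pushforward mN mu measurableT mf)//.
by apply: eq_measure_integral => //= A mA AS; exact: lebesgue_measureN.
Qed.

Lemma preserves_flip0 : preserves flip0.
Proof.
have ms : measurable_fun setT flip0.
  apply: mquad => //; apply: measurableT_comp => //; exact: oppr_measurable.
split=> // H mH H0; rewrite (leb4_iter mH H0).
have mHs := measurableT_comp mH ms; have H0s y : 0 <= (H \o flip0) y by exact: H0.
rewrite [LHS](leb4_iter mHs H0s) /flip0/=.
have m1 := measurable_fun_fubini_tonelli_F (m2 := mu) _ mH H0.
have p1 x : 0 <= \int[mu]_d H (x, d) by exact: integral_ge0.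
have m2 := measurable_fun_fubini_tonelli_F (m2 := mu) _ m1 p1.
have p2 x : 0 <= \int[mu]_c \int[mu]_d H (x, c, d) by exact: integral_ge0.
have m3 := measurable_fun_fubini_tonelli_F (m2 := mu) _ m2 p2.
rewrite -[RHS]ge0_integral_oppr//.
by move=> a; exact: integral_ge0.
Qed.

(** The transposition of coordinates 0 and k, written as a conjugate of adjacent swaps; each
    adjacent swap is one instance of Tonelli. *)
Definition swap (k : 'I_4) : R4 -> R4 :=
  nth id [:: id; swap01; swap12 \o swap01 \o swap12;
             swap23 \o swap12 \o swap01 \o swap12 \o swap23] k.

Lemma preserves_swap k : preserves (swap k).
Proof.
have h0 : preserves id by split.
have h1 := preserves_swap01; have h2 := preserves_swap12.
have h3 := preserves_swap23.
have h4 := preserves_comp h2 (preserves_comp h1 h2).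
have h5 := preserves_comp h3 (preserves_comp h4 h3).
by move: k; apply: ord4P; rewrite /swap inordK.
Qed.

Lemma pt4_swap k y : pt4 (swap k y) = col_perm (tperm (0 : 'I_4)%R k) (pt4 y).
Proof.
have nat_eq (a b : nat) : (a < 4)%N -> (b < 4)%N ->
    (inord a == inord b :> 'I_4) = (a == b).
  by move=> ha hb; rewrite -val_eqE /= !inordK.
have e0 : (0 : 'I_4)%R = inord 0 :> 'I_4 by apply: val_inj; rewrite /= inordK.
case: y => -[[a b] c] d; apply/rowP; apply: ord4P; rewrite mxE e0;
  move: k; apply: ord4P; rewrite /swap ?inordK//=;
  rewrite ?tperm1 ?perm1 ?tpermL ?tpermR ?tpermD ?nat_eq//;
  by rewrite /pt4/= !mxE !inordK.
Qed.

Definition reflect0 (x : V) : V :=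
  (\row_i if i == 0 then - x 0 i else x 0 i)%R.

Lemma pt4_flip0 y : pt4 (flip0 y) = reflect0 (pt4 y).
Proof.
case: y => -[[a b] c] d; apply/rowP; apply: ord4P; rewrite !mxE -val_eqE/= !inordK//.
Qed.

End SwapR4.

(** * Differential calculus on punctured R^4 *)

Section Calculus.
Context {R : realType}.
Local Notation V := 'rV[R]_4.

Definition ei (i : 'I_4) : V := delta_mx 0 i.

Lemma norm_ei i : `|ei i| <= 1.
Proof.
rewrite [leLHS]/Num.Def.normr/= mx_normrE bigmax_le// => -[a b] _ /=.
by rewrite mxE normr_nat (ler_nat _ _ 1) leq_b1.
Qed.

Lemma open_nz : open [set x : V | x != 0].
Proof.
rewrite (_ : mkset _ = ~` [set 0]); last by apply/seteqP; split=> z /eqP.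
apply: closed_openC; apply: accessible_closed_set1.
exact/hausdorff_accessible/norm_hausdorff.
Qed.

Lemma nz_nbhs (x : V) : x != 0 -> \forall y \near x, y != 0.
Proof.
by move=> x0; apply: open_nbhs_nbhs; split=> //; exact: open_nz.
Qed.

Lemma nz_ball (x : V) : x != 0 -> exists2 d : R, 0 < d &
  forall y, `|y - x| < d -> y != 0.
Proof.
move=> x0; exists `|x|; first by rewrite normr_gt0.
by move=> y yx; apply: contraTneq yx => ->; rewrite sub0r normrN ltxx.
Qed.

Lemma line_derive (W : normedModType R) (F : V -> W) (z v : V) (t : R) :
  derivable F (t *: v + z) v ->
  is_derive t (1 : R) (fun s : R => F (s *: v + z)) ('D_v F (t *: v + z)).
Proof.
have E : (fun h : R => h^-1 *: (F ((h *: 1 + t) *: v + z) - F (t *: v + z))) =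
  (fun h => h^-1 *: (F (h *: v + (t *: v + z)) - F (t *: v + z))).
  by apply/funext => h; rewrite [_ *: 1]mulr1 scalerDl addrA.
move=> dF; apply: DeriveDef; first by rewrite /derivable E.
by rewrite /derive E.
Qed.

Definition C1_off0 (F : V -> R) := forall x, x != 0 ->
  {for x, continuous F} /\ forall i, derivable F x (ei i) /\
  {for x, continuous (fun x => 'D_(ei i) F x)}.

Lemma mvt_line (F : V -> R) (z : V) i (s : R) :
  (forall t, `|t| <= `|s| -> t *: ei i + z != 0) -> C1_off0 F ->
  exists2 t, `|t| <= `|s| &
    F (s *: ei i + z) - F z = s * 'D_(ei i) F (t *: ei i + z).
Proof.
move=> nz cF.
have key (a b : R) : a <= b -> (forall t, a <= t <= b -> t *: ei i + z != 0) ->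
    exists2 t, a <= t <= b & F (b *: ei i + z) - F (a *: ei i + z) =
      'D_(ei i) F (t *: ei i + z) * (b - a).
  move=> ab h.
  have dl t : a <= t <= b -> is_derive t (1 : R) (fun s : R => F (s *: ei i + z))
      ('D_(ei i) F (t *: ei i + z)).
    by move=> tab; apply: line_derive; case: (cF _ (h t tab)) => _ /(_ i)[].
  have [t||t tab E] := @MVT_segment R (fun s => F (s *: ei i + z))
    (fun s => 'D_(ei i) F (s *: ei i + z)) a b ab.
  - by rewrite in_itv/= => /andP[a1 b1]; apply: dl; rewrite !ltW.
  - apply: derivable_within_continuous => t; rewrite in_itv/= => tab.
    exact: (@ex_derive _ _ _ _ _ _ _ (dl t tab)).
  by exists t => //; move: tab; rewrite in_itv.
have z0 : z = 0 *: ei i + z by rewrite scale0r add0r.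
have [s0|s0] := leP 0 s.
  have [t|t tab E] := key 0 s s0.
    by move=> /andP[t0 ts]; apply: nz; rewrite !ger0_norm.
  exists t; first by case/andP: tab => *; rewrite !ger0_norm.
  by rewrite [in F z]z0 E subr0 mulrC.
have [t|t tab E] := key s 0 (ltW s0).
  by move=> /andP[t0 ts]; apply: nz; rewrite !ler0_norm ?lerN2// ltW.
exists t; first by case/andP: tab => *; rewrite !ler0_norm ?lerN2// ltW.
by rewrite [in F z]z0 -[LHS]opprB E sub0r mulrN opprK mulrC.
Qed.

Lemma continuous_ball (F : V -> R) (x : V) (e : R) : {for x, continuous F} ->
  0 < e -> exists2 d : R, 0 < d & forall y, `|y - x| < d -> `|F y - F x| < e.
Proof.
move=> cF e0; have /cvgrPdist_lt/(_ e e0) := cF.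
rewrite -nbhs_nearE => /nbhs_normP[d/= d0 h]; exists d => // y yx.
by rewrite distrC; apply: h; rewrite /= distrC.
Qed.

Lemma C1_increment (F : V -> R) (x : V) (e : R) : x != 0 -> C1_off0 F ->
  0 < e -> exists2 d : R, 0 < d & forall i (z : V) (s : R),
    `|z - x| + `|s| < d ->
    `|F (s *: ei i + z) - F z - s * 'D_(ei i) F x| <= `|s| * e.
Proof.
move=> x0 cF e0; have [d1 d10 nz] := nz_ball x0.
have /choice[f hf] : forall i, exists d : R, 0 < d /\ forall y, `|y - x| < d ->
    `|'D_(ei i) F y - 'D_(ei i) F x| < e.
  move=> i; have [_ /(_ i)[_ ci]] := cF x x0.
  by have [d d0 h] := continuous_ball ci e0; exists d.
exists (\big[Num.min/d1]_i f i).
  by apply/bigmin_gtP; split=> // i _; case: (hf i).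
move=> i z s dz; have [_ hi] := hf i.
have near t : `|t| <= `|s| -> `|t *: ei i + z - x| < \big[Num.min/d1]_i f i.
  move=> ts; apply: le_lt_trans dz; rewrite -addrA addrC.
  apply: le_trans (ler_normD _ _) _; rewrite lerD2l normrZ.
  by apply: le_trans ts; rewrite ler_piMr// norm_ei.
have [|t ts ->] := @mvt_line F z i s _ cF.
  move=> t ts; apply: nz; apply: lt_le_trans (near t ts) _.
  exact: bigmin_le_id.
rewrite -mulrBr normrM ler_wpM2l// ltW//; apply: hi.
apply: lt_le_trans (near t ts) _.
exact: bigmin_le_cond.
Qed.

(** Go from x to x + h v one coordinate at a time; the mean value theorem handles each increment
    uniformly, by continuity of the partial derivatives. *)
Lemma C1_derive (F : V -> R) (x v : V) : x != 0 -> C1_off0 F ->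
  is_derive x v F (\sum_i v 0 i * 'D_(ei i) F x).
Proof.
move=> x0 cF; set l := \sum_i _.
suff cvg_l : h^-1 *: (F (h *: v + x) - F x) @[h --> 0^'] --> l.
  by apply: DeriveDef; [apply/cvg_ex; exists l|exact: cvg_lim].
apply/cvgrPdist_le => e e0.
pose w k : V := \sum_(i < 4 | (i < k)%N) v 0 i *: ei i.
pose M := 1 + \sum_i `|v 0 i|.
have M0 : 0 < M by rewrite ltr_pwDl// sumr_ge0.
have [d d0 inc] := C1_increment x0 cF (divr_gt0 e0 M0).
have w4 : w 4 = v.
  rewrite /w [RHS]row_sum_delta; apply: eq_big => // i; exact: ltn_ord.
have wS (i : 'I_4) : w i.+1 = v 0 i *: ei i + w i.
  rewrite /w (bigD1 i)//=; congr (_ + _); apply: eq_bigl => j.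
  by rewrite ltnS [RHS]ltn_neqAle andbC.
have normw k : `|w k| <= \sum_i `|v 0 i|.
  apply: le_trans (ler_norm_sum _ _ _) _.
  rewrite [leRHS](bigID (fun i : 'I_4 => (i < k)%N))/= ler_wpDr ?sumr_ge0//.
  by apply: ler_sum => i _; rewrite normrZ ler_piMr// norm_ei.
near=> h.
have h0 : h != 0 by near: h; exact: nbhs_dnbhs_neq.
have hs : `|h| < d / (2%:R * M).
  by near: h; apply: dnbhs0_lt; rewrite divr_gt0// mulr_gt0.
have step (i : 'I_4) : `|F (h *: w i.+1 + x) - F (h *: w i + x)
    - h * v 0 i * 'D_(ei i) F x| <= `|h| * (`|v 0 i| * (e / M)).
  rewrite wS scalerDr scalerA -[_ + _ + x]addrA.
  apply: le_trans (inc i (h *: w i + x) (h * v 0 i) _) _; last first.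
    by rewrite normrM mulrA.
  rewrite addrK normrZ normrM -mulrDr.
  have vi : `|v 0 i| <= M.
    by rewrite /M (bigD1 i)//= addrCA lerDl addr_ge0// sumr_ge0.
  have wi : `|w i| <= M by rewrite (le_trans (normw _))// lerDr.
  apply: le_lt_trans (_ : `|h| * (2%:R * M) < d).
    by rewrite ler_wpM2l// mulr_natl mulr2n lerD.
  by rewrite -ltr_pdivlMr// mulr_gt0.
have tele : F (h *: v + x) - F x =
    \sum_(i < 4) (F (h *: w i.+1 + x) - F (h *: w i + x)).
  rewrite -{1}w4 [w 4]/(w 4%N).
  have -> : F x = F (h *: w 0%N + x).
    by rewrite /w big_pred0 ?scaler0 ?add0r.
  rewrite -(big_mkord xpredT (fun i => F (h *: w i.+1 + x) - F (h *: w i + x))).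
  by rewrite telescope_sumr.
have -> : l - h^-1 *: (F (h *: v + x) - F x) =
    - (h^-1 * \sum_(i < 4) (F (h *: w i.+1 + x) - F (h *: w i + x)
        - h * v 0 i * 'D_(ei i) F x)).
  rewrite tele [_ *: _]/(h^-1 * _) -[in RHS]mulrN -sumrN; apply/eqP.
  rewrite subr_eq -mulrDr -big_split/= /l mulr_sumr; apply/eqP.
  by apply: eq_bigr => i _; field.
rewrite normrN normrM normfV ler_pdivrMl ?normr_gt0//.
apply: le_trans (ler_norm_sum _ _ _) _.
apply: le_trans (ler_sum _ (fun i _ => step i)) _.
rewrite -mulr_sumr ler_wpM2l// -mulr_suml mulrCA ler_piMr ?(ltW e0)//.
by rewrite ler_pdivrMr// mul1r /M lerDr.
Unshelve. all: by end_near. Qed.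

(** The second difference of F over a square of side h is symmetric in the two directions, and up to
    o(h^2) it is h^2 times either mixed derivative. *)
Lemma schwarz_off0 (F : V -> R) i j (x : V) : x != 0 -> C1_off0 F ->
  (forall k, C1_off0 (fun x => 'D_(ei k) F x)) ->
  'D_(ei i) (fun x => 'D_(ei j) F x) x = 'D_(ei j) (fun x => 'D_(ei i) F x) x.
Proof.
move=> x0 cF cdF.
suff half k l (e : R) : 0 < e -> exists2 d : R, 0 < d & forall h, 0 < h ->
    h < d -> `|F (h *: ei k + (h *: ei l + x)) - F (h *: ei l + x)
      - (F (h *: ei k + x) - F x)
      - h ^+ 2 * 'D_(ei l) (fun x => 'D_(ei k) F x) x| <= h ^+ 2 * e.
  apply/eqP; rewrite -subr_eq0 -normr_le0; apply/ler_addgt0Pr => e e0.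
  have e20 : 0 < e / 2%:R by rewrite divr_gt0.
  have [d1 d10 h1] := half i j _ e20; have [d2 d20 h2] := half j i _ e20.
  pose h := Num.min d1 d2 / 2%:R.
  have m0 : 0 < Num.min d1 d2 by rewrite lt_min d10.
  have hm : h < Num.min d1 d2 by rewrite /h ltr_pdivrMr// ltr_pMr// ltr1n.
  have h0 : 0 < h by rewrite divr_gt0.
  have md1 : Num.min d1 d2 <= d1 by rewrite ge_min lexx.
  have md2 : Num.min d1 d2 <= d2 by rewrite ge_min lexx orbT.
  have {}h1 := h1 h h0 (lt_le_trans hm md1).
  have {}h2 := h2 h h0 (lt_le_trans hm md2).
  have hh : 0 < h ^+ 2 by rewrite exprn_gt0.
  rewrite add0r -(ler_pM2l hh) -[X in X * _](gtr0_norm hh) -normrM.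
  move: h1 h2; set a := F (h *: ei i + (h *: ei j + x)).
  have -> : F (h *: ei j + (h *: ei i + x)) = a by rewrite addrCA.
  set b := F (h *: ei j + x); set c := F (h *: ei i + x); set d := F x.
  set A := 'D_(ei j) _ x; set B := 'D_(ei i) _ x => h1 h2.
  have -> : h ^+ 2 * (B - A) = (a - b - (c - d) - h ^+ 2 * A)
       - (a - c - (b - d) - h ^+ 2 * B) by ring.
  apply: le_trans (ler_normB _ _) _; apply: le_trans (lerD h1 h2) _.
  by rewrite -mulrDr -splitr.
move=> e0; have [d1 d10 nz] := nz_ball x0.
have [d2 d20 inc] := C1_increment x0 (cdF k) e0.
exists (Num.min d1 d2 / 2%:R); first by rewrite divr_gt0// lt_min d10.
move=> h h0 hd.
pose G y := F (h *: ei l + y) - F y.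
have hd1 : h + h < d1.
  by rewrite -mulr2n -mulr_natr -ltr_pdivlMr// (lt_le_trans hd)// ler_wpM2r//
     ge_min lexx.
have hd2 : h + h < d2.
  by rewrite -mulr2n -mulr_natr -ltr_pdivlMr// (lt_le_trans hd)// ler_wpM2r//
     ge_min lexx orbT.
have nzt t s : `|t| <= h -> `|s| <= h -> t *: ei k + (s *: ei l + x) != 0.
  move=> th sh; apply: nz; rewrite addrA addrK.
  apply: le_lt_trans hd1; apply: le_trans (ler_normD _ _) _.
  by rewrite !normrZ lerD//; [apply: le_trans th|apply: le_trans sh];
     rewrite ler_piMr// norm_ei.
have hn : `|h| = h by rewrite gtr0_norm.
                                                                   
(* Mean value theorem along direction k for the difference of F on two parallel lines at distance h
   in direction l. *)
have [t th E] : exists2 t, `|t| <= h & F (h *: ei k + (h *: ei l + x))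
    - F (h *: ei l + x) - (F (h *: ei k + x) - F x) =
    h * ('D_(ei k) F (t *: ei k + (h *: ei l + x)) - 'D_(ei k) F (t *: ei k + x)).
  have dl t : 0 <= t <= h -> is_derive t (1 : R)
      (fun s : R => F (s *: ei k + (h *: ei l + x)) - F (s *: ei k + x))
      ('D_(ei k) F (t *: ei k + (h *: ei l + x)) - 'D_(ei k) F (t *: ei k + x)).
    move=> /andP[t0 th]; apply: is_deriveB; apply: line_derive.
      have := nzt t h; rewrite ger0_norm// hn lexx => /(_ th isT) n0.
      by case: (cF _ n0) => _ /(_ k)[].
    have := nzt t 0; rewrite ger0_norm// normr0 (ltW h0) => /(_ th isT).
    rewrite scale0r add0r => n0.
    by case: (cF _ n0) => _ /(_ k)[].
  have [t||t tab E] := @MVT_segment R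
    (fun s => F (s *: ei k + (h *: ei l + x)) - F (s *: ei k + x))
    (fun t => 'D_(ei k) F (t *: ei k + (h *: ei l + x))
              - 'D_(ei k) F (t *: ei k + x)) 0 h (ltW h0).
  - by rewrite in_itv/= => /andP[a1 b1]; apply: dl; rewrite !ltW.
  - apply: derivable_within_continuous => t; rewrite in_itv/= => tab.
    exact: (@ex_derive _ _ _ _ _ _ _ (dl t tab)).
  move: tab; rewrite in_itv/= => /andP[t0 th].
  exists t; first by rewrite ger0_norm.
  by move: E; rewrite subr0 !scale0r !add0r mulrC => <-; ring.
rewrite E expr2 -!mulrA -mulrBr normrM hn ler_wpM2l ?(ltW h0)//.
rewrite addrCA -{3}hn; apply: inc.
rewrite hn addrK normrZ; apply: le_lt_trans hd2; rewrite lerD2r.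
by apply: le_trans th; rewrite ler_piMr// norm_ei.
Qed.

End Calculus.

(** * Smooth functions and tangent derivations on the sphere *)

Section SmoothCalculus.
Context {R : realType}.
Local Notation V := 'rV[R]_4.
Implicit Types (f g : V -> R) (x v : V).

Lemma derive_sqrt_comp f x v : 0 < f x -> derivable f x v ->
  is_derive x v (fun y => Num.sqrt (f y)) ('D_v f x * (2%:R * Num.sqrt (f x))^-1).
Proof.
move=> fx0 df.
have df' : is_derive (0 : R) (1 : R) (fun h : R => f (h *: v + x)) ('D_v f x).
  by have := @line_derive R _ f x v 0; rewrite scale0r add0r => /(_ df).
have ds : is_derive (f (0 *: v + x)) (1 : R) Num.sqrt
    (2%:R * Num.sqrt (f x))^-1.
  by rewrite scale0r add0r; exact: is_derive1_sqrt.
have [ex val] := @is_derive1_comp R Num.sqrt (fun h : R => f (h *: v + x)) 0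
  _ _ ds df'.
apply: DeriveDef; first by apply/derivable1P.
rewrite mulrC -val /derive.
suff -> : (fun h : R => h^-1 *: (Num.sqrt (f (h *: v + x)) - Num.sqrt (f x))) =
  (fun h : R => h^-1 *: ((Num.sqrt \o (fun h : R => f (h *: v + x))) (h *: 1 + 0)
     - (Num.sqrt \o (fun h : R => f (h *: v + x))) 0)) by [].
by apply/funext => h /=; rewrite [_ *: 1]mulr1 addr0 scale0r add0r.
Qed.

Lemma Ck_cont k f : Ck_off0 k f -> forall x, x != 0 -> {for x, continuous f}.
Proof. by case: k => [|k] []. Qed.

Lemma Ck_derive k f i : Ck_off0 k.+1 f ->
  (forall x, x != 0 -> derivable f x (ei i)) /\
  Ck_off0 k (fun x => 'D_(ei i) f x).
Proof. by case=> _ /(_ i). Qed.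

Lemma nz_near_eq f g : (forall x, x != 0 -> f x = g x) ->
  forall x, x != 0 -> {near x, f =1 g}.
Proof.
move=> fg x x0; apply: filterS (nz_nbhs x0) => y; exact: fg.
Qed.

Lemma cont_ext f g : (forall x, x != 0 -> f x = g x) -> forall x, x != 0 ->
  {for x, continuous f} -> {for x, continuous g}.
Proof.
move=> fg x x0 cf; have : g y @[y --> x] --> f x.
  have {}cf : f y @[y --> x] --> f x := cf.
  apply: cvg_trans cf; apply: near_eq_cvg; first exact: nbhs_filter.
  by apply: filterS (nz_nbhs x0) => y y0; rewrite fg.
by rewrite fg.
Qed.

Lemma Ck_ext k f g : (forall x, x != 0 -> f x = g x) -> Ck_off0 k f ->
  Ck_off0 k g.
Proof.
elim: k f g => [|k IH] f g fg Cf.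
  by split=> // x x0; exact: cont_ext fg _ x0 (Ck_cont Cf x0).
split=> [x x0|i]; first exact: cont_ext fg _ x0 (Ck_cont Cf x0).
have [d1 d2] := Ck_derive i Cf; split=> [x x0|].
  by apply: near_eq_derivable (d1 x x0); exact: nz_near_eq.
apply: IH d2 => x x0; apply: near_eq_derive.
exact: (nz_near_eq fg x0).
Qed.

Lemma Ck_mono k f : Ck_off0 k.+1 f -> Ck_off0 k f.
Proof.
elim: k f => [|k IH] f; first by case.
move=> [cf h]; split=> // i; have [d1 d2] := h i; split=> //.
exact: IH d2.
Qed.

Lemma Ck_cst k (c : R) : Ck_off0 k (fun=> c).
Proof.
elim: k c => [|k IH] c; first by split=> // x _; exact: (@cst_continuous _ _ c x).
split=> [x _|i]; first exact: (@cst_continuous _ _ c x).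
split; first by move=> x _; exact: derivable_cst.
by apply: Ck_ext (IH 0) => x _; rewrite derive_cst.
Qed.

Lemma Ck_add k f g : Ck_off0 k f -> Ck_off0 k g -> Ck_off0 k (fun x => f x + g x).
Proof.
elim: k f g => [|k IH] f g Cf Cg.
  by split=> // x x0; exact: continuousD (Ck_cont Cf x0) (Ck_cont Cg x0).
split=> [x x0|i]; first exact: continuousD (Ck_cont Cf x0) (Ck_cont Cg x0).
have [df Cdf] := Ck_derive i Cf; have [dg Cdg] := Ck_derive i Cg.
split=> [x x0|]; first exact: derivableD (df x x0) (dg x x0).
apply: Ck_ext (IH _ _ Cdf Cdg) => x x0.
by rewrite -(deriveD (df x x0) (dg x x0)).
Qed.

Lemma Ck_mul k f g : Ck_off0 k f -> Ck_off0 k g -> Ck_off0 k (fun x => f x * g x).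
Proof.
elim: k f g => [|k IH] f g Cf Cg.
  by split=> // x x0; exact: continuousM (Ck_cont Cf x0) (Ck_cont Cg x0).
split=> [x x0|i]; first exact: continuousM (Ck_cont Cf x0) (Ck_cont Cg x0).
have [df Cdf] := Ck_derive i Cf; have [dg Cdg] := Ck_derive i Cg.
split=> [x x0|]; first exact: derivableM (df x x0) (dg x x0).
apply: Ck_ext (Ck_add (IH _ _ (Ck_mono Cf) Cdg) (IH _ _ (Ck_mono Cg) Cdf)) => x x0.
by rewrite -[RHS]/('D_(ei i) (f * g) x) (deriveM (df x x0) (dg x x0)).
Qed.

Lemma Ck_inv k f : (forall x, x != 0 -> f x != 0) -> Ck_off0 k f ->
  Ck_off0 k (fun x => (f x)^-1).
Proof.
move=> f0; elim: k => [|k IH] Cf.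
  by split=> // x x0; exact: (continuousV (f0 x x0) (Ck_cont Cf x0)).
split=> [x x0|i]; first exact: (continuousV (f0 x x0) (Ck_cont Cf x0)).
have [df Cdf] := Ck_derive i Cf; have Ci := IH (Ck_mono Cf).
split=> [x x0|]; first exact: derivableV (f0 x x0) (df x x0).
apply: Ck_ext (Ck_mul (Ck_mul (Ck_cst k (-1)) (Ck_mul Ci Ci)) Cdf) => x x0.
by rewrite deriveV ?f0//; [rewrite mulN1r -invfM -expr2|exact: df].
Qed.

Lemma Ck_sqrt k f : (forall x, x != 0 -> 0 < f x) -> Ck_off0 k f ->
  Ck_off0 k (fun x => Num.sqrt (f x)).
Proof.
move=> f0.
have cs x : x != 0 -> {for x, continuous f} ->
    {for x, continuous (fun x => Num.sqrt (f x))}.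
  move=> x0 cf; exact: (continuous_comp cf (@sqrt_continuous R _)).
elim: k => [|k IH] Cf.
  by split=> // x x0; exact: cs (Ck_cont Cf x0).
split=> [x x0|i]; first exact: cs (Ck_cont Cf x0).
have [df Cdf] := Ck_derive i Cf; have Ci := IH (Ck_mono Cf).
have der x (x0 : x != 0) := derive_sqrt_comp (f0 x x0) (df x x0).
split=> [x x0|]; first by case: (der x x0).
have C2 := Ck_inv (f := fun x => 2%:R * Num.sqrt (f x)) _ (Ck_mul (Ck_cst k 2%:R) Ci).
apply: Ck_ext (Ck_mul Cdf (C2 _)) => x x0; last first.
  by rewrite mulf_neq0// gt_eqF// sqrtr_gt0 f0.
by case: (der x x0).
Qed.

Lemma is_derive_coord (j : 'I_4) x v : is_derive x v (fun y : V => y 0 j) (v 0 j).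
Proof.
have d : derivable (fun y : V => y) x v by exact: derivable_id.
apply: DeriveDef; first by move/derivable_mxP : d; apply.
by have := derive_mx d; rewrite derive_id => /matrixP/(_ 0 j); rewrite mxE.
Qed.

Lemma Ck_coord k (j : 'I_4) : Ck_off0 k (fun x : V => x 0 j).
Proof.
have c (x : V) : {for x, continuous (fun x : V => x 0 j)} by exact: coord_continuous.
case: k => [|k]; split=> // i; split; first by move=> x _; case: (is_derive_coord j x (ei i)).
by apply: Ck_ext (Ck_cst k (ei i 0 j)) => x _; case: (is_derive_coord j x (ei i)).
Qed.

Definition Cinf f := forall k, Ck_off0 k f.

Lemma Cinf_C1 f : Cinf f -> C1_off0 f.
Proof.
move=> Cf x x0; split; first exact: Ck_cont (Cf 0%N) x x0.
move=> i; have [d1 d2] := Ck_derive i (Cf 1%N); split; first exact: d1.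
exact: Ck_cont d2 x x0.
Qed.

Lemma Cinf_derive f i : Cinf f -> Cinf (fun x => 'D_(ei i) f x).
Proof. by move=> Cf k; case: (Ck_derive i (Cf k.+1)). Qed.

Lemma Cinf_dot : Cinf (fun x => dot x x).
Proof.
move=> k; apply: (@Ck_ext _ (fun x => x 0 (inord 0) * x 0 (inord 0)
  + x 0 (inord 1) * x 0 (inord 1) + x 0 (inord 2) * x 0 (inord 2)
  + x 0 (inord 3) * x 0 (inord 3))) => [x _|]; first by rewrite dotE sum4E.
by do ![apply: Ck_add]; apply: Ck_mul; exact: Ck_coord.
Qed.

Lemma Cinf_enorm : Cinf (@enorm R).
Proof.
move=> k; apply: Ck_sqrt; last exact: Cinf_dot.
by move=> x x0; rewrite lt_neqAle dot_ge0 andbT eq_sym dot_eq0.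
Qed.

Lemma Cinf_enormV : Cinf (fun x => (enorm x)^-1).
Proof.
move=> k; apply: Ck_inv; last exact: Cinf_enorm.
by move=> x; rewrite -enorm_gt0 => /gt_eqF ->.
Qed.

Lemma radial_S3 (W : Type) (f : V -> W) x : S3 x -> radial f x = f x.
Proof. by move=> /sproj_S3; rewrite /radial/= => ->. Qed.

Lemma smooth_ext f g : (forall x, S3 x -> f x = g x) -> smooth f -> smooth g.
Proof.
by move=> fg sf k; apply: Ck_ext (sf k) => x x0; exact: fg (S3_sproj x0).
Qed.

Lemma smooth_cst (c : R) : smooth (fun _ : V => c).
Proof. by move=> k; exact: Ck_cst. Qed.

Lemma smoothD f g : smooth f -> smooth g -> smooth (fun x => f x + g x).
Proof. by move=> sf sg k; exact: Ck_add (sf k) (sg k). Qed.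

Lemma smoothM f g : smooth f -> smooth g -> smooth (fun x => f x * g x).
Proof. by move=> sf sg k; exact: Ck_mul (sf k) (sg k). Qed.

Lemma smoothN f : smooth f -> smooth (fun x => - f x).
Proof.
move=> sf; apply: smooth_ext (smoothM (smooth_cst (-1)) sf) => x _.
by rewrite mulN1r.
Qed.

Lemma smoothB f g : smooth f -> smooth g -> smooth (fun x => f x - g x).
Proof. by move=> sf sg; exact: smoothD sf (smoothN sg). Qed.

Lemma smooth_sum (I : Type) (s : seq I) (F : I -> V -> R) :
  (forall i, smooth (F i)) -> smooth (fun x => \sum_(i <- s) F i x).
Proof.
move=> sF; elim: s => [|i s IH].
  by apply: smooth_ext (smooth_cst 0) => x _; rewrite big_nil.
by apply: smooth_ext (smoothD (sF i) IH) => x _; rewrite big_cons.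
Qed.

Lemma smoothV f : (forall x, S3 x -> f x != 0) -> smooth f ->
  smooth (fun x => (f x)^-1).
Proof.
by move=> f0 sf k; apply: (@Ck_inv _ (radial f)) => // x x0; exact/f0/S3_sproj.
Qed.

Lemma smooth_sqrt f : (forall x, S3 x -> 0 < f x) -> smooth f ->
  smooth (fun x => Num.sqrt (f x)).
Proof.
by move=> f0 sf k; apply: (@Ck_sqrt _ (radial f)) => // x x0; exact/f0/S3_sproj.
Qed.

Lemma smooth_coord i : smooth (fun x : V => x 0 i).
Proof.
move=> k; apply: Ck_ext (Ck_mul (Cinf_enormV k) (Ck_coord k i)) => x x0.
by rewrite /radial/= /sproj mxE.
Qed.

(** A partial derivative of the 0-homogeneous extension, hence homogeneous of degree -1 ([pdZ]). *)
Definition pd i f x := 'D_(ei i) (radial f) x.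

Lemma radial_derive f x v : smooth f -> x != 0 ->
  is_derive x v (radial f) (\sum_i v 0 i * pd i f x).
Proof. by move=> sf x0; exact: C1_derive (Cinf_C1 sf). Qed.

Lemma dalongE (X : V -> V) f x : smooth f -> S3 x ->
  dalong X f x = \sum_i X x 0 i * pd i f x.
Proof.
by move=> sf Sx; rewrite /dalong; case: (radial_derive (X x) sf (S3_nz Sx)).
Qed.

Lemma derive_linear_comp (F : V -> R) (L : {linear V -> V}) x v :
  'D_v (fun y => F (L y)) x = 'D_(L v) F (L x).
Proof.
rewrite /derive.
suff -> : (fun h : R => h^-1 *: (F (L (h *: v + x)) - F (L x))) =
  (fun h : R => h^-1 *: (F (h *: L v + L x) - F (L x))) by [].
by apply/funext => h; rewrite linearP.
Qed.

Lemma sprojZ (t : R) x : 0 < t -> sproj (t *: x) = sproj x.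
Proof.
move=> t0; rewrite /sproj enormZ ?(ltW t0)// scalerA invfM mulrAC mulVf ?mul1r//.
by rewrite gt_eqF.
Qed.

Lemma pdZ i f (t : R) x : smooth f -> 0 < t -> x != 0 ->
  pd i f (t *: x) = t^-1 * pd i f x.
Proof.
move=> sf t0 x0.
have tx0 : t *: x != 0 by rewrite scaler_eq0 negb_or gt_eqF.
have : 'D_(ei i) (fun y => radial f (t *: y)) x = 'D_(ei i) (radial f) x.
  suff -> : (fun y => radial f (t *: y)) = radial f by [].
  by apply/funext => y; rewrite /radial/= sprojZ.
rewrite (derive_linear_comp (radial f) (GRing.scale t)) => E.
rewrite [in RHS]/pd -E.
have [_ ->] := radial_derive (t *: ei i) sf tx0.
rewrite (bigD1 i)//= big1 ?addr0 => [|j ji]; last first.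
  by rewrite !mxE (negPf ji) andbF mulr0 mul0r.
by rewrite !mxE !eqxx mulr1 mulKf// gt_eqF.
Qed.

(** The factor [enorm x] compensates the degree -1 of the partial derivatives. *)
Lemma radial_dalong (X : V -> V) f x : smooth f -> x != 0 ->
  radial (dalong X f) x = enorm x * \sum_i radial X x 0 i * pd i f x.
Proof.
move=> sf x0; rewrite /radial/= dalongE//; last exact: S3_sproj.
rewrite mulr_sumr; apply: eq_bigr => i _; rewrite [in pd _ _ _]/sproj pdZ//.
  by rewrite invrK; ring.
by rewrite invr_gt0 enorm_gt0.
Qed.

Definition smooth_field (X : V -> V) := forall i, smooth (fun x => X x 0 i).

Lemma Cinf_pd i f : smooth f -> Cinf (pd i f).
Proof. exact: Cinf_derive. Qed.

Lemma smooth_dalong (X : V -> V) f : smooth_field X -> smooth f ->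
  smooth (dalong X f).
Proof.
move=> sX sf k; apply: (@Ck_ext _ (fun x => enorm x * (
  radial X x 0 (inord 0) * pd (inord 0) f x + radial X x 0 (inord 1) * pd (inord 1) f x
  + radial X x 0 (inord 2) * pd (inord 2) f x
  + radial X x 0 (inord 3) * pd (inord 3) f x))) => [x x0|].
  by rewrite radial_dalong// sum4E.
apply: Ck_mul; first exact: Cinf_enorm.
by do ![apply: Ck_add]; apply: Ck_mul; try exact: sX; exact: Cinf_pd.
Qed.

Lemma radial_near_eq (W : Type) (F G : V -> W) : (forall x, S3 x -> F x = G x) ->
  forall x, x != 0 -> {near x, radial F =1 radial G}.
Proof.
move=> fg x x0; apply: filterS (nz_nbhs x0) => y y0; exact/fg/S3_sproj.
Qed.

Lemma dalong_ext (W : normedModType R) (X Y : V -> V) (F G : V -> W) x : S3 x ->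
  X x = Y x -> (forall x, S3 x -> F x = G x) -> dalong X F x = dalong Y G x.
Proof.
move=> Sx XY FG; rewrite /dalong XY; apply: near_eq_derive.
exact: (radial_near_eq FG (S3_nz Sx)).
Qed.

Lemma dalong_cst (X : V -> V) (c : R) x : dalong X (fun=> c) x = 0.
Proof. exact: derive_cst. Qed.

Let deriv (X : V -> V) f x (sf : smooth f) (Sx : S3 x) :
  derivable (radial f) x (X x).
Proof. by case: (radial_derive (X x) sf (S3_nz Sx)). Qed.

Lemma dalongD (X : V -> V) f g x : smooth f -> smooth g -> S3 x ->
  dalong X (fun x => f x + g x) x = dalong X f x + dalong X g x.
Proof. by move=> sf sg Sx; exact: deriveD (deriv sf Sx) (deriv sg Sx). Qed.

Lemma dalongM (X : V -> V) f g x : smooth f -> smooth g -> S3 x ->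
  dalong X (fun x => f x * g x) x = f x * dalong X g x + g x * dalong X f x.
Proof.
move=> sf sg Sx; rewrite {1}/dalong.
have /= := deriveM (deriv (X := X) sf Sx) (deriv (X := X) sg Sx).
by rewrite !radial_S3.
Qed.

Lemma dalongZ (X : V -> V) (c : R) f x : smooth f -> S3 x ->
  dalong X (fun x => c * f x) x = c * dalong X f x.
Proof.
by move=> sf Sx; rewrite (dalongM _ (smooth_cst c))// dalong_cst mulr0 addr0.
Qed.

Lemma dalongN (X : V -> V) f x : smooth f -> S3 x ->
  dalong X (fun x => - f x) x = - dalong X f x.
Proof.
move=> sf Sx; rewrite -mulN1r -(dalongZ _ _ sf)//.
by apply: dalong_ext => // y _; rewrite mulN1r.
Qed.

Lemma dalongB (X : V -> V) f g x : smooth f -> smooth g -> S3 x ->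
  dalong X (fun x => f x - g x) x = dalong X f x - dalong X g x.
Proof.
by move=> sf sg Sx; rewrite (dalongD _ sf (smoothN sg))// dalongN.
Qed.

Lemma dalong_sum (I : Type) (s : seq I) (X : V -> V) (F : I -> V -> R) x :
  (forall i, smooth (F i)) -> S3 x ->
  dalong X (fun x => \sum_(i <- s) F i x) x = \sum_(i <- s) dalong X (F i) x.
Proof.
move=> sF Sx; elim: s => [|i s IH].
  rewrite [RHS]big_nil -[RHS](dalong_cst X 0 x); apply: dalong_ext => // y _.
  by rewrite big_nil.
rewrite big_cons -IH -dalongD//; last exact: smooth_sum.
by apply: dalong_ext => // y _; rewrite big_cons.
Qed.

Lemma dalong_field (X Y : V -> V) x i : smooth_field Y -> S3 x ->
  dalong X Y x 0 i = dalong X (fun x => Y x 0 i) x.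
Proof.
move=> sY Sx; have dY : derivable (radial Y) x (X x).
  by apply/derivable_mxP => a j; rewrite ord1; exact: (deriv (sY j) Sx).
by rewrite /dalong derive_mx// mxE.
Qed.

Lemma lie_coord (X Y : V -> V) x i : smooth_field X -> smooth_field Y -> S3 x ->
  lie X Y x 0 i = dalong X (fun x => Y x 0 i) x - dalong Y (fun x => X x 0 i) x.
Proof. by move=> sX sY Sx; rewrite /lie mxE [in X in _ + X]mxE !dalong_field. Qed.

Lemma derive_enorm x v : S3 x -> is_derive x v (@enorm R) (dot v x).
Proof.
move=> Sx; have dd : derivable (fun y : V => dot y y) x v /\
    'D_v (fun y : V => dot y y) x = 2%:R * dot v x.
  have D i := derivableM (@ex_derive _ _ _ _ _ _ _ (is_derive_coord i x v))
     (@ex_derive _ _ _ _ _ _ _ (is_derive_coord i x v)).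
  have E : (fun y : V => dot y y) = \sum_(i < 4)
     ((fun y : V => y 0 i) * (fun y : V => y 0 i)).
    by apply/funext => y; rewrite dotE fct_sumE.
  rewrite E; split; first exact: derivable_sum.
  rewrite derive_sum// dotE mulr_sumr; apply: eq_bigr => i _.
  rewrite deriveM; try by case: (is_derive_coord i x v).
  have [_ ->] := is_derive_coord i x v.
  by rewrite [_ *: _]/(x 0 i * v 0 i) mulr_natl mulr2n mulrC.
case: dd => d1 d2; have := derive_sqrt_comp _ d1.
rewrite (S3_dot Sx) sqrtr1 d2 mulr1 => /(_ ltr01).
by rewrite mulrAC divff ?mul1r// pnatr_eq0.
Qed.

                                                                              
                                                                        
                                                 
(** The extension of Y f is the flat directional derivative times [enorm]. A tangent X does not
    differentiate [enorm], so the usual computation applies, and the second-order terms cancel by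
    symmetry of mixed derivatives. *)
Lemma dalong_commutator (X Y : V -> V) f x : smooth_field X -> smooth_field Y ->
  tangent X -> tangent Y -> smooth f -> S3 x ->
  dalong X (dalong Y f) x - dalong Y (dalong X f) x = dalong (lie X Y) f x.
Proof.
move=> sX sY tX tY sf Sx; have x0 := S3_nz Sx.
have second (A B : V -> V) : smooth_field A -> smooth_field B -> tangent A ->
    dalong A (dalong B f) x = \sum_i (dalong A (fun x => B x 0 i) x * pd i f x
      + B x 0 i * \sum_j A x 0 j * 'D_(ei j) (pd i f) x).
  move=> sA sB tA; rewrite /dalong.
  have -> : 'D_(A x) (radial (fun x => 'D_(B x) (radial f) x)) x =
      'D_(A x) (enorm * \sum_i (radial (fun x => B x 0 i) * pd i f)) x.
    apply: near_eq_derive; apply: filterS (nz_nbhs x0) => y y0.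
    by rewrite [LHS](radial_dalong _ sf y0) [RHS]/GRing.mul/= fct_sumE.
  have dB i := deriv (X := A) (sB i) Sx.
  have dpv i := C1_derive (A x) x0 (Cinf_C1 (Cinf_pd i sf)).
  have dp i : derivable (pd i f) x (A x) by case: (dpv i).
  have dm i := derivableM (dB i) (dp i).
  have [de De] := derive_enorm (A x) Sx.
  rewrite (deriveM de (derivable_sum dm)).
  rewrite De -[dot _ _]/((A x *m x^T) 0 0).
  have -> : (A x *m x^T) 0 0 = 0.
    by rewrite -[LHS]/(dot (A x) x) -(tA x Sx) !dotE; apply: eq_bigr => i _; rewrite mulrC.
  rewrite scaler0 addr0 [enorm x](Sx : enorm x = 1) scale1r (derive_sum dm).
  apply: eq_bigr => i _; rewrite (deriveM (dB i) (dp i)).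
  have [_ ->] := dpv i.
  rewrite radial_S3// [_ *: _]/(_ * _) [X in _ + X]/(_ * _) addrC.
  by congr (_ + _); rewrite mulrC.
rewrite !second// dalongE//.
have sw i j : 'D_(ei i) (pd j f) x = 'D_(ei j) (pd i f) x.
  apply: (@schwarz_off0 _ (radial f)) => //; first exact: Cinf_C1.
  by move=> k; exact/Cinf_C1/Cinf_pd.
have comm : \sum_i (Y x 0 i * \sum_j X x 0 j * 'D_(ei j) (pd i f) x) =
    \sum_i (X x 0 i * \sum_j Y x 0 j * 'D_(ei j) (pd i f) x).
  under eq_bigr do rewrite mulr_sumr.
  rewrite exchange_big/=; apply: eq_bigr => i _; rewrite mulr_sumr.
  by apply: eq_bigr => j _; rewrite sw mulrCA.
have -> : \sum_i (lie X Y x 0 i * pd i f x) = \sum_i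
    (dalong X (fun x => Y x 0 i) x * pd i f x
     - dalong Y (fun x => X x 0 i) x * pd i f x).
  by apply: eq_bigr => i _; rewrite lie_coord// mulrBl.
rewrite sumrB !big_split/= comm.
by rewrite opprD addrACA subrr addr0.
Qed.

End SmoothCalculus.

(** * Integration by parts in R^4 *)

Section Divergence.
Context {R : realType}.
Local Notation V := 'rV[R]_4.
Local Notation R4 := (coordsR4 R).
Local Notation mu := (@lebesgue_measure R).

Lemma compact_S3 : compact (@S3 R).
Proof.
apply: bounded_closed_compact.
  exists 1; split=> // M M1 x Sx; apply: ltW; apply: le_lt_trans M1.
  rewrite [leLHS]/Num.Def.normr/= mx_normrE bigmax_le// => -[a i] _ /=.
  by rewrite ord1 -[leRHS](Sx : enorm x = 1); exact: coord_le_enorm.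
rewrite (_ : S3 = @enorm R @^-1` [set 1])//.
apply: closed_comp => [x _|]; first exact: continuous_enorm.
exact: closed_eq.
Qed.

Lemma S3_ei i : S3 (ei i : V).
Proof.
rewrite /S3/= /enorm dotE (bigD1 i)//= big1 ?addr0 => [|j ji].
  by rewrite mxE !eqxx mulr1 sqrtr1.
by rewrite mxE (negPf ji) andbF mulr0.
Qed.

Lemma smooth_max (f : V -> R) : smooth f ->
  exists2 x, S3 x & forall y, S3 y -> f y <= f x.
Proof.
move=> sf; have cf : {within @S3 R, continuous (radial f)}.
  apply: continuous_in_subspaceT => x /set_mem/S3_nz x0.
  exact: Ck_cont (sf 0%N) x x0.
have [|x xS h] := @EVT_max_rV R 4 (radial f) S3 _ compact_S3 cf.
  by exists (ei 0); exact: S3_ei.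
exists x; first exact: set_mem.
move=> y Sy; have := h y (mem_set Sy); rewrite !radial_S3//; exact: set_mem.
Qed.

Lemma smooth_bounded (f : V -> R) : smooth f ->
  exists2 M, 0 < M & forall x, S3 x -> `|f x| <= M.
Proof.
move=> sf; have [x _ hx] := smooth_max sf; have [y _ hy] := smooth_max (smoothN sf).
exists (1 + `|f x| + `|f y|) => [|z Sz].
  by rewrite -addrA ltr_pwDl// addr_ge0.
rewrite ler_norml; apply/andP; split.
  have := hy z Sz; rewrite lerN2 => /(le_trans _); apply.
  rewrite lerNl; apply: le_trans (ler_norm _) _; rewrite normrN.
  by rewrite lerDr addr_ge0.
apply: le_trans (hx z Sz) _; apply: le_trans (ler_norm _) _.
by rewrite addrAC lerDr addr_ge0.
Qed.

Lemma smooth_pos_bound (f : V -> R) : smooth f -> (forall x, S3 x -> 0 < f x) ->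
  exists2 m, 0 < m & forall x, S3 x -> m <= f x.
Proof.
move=> sf f0; have [x Sx hx] := smooth_max (smoothN sf).
by exists (f x); [exact: f0|move=> y Sy; rewrite -lerN2 hx].
Qed.

Lemma smooth_measurable (f : V -> R) : smooth f -> measurable_S3 f.
Proof.
move=> sf; rewrite /measurable_S3.
rewrite -[fun y => _]/(fun y => radial f (pt4 y)).
apply: measurable_off0; first exact: measurable_ball4.
  exact: ball4_nz.
exact: Ck_cont (sf 0%N).
Qed.

                                            
Lemma integral_line (H dH : V -> R) (z : V) : z 0 (inord 3) = 0 ->
  continuous dH -> (forall x, is_derive x (ei (inord 3)) H (dH x)) ->
  (forall x, 1 <= enorm x -> H x = 0 /\ dH x = 0) ->
  (\int[mu]_t (dH (t *: ei (inord 3) + z))%:E = 0)%E.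
Proof.
move=> z3 cdH der supp.
have far (t : R) : 1 <= `|t| -> 1 <= enorm (t *: ei (inord 3) + z).
  move=> t1; apply: le_trans t1 _; apply: le_trans (coord_le_enorm _ (inord 3)).
  by rewrite !mxE !eqxx mulr1 z3 addr0.
have dline t : is_derive t (1 : R) (fun t : R => H (t *: ei (inord 3) + z))
    (dH (t *: ei (inord 3) + z)).
  have [ex val] := der (t *: ei (inord 3) + z).
  by have := line_derive ex; rewrite val.
have cline : continuous (fun t : R => dH (t *: ei (inord 3) + z)).
  move=> t; apply: continuous_comp; last exact: cdH.
  apply: cvgD; last exact: cvg_cst.
  by apply: cvgZr_tmp; exact: cvg_id.
have -> : (\int[mu]_t (dH (t *: ei (inord 3) + z))%:E =
    \int[mu]_(t in `[(-1)%R, 1%R]) (dH (t *: ei (inord 3) + z))%:E)%E.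
  rewrite [RHS]integral_mkcond; apply: eq_integral => t _.
  rewrite patchE; case: ifPn => // /negP ht.
  have t1 : 1 <= `|t|.
    rewrite leNgt; apply/negP => t1; apply: ht; rewrite inE/= in_itv/=.
    by move: t1; rewrite ltr_norml => /andP[/ltW -> /ltW ->].
  by have [_ ->] := supp _ (far t t1).
have cH : continuous (fun t : R => H (t *: ei (inord 3) + z)).
  move=> t; apply: differentiable_continuous; apply/derivable1_diffP.
  by case: (dline t).
rewrite (@continuous_FTC2 R _ (fun t => H (t *: ei (inord 3) + z))).
- have n1 : 1 <= `|1 : R| by rewrite normr1.
  have n2 : 1 <= `|-1 : R| by rewrite normrN normr1.
  have [-> _] := supp _ (far 1 n1); have [-> _] := supp _ (far (-1) n2).
  by rewrite subee.
- by rewrite gtrN.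
- by apply: continuous_subspaceT => t; exact: cline.
- split=> [t _||]; first by case: (dline t).
    by apply: cvg_at_right_filter; exact: cH.
  by apply: cvg_at_left_filter; exact: cH.
- by move=> t _; rewrite derive1E; case: (dline t).
Qed.

Definition compact_ibp (i : 'I_4) := forall (H dH : V -> R), continuous dH ->
  (forall x, is_derive x (ei i) H (dH x)) ->
  (forall x, 1 <= enorm x -> H x = 0 /\ dH x = 0) ->
  (\int[leb4]_y (dH (pt4 y))%:E = 0)%E.

Lemma continuous_bounded_integrable (F : V -> R) : continuous F ->
  (forall x, 1 <= enorm x -> F x = 0) ->
  leb4.-integrable setT (fun y : R4 => (F (pt4 y))%:E).
Proof.
move=> cF supp.
have mF : measurable_fun setT (fun y : R4 => F (pt4 y)).
  exact: measurable_pt4_continuous.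
have cB : compact [set x : V | enorm x <= 1].
  apply: bounded_closed_compact.
    exists 1; split=> // M M1 x /= Sx; apply: ltW; apply: le_lt_trans M1.
    rewrite [leLHS]/Num.Def.normr/= mx_normrE bigmax_le// => -[a i] _ /=.
    by rewrite ord1; apply: le_trans Sx; exact: coord_le_enorm.
  rewrite (_ : mkset _ = @enorm R @^-1` [set x | x <= 1])//.
  apply: closed_comp => [x _|]; first exact: continuous_enorm.
  exact: closed_le.
have [M hM] : exists M, forall x, `|F x| <= M.
  have c1 : {within [set x : V | enorm x <= 1], continuous (fun x => `|F x|)}.
    apply: continuous_subspaceT => x; exact: (cvg_norm (cF x)).
  have [|x xS h] := @EVT_max_rV R 4 (fun x => `|F x|) _ _ cB c1.
    by exists (ei 0); rewrite /= (S3_ei 0 : enorm (ei 0) = 1).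
  exists `|F x| => y; have [y1|/ltW y1] := leP (enorm y) 1; first by apply: h; rewrite inE.
  by rewrite supp// normr0.
have [mC fC] := (@measurable_cube4 R, @cube4_fin R).
have iC : leb4.-integrable (@cube4 R) (EFin \o (fun y : R4 => F (pt4 y))).
  apply: measurable_bounded_integrable => //.
    exact: measurable_funS mF.
  exists M; split; first by rewrite num_real.
  by move=> N MN y _ /=; apply: le_trans (hM _) (ltW MN).
have := (integrable_mkcond (EFin \o (fun y : R4 => F (pt4 y))) mC).1 iC.
apply: eq_integrable => // y _; rewrite patchE/=; case: ifPn => // /negP yC.
rewrite supp// leNgt; apply/negP => y1; apply: yC; rewrite inE.
have [h0 h1 h2 h3] := pt4_coord y.
have h i : -1 <= pt4 y 0 i <= 1.
  by rewrite -ler_norml (le_trans (coord_le_enorm _ _))// ltW.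
have := h (inord 0); have := h (inord 1); have := h (inord 2).
have := h (inord 3); rewrite h0 h1 h2 h3 => *.
by do 3!(split; last by rewrite /= in_itv/=); rewrite /= in_itv/=.
Qed.

Lemma compact_ibp3 : compact_ibp (inord 3).
Proof.
move=> H dH cdH der supp.
have iH := continuous_bounded_integrable cdH (fun x h => (supp x h).2).
have E := integral12_prod_meas1 (m1 := @mu3 R) (m2 := mu) iH.
transitivity (\int[@mu3 R]_x fubini_F mu (fun y : R4 => (dH (pt4 y))%:E) x)%E.
  exact: esym E.
apply: integral0_eq => -[[a b] c] _; rewrite /fubini_F.
rewrite -[RHS](@integral_line H dH (pt4 ((a, b, c, 0) : R4))) //; last first.
  by have [_ _ _ ->] := pt4_coord ((a, b, c, 0) : R4).
apply: eq_integral => t _; congr ((dH _)%:E); apply/rowP; apply: ord4P;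
  by rewrite !mxE ?inordK//= -?val_eqE/= ?inordK//= ?mulr0 ?mulr1 ?add0r ?addr0.
Qed.

Let P (k : 'I_4) : {linear V -> V} := col_perm (tperm 0 k).

Let P_ei k i : P k (ei i) = ei (tperm 0 k i).
Proof.
apply/rowP => j; rewrite !mxE eqxx/=; congr (_%:R); congr nat_of_bool.
by rewrite -(inj_eq (@perm_inj _ (tperm 0 k))) tpermK.
Qed.

Let enormP k x : enorm (P k x) = enorm x.
Proof.
rewrite /enorm !dotE; congr (Num.sqrt _).
rewrite [RHS](reindex_inj (@perm_inj _ (tperm 0 k)))/=.
by apply: eq_bigr => j _; rewrite !mxE.
Qed.

Let cP k : continuous (P k).
Proof.
move=> x; apply/(@cvgrPdist_lt _ _ _ (nbhs x) (nbhs_filter x)) => e e0.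
apply: (@filterS _ (nbhs x) (nbhs_filter x) _ _ _ (nbhsx_ballx x e e0)).
move=> y [_ xy]; rewrite [ltLHS]/Num.Def.normr/= mx_normrE.
apply/bigmax_ltP; split=> // -[a i] _ /=; rewrite !mxE; exact: xy.
Qed.

(** Fubini integrates the last coordinate first, so only that direction is treated directly;
    measure-preserving transpositions carry the result to the others. *)
Lemma compact_ibp_swap i k : compact_ibp i -> compact_ibp (tperm 0 k i).
Proof.
move=> ibp H dH cdH der supp.
rewrite -(@preserves_integral R (swap k) (fun y => (dH (pt4 y))%:E)); last 2 first.
- exact: preserves_swap.
- apply/measurable_EFinP; exact: measurable_pt4_continuous.
under eq_integral do rewrite pt4_swap.
apply: (ibp (H \o P k) (dH \o P k)).
- by move=> x; apply: continuous_comp; [exact: cP|exact: cdH].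
- move=> x; have [ex val] := der (P k x).
  have E : (fun h : R => h^-1 *: ((H \o P k) (h *: ei i + x) - (H \o P k) x)) =
     (fun h : R => h^-1 *: (H (h *: ei (tperm 0 k i) + P k x) - H (P k x))).
    by apply/funext => h /=; rewrite linearP P_ei.
  apply: DeriveDef; first by rewrite /derivable E.
  by rewrite /derive E; exact: val.
- by move=> x h; apply: supp; rewrite enormP.
Qed.

Lemma compact_ibpT i : compact_ibp i.
Proof.
have h0 : compact_ibp 0.
  by have := compact_ibp_swap (k := inord 3) compact_ibp3; rewrite tpermR.
by have := compact_ibp_swap (k := i) h0; rewrite tpermL.
Qed.

End Divergence.

(** * The quaternionic frame is divergence free on the round sphere *)

Section QuaternionFrame.
Context {R : realType}.
Local Notation V := 'rV[R]_4.
Local Notation R4 := (coordsR4 R).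
Local Notation mu := (@lebesgue_measure R).

Lemma ord3P (P : 'I_3 -> Prop) : P 0 -> P 1 -> P 2%:R -> forall i, P i.
Proof.
by move=> h0 h1 h2 -[[|[|[|//]]] h]; [have -> : Ordinal h = 0|
  have -> : Ordinal h = 1|have -> : Ordinal h = 2%:R]; by [|apply: val_inj].
Qed.

Lemma quat0E (x : V) : [/\ quat_frame 0 x 0 (inord 0) = - x 0 (inord 1),
  quat_frame 0 x 0 (inord 1) = x 0 (inord 0),
  quat_frame 0 x 0 (inord 2) = x 0 (inord 3) &
  quat_frame 0 x 0 (inord 3) = - x 0 (inord 2)].
Proof. by rewrite /quat_frame !mxE !inordK. Qed.

Lemma quat1E (x : V) : [/\ quat_frame 1 x 0 (inord 0) = - x 0 (inord 2),
  quat_frame 1 x 0 (inord 1) = - x 0 (inord 3),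
  quat_frame 1 x 0 (inord 2) = x 0 (inord 0) &
  quat_frame 1 x 0 (inord 3) = x 0 (inord 1)].
Proof. by rewrite /quat_frame !mxE !inordK. Qed.

Lemma quat2E (x : V) : [/\ quat_frame 2%:R x 0 (inord 0) = - x 0 (inord 3),
  quat_frame 2%:R x 0 (inord 1) = x 0 (inord 2),
  quat_frame 2%:R x 0 (inord 2) = - x 0 (inord 1) &
  quat_frame 2%:R x 0 (inord 3) = x 0 (inord 0)].
Proof. by rewrite /quat_frame !mxE !inordK. Qed.

(** Since the i-th component of the field never involves the i-th coordinate, the field is
    divergence free in R^4. *)
Lemma quat_coord a i : exists (s : R) (j : 'I_4), j != i /\
  forall x : V, quat_frame a x 0 i = s * x 0 j.
Proof.
have ne (k l : nat) : (k < 4)%N -> (l < 4)%N -> k != l ->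
    (inord k : 'I_4) != inord l by move=> hk hl; rewrite -val_eqE/= !inordK.
move: i; apply: ord4P; move: a; apply: ord3P.
- by exists (-1), (inord 1); split=> [|x]; [exact: ne|have [-> _ _ _] := quat0E x; rewrite mulN1r].
- by exists (-1), (inord 2); split=> [|x]; [exact: ne|have [-> _ _ _] := quat1E x; rewrite mulN1r].
- by exists (-1), (inord 3); split=> [|x]; [exact: ne|have [-> _ _ _] := quat2E x; rewrite mulN1r].
- by exists 1, (inord 0); split=> [|x]; [exact: ne|have [_ -> _ _] := quat0E x; rewrite mul1r].
- by exists (-1), (inord 3); split=> [|x]; [exact: ne|have [_ -> _ _] := quat1E x; rewrite mulN1r].
- by exists 1, (inord 2); split=> [|x]; [exact: ne|have [_ -> _ _] := quat2E x; rewrite mul1r].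
- by exists 1, (inord 3); split=> [|x]; [exact: ne|have [_ _ -> _] := quat0E x; rewrite mul1r].
- by exists 1, (inord 0); split=> [|x]; [exact: ne|have [_ _ -> _] := quat1E x; rewrite mul1r].
- by exists (-1), (inord 1); split=> [|x]; [exact: ne|have [_ _ -> _] := quat2E x; rewrite mulN1r].
- by exists (-1), (inord 2); split=> [|x]; [exact: ne|have [_ _ _ ->] := quat0E x; rewrite mulN1r].
- by exists 1, (inord 1); split=> [|x]; [exact: ne|have [_ _ _ ->] := quat1E x; rewrite mul1r].
- by exists 1, (inord 0); split=> [|x]; [exact: ne|have [_ _ _ ->] := quat2E x; rewrite mul1r].
Qed.

Lemma quatZ a (t : R) (x : V) : quat_frame a (t *: x) = t *: quat_frame a x.
Proof.
apply/rowP => i; have [s [j [_ E]]] := quat_coord a i.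
by rewrite [RHS]mxE !E mxE mulrCA.
Qed.

Lemma dot_quat a (x : V) : dot x (quat_frame a x) = 0.
Proof.
rewrite dotE sum4E; move: a; apply: ord3P.
- by have [-> -> -> ->] := quat0E x; ring.
- by have [-> -> -> ->] := quat1E x; ring.
- by have [-> -> -> ->] := quat2E x; ring.
Qed.

Lemma tangent_quat a : tangent (@quat_frame R a).
Proof. by move=> x _; exact: dot_quat. Qed.

Lemma smooth_quat a : smooth_field (@quat_frame R a).
Proof.
move=> i; have [s [j [_ E]]] := quat_coord a i.
apply: smooth_ext (smoothM (smooth_cst s) (smooth_coord j)) => x _.
by rewrite E.
Qed.

Lemma quat_continuous a i : continuous (fun x : V => quat_frame a x 0 i).
Proof.
have [s [j [_ E]]] := quat_coord a i => x.
rewrite (_ : (fun x : V => _) = (fun x : V => s * x 0 j)); last first.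
  by apply/funext => y; rewrite E.
have c : {for x, continuous (fun x : V => x 0 j)} by exact: coord_continuous.
exact: continuousM (@cst_continuous _ _ s x) c.
Qed.

Lemma quat_derive a i (x : V) :
  is_derive x (ei i) (fun x : V => quat_frame a x 0 i) 0.
Proof.
have [s [j [ji E]]] := quat_coord a i.
rewrite (_ : (fun x : V => _) = (fun x : V => s * x 0 j)); last first.
  by apply/funext => y; rewrite E.
have -> : 0 = s *: (ei i 0 j : R) by rewrite mxE (negPf ji) andbF scaler0.
apply: is_deriveZ; exact: is_derive_coord.
Qed.

(** The integrand is the divergence of r(|x|^2) f E_a, with f extended radially: E_a has no
    divergence and the derivative of r(|x|^2) along E_a vanishes because E_a is orthogonal to x. The
    cutoff vanishes near 0, where the radial extension is singular, and outside the unit ball. *)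
Lemma quat_cutoff (r dr : R -> R) (eps : R) a (f : V -> R) : 0 < eps ->
  continuous dr -> (forall t, is_derive t (1 : R) r (dr t)) ->
  (forall t, t <= eps -> r t = 0 /\ dr t = 0) ->
  (forall t, 1 <= t -> r t = 0 /\ dr t = 0) -> smooth f ->
  (\int[leb4]_y (r (dot (pt4 y) (pt4 y)) *
      \sum_i quat_frame a (pt4 y) 0 i * pd i f (pt4 y))%:E = 0)%E.
Proof.
move=> eps0 cdr der small large sf.
have cr : continuous r.
  by move=> t; apply: differentiable_continuous; apply/derivable1_diffP; case: (der t).
pose s (x : V) := dot x x.
have cs : continuous s by exact: continuous_dot.
have near0 : forall x : V, x = 0 \/ x != 0.
  by move=> x; have [|] := eqVneq x 0; [left|right].
have nbhs0 : \forall y \near (0 : V), s y <= eps.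
  have s0 : s 0 = 0 by rewrite /s /dot mul0mx mxE.
  have h : s y @[y --> (0 : V)] --> (0 : R) by rewrite -[X in _ --> X]s0; exact: cs.
  apply: (h [set t | t <= eps]).
  by apply: filterS (lt_nbhsl eps0) => t /ltW.
have locz (F : V -> R) : {near (0 : V), (fun=> 0 : R) =1 F} ->
    {for 0, continuous F}.
  move=> E; have E0 : F 0 = 0 := esym (nbhs_singleton E).
  have c0 : (fun _ : V => 0 : R) y @[y --> (0 : V)] --> (0 : R).
    exact: (@cst_continuous _ _ (0 : R) (0 : V)).
  have : F y @[y --> (0 : V)] --> (0 : R).
    by apply: cvg_trans c0; apply: near_eq_cvg; first exact: nbhs_filter.
  by rewrite -[X in _ --> X]E0.
pose H i x := r (s x) * (quat_frame a x 0 i * radial f x).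
pose dH i x := r (s x) * (quat_frame a x 0 i * pd i f x)
   + dr (s x) * (2%:R * x 0 i) * (quat_frame a x 0 i * radial f x).
have cdH i : continuous (dH i).
  move=> x; case: (near0 x) => [->|x0].
    have E : {near (0 : V), (fun=> 0 : R) =1 dH i}.
      by apply: filterS nbhs0 => y /small[r0 dr0]; rewrite /dH r0 dr0 !mul0r add0r.
    exact: locz E.
  have crs : {for x, continuous (fun x => r (s x))}.
    by apply: continuous_comp; [exact: cs|exact: cr].
  have cdrs : {for x, continuous (fun x => dr (s x))}.
    by apply: continuous_comp; [exact: cs|exact: cdr].
  have cq : {for x, continuous (fun x => quat_frame a x 0 i)}.
    exact: quat_continuous.
  have cp : {for x, continuous (pd i f)} := Ck_cont (Cinf_pd i sf 0%N) x0.
  have cF : {for x, continuous (radial f)} := Ck_cont (sf 0%N) x0.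
  have cx : {for x, continuous (fun x : V => 2%:R * x 0 i)}.
    have c : {for x, continuous (fun x : V => x 0 i)} by exact: coord_continuous.
    exact: continuousM (@cst_continuous _ _ (2%:R : R) x) c.
  exact: (continuousD (continuousM crs (continuousM cq cp))
    (continuousM (continuousM cdrs cx) (continuousM cq cF))).
have dHder i x : is_derive x (ei i) (H i) (dH i x).
  case: (near0 x) => [->|x0].
    have E : {near (0 : V), (fun=> 0 : R) =1 H i}.
      by apply: filterS nbhs0 => y /small[r0 dr0]; rewrite /H r0 !mul0r.
    have -> : dH i 0 = 0.
      by have /small[r0 dr0] := nbhs_singleton nbhs0; rewrite /dH r0 dr0 !mul0r add0r.
    apply: near_eq_is_derive E _; exact: is_derive_cst.
  have ds : is_derive x (ei i) s (2%:R * x 0 i).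
    have D j := is_deriveM (is_derive_coord j x (ei i)) (is_derive_coord j x (ei i)).
    have E : s = \sum_(j < 4) ((fun y : V => y 0 j) * (fun y : V => y 0 j)).
      by apply/funext => y; rewrite /s dotE fct_sumE.
    have dd j := @ex_derive _ _ _ _ _ _ _ (D j).
    apply: DeriveDef; first by rewrite E; exact: derivable_sum.
    rewrite E derive_sum// (bigD1 i)//= big1 ?addr0 => [|j ji].
      have [_ ->] := D i; rewrite mxE !eqxx [_ *: _]mulr1.
      by rewrite mulr_natl mulr2n.
    by have [_ ->] := D j; rewrite mxE (negPf ji) andbF scaler0 addr0.
  have drs : is_derive x (ei i) (fun x => r (s x)) (dr (s x) * (2%:R * x 0 i)).
    have d1 : is_derive (0 : R) (1 : R) (fun h : R => s (h *: ei i + x)) (2%:R * x 0 i).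
      have [ex val] := ds; rewrite -val.
      by have := @line_derive R _ s x (ei i) 0; rewrite scale0r add0r => /(_ ex).
    have d2 : is_derive (s (0 *: ei i + x)) (1 : R) r (dr (s x)).
      by rewrite scale0r add0r.
    have [ex val] := @is_derive1_comp R r (fun h : R => s (h *: ei i + x)) 0 _ _ d2 d1.
    apply: DeriveDef; first by apply/derivable1P.
    rewrite -val /derive.
    suff -> : (fun h : R => h^-1 *: (r (s (h *: ei i + x)) - r (s x))) =
      (fun h : R => h^-1 *: ((r \o (fun h : R => s (h *: ei i + x))) (h *: 1 + 0)
       - (r \o (fun h : R => s (h *: ei i + x))) 0)) by [].
    by apply/funext => h /=; rewrite [_ *: 1]mulr1 addr0 scale0r add0r.
  have dF : is_derive x (ei i) (radial f) (pd i f x).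
    by have [ex _] := radial_derive (ei i) sf x0; exact: DeriveDef.
  have D := is_deriveM drs (is_deriveM (quat_derive a i x) dF).
  apply: (is_derive_eq D); rewrite /dH.
  rewrite -[LHS]/(r (s x) * (quat_frame a x 0 i * pd i f x + radial f x * 0)
    + (quat_frame a x 0 i * radial f x) * (dr (s x) * (2%:R * x 0 i))).
  by rewrite mulr0 addr0 [X in _ + X]mulrC.
have supp i x : 1 <= enorm x -> H i x = 0 /\ dH i x = 0.
  move=> x1; have [r0 dr0] : r (s x) = 0 /\ dr (s x) = 0.
    by apply: large; rewrite /s -enorm_sqr exprn_ege1.
  by rewrite /H /dH r0 dr0 !mul0r add0r.
have int0 i : (\int[leb4]_y (dH i (pt4 y))%:E = 0)%E.
  exact: (compact_ibpT (cdH i) (dHder i) (supp i)).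
have integ i := continuous_bounded_integrable (cdH i) (fun x h => (supp i x h).2).
have E (y : R4) : ((r (dot (pt4 y) (pt4 y)) *
    \sum_i quat_frame a (pt4 y) 0 i * pd i f (pt4 y))%:E =
    \sum_(i <- index_enum 'I_4) (dH i (pt4 y))%:E)%E.
  rewrite sumEFin /dH big_split/= -mulr_sumr; congr ((_)%:E).
  rewrite [X in _ = _ + X](_ : _ = 0) ?addr0//.
  have -> : \sum_i dr (s (pt4 y)) * (2%:R * pt4 y 0 i) *
      (quat_frame a (pt4 y) 0 i * radial f (pt4 y)) =
      dr (s (pt4 y)) * 2%:R * radial f (pt4 y) * dot (pt4 y) (quat_frame a (pt4 y)).
    by rewrite dotE mulr_sumr; apply: eq_bigr => i _; ring.
  by rewrite dot_quat mulr0.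
under eq_integral do rewrite E.
by rewrite integral_sum//= big1// => i _; exact: int0.
Qed.

End QuaternionFrame.

Section SphereDivergence.
Context {R : realType}.
Local Notation V := 'rV[R]_4.
Local Notation R4 := (coordsR4 R).

(** A C^1 bump profile; integration by parts asks for one continuous derivative. *)
Definition pos2 (t : R) : R := Num.max t 0 ^+ 2.

Let continuous_pos : continuous (fun t : R => Num.max t 0).
Proof.
move=> t.
exact: (@continuous_max _ _ (fun t : R => t) (fun=> 0) t (fun A => id) (@cst_continuous _ _ (0 : R) t)).
Qed.

Lemma is_derive_pos2 (t : R) : is_derive t (1 : R) pos2 (2%:R * Num.max t 0).
Proof.
have bound (h : R) : `|pos2 (h + t) - pos2 t - h * (2%:R * Num.max t 0)| <= h ^+ 2.
  rewrite /pos2 ler_norml; case: (leP t 0) => t0; case: (leP (h + t) 0) => ht0.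
  - rewrite expr0n/= subrr mulr0 mulr0 subrr; have := sqr_ge0 h; lra.
  - by apply/andP; split; nra.
  - by apply/andP; split; nra.
  - by apply/andP; split; nra.
suff cvg_l : h^-1 *: (pos2 (h *: 1 + t) - pos2 t) @[h --> 0^'] -->
    (2%:R * Num.max t 0).
  by apply: DeriveDef; [apply/cvg_ex; eexists; exact: cvg_l|exact: cvg_lim].
apply/cvgrPdist_le => e e0; near=> h.
have h0 : h != 0 by near: h; exact: nbhs_dnbhs_neq.
have hs : `|h| <= e by near: h; exact: dnbhs0_le.
apply: le_trans hs; rewrite [_ *: 1]mulr1.
have hh : 0 < `|h| by rewrite normr_gt0.
rewrite -(ler_pM2l hh) -normrM.
have -> : h * (2%:R * Num.max t 0 - h^-1 *: (pos2 (h + t) - pos2 t)) =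
    - (pos2 (h + t) - pos2 t - h * (2%:R * Num.max t 0)).
  by rewrite /GRing.scale/=; field.
by rewrite normrN -expr2 real_normK ?num_real.
Unshelve. all: by end_near. Qed.

Let is_derive_continuous (F : R -> R) (t l : R) : is_derive t (1 : R) F l ->
  {for t, continuous F}.
Proof.
by case=> ex _; apply: differentiable_continuous; apply/derivable1_diffP.
Qed.

Let is_derive_quot (k : R -> R) (l eps t : R) : k t + eps != 0 ->
  is_derive t (1 : R) k l ->
  is_derive t (1 : R) (fun t => k t / (k t + eps))
    (l * eps / ((k t + eps) * (k t + eps))).
Proof.
move=> ke dk.
pose q : R -> R := fun t => k t + eps.
have D1 : is_derive t (1 : R) q (l + 0) by exact: is_deriveD.
have D2 : is_derive t (1 : R) (fun t => (q t)^-1) (- (q t) ^- 2 *: (l + 0)).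
  have [ex val] := D1; have e1 := @derivableV _ _ q t 1 ke ex.
  have e2 := @deriveV _ _ q t 1 ke ex.
  by apply: DeriveDef => //; rewrite e2 val.
have D := is_deriveM dk D2; apply: (is_derive_eq D).
rewrite -[LHS]/(k t * (- (q t) ^- 2 * (l + 0)) + (q t)^-1 * l) /q.
by field.
Qed.

(** The quotient k / (k + eps) lies in [0, 1]. As eps tends to 0 it tends to 1 at each point of (0,
    1), which the explicit formula in the last clause is kept for. *)
Lemma cutoff_exists (eps : R) : 0 < eps -> exists r dr : R -> R,
  [/\ continuous dr, forall t, is_derive t (1 : R) r (dr t),
      forall t, t <= eps -> r t = 0 /\ dr t = 0,
      forall t, 1 <= t -> r t = 0 /\ dr t = 0 &
      forall t, r t = pos2 (t - eps) * pos2 (1 - t)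
                      / (pos2 (t - eps) * pos2 (1 - t) + eps)].
Proof.
move=> eps0.
pose k t := pos2 (t - eps) * pos2 (1 - t).
pose dk t := pos2 (t - eps) * - (2%:R * Num.max (1 - t) 0)
             + pos2 (1 - t) * (2%:R * Num.max (t - eps) 0).
have k0 t : 0 <= k t by rewrite mulr_ge0// sqr_ge0.
have ke t : k t + eps != 0 by rewrite gt_eqF// ltr_wpDl.
have c1 : continuous (fun t : R => t - eps).
  by move=> t; apply: cvgB; [exact: cvg_id|exact: cvg_cst].
have c2 : continuous (fun t : R => 1 - t).
  by move=> t; apply: cvgB; [exact: cvg_cst|exact: cvg_id].
have cm1 : continuous (fun t : R => Num.max (t - eps) 0).
  by move=> t; apply: continuous_comp (c1 t) (@continuous_pos _).
have cm2 : continuous (fun t : R => Num.max (1 - t) 0).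
  by move=> t; apply: continuous_comp (c2 t) (@continuous_pos _).
have cp1 : continuous (fun t : R => pos2 (t - eps)).
  by move=> t; exact: (continuousM (cm1 t) (cm1 t)).
have cp2 : continuous (fun t : R => pos2 (1 - t)).
  by move=> t; exact: (continuousM (cm2 t) (cm2 t)).
have ck : continuous k by move=> t; exact: (continuousM (cp1 t) (cp2 t)).
have cc (c : R) t : {for t, continuous (fun _ : R => c)} by exact: cst_continuous.
have cdk : continuous dk.
  move=> t; exact: (continuousD
    (continuousM (cp1 t) (continuousN (continuousM (cc 2%:R t) (cm2 t))))
    (continuousM (cp2 t) (continuousM (cc 2%:R t) (cm1 t)))).
have dkder t : is_derive t (1 : R) k (dk t).
  have i1 : is_derive t (1 : R) (fun t : R => t - eps) (1 - 0) by exact: is_deriveB.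
  have i2 : is_derive t (1 : R) (fun t : R => 1 - t) (0 - 1) by exact: is_deriveB.
  have d1 := @is_derive1_comp R pos2 (fun t : R => t - eps) t _ _
     (is_derive_pos2 (t - eps)) i1.
  have d2 := @is_derive1_comp R pos2 (fun t : R => 1 - t) t _ _
     (is_derive_pos2 (1 - t)) i2.
  have D := is_deriveM d1 d2; apply: (is_derive_eq D).
  rewrite /dk /= -[LHS]/(pos2 (t - eps) * (2%:R * Num.max (1 - t) 0 * (0 - 1))
    + pos2 (1 - t) * (2%:R * Num.max (t - eps) 0 * (1 - 0))).
  by rewrite sub0r subr0 mulrN1 mulr1.
pose r t := k t / (k t + eps).
pose dr t := dk t * eps / ((k t + eps) * (k t + eps)).
have kz t : k t = 0 -> dk t = 0 -> r t = 0 /\ dr t = 0.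
  by rewrite /r /dr => -> ->; rewrite !mul0r.
exists r, dr; split=> //.
- move=> t.
  have cke : {for t, continuous (fun t => k t + eps)}.
    exact: (continuousD (ck t) (cc eps t)).
  have nz : (k t + eps) * (k t + eps) != 0 by rewrite mulf_neq0.
  have q2 : {for t, continuous (fun t => (k t + eps) * (k t + eps))}.
    exact: (continuousM cke cke).
  have q3 : {for t, continuous (fun t => ((k t + eps) * (k t + eps))^-1)}.
    by apply: (@continuousV _ _ (fun t => (k t + eps) * (k t + eps)) t).
  have q4 : {for t, continuous (fun t => dk t * eps)}.
    exact: (continuousM (cdk t) (cc eps t)).
  exact: (continuousM q4 q3).
- by move=> t; exact: is_derive_quot (ke t) (dkder t).
- move=> t te; have m0 : Num.max (t - eps) 0 = 0 by rewrite max_r// subr_le0.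
  by apply: kz; rewrite /k /dk /pos2 m0 expr0n/= ?mul0r ?mulr0 ?addr0.
- move=> t te; have m0 : Num.max (1 - t) 0 = 0 by rewrite max_r// subr_le0.
  by apply: kz; rewrite /k /dk /pos2 m0 expr0n/= ?mul0r ?mulr0 ?oppr0 ?mulr0 ?addr0.
Qed.

Lemma quat_radial a (f : V -> R) (x : V) : smooth f -> x != 0 ->
  \sum_i quat_frame a x 0 i * pd i f x = dalong (quat_frame a) f (sproj x).
Proof.
move=> sf x0; rewrite -[RHS]/(radial (dalong (quat_frame a) f) x) radial_dalong//.
have n0 : enorm x != 0 by rewrite gt_eqF// enorm_gt0.
rewrite mulr_sumr; apply: eq_bigr => i _.
rewrite -[radial _ _]/(quat_frame a ((enorm x)^-1 *: x)) quatZ.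
by rewrite [X in _ = _ * (X * _)]mxE mulrA mulrA mulfV// mul1r.
Qed.

(** By [quat_radial] the integrand of [quat_cutoff] is the cutoff times E_a f at the projected
    point; dominated convergence removes the cutoff. *)
Lemma integral_quat a (f : V -> R) : smooth f ->
  (\int[leb4]_(y in @ball4 R) (dalong (quat_frame a) f (sproj (pt4 y)))%:E = 0)%E.
Proof.
move=> sf; set G : R4 -> R := fun y => dalong (quat_frame a) f (sproj (pt4 y)).
have sG := smooth_dalong (smooth_quat a) sf.
have mG : measurable_fun (@ball4 R) G := smooth_measurable sG.
have [M M0 GM] := smooth_bounded sG.
pose eps n : R := n.+1%:R^-1.
have eps0 n : 0 < eps n by rewrite invr_gt0.
have /choice[r hr] : forall n, exists r : R -> R, exists dr : R -> R,
  [/\ continuous dr, forall t, is_derive t (1 : R) r (dr t),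
      forall t, t <= eps n -> r t = 0 /\ dr t = 0,
      forall t, 1 <= t -> r t = 0 /\ dr t = 0 &
      forall t, r t = pos2 (t - eps n) * pos2 (1 - t)
                      / (pos2 (t - eps n) * pos2 (1 - t) + eps n)].
  by move=> n; exact: cutoff_exists.
pose s (y : R4) := dot (pt4 y) (pt4 y).
have mr n : measurable_fun setT (fun y : R4 => r n (s y)).
  have [dr [_ der _ _ _]] := hr n.
  apply: (measurable_pt4_continuous (F := fun x => r n (dot x x))) => // x.
  apply: continuous_comp; first exact: continuous_dot.
  apply: differentiable_continuous; apply/derivable1_diffP.
  by case: (der (dot x x)).
pose h n (y : R4) := (r n (s y) * G y)%:E.
have mh n : measurable_fun (@ball4 R) (h n).
  apply/measurable_EFinP; apply: measurable_funM => //.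
  exact: measurable_funS (mr n).
have int0 n : (\int[leb4]_(y in @ball4 R) h n y = 0)%E.
  have [dr [cdr der small large _]] := hr n.
  rewrite -(quat_cutoff a (eps0 n) cdr der small large sf) [LHS]integral_mkcond.
  apply: eq_integral => y _; rewrite patchE; case: ifPn => [/set_mem yB|/negP yB].
    by rewrite /h (quat_radial a sf (ball4_nz yB)).
  suff -> : r n (dot (pt4 y) (pt4 y)) = 0 by rewrite mul0r.
  have [y0|y0] := eqVneq (pt4 y) 0.
    have e1 : dot (pt4 y) (pt4 y) <= eps n by rewrite y0 /dot mul0mx mxE ltW.
    by have [-> _] := small _ e1.
  have e1 : 1 <= dot (pt4 y) (pt4 y).
    rewrite leNgt; apply/negP => y1; apply: yB; rewrite inE /ball4/= enorm_gt0 y0/=.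
    by rewrite /enorm -sqrtr1 ltr_sqrt.
  by have [-> _] := large _ e1.
have B0 := @measurable_ball4 R.
have iM : leb4.-integrable (@ball4 R) (cst M%:E).
  have := @measurable_bounded_integrable _ _ _ leb4 (cst M) _ B0 (@ball4_fin R).
  by apply; [exact: measurable_cst|exists M; split; [exact: num_real|
     move=> N MN y _ /=; rewrite gtr0_norm// ltW]].
have cvgr : forall y : R4, ball4 y -> h n y @[n --> \oo] --> (G y)%:E.
  move=> y yB; apply: cvg_EFin; first by near=> n.
  rewrite -[fine \o _]/(fun n => r n (s y) * G y) -[X in _ --> X]mul1r.
  apply: cvgM; last exact: cvg_cst.
  have rE n : r n (s y) = pos2 (s y - eps n) * pos2 (1 - s y)
     / (pos2 (s y - eps n) * pos2 (1 - s y) + eps n).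
    by have [dr [_ _ _ _]] := hr n; exact.
  under eq_fun do rewrite rE.
  have epsc : eps n @[n --> \oo] --> (0 : R) by exact: cvg_harmonic.
  have sy0 : 0 < s y.
    by rewrite /s lt_neqAle dot_ge0 andbT eq_sym dot_eq0 ball4_nz.
  have sy1 : s y < 1.
    rewrite /s -enorm_sqr expr_lt1// ?enorm_ge0//.
    by move: yB; rewrite /ball4/= => /andP[].
  have cp : pos2 (s y - eps n) @[n --> \oo] --> pos2 (s y).
    have c1 : s y - eps n @[n --> \oo] --> s y.
      by rewrite -[X in _ --> X]subr0; apply: cvgB => //; exact: cvg_cst.
    have := continuous_cvg _ (is_derive_continuous (is_derive_pos2 (s y))) c1.
    exact.
  have ck : pos2 (s y - eps n) * pos2 (1 - s y) @[n --> \oo] -->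
      pos2 (s y) * pos2 (1 - s y) by apply: cvgM => //; exact: cvg_cst.
  have k0 : pos2 (s y) * pos2 (1 - s y) != 0.
    have m1 : 0 < Num.max (s y) 0 by rewrite lt_max sy0.
    have m2 : 0 < Num.max (1 - s y) 0 by rewrite lt_max subr_gt0 sy1.
    by rewrite /pos2 mulf_neq0// expf_neq0// gt_eqF.
  have ce : pos2 (s y - eps n) * pos2 (1 - s y) + eps n @[n --> \oo] -->
      pos2 (s y) * pos2 (1 - s y) by rewrite -[X in _ --> X]addr0; exact: cvgD.
  have L : pos2 (s y - eps n) * pos2 (1 - s y)
      / (pos2 (s y - eps n) * pos2 (1 - s y) + eps n) @[n --> \oo] --> (1 : R).
    by rewrite -[X in _ --> X](divff k0); exact: (cvgM ck (cvgV k0 ce)).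
  exact: L.
have bnd : forall y : R4, ball4 y -> forall n, (`|h n y| <= M%:E)%E.
  move=> y yB n; rewrite /h lee_fin normrM -[leRHS]mul1r.
  have [dr [_ _ _ _ rE]] := hr n.
  have k0 : 0 <= pos2 (s y - eps n) * pos2 (1 - s y) by rewrite mulr_ge0// sqr_ge0.
  apply: ler_pM => //; last exact: GM (ball4_S3 yB).
  rewrite rE ger0_norm ?ler_pdivrMr ?mul1r ?lerDl ?(ltW (eps0 n))//.
    by rewrite ltr_wpDl.
  by rewrite divr_ge0// addr_ge0// ltW.
have [_ _ cvgI] := @dominated_convergence _ _ _ leb4 _ B0 h (EFin \o G)
  (cst M%:E) mh ((measurable_EFinP _ _).2 mG) (aeW _ cvgr) iM
  (aeW _ (fun y n yB => bnd y yB n)).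
have zero : (fun n => \int[leb4]_(y in @ball4 R) h n y)%E = cst 0%E.
  by apply/funext => n; exact: int0.
move: cvgI; rewrite zero => cvgI.
exact: (cvg_unique _ cvgI (cvg_cst _)).
Unshelve. all: by end_near. Qed.

End SphereDivergence.

                                               

(** * Quantitative Riesz-Fischer theorem *)

Section FastL2Convergence.
Context {R : realType}.
Implicit Types u : nat -> R.

Definition sqsum u n : R := \sum_(k < n) 4%:R ^+ k * (u k.+1 - u k) ^+ 2.

Lemma sqsum_ge0 u n : 0 <= sqsum u n.
Proof. by apply: sumr_ge0 => k _; rewrite mulr_ge0 ?sqr_ge0// exprn_ge0. Qed.

Lemma sqsum_nd u : nondecreasing_seq (sqsum u).
Proof.
apply/nondecreasing_seqP => n; rewrite /sqsum big_ord_recr/= lerDl.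
by rewrite mulr_ge0 ?sqr_ge0// exprn_ge0.
Qed.

(** Each increment is at most sqrt M / 2^k, so u k - e k increases, u k + e k decreases, and they
    enclose the limit. *)
Lemma fast_cvg u (M : R) : (forall n, sqsum u n <= M) ->
  exists l : R, u k @[k --> \oo] --> l /\
    forall k, (u k - l) ^+ 2 <= 4%:R / 4%:R ^+ k * M.
Proof.
move=> uM; have M0 : 0 <= M by exact: le_trans (sqsum_ge0 u 0) (uM 0%N).
pose c := Num.sqrt M; have c0 : 0 <= c by exact: sqrtr_ge0.
pose e k : R := 2%:R * c * 2%:R^-1 ^+ k.
have e0 k : 0 <= e k by rewrite !mulr_ge0// exprn_ge0// invr_ge0.
have eS k : e k = 2%:R * e k.+1 by rewrite /e exprS; field.
have dk k : `|u k.+1 - u k| <= e k.+1.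
  have h : (2%:R ^+ k * `|u k.+1 - u k|) ^+ 2 <= M.
    apply: le_trans (uM k.+1); rewrite /sqsum big_ord_recr/=.
    rewrite exprMn -exprM mulnC exprM real_normK ?num_real//.
    rewrite (_ : 2%:R ^+ 2 = 4%:R :> R) ?lerDr; last by rewrite -natrX.
    exact: sqsum_ge0.
  have h2 : 2%:R ^+ k * `|u k.+1 - u k| <= c.
    rewrite -(ler_sqr (_ : _ \is Num.nneg)) ?nnegrE ?mulr_ge0 ?exprn_ge0//.
    by rewrite sqr_sqrtr.
  rewrite /e exprS exprVn -(ler_pM2l (_ : 0 < 2%:R ^+ k)) ?exprn_gt0//.
  apply: le_trans h2 _; rewrite le_eqVlt; apply/orP; left; apply/eqP.
  by field; rewrite expf_neq0.
pose a k := u k - e k.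
have nda : nondecreasing_seq a.
  apply/nondecreasing_seqP => k; rewrite /a (eS k).
  by have := dk k; rewrite ler_norml => /andP[]; lra.
have nib : nonincreasing_seq (fun k => u k + e k).
  apply/nonincreasing_seqP => k; rewrite (eS k).
  by have := dk k; rewrite ler_norml => /andP[]; lra.
have ab k m : a k <= u m + e m.
  have [km|/ltnW mk] := leqP k m.
    by apply: le_trans (nda _ _ km) _; rewrite /a; have := e0 m; lra.
  by apply: le_trans (nib _ _ mk); rewrite /a; have := e0 k; lra.
have ca : cvgn a.
  apply: nondecreasing_is_cvgn => //.
  by exists (u 0%N + e 0%N) => _ [k _ <-]; exact: ab.
have ec : e k @[k --> \oo] --> (0 : R).
  rewrite -[X in _ --> X](mulr0 (2%:R * c)); apply: cvgM; first exact: cvg_cst.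
  by apply: cvg_expr; rewrite ger0_norm ?invr_ge0// invf_lt1// ltr1n.
exists (limn a); split.
  have -> : u = (fun k => a k + e k) by apply/funext => k; rewrite /a subrK.
  by rewrite -[X in _ --> X]addr0; exact: cvgD.
move=> k; have l1 : a k <= limn a by exact: nondecreasing_cvgn_le.
have l2 : limn a <= u k + e k.
  by apply: limr_le => //; apply: nearW => m; exact: ab.
have : `|u k - limn a| <= e k by rewrite ler_norml; apply/andP; split; move: l1 l2; rewrite /a; lra.
rewrite -(ler_sqr (_ : _ \is Num.nneg)) ?nnegrE// real_normK ?num_real//.
move=> /le_trans; apply; rewrite /e !exprMn sqr_sqrtr// -exprM mulnC exprM.
rewrite exprVn (_ : 2%:R ^+ 2 = 4%:R :> R) ?exprVn; last by rewrite -natrX.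
by rewrite mulrAC.
Qed.

(** The default 0 where the weighted sum diverges makes the limit function total and measurable. *)
Definition fast_lim u : R :=
  if pselect (exists M, forall n, sqsum u n <= M) then limn u else 0.

Context d (T : measurableType d) (mu : {measure set T -> \bar R}).

(** The series of 4^k / 8^k sums to 2, so the weighted sum of squared increments has integral at
    most 2. It is finite almost everywhere, and integrating the pointwise rate of [fast_cvg] gives
    the L^2 rate. *)
Lemma fast_lim_L2 (D : set T) (f : nat -> T -> R) : measurable D ->
  (forall k, measurable_fun D (f k)) ->
  (forall k, (\int[mu]_(x in D) ((f k.+1 x - f k x) ^+ 2)%:E
                <= ((8%:R ^+ k)^-1)%:E)%E) ->
  measurable_fun D (fun x => fast_lim (f ^~ x)) /\
  forall k, (\int[mu]_(x in D) ((f k x - fast_lim (f ^~ x)) ^+ 2)%:E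
               <= (8%:R / 4%:R ^+ k)%:E)%E.
Proof.
move=> mD mf intf.
pose g n x := sqsum (f ^~ x) n.
have mg n : measurable_fun D (g n).
  apply: measurable_sum => k; apply: measurable_funM; first exact: measurable_cst.
  by apply: measurable_funX; exact: measurable_funB.
pose G x := limn (fun n => (g n x)%:E).
have ndg x : {homo (fun n => (g n x)%:E) : n m / (n <= m)%N >-> (n <= m)%E}.
  by move=> n m nm; rewrite lee_fin; exact: sqsum_nd.
have cG x : (g n x)%:E @[n --> \oo] --> G x.
  exact: ereal_nondecreasing_is_cvgn (ndg x).
have mG : measurable_fun D G.
  apply: (emeasurable_fun_cvg (fun n x => (g n x)%:E)) => [n|x _].
    exact/measurable_EFinP.
  exact: cG.
have G0 x : (0 <= G x)%E.
  by apply: lime_ge; [exact: cG|apply: nearW => n; rewrite lee_fin; exact: sqsum_ge0].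
have gG n x : ((g n x)%:E <= G x)%E.
  by apply: lime_ge; [exact: cG|exists n => // m /= nm; exact: ndg].
have intg n : (\int[mu]_(x in D) (g n x)%:E <= 2%:E)%E.
  rewrite (_ : (fun x => _) = (fun x => \sum_(k < n)
    ((4%:R ^+ k)%:E * ((f k.+1 x - f k x) ^+ 2)%:E))%E); last first.
    by apply/funext => x; rewrite /g /sqsum -sumEFin; apply: eq_bigr => k _; rewrite EFinM.
  rewrite ge0_integral_sum//; last 2 first.
  - move=> k; apply/measurable_EFinP; apply: measurable_funM; first exact: measurable_cst.
    by apply: measurable_funX; exact: measurable_funB.
  - by move=> k x _; rewrite -EFinM lee_fin mulr_ge0 ?sqr_ge0// exprn_ge0.
  have term (k : 'I_n) : (\int[mu]_(x in D) ((4%:R ^+ k)%:E *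
      ((f k.+1 x - f k x) ^+ 2)%:E) <= (2%:R^-1 ^+ k)%:E)%E.
    have h1 x : D x -> (0 <= ((f k.+1 x - f k x) ^+ 2)%:E)%E.
      by move=> _; rewrite lee_fin sqr_ge0.
    have h2 : measurable_fun D (fun x => ((f k.+1 x - f k x) ^+ 2)%:E).
      by apply/measurable_EFinP; apply: measurable_funX; exact: measurable_funB.
    have h3 : 0 <= 4%:R ^+ k :> R by rewrite exprn_ge0.
    rewrite ge0_integralZl_EFin//.
    apply: le_trans (lee_wpmul2l _ (intf k)) _; first by rewrite lee_fin exprn_ge0.
    rewrite -EFinM lee_fin le_eqVlt; apply/orP; left; apply/eqP.
    rewrite (_ : 8%:R = 4%:R * 2%:R :> R); last by rewrite -natrM.
    by rewrite exprMn exprVn; field; rewrite !expf_neq0.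
  apply: le_trans (lee_sum _ (fun k _ => term k)) _.
  rewrite sumEFin lee_fin.
  have -> : \sum_(k < n) 2%:R^-1 ^+ k = 2%:R - 2%:R * 2%:R^-1 ^+ n :> R.
    elim: n {term} => [|n IH]; first by rewrite big_ord0 expr0 mulr1 subrr.
    by rewrite big_ord_recr/= IH exprS; field.
  by rewrite gerBl mulr_ge0// exprn_ge0// invr_ge0.
have intG : (\int[mu]_(x in D) G x <= 2%:E)%E.
  have E := @cvg_monotone_convergence _ _ _ mu D mD (fun n x => (g n x)%:E)
    (fun n => (measurable_EFinP _ _).2 (mg n)) (fun n x _ => sqsum_ge0 _ n)
    (fun x _ => ndg x).
  rewrite -(cvg_lim _ E)//; apply: lime_le; first by apply/cvg_ex; eexists; exact: E.
  by apply: nearW => n; exact: intg.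
have iG : mu.-integrable D G.
  apply/integrableP; split=> //; apply: le_lt_trans (ltry 2%:R).
  by apply: le_trans intG; rewrite le_eqVlt; apply/orP; left; apply/eqP;
     apply: eq_integral => x _; rewrite gee0_abs.
pose good x := exists M, forall n, sqsum (f ^~ x) n <= M.
have goodE x : good x <-> G x \is a fin_num.
  split=> [[M hM]|fG].
    rewrite ge0_fin_numE//; apply: le_lt_trans (ltry M).
    by apply: lime_le; [exact: cG|apply: nearW => n; rewrite lee_fin; exact: hM].
  exists (fine (G x)) => n; rewrite -lee_fin fineK//; exact: gG.
pose Gd := D `&` G @^-1` [set e | e \is a fin_num].
have mGd : measurable Gd by exact: emeasurable_fin_num.
have onGd x : Gd x -> (f ^~ x) k @[k --> \oo] --> fast_lim (f ^~ x) /\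
    forall k, (((f k x - fast_lim (f ^~ x)) ^+ 2)%:E
                 <= (4%:R / 4%:R ^+ k)%:E * G x)%E.
  move=> [Dx /= fG]; have gx := (goodE x).2 fG.
  have gle n : sqsum (f ^~ x) n <= fine (G x).
    rewrite -lee_fin fineK//; exact: gG.
  have [l [cl hl]] := fast_cvg gle.
  have -> : fast_lim (f ^~ x) = l.
    by rewrite /fast_lim; case: pselect => [?|//]; exact: cvg_lim cl.
  by split=> // k; rewrite -[G x]fineK// -EFinM lee_fin; exact: hl.
have mF : measurable_fun D (fun x => fast_lim (f ^~ x)).
  (* Multiplying by the indicator of the set where the sum is finite gives convergence at every
     point of D, with limit 0 off that set. *)
  pose h k x : R := f k x * \1_Gd x.
  apply: (@measurable_fun_cvg _ _ _ D h) => [k|x Dx].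
    by apply: measurable_funM => //; exact: measurable_indic.
  have [xG|xG] := pselect (Gd x).
    suff -> : h ^~ x = f ^~ x by have [] := onGd x xG.
    by apply/funext => k; rewrite /h indicE mem_set// mulr1.
  have -> : h ^~ x = fun=> 0.
    by apply/funext => k; rewrite /h indicE memNset// mulr0.
  suff -> : fast_lim (f ^~ x) = 0 by exact: cvg_cst.
  rewrite /fast_lim; case: pselect => // gx.
  by exfalso; apply: xG; split=> //; exact/goodE.
split=> // k.
have m1 : measurable_fun D (fun x => ((f k x - fast_lim (f ^~ x)) ^+ 2)%:E).
  by apply/measurable_EFinP; apply: measurable_funX; exact: measurable_funB.
have c0 : 0 <= 4%:R / 4%:R ^+ k :> R by rewrite divr_ge0// exprn_ge0.
apply: (@le_trans _ _ (\int[mu]_(x in D) ((4%:R / 4%:R ^+ k)%:E * G x))%E).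
  apply: ae_ge0_le_integral => //.
  - by move=> x _; rewrite lee_fin sqr_ge0.
  - by move=> x _; rewrite mule_ge0// lee_fin.
  - exact: measurable_funeM.
  - have := integrable_ae mD iG; apply: filterS => x fG Dx.
    by have [_] := onGd x (conj Dx (fG Dx)); exact.
rewrite ge0_integralZl_EFin//.
apply: le_trans (lee_wpmul2l _ intG) _; first by rewrite lee_fin.
by rewrite -EFinM lee_fin le_eqVlt; apply/orP; left; apply/eqP; field;
   rewrite expf_neq0.
Qed.

End FastL2Convergence.

(** * Integration against the Riemannian volume *)

Section WeightedIntegral.
Context {R : realType}.
Local Notation V := 'rV[R]_4.
Local Notation R4 := (coordsR4 R).
Implicit Types (f h : V -> R).

Lemma measurable_S3_cst (c : R) : measurable_S3 (fun _ : V => c).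
Proof. exact: measurable_cst. Qed.

Lemma measurable_S3D f h : measurable_S3 f -> measurable_S3 h ->
  measurable_S3 (fun x => f x + h x).
Proof. by move=> mf mh; exact: measurable_funD. Qed.

Lemma measurable_S3B f h : measurable_S3 f -> measurable_S3 h ->
  measurable_S3 (fun x => f x - h x).
Proof. by move=> mf mh; exact: measurable_funB. Qed.

Lemma measurable_S3M f h : measurable_S3 f -> measurable_S3 h ->
  measurable_S3 (fun x => f x * h x).
Proof. by move=> mf mh; exact: measurable_funM. Qed.

Lemma measurable_S3X f n : measurable_S3 f -> measurable_S3 (fun x => f x ^+ n).
Proof. by move=> mf; exact: measurable_funX. Qed.

Lemma measurable_S3_sum (I : Type) (s : seq I) (F : I -> V -> R) :
  (forall i, measurable_S3 (F i)) -> measurable_S3 (fun x => \sum_(i <- s) F i x).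
Proof.
move=> mF.
have mF' i : measurable_fun ball4 (fun y : R4 => F i (sproj (pt4 y))) := mF i.
exact: (measurable_sum s mF').
Qed.

Lemma measurable_S3_norm f : measurable_S3 f -> measurable_S3 (fun x => `|f x|).
Proof. by move=> mf; exact: measurableT_comp. Qed.

Lemma measurable_S3_min f h : measurable_S3 f -> measurable_S3 h ->
  measurable_S3 (fun x => Num.min (f x) (h x)).
Proof. by move=> mf mh; exact: measurable_minr. Qed.

Lemma measurable_S3_ext f h : (forall x, S3 x -> f x = h x) ->
  measurable_S3 f -> measurable_S3 h.
Proof.
move=> fh; apply: eq_measurable_fun => y /set_mem y1; exact/fh/ball4_S3.
Qed.

Variable g : V -> 'M[R]_4.
Local Notation w := (vol_density g).
Local Notation J := (integrable_vol g).
Local Notation I := (int_vol g).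
Hypothesis sw : smooth w.
Hypothesis w0 : forall x, S3 x -> 0 < w x.

Local Notation wt f := (fun y : R4 => (f (sproj (pt4 y)) * w (sproj (pt4 y)))%:E).
Let mB := @measurable_ball4 R.

Lemma int_vol_fine f : I f = 4%:R * fine (\int[leb4]_(y in ball4) wt f y)%E.
Proof. by []. Qed.

Lemma measurable_wt f : measurable_S3 f -> measurable_fun ball4 (wt f).
Proof.
by move=> mf; apply/measurable_EFinP; apply: measurable_S3M => //; exact: smooth_measurable.
Qed.

Lemma integrable_vol_ext f h : (forall x, S3 x -> f x = h x) -> J f -> J h.
Proof.
move=> fh; apply: eq_integrable => // y /set_mem y1; congr (_ * _)%:E.
exact/fh/ball4_S3.
Qed.

Lemma int_vol_ext f h : (forall x, S3 x -> f x = h x) -> I f = I h.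
Proof.
move=> fh; rewrite !int_vol_fine; congr (_ * fine _); apply: eq_integral => y /set_mem y1.
by rewrite (fh _ (ball4_S3 y1)).
Qed.

Lemma integrable_volD f h : J f -> J h -> J (fun x => f x + h x).
Proof.
move=> Jf Jh; rewrite /integrable_vol /integrable_round.
have := integrableD mB Jf Jh; apply: eq_integrable => // y _ /=.
by rewrite mulrDl.
Qed.

Lemma integrable_volZ (c : R) f : J f -> J (fun x => c * f x).
Proof.
move=> Jf; have := integrableZl mB c Jf; apply: eq_integrable => // y _ /=.
by rewrite -EFinM mulrA.
Qed.

Lemma integrable_volB f h : J f -> J h -> J (fun x => f x - h x).
Proof.
move=> Jf /(integrable_volZ (-1)) Jh; apply: integrable_vol_ext (integrable_volD Jf Jh) => x _.
by rewrite mulN1r.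
Qed.

Lemma integrable_vol0 : J (fun=> 0).
Proof.
have := @integrable0 _ _ R leb4 (@ball4 R); apply: eq_integrable => // y _.
by rewrite mul0r.
Qed.

Lemma integrable_vol_sum (T : Type) (s : seq T) (F : T -> V -> R) :
  (forall i, J (F i)) -> J (fun x => \sum_(i <- s) F i x).
Proof.
move=> JF; elim: s => [|i s IH].
  by apply: integrable_vol_ext integrable_vol0 => x _; rewrite big_nil.
by apply: integrable_vol_ext (integrable_volD (JF i) IH) => x _; rewrite big_cons.
Qed.

Lemma int_volD f h : J f -> J h -> I (fun x => f x + h x) = I f + I h.
Proof.
move=> Jf Jh; rewrite -mulrDr; congr (_ * _); rewrite -RintegralD//.
by apply: eq_Rintegral => y _; rewrite mulrDl.
Qed.

Lemma int_volZ (c : R) f : J f -> I (fun x => c * f x) = c * I f.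
Proof.
move=> Jf; rewrite mulrCA; congr (_ * _); rewrite -RintegralZl//.
by apply: eq_Rintegral => y _; rewrite mulrA.
Qed.

Lemma int_volB f h : J f -> J h -> I (fun x => f x - h x) = I f - I h.
Proof.
move=> Jf Jh; rewrite -[in RHS]mulN1r -int_volZ// -int_volD//; last exact: integrable_volZ.
by apply: int_vol_ext => x _; rewrite mulN1r.
Qed.

Lemma int_vol0 : I (fun=> 0) = 0.
Proof.
have e := int_volZ 0 integrable_vol0; rewrite [RHS]mul0r in e.
rewrite -[RHS]e.
by apply: int_vol_ext => x _; rewrite mulr0.
Qed.

Lemma int_vol_sum (T : Type) (s : seq T) (F : T -> V -> R) :
  (forall i, J (F i)) -> I (fun x => \sum_(i <- s) F i x) = \sum_(i <- s) I (F i).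
Proof.
move=> JF; elim: s => [|i s IH].
  by rewrite big_nil -[RHS]int_vol0; apply: int_vol_ext => x _; rewrite big_nil.
rewrite big_cons -IH -int_volD//; last exact: integrable_vol_sum.
by apply: int_vol_ext => x _; rewrite big_cons.
Qed.

Lemma integrable_vol_le f h : measurable_S3 f ->
  (forall x, S3 x -> `|f x| <= h x) -> J h -> J f.
Proof.
move=> mf fh; apply: le_integrable => //; first exact: measurable_wt.
move=> y y1; have yS := ball4_S3 y1; rewrite !abse_EFin lee_fin !normrM.
by apply: ler_wpM2r => //; apply: le_trans (fh _ yS) (ler_norm _).
Qed.

Lemma int_vol_le f h : J f -> J h -> (forall x, S3 x -> f x <= h x) -> I f <= I h.
Proof.
move=> Jf Jh fh; rewrite ler_wpM2l// le_Rintegral// => y y1.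
by have yS := ball4_S3 y1; rewrite ler_wpM2r ?fh// ltW// w0.
Qed.

Lemma int_vol_ge0 f : (forall x, S3 x -> 0 <= f x) -> 0 <= I f.
Proof.
move=> f0; rewrite mulr_ge0// Rintegral_ge0// => y y1.
by have yS := ball4_S3 y1; rewrite mulr_ge0 ?f0// ltW// w0.
Qed.

Lemma bounded_integrable_vol f (M : R) : measurable_S3 f ->
  (forall x, S3 x -> `|f x| <= M) -> J f.
Proof.
move=> mf fM; apply: (@integrable_vol_le _ (fun=> M)) => //.
have [N N0 wN] := smooth_bounded sw.
have i1 : leb4.-integrable (@ball4 R) (fun=> (`|M| * N)%:E).
  apply/integrableP; split; first exact: measurable_cst.
  by rewrite abse_EFin integral_cst// lte_mul_pinfty// ball4_fin.
apply: le_integrable i1 => //.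
  by apply: measurable_wt; exact: measurable_S3_cst.
move=> y y1; have yS := ball4_S3 y1; rewrite !abse_EFin lee_fin !normrM normr_id.
by rewrite ler_wpM2l// (le_trans (wN _ yS))// ler_norm.
Qed.

Lemma smooth_integrable_vol f : smooth f -> J f.
Proof.
move=> sf; have [M _ fM] := smooth_bounded sf.
exact: bounded_integrable_vol (smooth_measurable sf) fM.
Qed.

Lemma int_vol_EFin f : J f ->
  (\int[leb4]_(y in ball4) wt f y = (I f / 4%:R)%:E)%E.
Proof.
move=> Jf; rewrite int_vol_fine mulrC mulrA mulVf ?mul1r ?fineK//.
exact: integrable_fin_num.
Qed.

Lemma ge0_integrable_vol f (C : R) : measurable_S3 f -> (forall x, S3 x -> 0 <= f x) ->
  (\int[leb4]_(y in ball4) wt f y <= (C / 4%:R)%:E)%E -> J f /\ I f <= C.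
Proof.
move=> mf f0 le; have Jf : J f.
  apply/integrableP; split; first exact: measurable_wt.
  apply: le_lt_trans (ltry (C / 4%:R)); apply: le_trans le.
  rewrite le_eqVlt; apply/orP; left; apply/eqP; apply: eq_integral => y /set_mem y1.
  have yS := ball4_S3 y1; rewrite abse_EFin ger0_norm// mulr_ge0 ?f0//.
  exact/ltW/w0.
by split=> //; move: le; rewrite int_vol_EFin// lee_fin ler_pM2r// invr_gt0.
Qed.

Lemma int_vol_mct (F : nat -> V -> R) f (C : R) :
  (forall n, measurable_S3 (F n)) -> measurable_S3 f ->
  (forall n x, S3 x -> 0 <= F n x) ->
  (forall x, S3 x -> nondecreasing_seq (F ^~ x)) ->
  (forall x, S3 x -> F n x @[n --> \oo] --> f x) ->
  (forall n, J (F n)) -> (forall n, I (F n) <= C) -> J f /\ I f <= C.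
Proof.
move=> mF mf F0 ndF cF JF IF.
have f0 x : S3 x -> 0 <= f x.
  move=> xS; rewrite -(cvg_lim _ (cF _ xS))//; apply: limr_ge; first by apply/cvg_ex; exists (f x); exact: cF.
  by apply: nearW => n; exact: F0.
apply: ge0_integrable_vol => //.
have E := @cvg_monotone_convergence _ _ _ leb4 ball4 mB (fun n => wt (F n))
  (fun n => measurable_wt (mF n)).
have {}E := E (fun n y y1 => mulr_ge0 (F0 n _ (ball4_S3 y1)) (ltW (w0 (ball4_S3 y1)))).
have {}E := E (fun y y1 n m nm => ler_wpM2r (ltW (w0 (ball4_S3 y1))) (ndF _ (ball4_S3 y1) n m nm)).
have -> : (\int[leb4]_(y in ball4) wt f y =
    \int[leb4]_(y in ball4) limn (fun n => wt (F n) y))%E.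
  apply: eq_integral => y /set_mem y1; apply/esym/cvg_lim => //.
  by apply: cvg_EFin; [exact: nearW|apply: cvgMl; exact/cF/ball4_S3].
rewrite -(cvg_lim _ E)//; apply: lime_le; first by apply/cvg_ex; eexists; exact: E.
by apply: nearW => n; rewrite int_vol_EFin// lee_fin ler_pM2r// invr_gt0.
Qed.

Lemma int_vol_eq0 f : J f -> (forall x, S3 x -> 0 <= f x) -> I f = 0 ->
  ae_S3 (fun x => f x = 0).
Proof.
move=> Jf f0 If; have := int_vol_EFin Jf; rewrite If mul0r => E.
have mw : measurable_fun ball4 (wt f) by case/integrableP: (Jf).
have [+ _] := ae_eq_integral_abs leb4 mB mw.
have -> : (\int[leb4]_(x in ball4) `|wt f x| = 0)%E.
  rewrite -[RHS]E; apply: eq_integral => y /set_mem y1.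
  have yS := ball4_S3 y1; rewrite abse_EFin ger0_norm// mulr_ge0 ?f0//.
  exact/ltW/w0.
move=> /(_ erefl); apply: filterS => y h y1; have := h y1.
move=> [] /eqP; rewrite mulf_eq0 (gt_eqF (w0 (ball4_S3 y1))) orbF => /eqP.
by [].
Qed.

(** Multiplication by the square root of the density turns the weighted L^2 norm into the flat one;
    the factor is divided out after the limit. *)
Definition vol_lim (F : nat -> V -> R) : V -> R :=
  fun x => fast_lim (fun k => F k x * Num.sqrt (w x)) / Num.sqrt (w x).

Lemma vol_lim_L2 (F : nat -> V -> R) : (forall k, measurable_S3 (F k)) ->
  (forall k, J (fun x => (F k.+1 x - F k x) ^+ 2)) ->
  (forall k, I (fun x => (F k.+1 x - F k x) ^+ 2) <= (8%:R ^+ k)^-1) ->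
  measurable_S3 (vol_lim F) /\
  forall k, J (fun x => (F k x - vol_lim F x) ^+ 2) /\
    I (fun x => (F k x - vol_lim F x) ^+ 2) <= 32%:R / 4%:R ^+ k.
Proof.
move=> mF JF IF; have ss := smooth_sqrt w0 sw.
pose q x := Num.sqrt (w x); have q0 x : S3 x -> 0 < q x by move=> h; rewrite sqrtr_gt0; exact: w0.
have qq x : S3 x -> q x ^+ 2 = w x by move=> h; apply: sqr_sqrtr; exact/ltW/w0.
pose f k (y : R4) := F k (sproj (pt4 y)) * q (sproj (pt4 y)).
have mf k : measurable_fun ball4 (f k).
  by apply: measurable_S3M => //; exact: smooth_measurable.
have le k : (\int[leb4]_(y in ball4) ((f k.+1 y - f k y) ^+ 2)%:E <= ((8%:R ^+ k)^-1)%:E)%E.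
  have -> : (\int[leb4]_(y in ball4) ((f k.+1 y - f k y) ^+ 2)%:E =
     (I (fun x => (F k.+1 x - F k x) ^+ 2) / 4%:R)%:E)%E.
    rewrite -(int_vol_EFin (JF k)); apply: eq_integral => y /set_mem y1; congr (_%:E).
    by rewrite /f -mulrBl exprMn qq//; exact: ball4_S3.
  rewrite lee_fin ler_pdivrMr//; apply: le_trans (IF k) _.
  by rewrite ler_peMr ?invr_ge0 ?exprn_ge0// ler1n.
have [mL iL] := fast_lim_L2 mB mf le.
have mV : measurable_S3 (vol_lim F).
  apply: measurable_S3M; first exact: mL.
  apply: smooth_measurable; apply: smoothV => // x /q0.
  by rewrite -/(q x) => /gt_eqF ->.
split=> // k; apply: ge0_integrable_vol.
- by apply: measurable_S3X; exact: measurable_S3B.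
- by move=> x _; exact: sqr_ge0.
have -> : (\int[leb4]_(y in ball4) wt (fun x => (F k x - vol_lim F x) ^+ 2) y =
   \int[leb4]_(y in ball4) ((f k y - fast_lim (f ^~ y)) ^+ 2)%:E)%E.
  apply: eq_integral => y /set_mem y1; have yS := ball4_S3 y1; congr (_%:E).
  rewrite -(qq _ yS) -exprMn mulrBl /f /vol_lim -/(q _) divfK//.
  by rewrite gt_eqF// q0.
apply: le_trans (iL k) _; rewrite lee_fin le_eqVlt; apply/orP; left; apply/eqP.
by field; rewrite expf_neq0.
Qed.

End WeightedIntegral.

                                                    

(** * The orthonormal frame and the volume density *)

Section Frame.
Context {R : realType}.
Local Notation V := 'rV[R]_4.
Implicit Types (X Y : V -> V) (f : V -> R).

Lemma sum3E (A : nmodType) (f : 'I_3 -> A) : \sum_a f a = f 0 + f 1 + f 2%:R.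
Proof.
rewrite !big_ord_recr big_ord0/= add0r.
by congr (f _ + f _ + f _); apply: val_inj.
Qed.

Lemma dotC (u v : V) : dot u v = dot v u.
Proof. by rewrite !dotE; apply: eq_bigr => i _; rewrite mulrC. Qed.
Lemma dotDl (u v t : V) : dot (u + v) t = dot u t + dot v t.
Proof. by rewrite /dot mulmxDl mxE. Qed.
Lemma dotZl a (u t : V) : dot (a *: u) t = a * dot u t.
Proof. by rewrite /dot -scalemxAl mxE. Qed.
Lemma dotNl (u t : V) : dot (- u) t = - dot u t.
Proof. by rewrite /dot mulNmx mxE. Qed.
Lemma dotBl (u v t : V) : dot (u - v) t = dot u t - dot v t.
Proof. by rewrite dotDl dotNl. Qed.
Lemma dotDr (u v t : V) : dot t (u + v) = dot t u + dot t v.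
Proof. by rewrite dotC dotDl !(dotC t). Qed.
Lemma dotZr a (u t : V) : dot t (a *: u) = a * dot t u.
Proof. by rewrite dotC dotZl (dotC t). Qed.
Lemma dotNr (u t : V) : dot t (- u) = - dot t u.
Proof. by rewrite dotC dotNl (dotC t). Qed.
Lemma dotBr (u v t : V) : dot t (u - v) = dot t u - dot t v.
Proof. by rewrite dotDr dotNr. Qed.
Lemma dot0l (t : V) : dot 0 t = 0.
Proof. by rewrite /dot mul0mx mxE. Qed.
Lemma dot_suml (T : Type) (s : seq T) (F : T -> V) t :
  dot (\sum_(i <- s) F i) t = \sum_(i <- s) dot (F i) t.
Proof. by rewrite /dot mulmx_suml summxE. Qed.
Lemma dot_sumr (T : Type) (s : seq T) (F : T -> V) t :
  dot t (\sum_(i <- s) F i) = \sum_(i <- s) dot t (F i).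
Proof. by rewrite dotC dot_suml; apply: eq_bigr => i _; rewrite dotC. Qed.

Lemma smooth_fieldZ f X : smooth f -> smooth_field X ->
  smooth_field (fun x => f x *: X x).
Proof.
move=> sf sX i; apply: smooth_ext (smoothM sf (sX i)) => x _.
by rewrite mxE.
Qed.

Lemma smooth_fieldB X Y : smooth_field X -> smooth_field Y ->
  smooth_field (fun x => X x - Y x).
Proof.
by move=> sX sY i; apply: smooth_ext (smoothB (sX i) (sY i)) => x _; rewrite !mxE.
Qed.

Lemma smooth_field_sum (T : Type) (s : seq T) (F : T -> V -> V) :
  (forall a, smooth_field (F a)) -> smooth_field (fun x => \sum_(a <- s) F a x).
Proof.
move=> sF i; apply: smooth_ext (smooth_sum s (fun a => sF a i)) => x _.
by rewrite summxE.
Qed.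

Lemma smooth_field_ext X Y : (forall x, S3 x -> X x = Y x) ->
  smooth_field X -> smooth_field Y.
Proof. by move=> XY sX i; apply: smooth_ext (sX i) => x xS; rewrite XY. Qed.

Lemma smooth_dot X Y : smooth_field X -> smooth_field Y ->
  smooth (fun x => dot (X x) (Y x)).
Proof.
move=> sX sY; apply: smooth_ext (smooth_sum (index_enum 'I_4)
  (fun i => smoothM (sX i) (sY i))) => x _.
by rewrite dotE.
Qed.

Lemma tangentZ f X : tangent X -> tangent (fun x => f x *: X x).
Proof. by move=> tX x xS; rewrite dotZr tX// mulr0. Qed.

Lemma tangentB X Y : tangent X -> tangent Y -> tangent (fun x => X x - Y x).
Proof. by move=> tX tY x xS; rewrite dotBr tX// tY// subr0. Qed.

Lemma dot_quat_quat a b (x : V) : S3 x ->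
  dot (quat_frame a x) (quat_frame b x) = (a == b)%:R.
Proof.
move=> /S3_dot; rewrite !dotE !sum4E => e.
have [a0 a1 a2 a3] := quat0E x; have [b0 b1 b2 b3] := quat1E x.
have [c0 c1 c2 c3] := quat2E x.
move: a b; apply: ord3P; apply: ord3P; rewrite ?a0 ?a1 ?a2 ?a3 ?b0 ?b1 ?b2 ?b3
  ?c0 ?c1 ?c2 ?c3 /= -?[RHS]e ?mulr1n ?mulr0n; ring.
Qed.

(** At a point of the sphere, x and the three frame vectors form an orthonormal basis of R^4; the
    identity [h] is this expansion in polynomial form. *)
Lemma quat_expand (x v : V) : S3 x -> dot x v = 0 ->
  v = \sum_b dot v (quat_frame b x) *: quat_frame b x.
Proof.
move=> /S3_dot e xv.
suff h : dot x x *: v - dot x v *: x =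
    \sum_b dot v (quat_frame b x) *: quat_frame b x.
  by rewrite -h e xv scale1r scale0r subr0.
rewrite sum3E !dotE !sum4E.
have [a0 a1 a2 a3] := quat0E x; have [b0 b1 b2 b3] := quat1E x.
have [c0 c1 c2 c3] := quat2E x.
move: (quat_frame 0 x) (quat_frame 1 x) (quat_frame 2%:R x) a0 a1 a2 a3
  b0 b1 b2 b3 c0 c1 c2 c3 => E0 E1 E2 a0 a1 a2 a3 b0 b1 b2 b3 c0 c1 c2 c3.
by apply/rowP; apply: ord4P; rewrite !mxE a0 a1 a2 a3 b0 b1 b2 b3 c0 c1 c2 c3; ring.
Qed.

Variable g : V -> 'M[R]_4.
Hypothesis hg : riemannian_metric g.

Definition gip x (u v : V) : R := (u *m g x *m v^T) 0 0.

Lemma gipDl x u v t : gip x (u + v) t = gip x u t + gip x v t.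
Proof. by rewrite /gip !mulmxDl mxE. Qed.
Lemma gipZl x a u t : gip x (a *: u) t = a * gip x u t.
Proof. by rewrite /gip -!scalemxAl mxE. Qed.
Lemma gipZr x a u t : gip x t (a *: u) = a * gip x t u.
Proof. by rewrite /gip linearZ -scalemxAr mxE. Qed.
Lemma gipBl x u v t : gip x (u - v) t = gip x u t - gip x v t.
Proof. by rewrite -scaleN1r gipDl gipZl mulN1r. Qed.
Lemma gip0l x t : gip x 0 t = 0.
Proof. by rewrite -(scale0r t) gipZl mul0r. Qed.
Lemma gip_suml (T : Type) (s : seq T) (F : T -> V) x t :
  gip x (\sum_(i <- s) F i) t = \sum_(i <- s) gip x (F i) t.
Proof.
by elim/big_rec2: _ => [|i y z _ <-]; rewrite ?gip0l// gipDl.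
Qed.

Lemma gipC x u v : S3 x -> gip x u v = gip x v u.
Proof.
move=> xS; have [_ gT _] := hg; rewrite /gip.
rewrite -[LHS](_ : (u *m g x *m v^T)^T 0 0 = _); last by rewrite mxE.
by rewrite !trmx_mul trmxK gT// mulmxA.
Qed.

Lemma gip_sumr (T : Type) (s : seq T) (F : T -> V) x t : S3 x ->
  gip x t (\sum_(i <- s) F i) = \sum_(i <- s) gip x t (F i).
Proof.
by move=> xS; rewrite gipC// gip_suml; apply: eq_bigr => i _; rewrite gipC.
Qed.

Lemma smooth_ip X Y : smooth_field X -> smooth_field Y -> smooth (ip g X Y).
Proof.
move=> sX sY; have [sg _ _] := hg.
apply: smooth_ext (smooth_sum (index_enum 'I_4) (fun j => smoothM (smooth_sum
  (index_enum 'I_4) (fun i => smoothM (sX i) (sg i j))) (sY j))) => x _.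
by rewrite /ip mxE; apply: eq_bigr => j _; rewrite !mxE.
Qed.

Lemma normalize_facts X : smooth_field X -> tangent X ->
  (forall x, S3 x -> X x != 0) ->
  [/\ smooth_field (normalize g X), tangent (normalize g X),
      forall x, S3 x -> ip g (normalize g X) (normalize g X) x = 1 &
      forall x, S3 x -> 0 < (Num.sqrt (ip g X X x))^-1].
Proof.
move=> sX tX X0; have [_ _ pg] := hg.
have p0 x : S3 x -> 0 < ip g X X x.
  by move=> xS; apply: pg => //; [exact: tX|exact: X0].
have q0 x : S3 x -> 0 < Num.sqrt (ip g X X x) by move=> /p0; rewrite sqrtr_gt0.
split.
- apply: smooth_fieldZ => //; apply: smoothV; first by move=> x /q0/gt_eqF ->.
  by apply: smooth_sqrt => //; exact: smooth_ip.
- exact: tangentZ.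
- move=> x xS; rewrite -[LHS]/(gip x (_ *: X x) (_ *: X x)) gipZl gipZr.
  rewrite -[X in _ * (_ * X)]/(ip g X X x) -[X in _ * (_ * X)]sqr_sqrtr; last exact/ltW/p0.
  by have := q0 _ xS => /gt_eqF/negbT h; field.
- by move=> x /q0; rewrite invr_gt0.
Qed.

Local Notation E := (@quat_frame R).
Local Notation e := (frame g).
Local Notation p a b x := (dot (e a x) (quat_frame b x)).

(** Gram-Schmidt starts from the quaternionic frame, so the transition matrix is triangular with
    positive diagonal. This keeps the process from degenerating and later computes the volume
    density. *)
Lemma frame_facts : [/\ forall a, smooth_field (e a), forall a, tangent (e a),
  forall a b x, S3 x -> gip x (e a x) (e b x) = (a == b)%:R,
  forall a x, S3 x -> 0 < p a a x &
  forall (a b : 'I_3) x, S3 x -> (a < b)%N -> p a b x = 0].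
Proof.
have nz (v t : V) : dot v t = 1 -> v != 0.
  by move=> h; apply/eqP => v0; move: h; rewrite v0 dot0l => /eqP; rewrite eq_sym oner_eq0.
have sE := @smooth_quat R; have tE := @tangent_quat R.
have [s1 t1 n1 l1] : [/\ smooth_field (frame1 g), tangent (frame1 g),
    forall x, S3 x -> ip g (frame1 g) (frame1 g) x = 1 &
    forall x, S3 x -> 0 < (Num.sqrt (ip g (E 0) (E 0) x))^-1].
  apply: normalize_facts => // x xS; apply: (nz _ (E 0 x)).
  by rewrite dot_quat_quat.
have o1 b x : S3 x -> b != 0 -> dot (frame1 g x) (E b x) = 0.
  by move=> xS b0; rewrite /frame1 /normalize dotZl dot_quat_quat// eq_sym (negbTE b0) mulr0.
pose X2 x := E 1 x - ip g (E 1) (frame1 g) x *: frame1 g x.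
have sX2 : smooth_field X2.
  by apply: smooth_fieldB => //; apply: smooth_fieldZ => //; exact: smooth_ip.
have tX2 : tangent X2 by apply: tangentB => //; exact: tangentZ.
have X2d x : S3 x -> dot (X2 x) (E 1 x) = 1.
  by move=> xS; rewrite dotBl dotZl dot_quat_quat// o1// mulr0 subr0.
have [s2 t2 n2 l2] : [/\ smooth_field (frame2 g), tangent (frame2 g),
    forall x, S3 x -> ip g (frame2 g) (frame2 g) x = 1 &
    forall x, S3 x -> 0 < (Num.sqrt (ip g X2 X2 x))^-1].
  apply: normalize_facts => // x xS; exact: (nz _ _ (X2d x xS)).
have o2 x : S3 x -> dot (frame2 g x) (E 2%:R x) = 0.
  move=> xS; rewrite -[frame2 g x]/(_ *: X2 x) dotZl /X2 dotBl dotZl.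
  by rewrite dot_quat_quat// o1// mulr0 subr0 mulr0.
have i21 x : S3 x -> gip x (frame2 g x) (frame1 g x) = 0.
  move=> xS; rewrite -[frame2 g x]/(_ *: X2 x) gipZl /X2 gipBl gipZl.
  by rewrite -[gip x (frame1 g x) _]/(ip g (frame1 g) (frame1 g) x) n1// mulr1 subrr mulr0.
pose X3 x := E 2%:R x - ip g (E 2%:R) (frame1 g) x *: frame1 g x
  - ip g (E 2%:R) (frame2 g) x *: frame2 g x.
have sX3 : smooth_field X3.
  by apply: smooth_fieldB; [apply: smooth_fieldB => //|]; apply: smooth_fieldZ => //; exact: smooth_ip.
have tX3 : tangent X3.
  by apply: tangentB; [apply: tangentB => //|]; exact: tangentZ.
have X3d x : S3 x -> dot (X3 x) (E 2%:R x) = 1.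
  by move=> xS; rewrite dotBl dotBl (dotZl _ (frame1 g x)) (dotZl _ (frame2 g x)) dot_quat_quat// o1// o2// !mulr0 !subr0.
have [s3 t3 n3 l3] : [/\ smooth_field (frame3 g), tangent (frame3 g),
    forall x, S3 x -> ip g (frame3 g) (frame3 g) x = 1 &
    forall x, S3 x -> 0 < (Num.sqrt (ip g X3 X3 x))^-1].
  apply: normalize_facts => // x xS; exact: (nz _ _ (X3d x xS)).
have i31 x : S3 x -> gip x (frame3 g x) (frame1 g x) = 0.
  move=> xS; rewrite -[frame3 g x]/(_ *: X3 x) gipZl /X3 gipBl gipBl (gipZl _ _ (frame1 g x)) (gipZl _ _ (frame2 g x)) i21//.
  by rewrite -[gip x (frame1 g x) _]/(ip g (frame1 g) (frame1 g) x) n1// mulr1 mulr0 subr0 subrr mulr0.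
have i32 x : S3 x -> gip x (frame3 g x) (frame2 g x) = 0.
  move=> xS; rewrite -[frame3 g x]/(_ *: X3 x) gipZl /X3 gipBl gipBl (gipZl _ _ (frame1 g x)) (gipZl _ _ (frame2 g x)).
  rewrite -[gip x (frame2 g x) _]/(ip g (frame2 g) (frame2 g) x) n2//.
  by rewrite (gipC (frame1 g x))// i21// mulr0 subr0 mulr1 subrr mulr0.
split.
- by apply: (@ord3P (fun a => smooth_field (e a))); [exact: s1|exact: s2|exact: s3].
- by apply: (@ord3P (fun a => tangent (e a))); [exact: t1|exact: t2|exact: t3].
- move=> a b x xS; move: a b; apply: ord3P; apply: ord3P => /=.
  + exact: n1.
  + by rewrite gipC// i21.
  + by rewrite gipC// i31.
  + by rewrite i21.
  + exact: n2.
  + by rewrite gipC// i32.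
  + by rewrite i31.
  + by rewrite i32.
  + exact: n3.
- move=> a x xS; move: a; apply: ord3P.
  + by rewrite -[e 0 x]/(_ *: E 0 x) dotZl dot_quat_quat// mulr1 l1.
  + by rewrite -[e 1 x]/(_ *: X2 x) dotZl X2d// mulr1 l2.
  + by rewrite -[e 2%:R x]/(_ *: X3 x) dotZl X3d// mulr1 l3.
- move=> a b x xS; move: a b; apply: ord3P; apply: ord3P => //= _.
  + by rewrite o1.
  + by rewrite o1.
  + by rewrite o2.
Qed.

Lemma smooth_frame a : smooth_field (e a). Proof. by case: frame_facts. Qed.
Lemma tangent_frame a : tangent (e a). Proof. by case: frame_facts. Qed.
Lemma gip_frame a b x : S3 x -> gip x (e a x) (e b x) = (a == b)%:R.
Proof. by case: frame_facts => _ _ h _ _; exact: h. Qed.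

Let P x : 'M[R]_3 := \matrix_(a, b) p a b x.
Let Q x : 'M[R]_3 := \matrix_(b, c) gip x (E b x) (e c x).

Lemma frame_quat a x : S3 x -> e a x = \sum_b p a b x *: E b x.
Proof. by move=> xS; apply: quat_expand => //; exact: tangent_frame. Qed.

Let PQ x : S3 x -> P x *m Q x = 1%:M.
Proof.
move=> xS; apply/matrixP => a c; rewrite !mxE -(gip_frame a c xS).
rewrite [in RHS](frame_quat a xS) gip_suml; apply: eq_bigr => b _.
by rewrite !mxE gipZl.
Qed.

Let QP x : S3 x -> Q x *m P x = 1%:M.
Proof. by move=> /PQ; exact: mulmx1C. Qed.

Lemma quat_frameE b x : S3 x -> E b x = \sum_c gip x (E b x) (e c x) *: e c x.
Proof.
move=> xS.
transitivity (\sum_d (Q x *m P x) b d *: E d x).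
  rewrite QP// (bigD1 b)//= mxE eqxx scale1r big1 ?addr0// => d db.
  by rewrite mxE eq_sym (negbTE db) scale0r.
under [RHS]eq_bigr => c _ do rewrite [in X in _ *: X](frame_quat c xS) scaler_sumr.
rewrite exchange_big/=; apply: eq_bigr => d _; rewrite mxE scaler_suml.
by apply: eq_bigr => c _; rewrite !mxE scalerA.
Qed.

Lemma frame_expand x v : S3 x -> dot x v = 0 ->
  v = \sum_k gip x v (e k x) *: e k x.
Proof.
move=> xS xv; rewrite [LHS](quat_expand xS xv).
transitivity (\sum_b dot v (E b x) *: \sum_c gip x (E b x) (e c x) *: e c x).
  by apply: eq_bigr => b _; rewrite -quat_frameE.
under eq_bigr => b _ do rewrite scaler_sumr.
rewrite exchange_big/=; apply: eq_bigr => c _.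
rewrite [in RHS](quat_expand xS xv) gip_suml scaler_suml.
by apply: eq_bigr => b _; rewrite gipZl scalerA.
Qed.

(** The Gram matrix of the quaternionic frame is Q Q^T with Q inverse to the triangular P, so the
    root of its determinant is 1 / det P. *)
Lemma vol_densityE x : S3 x -> vol_density g x = \prod_a (p a a x)^-1.
Proof.
move=> xS; have [_ _ _ p0 pt] := frame_facts.
have dP : \det (P x) = \prod_a p a a x.
  rewrite det_trig; first by apply: eq_bigr => a _; rewrite mxE.
  by apply/is_trig_mxP => a b ab; rewrite mxE pt.
have dP0 : 0 < \det (P x) by rewrite dP; apply: prodr_gt0 => a _; exact: p0.
have dQ : \det (Q x) = (\det (P x))^-1.
  apply: (mulfI (lt0r_neq0 dP0)); rewrite -det_mulmx PQ// det1 mulfV//.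
  exact: lt0r_neq0.
rewrite prodfV -dP -dQ /vol_density.
have -> : \matrix_(a, b) ip g (E a) (E b) x = Q x *m (Q x)^T.
  apply/matrixP => a b; rewrite !mxE -[LHS]/(gip x (E a x) (E b x)).
  rewrite [in LHS](quat_frameE a xS) gip_suml; apply: eq_bigr => c _.
  by rewrite !mxE gipZl (gipC (e c x)).
by rewrite det_mulmx det_tr -expr2 sqrtr_sqr ger0_norm// dQ invr_ge0 ltW.
Qed.

Lemma smooth_coef a b : smooth (fun x => p a b x).
Proof. by apply: smooth_dot; [exact: smooth_frame|exact: smooth_quat]. Qed.

Lemma vol_density_gt0 x : S3 x -> 0 < vol_density g x.
Proof.
move=> xS; have [_ _ _ p0 _] := frame_facts; rewrite vol_densityE//.
by apply: prodr_gt0 => a _; rewrite invr_gt0 p0.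
Qed.

Lemma smooth_vol_density : smooth (vol_density g).
Proof.
have [_ _ _ p0 _] := frame_facts.
have sV a : smooth (fun x => (p a a x)^-1).
  by apply: smoothV (smooth_coef a a) => x /p0 => /(_ a)/gt_eqF ->.
apply: smooth_ext (smoothM (smoothM (sV 0) (sV 1)) (sV 2%:R)) => x xS.
by rewrite vol_densityE// !big_ord_recr big_ord0/= mul1r; congr (_ * _ * _);
  congr (dot _ _)^-1; congr (_ x); congr (_ _); apply: val_inj.
Qed.

End Frame.

(** * Levi-Civita connection and curvature in the frame *)

Section FrameAlgebra.
Context {R : realFieldType}.
Implicit Types (u v E : 'I_3 -> R) (du dv dE : 'I_3 -> 'I_3 -> R).

Lemma sum_delta (h : 'I_3 -> R) c : \sum_k (c == k)%:R * h k = h c.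
Proof.
rewrite (bigD1 c)//= big1 ?addr0 ?eqxx ?mul1r// => k kc.
by rewrite eq_sym (negbTE kc) mul0r.
Qed.

Lemma lie_algebra u v E du dv dE :
  \sum_k \sum_l (u k * dv k l * E l + u k * v l * dE k l)
  - \sum_k \sum_l (v k * du k l * E l + v k * u l * dE k l)
  = \sum_l (\sum_k (u k * dv k l - v k * du k l)) * E l
    + \sum_k \sum_l (u k * v l) * (dE k l - dE l k).
Proof. rewrite !sum3E; ring. Qed.

(** Koszul's formula with third argument e_c, for fields with coefficients u and v. Here [dd] stands
    for the derivatives of the constant coefficients of e_c, [C] for the structure functions; all
    derivatives cancel except those of v along the first field. *)
Lemma koszul_algebra u v du dv (dd : 'I_3 -> 'I_3 -> R)
    (C : 'I_3 -> 'I_3 -> 'I_3 -> R) (c : 'I_3) : (forall m k, dd m k = 0) ->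
  (\sum_k u k * dv k c + \sum_k v k * du k c
   - \sum_k (u k * dv c k + v k * du c k)
   + (\sum_k (u k * dv k c - v k * du k c) + \sum_k \sum_l u k * v l * C k l c)
   - \sum_k v k * (\sum_m (u m * dd m k - (c == m)%:R * du m k)
                   + \sum_m \sum_l u m * (c == l)%:R * C m l k)
   - \sum_k u k * (\sum_m (v m * dd m k - (c == m)%:R * dv m k)
                   + \sum_m \sum_l v m * (c == l)%:R * C m l k)) / 2%:R
  = \sum_k u k * (dv k c + \sum_l v l * ((C k l c - C k c l - C l c k) / 2%:R)).
Proof.
move=> d0; have d3 : ((0 : 'I_3) == 1 = false) * ((0 : 'I_3) == 2%:R = false) *
  ((1 : 'I_3) == 0 = false) * ((1 : 'I_3) == 2%:R = false) *
  ((2%:R : 'I_3) == 0 = false) * ((2%:R : 'I_3) == 1 = false) by [].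
by move: c; apply: ord3P; rewrite !sum3E !d0 ?eqxx ?d3 ?mulr1n ?mulr0n; field.
Qed.

End FrameAlgebra.

Section Connection.
Context {R : realType}.
Local Notation V := 'rV[R]_4.
Implicit Types (X Y : V -> V) (f : V -> R).

Lemma dalong_coord X i x : S3 x -> dot x (X x) = 0 ->
  dalong X (fun y : V => y 0 i) x = X x 0 i.
Proof.
move=> xS xX; have x0 := S3_nz xS; have x1 : enorm x = 1 := xS.
have d1 := derive_enorm (X x) xS.
have d2 := radial_derive (X x) (smooth_coord i) x0.
have [_ e2] := is_deriveM d2 d1.
have [_ e3] := is_derive_coord i x (X x).
have e4 : 'D_(X x) (radial (fun y : V => y 0 i) * @enorm R) x = X x 0 i.
  rewrite -[RHS]e3; apply: near_eq_derive; apply: filterS (nz_nbhs x0) => y y0.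
  rewrite /radial /= /GRing.mul/= mxE mulrC mulrA mulfV ?mul1r//.
  by rewrite gt_eqF// enorm_gt0.
have [_ e5] := d2; rewrite /dalong e5.
by move: e4; rewrite e2 dotC xX x1 scaler0 add0r scale1r.
Qed.

Lemma dalong_comb (a : 'I_3 -> R) (F : 'I_3 -> V -> V) X f x : smooth f -> S3 x ->
  X x = \sum_k a k *: F k x -> dalong X f x = \sum_k a k * dalong (F k) f x.
Proof.
move=> sf xS Xx; rewrite dalongE// Xx.
under [RHS]eq_bigr => k _ do rewrite dalongE// mulr_sumr.
rewrite exchange_big/=; apply: eq_bigr => i _; rewrite summxE mulr_suml.
by apply: eq_bigr => k _; rewrite mxE mulrA.
Qed.

Lemma dalong_dot (W X Y : V -> V) x : smooth_field X -> smooth_field Y -> S3 x ->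
  dalong W (fun x => dot (X x) (Y x)) x =
  dot (dalong W X x) (Y x) + dot (X x) (dalong W Y x).
Proof.
move=> sX sY xS.
rewrite (@dalong_ext _ _ W W _ (fun x => \sum_i X x 0 i * Y x 0 i))//; last first.
  by move=> y _; exact: dotE.
rewrite dalong_sum//; last by move=> i; exact: smoothM.
rewrite !dotE -big_split/=; apply: eq_bigr => i _.
by rewrite dalongM// !dalong_field// addrC; congr (_ + _); exact: mulrC.
Qed.

Lemma smooth_id : smooth_field (@id V). Proof. exact: smooth_coord. Qed.

Lemma smooth_lie X Y : smooth_field X -> smooth_field Y -> smooth_field (lie X Y).
Proof.
move=> sX sY i; apply: smooth_ext (smoothB (smooth_dalong sX (sY i))
  (smooth_dalong sY (sX i))) => x xS; exact/esym/lie_coord.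
Qed.

Lemma dalong_id X x : S3 x -> dot x (X x) = 0 -> dalong X (@id V) x = X x.
Proof.
move=> xS xX; apply/rowP => i; rewrite dalong_field//; last exact: smooth_id.
exact: dalong_coord.
Qed.

Lemma tangent_lie X Y : smooth_field X -> smooth_field Y -> tangent X ->
  tangent Y -> tangent (lie X Y).
Proof.
move=> sX sY tX tY x xS.
have h (A B : V -> V) : smooth_field A -> smooth_field B -> tangent A ->
    tangent B -> dot x (dalong A B x) = - dot (A x) (B x).
  move=> sA sB tA tB; have := dalong_dot A smooth_id sB xS.
  rewrite (@dalong_ext _ _ A A _ (fun=> 0))//.
  rewrite dalong_cst dalong_id//; last exact: tA.
  by move/esym/eqP; rewrite addr_eq0 => /eqP ->; rewrite opprK.
by rewrite dotBr !h// (dotC (Y x)) subrr.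
Qed.

Variable g : V -> 'M[R]_4.
Hypothesis hg : riemannian_metric g.
Local Notation e := (frame g).
Local Notation gip := (gip g).
Let se := smooth_frame hg.
Let te := tangent_frame hg.

Definition cc a b k x := gip x (lie (e a) (e b) x) (e k x).
(** Koszul's formula for an orthonormal frame: this is g(nabla_(e_a) e_b, e_c), see
    [levi_civita_frame_gip]. *)
Definition om a b c x := (cc a b c x - cc a c b x - cc b c a x) / 2%:R.

Lemma smooth_cc a b k : smooth (cc a b k).
Proof. by apply: (smooth_ip hg) => //; exact: smooth_lie. Qed.

Lemma smooth_om a b c : smooth (om a b c).
Proof.
apply: smoothM; last exact: smooth_cst.
by do 2 (apply: smoothB; last exact: smooth_cc); exact: smooth_cc.
Qed.

Lemma cc_anti a b k x : cc a b k x = - cc b a k x.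
Proof.
rewrite /cc; have -> : lie (e a) (e b) x = (-1) *: lie (e b) (e a) x.
  by rewrite scaleN1r opprB.
by rewrite gipZl mulN1r.
Qed.

Lemma om_anti a b c x : om a b c x = - om a c b x.
Proof. by rewrite /om (cc_anti b c); field. Qed.

Lemma om_torsion a b c x : om a b c x - om b a c x = cc a b c x.
Proof. by rewrite /om (cc_anti b a) (cc_anti b c) (cc_anti a c); field. Qed.

Lemma lie_frame a b x : S3 x -> lie (e a) (e b) x = \sum_k cc a b k x *: e k x.
Proof. by move=> xS; apply: (frame_expand hg) => //; apply: tangent_lie. Qed.

(** Smooth frame coefficients reduce brackets, connection and curvature to finite sums of
    functions. *)
Definition combination (X : V -> V) (u : 'I_3 -> V -> R) :=
  (forall k, smooth (u k)) /\ forall x, S3 x -> X x = \sum_k u k x *: e k x.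

Lemma combination_smooth X u : combination X u -> smooth_field X.
Proof.
move=> [su Xu]; apply: (smooth_field_ext (fun x xS => esym (Xu x xS))).
by apply: smooth_field_sum => a; exact: smooth_fieldZ.
Qed.

Lemma gip_frame_sum (a : 'I_3 -> R) k x : S3 x ->
  gip x (\sum_c a c *: e c x) (e k x) = a k.
Proof.
move=> xS; rewrite gip_suml (bigD1 k)//= gipZl gip_frame// eqxx mulr1.
by rewrite big1 ?addr0// => l lk; rewrite gipZl gip_frame// (negbTE lk) mulr0.
Qed.

Lemma combination_gip X u k x : combination X u -> S3 x ->
  gip x (X x) (e k x) = u k x.
Proof. by move=> [_ Xu] xS; rewrite Xu// gip_frame_sum. Qed.

Lemma combination_field X : smooth_field X -> tangent X ->
  combination X (fun k x => gip x (X x) (e k x)).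
Proof.
move=> sX tX; split=> [k|x xS]; first exact: smooth_ip.
by apply: (frame_expand hg) => //; exact: tX.
Qed.

Lemma combination_frame a : combination (e a) (fun k _ => (a == k)%:R).
Proof.
split=> [k|x xS]; first exact: smooth_cst.
rewrite (bigD1 a)//= eqxx scale1r big1 ?addr0// => k ka.
by rewrite eq_sym (negbTE ka) scale0r.
Qed.

Lemma combination_dalong X u f x : combination X u -> smooth f -> S3 x ->
  dalong X f x = \sum_k u k x * dalong (e k) f x.
Proof. by move=> [_ Xu] sf xS; apply: dalong_comb => //; exact: Xu. Qed.

Lemma combination_lie X Y u v x c : combination X u -> combination Y v -> S3 x ->
  gip x (lie X Y x) (e c x) =
  \sum_k (u k x * dalong (e k) (v c) x - v k x * dalong (e k) (u c) x)
  + \sum_k \sum_l u k x * v l x * cc k l c x.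
Proof.
move=> cX cY xS; have [su Xu] := cX; have [sv Yv] := cY.
have h (A B : V -> V) (a b : 'I_3 -> V -> R) i : combination A a -> combination B b ->
    dalong A (fun x => B x 0 i) x = \sum_k \sum_l (a k x * dalong (e k) (b l) x * e l x 0 i
       + a k x * b l x * dalong (e k) (fun x => e l x 0 i) x).
  move=> cA cB; have sB := combination_smooth cB; have [sb Bb] := cB.
  rewrite (combination_dalong cA)//; apply: eq_bigr => k _.
  rewrite (@dalong_ext _ _ (e k) (e k) _ (fun x => \sum_l b l x * e l x 0 i))//; last first.
    by move=> y yS; rewrite Bb// summxE; apply: eq_bigr => l _; rewrite mxE.
  rewrite dalong_sum//; last by move=> l; apply: smoothM => //; exact: se.
  rewrite mulr_sumr; apply: eq_bigr => l _; rewrite dalongM//; last exact: se.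
  ring.
have -> : lie X Y x = \sum_l (\sum_k (u k x * dalong (e k) (v l) x
      - v k x * dalong (e k) (u l) x)) *: e l x
    + \sum_k \sum_l (u k x * v l x) *: lie (e k) (e l) x.
  apply/rowP => i; rewrite lie_coord//; try exact: combination_smooth cX; try exact: combination_smooth cY.
  rewrite (h _ _ _ _ i cX cY) (h _ _ _ _ i cY cX) mxE !summxE.
  transitivity (\sum_l (\sum_k (u k x * dalong (e k) (v l) x
      - v k x * dalong (e k) (u l) x)) * e l x 0 i
    + \sum_k \sum_l (u k x * v l x) * (dalong (e k) (fun x => e l x 0 i) x
      - dalong (e l) (fun x => e k x 0 i) x)).
    exact: (lie_algebra (u^~ x) (v^~ x) (fun l => e l x 0 i)
      (fun k l => dalong (e k) (u l) x) (fun k l => dalong (e k) (v l) x)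
      (fun k l => dalong (e k) (fun x => e l x 0 i) x)).
  congr (_ + _); first by apply: eq_bigr => l _; rewrite mxE.
  apply: eq_bigr => k _; rewrite summxE; apply: eq_bigr => l _.
  by rewrite mxE lie_coord//; exact: se.
rewrite gipDl (gip_frame_sum (fun l => \sum_k (u k x * dalong (e k) (v l) x
      - v k x * dalong (e k) (u l) x)))//; congr (_ + _).
rewrite gip_suml; apply: eq_bigr => k _; rewrite gip_suml.
by apply: eq_bigr => l _; rewrite gipZl.
Qed.

Lemma combination_ip X Y u v x : combination X u -> combination Y v -> S3 x ->
  ip g X Y x = \sum_k u k x * v k x.
Proof.
move=> cX cY xS; have [_ Yv] := cY.
rewrite -[LHS]/(gip x (X x) (Y x)) Yv// gip_sumr//; apply: eq_bigr => k _.
by rewrite gipZr (combination_gip k cX)// mulrC.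
Qed.

Lemma levi_civita_frame X Y u v x : combination X u -> combination Y v -> S3 x ->
  levi_civita g X Y x = \sum_c (\sum_k u k x * (dalong (e k) (v c) x
     + \sum_l v l x * om k l c x)) *: e c x.
Proof.
move=> cX cY xS; have [su Xu] := cX; have [sv Yv] := cY.
have cE := combination_frame.
apply: eq_bigr => c _; congr (_ *: _); rewrite /koszul.
have -> : dalong X (ip g Y (e c)) x = \sum_k u k x * dalong (e k) (v c) x.
  rewrite -(combination_dalong cX)//; apply: dalong_ext => // y yS.
  exact: combination_gip cY yS.
have -> : dalong Y (ip g X (e c)) x = \sum_k v k x * dalong (e k) (u c) x.
  rewrite -(combination_dalong cY)//; apply: dalong_ext => // y yS.
  exact: combination_gip cX yS.
have -> : dalong (e c) (ip g X Y) x = \sum_k (u k x * dalong (e c) (v k) x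
    + v k x * dalong (e c) (u k) x).
  rewrite (@dalong_ext _ _ (e c) (e c) _ (fun x => \sum_k u k x * v k x))//; last first.
    by move=> y yS; exact: combination_ip.
  rewrite dalong_sum//; last by move=> k; exact: smoothM.
  by apply: eq_bigr => k _; rewrite dalongM.
have ipe (A B : V -> V) (b : 'I_3 -> V -> R) : combination B b ->
    ip g A B x = \sum_k b k x * gip x (A x) (e k x).
  move=> [_ Bb]; rewrite -[LHS]/(gip x (A x) (B x)) Bb// gip_sumr//.
  by apply: eq_bigr => k _; rewrite gipZr.
have lE (Z W : V -> V) (z w : 'I_3 -> V -> R) : combination Z z -> combination W w ->
    ip g (lie Z (e c)) W x = \sum_k w k x * (\sum_m (z m x *
      dalong (e m) (fun=> ((c == k)%:R : R)) x - (c == m)%:R * dalong (e m) (z k) x)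
      + \sum_m \sum_l z m x * (c == l)%:R * cc m l k x).
  move=> cZ cW; rewrite (ipe (lie Z (e c)) W w cW); apply: eq_bigr => k _.
  by rewrite (combination_lie k cZ (cE c) xS).
apply: etrans (koszul_algebra (u^~ x) (v^~ x) (fun k l => dalong (e k) (u l) x)
  (fun k l => dalong (e k) (v l) x) (fun k l m => cc k l m x) c
  (fun m k => dalong_cst (e m) ((c == k)%:R) x)).
congr ((_ + _ - _ + _ - _ - _) / _).
- exact: combination_lie c cX cY xS.
- exact: lE X Y u v cX cY.
- exact: lE Y X v u cY cX.
Qed.

Lemma levi_civita_gip X Y u v x c : combination X u -> combination Y v -> S3 x ->
  gip x (levi_civita g X Y x) (e c x) = \sum_k u k x * (dalong (e k) (v c) x
     + \sum_l v l x * om k l c x).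
Proof.
move=> cX cY xS; rewrite (levi_civita_frame cX cY xS).
exact: (gip_frame_sum (fun c => \sum_k u k x * (dalong (e k) (v c) x
     + \sum_l v l x * om k l c x))).
Qed.

Lemma levi_civita_frame_gip a b c x : S3 x ->
  gip x (levi_civita g (e a) (e b) x) (e c x) = om a b c x.
Proof.
move=> xS; rewrite (levi_civita_gip c (combination_frame a) (combination_frame b) xS).
rewrite (sum_delta (fun k => _) a) dalong_cst add0r.
exact: (sum_delta (fun l => om a l c x)).
Qed.

Lemma combination_levi_civita a b :
  combination (levi_civita g (e a) (e b)) (om a b).
Proof.
split=> [k|x xS]; first exact: smooth_om.
rewrite (levi_civita_frame (combination_frame a) (combination_frame b) xS).
apply: eq_bigr => c _; congr (_ *: _); rewrite -levi_civita_frame_gip//.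
by rewrite (levi_civita_gip c (combination_frame a) (combination_frame b) xS).
Qed.

Lemma combination_lie_frame a b : combination (lie (e a) (e b)) (cc a b).
Proof. by split=> [k|x xS]; [exact: smooth_cc|exact: lie_frame]. Qed.

(** This is the form in which the curvature emerges from [lichnerowicz_algebra]; it also shows that
    the curvature is smooth. *)
Lemma scalar_curvatureE x : S3 x -> scalar_curvature g x = \sum_a \sum_b
  (dalong (e a) (om b b a) x + \sum_l om b b l x * om a l a x
   - (dalong (e b) (om a b a) x + \sum_l om a b l x * om b l a x)
   - \sum_k cc a b k x * om k b a x).
Proof.
move=> xS; apply: eq_bigr => a _; apply: eq_bigr => b _.
rewrite -[LHS]/(gip x (riemann g (e a) (e b) (e b) x) (e a x)) /riemann !gipBl.
congr (_ - _ - _).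
- by rewrite (levi_civita_gip a (combination_frame a) (combination_levi_civita b b) xS) (sum_delta (fun k => _)).
- by rewrite (levi_civita_gip a (combination_frame b) (combination_levi_civita a b) xS) (sum_delta (fun k => _)).
- rewrite (levi_civita_gip a (combination_lie_frame a b) (combination_frame b) xS).
  by apply: eq_bigr => k _; rewrite dalong_cst add0r (sum_delta (fun l => om k l a x)).
Qed.

Lemma smooth_scalar_curvature : smooth (scalar_curvature g).
Proof.
have so := smooth_om; have sc := smooth_cc.
have H := smooth_sum (index_enum 'I_3) (fun a => smooth_sum (index_enum 'I_3)
  (fun b => smoothB (smoothB (smoothD (smooth_dalong (se a) (so b b a))
     (smooth_sum (index_enum 'I_3) (fun l => smoothM (so b b l) (so a l a))))
     (smoothD (smooth_dalong (se b) (so a b a))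
     (smooth_sum (index_enum 'I_3) (fun l => smoothM (so a b l) (so b l a)))))
     (smooth_sum (index_enum 'I_3) (fun k => smoothM (sc a b k) (so k b a))))).
by apply: smooth_ext H => x xS; rewrite scalar_curvatureE.
Qed.

Lemma gradient_ip f h x : S3 x ->
  ip g (gradient g f) (gradient g h) x = \sum_a dalong (e a) f x * dalong (e a) h x.
Proof.
move=> xS; rewrite -[LHS]/(gip x (\sum_a dalong (e a) f x *: e a x)
  (\sum_a dalong (e a) h x *: e a x)) gip_suml; apply: eq_bigr => a _.
rewrite gipZl gip_sumr// (bigD1 a)//= gipZr gip_frame// eqxx mulr1.
by rewrite big1 ?addr0// => b ba; rewrite gipZr gip_frame// eq_sym (negbTE ba) mulr0.
Qed.

Lemma frame_commutator a b f x : smooth f -> S3 x ->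
  dalong (e a) (dalong (e b) f) x - dalong (e b) (dalong (e a) f) x =
  \sum_k cc a b k x * dalong (e k) f x.
Proof.
move=> sf xS; rewrite dalong_commutator//.
exact: combination_dalong (combination_lie_frame a b) sf xS.
Qed.

End Connection.

(** * Divergence theorem for the orthonormal frame *)

Lemma div_algebra (R : realFieldType) (p q : 'I_3 -> 'I_3 -> R)
    (dp dq C : 'I_3 -> 'I_3 -> 'I_3 -> R) a :
  (forall a c, \sum_b p a b * q b c = (a == c)%:R) ->
  (forall d, \sum_b \sum_c p c b * (\sum_k (q b k * dq k d c - q d k * dq k b c)
     + \sum_k \sum_l q b k * q d l * C k l c) = 0) ->
  (forall a c k, \sum_b (p a b * dq k b c + q b c * dp k a b) = 0) ->
  \sum_b \sum_k q b k * dp k a b = \sum_c C c a c - \sum_b \sum_c p c b * dq a b c.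
Proof.
move=> pq A B; pose t k := \sum_b \sum_c p c b * dq k b c.
pose D l := \sum_c C c l c.
have one (h : 'I_3 -> 'I_3 -> R) :
    \sum_c \sum_k (\sum_b p c b * q b k) * h k c = \sum_c h c c.
  apply: eq_bigr => c _; rewrite -(sum_delta (h^~ c) c).
  by apply: eq_bigr => k _; rewrite pq.
have A' d : \sum_c dq c d c - \sum_k q d k * t k + \sum_l q d l * D l = 0.
  rewrite -[RHS](A d); transitivity
    (\sum_c \sum_k (\sum_b p c b * q b k) * dq k d c - \sum_k q d k * t k
     + \sum_l q d l * \sum_c \sum_k (\sum_b p c b * q b k) * C k l c).
    rewrite (one (fun k c => dq k d c)); congr (_ + _); apply: eq_bigr => l _.
    by rewrite (one (fun k c => C k l c)).
  by rewrite /t !sum3E; ring.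
have B' k : \sum_b q b k * dp k a b = - \sum_b p a b * dq k b k.
  by apply/eqP; rewrite -addr_eq0 -big_split/=; apply/eqP; rewrite -[RHS](B a k k);
     apply: eq_bigr => b _; rewrite addrC.
rewrite exchange_big/=; under eq_bigr => k _ do rewrite B'.
have two (h : 'I_3 -> R) : \sum_d p a d * \sum_k q d k * h k = h a.
  rewrite -(sum_delta h a); under eq_bigr => d _ do rewrite mulr_sumr.
  rewrite exchange_big/=; apply: eq_bigr => k _; rewrite -pq mulr_suml.
  by apply: eq_bigr => d _; rewrite mulrA.
rewrite -/(t a) -/(D a) -(two t) -(two D).
have h d : \sum_c dq c d c = \sum_k q d k * t k - \sum_l q d l * D l.
  by apply/eqP; rewrite -subr_eq0; apply/eqP; rewrite -[RHS](A' d); ring.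
rewrite sumrN exchange_big/=.
under eq_bigr => d _ do rewrite -mulr_sumr h mulrBr.
by rewrite sumrB opprB.
Qed.

(** Jacobi's formula for the derivative of the determinant of the triangular matrix q, with p as its
    inverse. *)
Lemma tri_algebra (R : realFieldType) (p q dq : 'I_3 -> 'I_3 -> R) :
  p 0 1 = 0 -> p 0 2%:R = 0 -> p 1 2%:R = 0 ->
  dq 0 1 = 0 -> dq 0 2%:R = 0 -> dq 1 2%:R = 0 ->
  (forall c, p c c * q c c = 1) ->
  q 0 0 * q 1 1 * dq 2%:R 2%:R + q 2%:R 2%:R * (q 0 0 * dq 1 1 + q 1 1 * dq 0 0)
  = q 0 0 * q 1 1 * q 2%:R 2%:R * \sum_b \sum_c p c b * dq b c.
Proof.
move=> p01 p02 p12 z01 z02 z12 h; have h0 := h 0; have h1 := h 1; have h2 := h 2%:R.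
rewrite !sum3E z01 z02 z12 p01 p02 p12.
transitivity (q 1 1 * q 2%:R 2%:R * (p 0 0 * q 0 0) * dq 0 0
  + q 0 0 * q 2%:R 2%:R * (p 1 1 * q 1 1) * dq 1 1
  + q 0 0 * q 1 1 * (p 2%:R 2%:R * q 2%:R 2%:R) * dq 2%:R 2%:R).
  by rewrite h0 h1 h2; ring.
ring.
Qed.

Section FrameDivergence.
Context {R : realType}.
Local Notation V := 'rV[R]_4.
Local Notation E := (@quat_frame R).
Implicit Types (X Y : V -> V) (f : V -> R).

Lemma dalong_quat X b x : S3 x -> dot x (X x) = 0 ->
  dalong X (E b) x = E b (X x).
Proof.
move=> xS xX; apply/rowP => i; rewrite dalong_field//; last exact: smooth_quat.
have [s [j [_ h]]] := @quat_coord R b i; rewrite h.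
rewrite (@dalong_ext _ _ X X _ (fun y => s * y 0 j))//.
by rewrite dalongZ ?dalong_coord//; exact: smooth_coord.
Qed.

Lemma quat_isometry b (u v : V) : dot (E b u) (E b v) = dot u v.
Proof.
rewrite !dotE !sum4E; move: b; apply: ord3P.
- by have [-> -> -> ->] := quat0E u; have [-> -> -> ->] := quat0E v; ring.
- by have [-> -> -> ->] := quat1E u; have [-> -> -> ->] := quat1E v; ring.
- by have [-> -> -> ->] := quat2E u; have [-> -> -> ->] := quat2E v; ring.
Qed.

Lemma lie_quat_trace b d x : S3 x -> dot (lie (E b) (E d) x) (E b x) = 0.
Proof.
move=> xS; rewrite /lie !dalong_quat//; try exact: tangent_quat.
rewrite dotBl quat_isometry (dotC (E d x)) dot_quat subr0.
by rewrite dotC dot_quat.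
Qed.

Variable g : V -> 'M[R]_4.
Hypothesis hg : riemannian_metric g.
Local Notation e := (frame g).
Local Notation gip := (gip g).
Local Notation w := (vol_density g).
Let se := smooth_frame hg.
Let te := tangent_frame hg.
Let p a b x := dot (e a x) (E b x).
Let q b c x := gip x (E b x) (e c x).

Let sp a b : smooth (p a b). Proof. exact: smooth_coef. Qed.
Let sq b c : smooth (q b c).
Proof. by apply: (smooth_ip hg) => //; exact: smooth_quat. Qed.

Let pq a c x : S3 x -> \sum_b p a b x * q b c x = (a == c)%:R.
Proof.
move=> xS; rewrite -(gip_frame hg a c xS) [in RHS](frame_quat hg a xS) gip_suml.
by apply: eq_bigr => b _; rewrite gipZl.
Qed.

(** The divergence of e_a: g([e_c, e_a], e_c) equals g(nabla_(e_c) e_a, e_c), because e_c has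
    constant length. *)
Definition fdiv a x := \sum_c cc g c a c x.

Lemma smooth_fdiv a : smooth (fdiv a).
Proof. by apply: smooth_sum => c; exact: smooth_cc. Qed.

Let cq b : combination g (E b) (q b).
Proof. exact: (combination_field hg (smooth_quat b) (tangent_quat b)). Qed.

Let qtri x : S3 x -> [/\ q 0 1 x = 0, q 0 2%:R x = 0, q 1 2%:R x = 0 &
  forall c, p c c x * q c c x = 1].
Proof.
move=> xS; have [_ _ _ p0 pt] := frame_facts hg.
have h a c := pq a c xS; have pn a : p a a x != 0 by rewrite gt_eqF// p0.
have p01 : p 0 1 x = 0 by exact: pt.
have p02 : p 0 2%:R x = 0 by exact: pt.
have p12 : p 1 2%:R x = 0 by exact: pt.
have z (s t : R) : s != 0 -> s * t = 0 -> t = 0.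
  by move=> s0 /eqP; rewrite mulf_eq0 (negbTE s0) => /eqP.
have q01 : q 0 1 x = 0.
  by apply: (z _ _ (pn 0)); have := h 0 1; rewrite sum3E p01 p02 !mul0r !addr0.
have q02 : q 0 2%:R x = 0.
  by apply: (z _ _ (pn 0)); have := h 0 2%:R; rewrite sum3E p01 p02 !mul0r !addr0.
have q12 : q 1 2%:R x = 0.
  by apply: (z _ _ (pn 1)); have := h 1 2%:R; rewrite sum3E q02 p12 mulr0 mul0r addr0 add0r.
split=> //; apply: ord3P.
- by have := h 0 0; rewrite sum3E p01 p02 !mul0r !addr0.
- by have := h 1 1; rewrite sum3E p12 q01 mulr0 mul0r addr0 add0r.
- by have := h 2%:R 2%:R; rewrite sum3E q02 q12 !mulr0 !add0r.
Qed.

Let wq x : S3 x -> w x = q 0 0 x * q 1 1 x * q 2%:R 2%:R x.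
Proof.
move=> xS; have [_ _ _ h] := qtri xS.
have i a : (p a a x)^-1 = q a a x.
  have n0 : p a a x != 0.
    by apply/eqP => p0; have := h a; rewrite p0 mul0r => /eqP; rewrite eq_sym oner_eq0.
  by apply: (mulfI n0); rewrite mulfV// h.
rewrite (vol_densityE hg xS) !big_ord_recr big_ord0/= mul1r -!i.
by congr (_^-1 * _^-1 * _^-1); congr (p _ _ x); apply: val_inj.
Qed.

Let dw k x : S3 x -> dalong (e k) w x =
  w x * \sum_b \sum_c p c b x * dalong (e k) (q b c) x.
Proof.
move=> xS; have [_ _ _ _ pt] := frame_facts hg.
have [_ _ _ h] := qtri xS.
have z b c : (forall y, S3 y -> q b c y = 0) -> dalong (e k) (q b c) x = 0.
  by move=> q0; rewrite (@dalong_ext _ _ (e k) (e k) _ (fun=> 0)) ?dalong_cst.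
have z01 : dalong (e k) (q 0 1) x = 0 by apply: z => y /qtri[].
have z02 : dalong (e k) (q 0 2%:R) x = 0 by apply: z => y /qtri[].
have z12 : dalong (e k) (q 1 2%:R) x = 0 by apply: z => y /qtri[].
have p01 : p 0 1 x = 0 by exact: pt.
have p02 : p 0 2%:R x = 0 by exact: pt.
have p12 : p 1 2%:R x = 0 by exact: pt.
have -> : dalong (e k) w x = dalong (e k) (fun x => q 0 0 x * q 1 1 x * q 2%:R 2%:R x) x.
  by apply: dalong_ext => // y yS; exact: wq.
rewrite (wq xS) (dalongM (e k) (smoothM (sq 0 0) (sq 1 1)) (sq 2%:R 2%:R) xS).
rewrite (dalongM (e k) (sq 0 0) (sq 1 1) xS).
exact: (tri_algebra (p := fun a b => p a b x) (q := fun b c => q b c x)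
  (dq := fun b c => dalong (e k) (q b c) x) p01 p02 p12 z01 z02 z12 h).
Qed.

(** Three relations determine the sum: p inverts q, the derivative of the product p q vanishes, and
    the brackets of the quaternionic frame have zero trace ([lie_quat_trace]). [div_algebra]
    eliminates between them. *)
Lemma frame_div_coef a x : S3 x -> \sum_b dalong (E b) (p a b) x =
  fdiv a x - \sum_b \sum_c p c b x * dalong (e a) (q b c) x.
Proof.
move=> xS.
rewrite -(@div_algebra _ (fun a b => p a b x) (fun b c => q b c x)
  (fun k a b => dalong (e k) (p a b) x) (fun k b c => dalong (e k) (q b c) x)
  (fun k l c => cc g k l c x)).
- by apply: eq_bigr => b _; apply: (combination_dalong (cq b)).
- by move=> a' c; exact: pq.
- move=> d; transitivity (\sum_b dot (lie (E b) (E d) x) (E b x)); last first.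
    by apply: big1 => b _; exact: lie_quat_trace.
  apply: eq_bigr => b _.
  have tl : dot x (lie (E b) (E d) x) = 0.
    by apply: tangent_lie xS; try exact: smooth_quat; exact: tangent_quat.
  rewrite [in RHS](frame_expand hg xS tl) dot_suml; apply: eq_bigr => c _.
  by rewrite dotZl mulrC (combination_lie hg c (cq b) (cq d) xS).
- move=> a' c k; rewrite -[RHS](dalong_cst (e k) ((a' == c)%:R : R) x).
  rewrite -(@dalong_ext _ _ (e k) (e k) (fun x => \sum_b p a' b x * q b c x))//; last first.
    by move=> y yS; exact: pq.
  rewrite dalong_sum//; last by move=> b; exact: smoothM.
  by apply: eq_bigr => b _; rewrite dalongM.
Qed.

(** With e_a = sum_b p_ab E_b and volume density w, the product w (e_a f + fdiv a f) is sum_b E_b(f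
    p_ab w), by [frame_div_coef] and the logarithmic derivative of w. Each term integrates to 0 by
    [integral_quat]. *)
Theorem frame_divergence a f : smooth f ->
  int_vol g (fun x => dalong (e a) f x + fdiv a x * f x) = 0.
Proof.
move=> sf; have sw := smooth_vol_density hg.
have w0 x (xS : S3 x) := vol_density_gt0 hg xS.
pose F b x := f x * (p a b x * w x).
have sF b : smooth (F b) by apply: smoothM => //; exact: smoothM.
have sV : smooth (fun x => (w x)^-1) by apply: smoothV => // x /w0 /gt_eqF ->.
have key x : S3 x -> dalong (e a) f x + fdiv a x * f x =
    \sum_b dalong (E b) (F b) x * (w x)^-1.
  move=> xS; have wn : w x != 0 by rewrite gt_eqF// w0.
  rewrite -mulr_suml; apply: (mulIf wn); rewrite divfK//.
  have eE h : smooth h -> \sum_b p a b x * dalong (E b) h x = dalong (e a) h x.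
    by move=> sh; rewrite (dalong_comb sh xS (frame_quat hg a xS)).
  transitivity (\sum_b (f x * (p a b x * dalong (E b) w x + w x * dalong (E b) (p a b) x)
      + p a b x * w x * dalong (E b) f x)); last first.
    by apply: eq_bigr => b _; rewrite dalongM ?dalongM//; exact: smoothM.
  transitivity (f x * (\sum_b p a b x * dalong (E b) w x) +
     f x * w x * (\sum_b dalong (E b) (p a b) x) +
     w x * (\sum_b p a b x * dalong (E b) f x)); last first.
    rewrite !mulr_sumr -!big_split/=; apply: eq_bigr => b _.
    by have al (r s t u v z : R) : r * (s * u) + r * t * v + t * (s * z) =
      r * (s * u + t * v) + s * t * z by ring; exact: al.
  rewrite (eE w sw) (eE f sf) (frame_div_coef a xS) (dw a xS).
  by have al (r s t u v : R) : (r + s * t) * u = t * (u * v) + t * u * (s - v) + u * r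
    by ring; exact: al.
rewrite (int_vol_ext _ key) int_vol_sum//; last first.
  move=> b; apply: smooth_integrable_vol => //; apply: smoothM => //.
  by apply: smooth_dalong => //; exact: smooth_quat.
apply: big1 => b _; rewrite /int_vol /int_round /Rintegral.
rewrite (_ : (\int[_]_(y in _) _)%E = 0%E) ?mulr0//.
rewrite -[RHS](integral_quat b (sF b)); apply: eq_integral => y /set_mem y1.
by rewrite divfK// gt_eqF// w0//; exact: ball4_S3.
Qed.

End FrameDivergence.

                                 

(** * Schrödinger-Lichnerowicz formula *)

Section LichnerowiczAlgebra.
Context {R : realFieldType}.
Implicit Types (s t : nat -> R).

                                                                           
                                                   
(** Clifford multiplication by e_a on the four real components of a spinor, ordered as real and
    imaginary part of the first entry, then of the second; see [scmp_cliff]. *)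
Definition qg (a : nat) s (i : nat) : R :=
  match a, i with
  | 0, 0 => - s 1%N | 0, 1 => s 0%N | 0, 2 => s 3%N | 0, _ => - s 2%N
  | 1, 0 => s 2%N | 1, 1 => s 3%N | 1, 2 => - s 0%N | 1, _ => - s 1%N
  | _, 0 => - s 3%N | _, 1 => s 2%N | _, 2 => - s 1%N | _, _ => s 0%N
  end.

Definition sm3 (f : nat -> R) : R := f 0%N + f 1%N + f 2%N.
Definition dt s t : R := s 0%N * t 0%N + s 1%N * t 1%N + s 2%N * t 2%N + s 3%N * t 3%N.

                                                                              
                                                                                       
(** A skew connection matrix rebuilt from its three independent entries, stored by the complementary
    index. *)
Definition oab (b : nat -> nat -> R) (a j k : nat) : R :=
  match j, k with
  | 1, 2 => b a 0%N | 2, 1 => - b a 0%N | 2, 0 => b a 1%N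
  | 0, 2 => - b a 1%N | 0, 1 => b a 2%N | 1, 0 => - b a 2%N | _, _ => 0
  end.

(** The spin connection term: one quarter of the sum of om_jk e_j e_k collapses to this because e_1
    e_2 = e_0, and cyclically. *)
Definition cconn (b : nat -> R) s (i : nat) : R := sm3 (fun k => b k * qg k s i) / 2%:R.
Definition cdir (N : nat -> nat -> R) (i : nat) : R := sm3 (fun a => qg a (N a) i).
(** With N the covariant derivatives of a spinor F, this is e_b . D F + nabla_b F. Its pairing with
    F is the current whose divergence gives the formula. *)
Definition cchi (N : nat -> nat -> R) (b i : nat) : R := qg b (cdir N) i + N b i.

Lemma chi_algebra (N : nat -> nat -> R) :
  sm3 (fun b => dt (N b) (cchi N b)) =
  sm3 (fun b => dt (N b) (N b)) - dt (cdir N) (cdir N).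
Proof. rewrite /cchi /cdir /sm3 /dt /=; ring. Qed.

Lemma conn_skew b s t : dt (cconn b s) t = - dt s (cconn b t).
Proof. by rewrite /cconn /sm3 /dt /=; field. Qed.

Variables (f : nat -> R) (P : nat -> nat -> R) (S : nat -> nat -> nat -> R).
Variables (b : nat -> nat -> R) (db : nat -> nat -> nat -> R).
Let c i j k := oab b i j k - oab b j i k.
Hypothesis S01 : forall i, S 0 1 i = S 1 0 i + sm3 (fun k => c 0 1 k * P k i).
Hypothesis S12 : forall i, S 1 2 i = S 2 1 i + sm3 (fun k => c 1 2 k * P k i).
Hypothesis S20 : forall i, S 2 0 i = S 0 2 i + sm3 (fun k => c 2 0 k * P k i).
Let N a i := P a i + cconn (b a) f i.
Let M a j i := S a j i + (cconn (db a j) f i + cconn (b j) (P a) i).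
Let d a := sm3 (fun k => c k a k).
Let scal := sm3 (fun a => sm3 (fun j => oab (db a) j j a
  + sm3 (fun l => oab b j j l * oab b a l a)
  - (oab (db j) a j a + sm3 (fun l => oab b a j l * oab b j l a))
  - sm3 (fun k => c a j k * oab b k j a))).

(** Here P and S stand for first and second frame derivatives of the components, [db] for
    derivatives of the connection. Once the commutation rules [S01], [S12], [S20] are substituted,
    second derivatives cancel and a polynomial identity remains, in which the Clifford relations
    leave only the scalar curvature. *)
Lemma lichnerowicz_algebra :
  sm3 (fun a => dt f (fun i => cchi (M a) a i + cconn (b a) (cchi N a) i + d a * cchi N a i))
  = scal / 4%:R * dt f f.
Proof.
rewrite /scal /cchi /cdir /d /M /N /cconn /c /dt /sm3 /= !S01 !S12 !S20 /c /sm3 /=.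
by field.
Qed.

End LichnerowiczAlgebra.

Section Lichnerowicz.
Context {R : realType}.
Local Notation V := 'rV[R]_4.
Implicit Types (X : V -> V) (F G : nat -> V -> R).

Definition i3 (n : nat) : 'I_3 := match n with 0 => 0 | 1 => 1 | _ => 2%:R end.

Lemma sum_sm3 (f : 'I_3 -> R) : \sum_a f a = sm3 (fun n => f (i3 n)).
Proof. exact: sum3E. Qed.

Lemma sm3_eq (f h : nat -> R) : (forall n, (n < 3)%N -> f n = h n) -> sm3 f = sm3 h.
Proof. by move=> fh; rewrite /sm3 !fh. Qed.

Lemma sm3D (f h : nat -> R) : sm3 (fun n => f n + h n) = sm3 f + sm3 h.
Proof. rewrite /sm3; ring. Qed.

Lemma smooth_qg a F i : (forall j, smooth (F j)) ->
  smooth (fun x => qg a (F^~ x) i).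
Proof.
move=> sF; case: a => [|[|a]]; case: i => [|[|[|i]]] /=; try exact: sF;
  exact/smoothN/sF.
Qed.

Lemma smooth_sm3 F : (forall j, smooth (F j)) -> smooth (fun x => sm3 (F^~ x)).
Proof. by move=> sF; apply: smoothD => //; exact: smoothD. Qed.

Lemma smooth_dt F G : (forall j, smooth (F j)) -> (forall j, smooth (G j)) ->
  smooth (fun x => dt (F^~ x) (G^~ x)).
Proof. by move=> sF sG; do 3 (apply: smoothD; last exact: smoothM); exact: smoothM. Qed.

Lemma smooth_cconn B F i : (forall k, smooth (B k)) -> (forall j, smooth (F j)) ->
  smooth (fun x => cconn (B^~ x) (F^~ x) i).
Proof.
move=> sB sF; apply: smoothM; last exact: smooth_cst.
apply: (@smooth_sm3 (fun k x => B k x * qg k (F^~ x) i)) => k.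
by apply: smoothM => //; exact: smooth_qg.
Qed.

Lemma smooth_cdir (N : nat -> nat -> V -> R) i : (forall a j, smooth (N a j)) ->
  smooth (fun x => cdir (fun a j => N a j x) i).
Proof.
move=> sN; apply: (@smooth_sm3 (fun a x => qg a (fun j => N a j x) i)) => a.
exact: smooth_qg.
Qed.

Lemma smooth_cchi (N : nat -> nat -> V -> R) b i : (forall a j, smooth (N a j)) ->
  smooth (fun x => cchi (fun a j => N a j x) b i).
Proof.
move=> sN; apply: smoothD => //.
by apply: (smooth_qg b i (F := fun i x => cdir (fun a j => N a j x) i)) => j; exact: smooth_cdir.
Qed.

Lemma dalong_qg X a F i x : (forall j, smooth (F j)) -> S3 x ->
  dalong X (fun x => qg a (F^~ x) i) x = qg a (fun j => dalong X (F j) x) i.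
Proof.
move=> sF xS; case: a => [|[|a]]; case: i => [|[|[|i]]] //=; exact: dalongN.
Qed.

Lemma dalong_sm3 X F x : (forall j, smooth (F j)) -> S3 x ->
  dalong X (fun x => sm3 (F^~ x)) x = sm3 (fun j => dalong X (F j) x).
Proof. by move=> sF xS; rewrite /sm3 dalongD ?dalongD//; exact: smoothD. Qed.

Lemma dalong_dt X F G x : (forall j, smooth (F j)) -> (forall j, smooth (G j)) ->
  S3 x -> dalong X (fun x => dt (F^~ x) (G^~ x)) x =
  dt (fun j => dalong X (F j) x) (G^~ x) + dt (F^~ x) (fun j => dalong X (G j) x).
Proof.
move=> sF sG xS; have sM j : smooth (fun x => F j x * G j x) by exact: smoothM.
have s2 := smoothD (sM 0%N) (sM 1%N); have s3 := smoothD s2 (sM 2%N).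
rewrite /dt (dalongD X s3 (sM 3%N) xS) (dalongD X s2 (sM 2%N) xS) (dalongD X (sM 0%N) (sM 1%N) xS).
rewrite !dalongM//.
have al (a0 a1 a2 a3 b0 b1 b2 b3 c0 c1 c2 c3 d0 d1 d2 d3 : R) :
  a0 * b0 + c0 * d0 + (a1 * b1 + c1 * d1) + (a2 * b2 + c2 * d2) + (a3 * b3 + c3 * d3) =
  d0 * c0 + d1 * c1 + d2 * c2 + d3 * c3 + (a0 * b0 + a1 * b1 + a2 * b2 + a3 * b3) by ring.
exact: al.
Qed.

Lemma dalong_cconn X B F i x : (forall k, smooth (B k)) -> (forall j, smooth (F j)) ->
  S3 x -> dalong X (fun x => cconn (B^~ x) (F^~ x) i) x =
  cconn (fun k => dalong X (B k) x) (F^~ x) i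
  + cconn (B^~ x) (fun j => dalong X (F j) x) i.
Proof.
move=> sB sF xS; have sq k : smooth (fun x => qg k (F^~ x) i) by exact: smooth_qg.
have sM k : smooth (fun x => B k x * qg k (F^~ x) i) by exact: smoothM.
rewrite /cconn (@dalong_ext _ _ X X _ (fun x => 2%:R^-1 * sm3 (fun k => B k x * qg k (F^~ x) i)))//; last first.
  by move=> y _; rewrite mulrC.
rewrite dalongZ//; last exact: smooth_sm3.
rewrite (@dalong_sm3 X (fun k x => B k x * qg k (F^~ x) i))//.
rewrite -mulrDl mulrC; congr (_ / _); rewrite /sm3 !dalongM// !dalong_qg//.
have al (a0 a1 a2 b0 b1 b2 c0 c1 c2 d0 d1 d2 : R) :
  a0 * b0 + c0 * d0 + (a1 * b1 + c1 * d1) + (a2 * b2 + c2 * d2) =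
  d0 * c0 + d1 * c1 + d2 * c2 + (a0 * b0 + a1 * b1 + a2 * b2) by ring.
exact: al.
Qed.

Lemma dalong_cchi X (N : nat -> nat -> V -> R) b i x : (forall a j, smooth (N a j)) ->
  S3 x -> dalong X (fun x => cchi (fun a j => N a j x) b i) x =
  cchi (fun a j => dalong X (N a j) x) b i.
Proof.
move=> sN xS; have sc j := smooth_cdir j sN.
rewrite /cchi dalongD//; last exact: (smooth_qg b i (F := fun i x => cdir (fun a j => N a j x) i)).
rewrite (dalong_qg X b (F := fun i x => cdir (fun a j => N a j x) i))//.
congr (qg b _ i + _); apply/funext => j.
rewrite /cdir (@dalong_sm3 X (fun a x => qg a (fun k => N a k x) j))//; last first.
  by move=> a; exact: smooth_qg.
by rewrite /sm3 !dalong_qg.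
Qed.

Variable g : V -> 'M[R]_4.
Hypothesis hg : riemannian_metric g.
Local Notation e := (frame g).
Local Notation I := (int_vol g).
Let se := smooth_frame hg.

Definition bet (a k : nat) : V -> R :=
  match k with
  | 0 => om g (i3 a) 1 2%:R | 1 => om g (i3 a) 2%:R 0 | _ => om g (i3 a) 0 1
  end.

Lemma smooth_bet a k : smooth (bet a k).
Proof. by case: k => [|[|k]] /=; exact: smooth_om. Qed.

Lemma om_diag a b x : om g a b b x = 0.
Proof. by have := om_anti g a b b x; lra. Qed.

Lemma oab_bet a j k x : (j < 3)%N -> (k < 3)%N ->
  oab (fun a k => bet a k x) a j k = om g (i3 a) (i3 j) (i3 k) x.
Proof.
by case: j => [|[|[|//]]]; case: k => [|[|[|//]]] //= _ _;
  rewrite ?om_diag// -om_anti.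
Qed.

Lemma oab_dbet X a j k x : (j < 3)%N -> (k < 3)%N -> S3 x ->
  oab (fun a k => dalong X (bet a k) x) a j k =
  dalong X (om g (i3 a) (i3 j) (i3 k)) x.
Proof.
move=> + + xS.
have z b : dalong X (om g (i3 a) b b) x = 0.
  rewrite (@dalong_ext _ _ X X _ (fun=> 0)) ?dalong_cst// => y _; exact: om_diag.
have n b c : - dalong X (om g (i3 a) b c) x = dalong X (om g (i3 a) c b) x.
  rewrite -dalongN//; last exact: smooth_om.
  by apply: dalong_ext => // y _; rewrite -om_anti.
by case: j => [|[|[|//]]]; case: k => [|[|[|//]]] //= _ _; rewrite ?z ?n.
Qed.

Definition nabs (F : nat -> V -> R) a i x : R :=
  dalong (e (i3 a)) (F i) x + cconn ((bet a)^~ x) (F^~ x) i.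
Definition dirs (F : nat -> V -> R) i x : R := cdir (fun a j => nabs F a j x) i.

Lemma smooth_nabs F a i : (forall j, smooth (F j)) -> smooth (nabs F a i).
Proof.
move=> sF; apply: smoothD; first exact: smooth_dalong.
by apply: smooth_cconn => // k; exact: smooth_bet.
Qed.

Lemma smooth_dirs F i : (forall j, smooth (F j)) -> smooth (dirs F i).
Proof. by move=> sF; apply: smooth_cdir => a j; exact: smooth_nabs. Qed.

Lemma dtDl (s s' t : nat -> R) : dt (fun i => s i + s' i) t = dt s t + dt s' t.
Proof. rewrite /dt; ring. Qed.
Lemma dtDr (s s' t : nat -> R) : dt t (fun i => s i + s' i) = dt t s + dt t s'.
Proof. rewrite /dt; ring. Qed.
Lemma dtZr (a : R) (s t : nat -> R) : dt t (fun i => a * s i) = a * dt t s.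
Proof. rewrite /dt; ring. Qed.

(** Skewness of the connection ([conn_skew]) turns the derivative falling on F into a covariant one;
    by [chi_algebra] these terms sum to |nabla F|^2 - |D F|^2. The terms where the derivative falls
    on [cchi] give the curvature, by [lichnerowicz_algebra]. *)
Lemma lichnerowicz_pointwise F x : (forall j, smooth (F j)) -> S3 x ->
  let Z b y := dt (F^~ y) (cchi (fun a j => nabs F a j y) b) in
  sm3 (fun b => dalong (e (i3 b)) (Z b) x + fdiv g (i3 b) x * Z b x) =
  sm3 (fun a => dt ((nabs F a)^~ x) ((nabs F a)^~ x)) - dt ((dirs F)^~ x) ((dirs F)^~ x)
  + scalar_curvature g x / 4%:R * dt (F^~ x) (F^~ x).
Proof.
move=> sF xS Z; pose N a j := nabs F a j x.
pose M a j i : R := dalong (e (i3 a)) (nabs F j i) x.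
have sN a j : smooth (nabs F a j) := smooth_nabs a j sF.
have dZ b : dalong (e (i3 b)) (Z b) x =
    dt (N b) (cchi N b) + dt (F^~ x) (fun i => cconn ((bet b)^~ x) (cchi N b) i)
    + dt (F^~ x) (cchi (M b) b).
  rewrite /Z (dalong_dt (e (i3 b)) (G := fun i y => cchi (fun a j => nabs F a j y) b i))//; last first.
    by move=> j; exact: smooth_cchi.
  congr (_ + dt _ _); last by apply/funext => i; rewrite dalong_cchi.
  have -> : dt (F^~ x) (fun i => cconn ((bet b)^~ x) (cchi N b) i) =
      - dt (cconn ((bet b)^~ x) (F^~ x)) (cchi N b) by rewrite conn_skew opprK.
  by rewrite /N /nabs dtDl addrK.
have -> : sm3 (fun b => dalong (e (i3 b)) (Z b) x + fdiv g (i3 b) x * Z b x) =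
    sm3 (fun b => dt (N b) (cchi N b)) +
    sm3 (fun a => dt (F^~ x) (fun i => cchi (M a) a i + cconn ((bet a)^~ x) (cchi N a) i
       + fdiv g (i3 a) x * cchi N a i)).
  rewrite -sm3D; apply: sm3_eq => b _; rewrite dZ.
  rewrite (dtDr (fun i => cchi (M b) b i + cconn ((bet b)^~ x) (cchi N b) i)).
  rewrite (dtDr (cchi (M b) b)) dtZr.
  by have al (r s t u : R) : r + s + t + u = r + (t + s + u) by ring; exact: al.
rewrite chi_algebra; congr (_ + _).
pose P k i : R := dalong (e (i3 k)) (F i) x.
pose S a j i : R := dalong (e (i3 a)) (dalong (e (i3 j)) (F i)) x.
pose b a k : R := bet a k x.
pose db a j k : R := dalong (e (i3 a)) (bet j k) x.
have cE i j k : (i < 3)%N -> (j < 3)%N -> (k < 3)%N ->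
    oab b i j k - oab b j i k = cc g (i3 i) (i3 j) (i3 k) x.
  by move=> i3' j3' k3'; rewrite !oab_bet// om_torsion.
have SC i j l : (i < 3)%N -> (j < 3)%N ->
    S i j l = S j i l + sm3 (fun k => (oab b i j k - oab b j i k) * P k l).
  move=> i3' j3'; apply/eqP; rewrite addrC -subr_eq; apply/eqP.
  rewrite [LHS](frame_commutator hg (i3 i) (i3 j) (sF l) xS) sum_sm3.
  by apply: sm3_eq => k k3; rewrite cE.
have := @lichnerowicz_algebra R (F^~ x) P S b db (fun i => SC 0%N 1%N i isT isT)
  (fun i => SC 1%N 2%N i isT isT) (fun i => SC 2%N 0%N i isT isT).
have ME : M = fun a j i => S a j i + (cconn (db a j) (F^~ x) i + cconn (b j) (P a) i).
  apply/funext => a; apply/funext => j; apply/funext => i.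
  rewrite /M /nabs dalongD//; last first.
  - by apply: smooth_cconn => // k; exact: smooth_bet.
  - exact: smooth_dalong.
  congr (_ + _); apply: dalong_cconn => // k; exact: smooth_bet.
move=> H; transitivity (sm3 (fun a => dt (F^~ x) (fun i => cchi (M a) a i
    + cconn (b a) (cchi N a) i
    + sm3 (fun k => oab b k a k - oab b a k k) * cchi N a i))).
  apply: sm3_eq => a a3; congr (dt _ _); apply/funext => i.
  congr (_ + _ * _); rewrite /fdiv sum_sm3; apply: sm3_eq => k k3.
  by rewrite cE.
rewrite ME; apply: (etrans H); congr (_ / _ * _).
rewrite scalar_curvatureE// sum_sm3; apply: sm3_eq => a a3.
rewrite sum_sm3; apply: sm3_eq => j j3.
congr (_ + _ - (_ + _) - _).
- exact: oab_dbet.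
- by rewrite sum_sm3; apply: sm3_eq => l l3; rewrite !oab_bet.
- exact: oab_dbet.
- by rewrite sum_sm3; apply: sm3_eq => l l3; rewrite !oab_bet.
- by rewrite sum_sm3; apply: sm3_eq => k k3; rewrite cE// oab_bet.
Qed.

Theorem lichnerowicz F : (forall j, smooth (F j)) ->
  I (fun x => dt ((dirs F)^~ x) ((dirs F)^~ x)) =
  I (fun x => sm3 (fun a => dt ((nabs F a)^~ x) ((nabs F a)^~ x))
     + scalar_curvature g x / 4%:R * dt (F^~ x) (F^~ x)).
Proof.
move=> sF; have sw := smooth_vol_density hg; have w0 := vol_density_gt0 hg.
have sR := smooth_scalar_curvature hg.
have sN a j : smooth (nabs F a j) := smooth_nabs a j sF.
have s1 : smooth (fun x => dt ((dirs F)^~ x) ((dirs F)^~ x)).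
  by apply: smooth_dt => j; exact: smooth_dirs.
have s2 : smooth (fun x => sm3 (fun a => dt ((nabs F a)^~ x) ((nabs F a)^~ x))
     + scalar_curvature g x / 4%:R * dt (F^~ x) (F^~ x)).
  apply: smoothD.
    by apply: (@smooth_sm3 (fun a x => dt ((nabs F a)^~ x) ((nabs F a)^~ x))) => a; exact: smooth_dt.
  by apply: smoothM; [apply: smoothM => //; exact: smooth_cst|exact: smooth_dt].
pose Z b y := dt (F^~ y) (cchi (fun a j => nabs F a j y) b).
have sZ b : smooth (Z b).
  apply: (@smooth_dt F (fun i y => cchi (fun a j => nabs F a j y) b i)) => // j.
  exact: smooth_cchi.
pose W b y := dalong (e (i3 b)) (Z b) y + fdiv g (i3 b) y * Z b y.
have sW b : smooth (W b).
  apply: smoothD; first exact: smooth_dalong.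
  by apply: smoothM => //; exact: smooth_fdiv.
have J f : smooth f -> integrable_vol g f by exact: smooth_integrable_vol.
apply/esym/eqP; rewrite -subr_eq0 -int_volB; [|exact: J..].
apply/eqP; transitivity (I (fun x => W 0%N x + W 1%N x + W 2%N x)).
  apply: int_vol_ext => x xS; rewrite addrAC; apply/esym.
  exact: lichnerowicz_pointwise.
have z b : I (W b) = 0 by exact: frame_divergence.
have s01 := smoothD (sW 0%N) (sW 1%N).
have e1 : I (fun x => W 0%N x + W 1%N x) = 0 :=
  etrans (int_volD (J _ (sW 0%N)) (J _ (sW 1%N)))
    (etrans (congr2 +%R (z 0%N) (z 1%N)) (addr0 0)).
exact: etrans (int_volD (J _ s01) (J _ (sW 2%N)))
  (etrans (congr2 +%R e1 (z 2%N)) (addr0 0)).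
Qed.

End Lichnerowicz.

                               

(** * Loomis-Whitney inequality and L^6 Sobolev inequality on a cube *)

Section LoomisWhitney.
Context {R : realType}.
Local Notation T1 := (measurableTypeR R).
Local Notation mu := (@lebesgue_measure R).

Lemma measurable_sqrtr : measurable_fun setT (@Num.sqrt R).
Proof. by apply: continuous_measurable_fun; exact: sqrt_continuous. Qed.

Lemma quadratic_opt (X A B : R) : 0 <= X -> 0 <= A -> 0 <= B ->
  (forall t, 0 < t -> 2%:R * X <= t * A + t^-1 * B) -> X <= Num.sqrt (A * B).
Proof.
move=> X0 A0 B0 h; rewrite -[X]ger0_norm// -sqrtr_sqr ler_sqrt ?mulr_ge0//.
rewrite mulrC -[X ^+ 2]sqrrN.
apply: (@discriminant_le _ B (- X) A) => // t.
have [t0|t0] := leP t 0.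
  have -> : B + 2%:R * t * - X + t ^+ 2 * A = B + 2%:R * (- t * X) + t ^+ 2 * A by ring.
  rewrite addr_ge0//; first by rewrite addr_ge0// mulr_ge0// mulr_ge0// oppr_ge0.
  by rewrite mulr_ge0// sqr_ge0.
have := h t t0; rewrite -(ler_pM2l t0).
have -> : t * (t * A + t^-1 * B) = t ^+ 2 * A + B.
  by rewrite mulrDr mulrA mulrA mulfV ?gt_eqF// mul1r -expr2.
rewrite -subr_ge0; have -> // : B + 2%:R * t * - X + t ^+ 2 * A =
  t ^+ 2 * A + B - t * (2%:R * X) by ring.
Qed.

Lemma cs_integral d (T : measurableType d) (m : {measure set T -> \bar R})
    (f h : T -> R) (A B : R) :
  measurable_fun setT f -> measurable_fun setT h ->
  (forall x, 0 <= f x) -> (forall x, 0 <= h x) -> 0 <= A -> 0 <= B ->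
  (\int[m]_x (f x ^+ 2)%:E <= A%:E)%E -> (\int[m]_x (h x ^+ 2)%:E <= B%:E)%E ->
  (\int[m]_x (f x * h x)%:E <= (Num.sqrt (A * B))%:E)%E.
Proof.
move=> mf mh f0 h0 A0 B0 fA hB.
have mX (u : T -> R) : measurable_fun setT u -> measurable_fun setT (fun x => (u x ^+ 2)%:E).
  by move=> mu'; apply/measurable_EFinP; exact: measurable_funX.
have mM : measurable_fun setT (fun x => (f x * h x)%:E).
  by apply/measurable_EFinP; exact: measurable_funM.
pose X := (\int[m]_x (f x * h x)%:E)%E.
have key t : 0 < t -> (2%:E * X <= (t * A + t^-1 * B)%:E)%E.
  move=> t0; have ti0 : 0 < t^-1 by rewrite invr_gt0.
  have pM x : setT x -> (0 <= (f x * h x)%:E)%E by move=> _; rewrite lee_fin mulr_ge0.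
  rewrite /X -ge0_integralZl_EFin//.
  apply: (@le_trans _ _ (\int[m]_x (t%:E * (f x ^+ 2)%:E + t^-1%:E * (h x ^+ 2)%:E))%E).
    apply: ge0_le_integral => //.
    - by move=> x _; rewrite -EFinM lee_fin !mulr_ge0.
    - by apply: measurable_funeM.
    - by apply: emeasurable_funD; apply: measurable_funeM; exact: mX.
    - move=> x _; rewrite -!EFinM -EFinD lee_fin.
      rewrite -subr_ge0; have -> : t * f x ^+ 2 + t^-1 * h x ^+ 2 - 2%:R * (f x * h x)
        = t^-1 * (t * f x - h x) ^+ 2.
        by field; rewrite gt_eqF.
      by rewrite mulr_ge0 ?sqr_ge0// ltW.
  rewrite ge0_integralD//.
  - rewrite ge0_integralZl_EFin ?ge0_integralZl_EFin ?(ltW t0) ?(ltW ti0)//.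
    + by rewrite EFinD !EFinM; apply: leeD; apply: lee_wpmul2l; rewrite // lee_fin ltW.
    + by move=> x _; rewrite lee_fin sqr_ge0.
    + exact: mX.
    + by move=> x _; rewrite lee_fin sqr_ge0.
    + exact: mX.
  - by move=> x _; rewrite -EFinM lee_fin mulr_ge0 ?sqr_ge0// ltW.
  - by apply: measurable_funeM; exact: mX.
  - by move=> x _; rewrite -EFinM lee_fin mulr_ge0 ?sqr_ge0// ltW.
  - by apply: measurable_funeM; exact: mX.
have X0 : (0 <= X)%E by apply: integral_ge0 => x _; rewrite lee_fin mulr_ge0.
have Xf : X \is a fin_num.
  rewrite ge0_fin_numE//; apply: le_lt_trans (ltry (1 * A + 1^-1 * B)).
  apply: le_trans (key 1 ltr01); rewrite -[leLHS]mul1e; apply: lee_wpmul2r => //.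
  by rewrite lee_fin ler1n.
rewrite -/X -(fineK Xf) lee_fin; apply: quadratic_opt => //; first exact: fine_ge0.
by move=> t /key; rewrite -{1}(fineK Xf) -EFinM lee_fin.
Qed.

Lemma ge0_integral_scale (c : R) (f : R -> \bar R) : 0 < c ->
  measurable_fun setT f -> (forall r, (0 <= f r)%E) ->
  (\int[mu]_r f r = c%:E * \int[mu]_r f (c * r)%R)%E.
Proof.
move=> c0 mf f0.
have mS : measurable_fun setT ( *%R c : T1 -> T1) by exact: mulrl_measurable.
pose nu0 := mscale (NngNum (ltW c0)) (pushforward mu ( *%R c : T1 -> T1)).
pose nu := nu0 mS.
have munu A : measurable A -> mu A = nu A.
  move=> mA; apply: lebesgue_measure_unique => //= _ [[a b]] _ <-.
  rewrite /nu /nu0 /mscale/= /pushforward.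
  have -> : *%R c @^-1` `]a, b] = `](c^-1 * a), (c^-1 * b)]%classic.
    apply/seteqP; split => x /=; rewrite !in_itv/= => /andP[h1 h2]; apply/andP.
      by rewrite mulrC ltr_pdivrMr// mulrC ler_pdivlMl// h1 h2.
    by move: h1 h2; rewrite mulrC ltr_pdivrMr// ler_pdivlMl// mulrC.
  rewrite !lebesgue_measure_itv/= !lte_fin (ltr_pM2l (_ : 0 < c^-1)) ?invr_gt0//.
  case: ifPn => _; last by rewrite mule0.
  by rewrite -!EFinD -EFinM -mulrBr mulrA mulfV ?gt_eqF// mul1r.
transitivity (\int[nu]_r f r)%E.
  by apply: eq_measure_integral => A mA _; exact: munu.
rewrite ge0_integral_mscale//; congr (_ * _)%E.
by rewrite (ge0_integral_pushforward mS mu measurableT mf).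
Qed.

(** For fixed b, Cauchy-Schwarz in (c, d) separates p1 from p2 p3, whose square integrates to a
    product of slice integrals. A second Cauchy-Schwarz in b separates those. The bound B makes the
    slice integrals finite. *)
Lemma loomis_whitney (p1 p2 p3 : T1 * T1 -> R) (I1 I2 I3 B : R) :
  [/\ measurable_fun setT p1, measurable_fun setT p2 & measurable_fun setT p3] ->
  [/\ forall z, 0 <= p1 z, forall z, 0 <= p2 z & forall z, 0 <= p3 z] ->
  [/\ 0 <= I1, 0 <= I2 & 0 <= I3] ->
  (forall b, \int[mu]_d (p2 (b, d) ^+ 2)%:E <= B%:E)%E ->
  (forall b, \int[mu]_c (p3 (b, c) ^+ 2)%:E <= B%:E)%E ->
  (\int[mu]_c \int[mu]_d (p1 (c, d) ^+ 2)%:E <= I1%:E)%E ->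
  (\int[mu]_b \int[mu]_d (p2 (b, d) ^+ 2)%:E <= I2%:E)%E ->
  (\int[mu]_b \int[mu]_c (p3 (b, c) ^+ 2)%:E <= I3%:E)%E ->
  (\int[mu]_b \int[mu]_c \int[mu]_d (p1 (c, d) * (p2 (b, d) * p3 (b, c)))%:E
    <= (Num.sqrt (I2 * I3) * Num.sqrt I1)%:E)%E.
Proof.
move=> [m1 m2 m3] [n1 n2 n3] [i1 i2 i3] B2 B3 h1 h2 h3.
have msq (p : T1 * T1 -> R) : measurable_fun setT p ->
    measurable_fun setT (fun z => (p z ^+ 2)%:E).
  by move=> mp; apply/measurable_EFinP; exact: measurable_funX.
have psq (p : T1 * T1 -> R) z : (0 <= (p z ^+ 2)%:E)%E by rewrite lee_fin sqr_ge0.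
pose al (p : T1 * T1 -> R) b := fine (\int[mu]_d (p (b, d) ^+ 2)%:E)%E.
have alf (p : T1 * T1 -> R) b : (forall b, \int[mu]_d (p (b, d) ^+ 2)%:E <= B%:E)%E ->
    (\int[mu]_d (p (b, d) ^+ 2)%:E = (al p b)%:E)%E.
  move=> hB; rewrite fineK// ge0_fin_numE; last by apply: integral_ge0 => d _; exact: psq.
  exact: le_lt_trans (hB b) (ltry _).
have al0 p b : 0 <= al p b by apply: fine_ge0; apply: integral_ge0 => d _; exact: psq.
have mal p : measurable_fun setT p -> measurable_fun setT (al p).
  move=> mp; apply: measurableT_comp => //.
  exact: (measurable_fun_fubini_tonelli_F (m2 := mu) _ (msq _ mp) (psq p)).
have inner b : (\int[mu]_c \int[mu]_d (p1 (c, d) * (p2 (b, d) * p3 (b, c)))%:E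
    <= (Num.sqrt (al p2 b) * Num.sqrt (al p3 b) * Num.sqrt I1)%:E)%E.
  pose h (z : T1 * T1) : R := p2 (b, z.2) * p3 (b, z.1).
  have mh : measurable_fun setT h.
    by apply: measurable_funM; [apply: (measurableT_comp m2)|apply: (measurableT_comp m3)];
       apply: measurable_fun_pair => //; exact: measurable_cst.
  have h0 z : 0 <= h z by rewrite mulr_ge0.
  have E1 := fubini_tonelli1 (m1 := mu) (m2 := mu) _ (msq _ m1) (psq p1).
  have E2 := fubini_tonelli1 (m1 := mu) (m2 := mu) _ (msq _ mh) (psq h).
  have mph : measurable_fun setT (fun z => (p1 z * h z)%:E).
    by apply/measurable_EFinP; exact: measurable_funM.
  have E3 := fubini_tonelli1 (m1 := mu) (m2 := mu) _ mph
    (fun z => mulr_ge0 (n1 z) (h0 z)).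
  rewrite -[leLHS]E3.
  have hh : (\int[mu \x mu]_z (h z ^+ 2)%:E <= (al p2 b * al p3 b)%:E)%E.
    rewrite [leLHS]E2 /fubini_F /=.
    have -> : (\int[mu]_c \int[mu]_d ((p2 (b, d) * p3 (b, c)) ^+ 2)%:E =
        \int[mu]_c ((al p2 b)%:E * (p3 (b, c) ^+ 2)%:E))%E.
      apply: eq_integral => c _; rewrite -(alf p2 b B2) muleC -ge0_integralZl_EFin ?sqr_ge0//.
        by apply: eq_integral => d _; rewrite exprMn EFinM muleC.
      all: try by move=> ? _; exact: psq.
      exact: (measurableT_comp (msq _ m2) (pair1_measurable b)).
    rewrite ge0_integralZl_EFin ?al0//.
      by rewrite (alf p3 b B3) EFinM.
    all: try by move=> ? _; exact: psq.
    exact: (measurableT_comp (msq _ m3) (pair1_measurable b)).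
  have h1' : (\int[mu \x mu]_z (p1 z ^+ 2)%:E <= I1%:E)%E by rewrite [leLHS]E1.
  have := cs_integral m1 mh n1 h0 i1 (mulr_ge0 (al0 p2 b) (al0 p3 b)) h1' hh.
  by rewrite mulrC sqrtrM ?mulr_ge0// sqrtrM.
apply: (@le_trans _ _ (\int[mu]_b ((Num.sqrt I1)%:E *
    (Num.sqrt (al p2 b) * Num.sqrt (al p3 b))%:E))%E).
  apply: ge0_le_integral => //.
  - move=> b _; apply: integral_ge0 => c _; apply: integral_ge0 => d _.
    by rewrite lee_fin !mulr_ge0.
  - pose k (z : T1 * T1 * T1) : R := p1 (z.1.2, z.2) * (p2 (z.1.1, z.2) * p3 (z.1.1, z.1.2)).
    have mk : measurable_fun setT (fun z => (k z)%:E).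
      apply/measurable_EFinP; apply: measurable_funM; last apply: measurable_funM.
      + apply: (measurableT_comp m1); apply: measurable_fun_pair => //.
        exact: measurableT_comp.
      + apply: (measurableT_comp m2); apply: measurable_fun_pair => //.
        exact: measurableT_comp.
      + apply: (measurableT_comp m3); apply: measurable_fun_pair => //;
        exact: measurableT_comp.
    have k0 z : (0 <= (k z)%:E)%E by rewrite lee_fin !mulr_ge0.
    have mk2 := measurable_fun_fubini_tonelli_F (m2 := mu) _ mk k0.
    have k02 z : (0 <= fubini_F mu (fun z => (k z)%:E) z)%E by exact: integral_ge0.
    exact: (measurable_fun_fubini_tonelli_F (m2 := mu) _ mk2 k02).
  - apply: measurable_funeM; apply/measurable_EFinP; apply: measurable_funM.
      by apply: measurableT_comp; [exact: measurable_sqrtr|exact: mal].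
    by apply: measurableT_comp; [exact: measurable_sqrtr|exact: mal].
  - by move=> b _; rewrite -EFinM mulrC; exact: inner.
have ms p : measurable_fun setT p -> measurable_fun setT (fun b => Num.sqrt (al p b)).
  by move=> mp; apply: measurableT_comp; [exact: measurable_sqrtr|exact: mal].
rewrite ge0_integralZl_EFin ?sqrtr_ge0//.
- rewrite EFinM muleC; apply: lee_wpmul2r; first by rewrite lee_fin sqrtr_ge0.
  apply: cs_integral => //; try exact: ms; try by move=> b; exact: sqrtr_ge0.
  + apply: le_trans h2; rewrite le_eqVlt; apply/orP; left; apply/eqP.
    by apply: eq_integral => b _; rewrite sqr_sqrtr// -alf.
  + apply: le_trans h3; rewrite le_eqVlt; apply/orP; left; apply/eqP.
    by apply: eq_integral => b _; rewrite sqr_sqrtr// -alf.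
all: try by move=> ? _; rewrite lee_fin mulr_ge0// sqrtr_ge0.
by apply/measurable_EFinP; apply: measurable_funM; exact: ms.
Qed.

Lemma lebesgue_itv11 : mu `[(-1)%R, 1%R]%classic = (2%:R : R)%:E.
Proof. by rewrite lebesgue_measure_itv/= lte_fin ifT ?gtrN// -EFinD opprK. Qed.

(** The minimum of |k| is at most its integral, as the interval has length 2; the integral of |dk|
    bounds the deviation of k t from the value at the minimum. *)
Lemma slice_bound (k dk : R -> R) (t : R) : continuous dk ->
  (forall r, is_derive r (1 : R) k (dk r)) -> -1 <= t <= 1 ->
  (`|k t|%:E <= \int[mu]_(r in `[(-1)%R, 1%R]) (`|k r| + `|dk r|)%:E)%E.
Proof.
move=> cdk der /andP[t1 t2].
have ck : continuous k.
  by move=> r; apply: differentiable_continuous; apply/derivable1_diffP; case: (der r).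
have cnk (u : R -> R) : continuous u -> continuous (fun r => `|u r|).
  by move=> cu r; apply: (continuous_comp (cu r)); exact: norm_continuous.
have m11 : (-1 : R) <= 1 by lra.
have mI : measurable (`[(-1)%R, 1%R]%classic : set T1) by exact: measurable_itv.
have me (u : R -> R) (D : set T1) : continuous u -> measurable_fun D (fun r => (`|u r|)%:E).
  move=> cu; apply/measurable_EFinP; apply: measurable_funTS.
  apply: continuous_measurable_fun; exact: cnk.
have [s sI smin] := EVT_min m11 (continuous_subspaceT (cnk _ ck)).
move: (sI); rewrite in_itv/= => /andP[s1 s2].
pose A := (\int[mu]_(r in `[(-1)%R, 1%R]) (`|k r|)%:E)%E.
pose B := (\int[mu]_(r in `[(-1)%R, 1%R]) (`|dk r|)%:E)%E.
have hA : (`|k s|%:E <= A)%E.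
  apply: (@le_trans _ _ (\int[mu]_(r in `[(-1)%R, 1%R]) (`|k s|)%:E)%E).
    rewrite integral_cst// [X in (_ * X)%E](_ : _ = (2%:R : R)%:E); last exact: lebesgue_itv11.
    by rewrite -EFinM lee_fin ler_peMr//; lra.
  by apply: ge0_le_integral => //; exact: me.
have hB a b : -1 <= a -> a < b -> b <= 1 -> (`|k b - k a|%:E <= B)%E.
  move=> a1 ab b1.
  have -> : (`|k b - k a|%:E = `|\int[mu]_(r in `[a, b]) (dk r)%:E|)%E.
    rewrite (@continuous_FTC2 R dk k)//.
    - exact: continuous_subspaceT.
    - split=> [r _||]; first by case: (der r).
        by apply: cvg_at_right_filter; exact: ck.
      by apply: cvg_at_left_filter; exact: ck.
    - by move=> r _; rewrite derive1E; case: (der r).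
  have mab : measurable (`[a, b]%classic : set T1) by exact: measurable_itv.
  apply: le_trans (le_abse_integral _ _ _) _ => //.
    by apply/measurable_EFinP; apply: measurable_funTS; exact: continuous_measurable_fun.
  apply: ge0_subset_integral => //; first exact: me.
  by move=> r /=; rewrite !in_itv/= => /andP[ra rb]; rewrite (le_trans a1 ra) (le_trans rb b1).
have hC : (`|k t - k s|%:E <= B)%E.
  have [ts|st|->] := ltgtP t s; last first.
  - by rewrite subrr normr0; apply: integral_ge0 => r _; rewrite lee_fin.
  - exact: hB.
  - by rewrite distrC; exact: hB.
have -> : (\int[mu]_(r in `[(-1)%R, 1%R]) (`|k r| + `|dk r|)%:E = A + B)%E.
  under eq_integral do rewrite EFinD.
  by rewrite ge0_integralD//; exact: me.
apply: le_trans (leeD hA hC); rewrite -EFinD lee_fin.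
by rewrite -[X in `|X|](subrK (k s)) addrC ler_normD.
Qed.

End LoomisWhitney.

Section CubeSobolev.
Context {R : realType}.
Local Notation T1 := (measurableTypeR R).
Local Notation T3 := (T1 * T1 * T1)%type.
Local Notation mu := (@lebesgue_measure R).

Definition ch (r : R) : R := \1_(`[(-1)%R, 1%R]%classic : set R) r.
Definition ch3 (z : T3) : R := ch z.1.1 * ch z.1.2 * ch z.2.

Lemma ch_in r : -1 <= r <= 1 -> ch r = 1.
Proof. by move=> h; rewrite /ch indicE mem_set//= in_itv. Qed.
Lemma ch_out r : ~~ (-1 <= r <= 1) -> ch r = 0.
Proof. by move=> h; rewrite /ch indicE memNset//= in_itv /=; exact/negP. Qed.
Lemma ch_ge0 r : 0 <= ch r.
Proof. by rewrite /ch indicE. Qed.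
Lemma ch_sqr r : ch r ^+ 2 = ch r.
Proof. by rewrite /ch indicE; case: (_ \in _); rewrite ?expr1n ?expr0n. Qed.
Lemma ch3_ge0 z : 0 <= ch3 z.
Proof. by rewrite !mulr_ge0 ?ch_ge0. Qed.
Lemma ch3_sqr z : ch3 z ^+ 2 = ch3 z.
Proof. by rewrite !exprMn !ch_sqr. Qed.

Lemma measurable_ch : measurable_fun [set: T1] ch.
Proof. by apply: measurable_indic; exact: measurable_itv. Qed.

Lemma measurable_ch3 : measurable_fun setT ch3.
Proof.
apply: measurable_funM; first apply: measurable_funM.
- apply: (measurableT_comp measurable_ch); exact: (measurableT_comp (f := fst)).
- apply: (measurableT_comp measurable_ch); exact: (measurableT_comp (f := snd)).
- exact: (measurableT_comp measurable_ch).
Qed.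

Lemma integral_itv_ch (f : R -> R) :
  (\int[mu]_(r in `[(-1)%R, 1%R]) (f r)%:E = \int[mu]_r (f r * ch r)%:E)%E.
Proof.
rewrite [LHS]integral_mkcond; apply: eq_integral => r _; rewrite patchE /ch indicE.
by case: ifPn => h; rewrite ?mulr1 ?mulr0.
Qed.

Lemma integral_ch (K : R) : (\int[mu]_r (K * ch r)%:E = (2%:R * K)%:E)%E.
Proof.
rewrite -(integral_itv_ch (fun=> K)) integral_cst; last exact: measurable_itv.
rewrite [X in (_ * X)%E](_ : _ = (2%:R : R)%:E); last exact: lebesgue_itv11.
by rewrite -EFinM mulrC.
Qed.

Lemma slice_pow4 (k dk : R -> R) t : continuous dk ->
  (forall r, is_derive r (1 : R) k (dk r)) -> -1 <= t <= 1 ->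
  ((k t ^+ 4)%:E <= \int[mu]_r ((k r ^+ 4 + 4%:R * `|k r ^+ 3 * dk r|) * ch r)%:E)%E.
Proof.
move=> cdk der t1.
have ck : continuous k.
  by move=> r; apply: differentiable_continuous; apply/derivable1_diffP; case: (der r).
have c4 : continuous (fun r => 4%:R * (k r ^+ 3 * dk r)).
  move=> r; apply: cvgM; first exact: cvg_cst.
  apply: cvgM; last exact: cdk.
  exact: (continuous_comp (ck r) (@exprn_continuous _ 3 _)).
have d4 r : is_derive r (1 : R) (fun r => k r ^+ 4) (4%:R * (k r ^+ 3 * dk r)).
  have [ex e] := @is_deriveX _ _ k 4 r 1 (dk r) (der r).
  have E : k ^+ 4 = (fun r => k r ^+ 4) by apply/funext => s; rewrite exprfctE.
  by rewrite E in ex e; split=> //; rewrite e /GRing.scale/= mulrA.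
have := slice_bound c4 d4 t1; rewrite ger0_norm ?exprn_even_ge0//.
move=> /le_trans; apply; rewrite integral_itv_ch le_eqVlt; apply/orP; left; apply/eqP.
apply: eq_integral => r _; rewrite (ger0_norm (_ : 0 <= k r ^+ 4)) ?exprn_even_ge0//.
by rewrite normrM normr_nat.
Qed.

Lemma leb3_iter (H : T3 -> \bar R) : measurable_fun setT H -> (forall y, 0 <= H y)%E ->
  (\int[mu3]_z H z = \int[mu]_b \int[mu]_c \int[mu]_d H (b, c, d))%E.
Proof.
move=> mH H0.
have E := fubini_tonelli1 (m1 := mu2) (m2 := mu) H mH H0.
have m1 := measurable_fun_fubini_tonelli_F (m2 := mu) H mH H0.
have p1 x : (0 <= fubini_F mu H x)%E by exact: integral_ge0.
have E2 := fubini_tonelli1 (m1 := mu) (m2 := mu) _ m1 p1.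
by transitivity (\int[mu2]_x fubini_F mu H x)%E; [exact: E|exact: E2].
Qed.

Lemma tonelli_swap (H : T1 * T1 -> \bar R) : measurable_fun setT H ->
  (forall y, 0 <= H y)%E ->
  (\int[mu]_x \int[mu]_y H (x, y) = \int[mu]_y \int[mu]_x H (x, y))%E.
Proof.
move=> mH H0; have E1 := fubini_tonelli1 (m1 := mu) (m2 := mu) _ mH H0.
have E2 := fubini_tonelli2 (m1 := mu) (m2 := mu) _ mH H0.
by rewrite -[LHS]E1 -[RHS]E2.
Qed.

Definition rot1 (z : T3) : T3 := (z.2, z.1.1, z.1.2).
Definition rot2 (z : T3) : T3 := (z.1.1, z.2, z.1.2).

Lemma measurable_rot1 : measurable_fun setT rot1.
Proof.
by apply: measurable_fun_pair; [apply: measurable_fun_pair|] => //; exact: measurableT_comp.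
Qed.

Lemma measurable_rot2 : measurable_fun setT rot2.
Proof.
by apply: measurable_fun_pair; [apply: measurable_fun_pair|] => //; exact: measurableT_comp.
Qed.

Lemma integral_rot2 (P : T3 -> \bar R) : measurable_fun setT P ->
  (forall z, 0 <= P z)%E ->
  (\int[mu3]_z P (rot2 z) = \int[mu3]_z P z)%E.
Proof.
move=> mP P0; rewrite (leb3_iter mP P0).
rewrite (leb3_iter (measurableT_comp mP measurable_rot2))/=; last by move=> z; exact: P0.
apply: eq_integral => b _.
apply: (@tonelli_swap (fun z => P (b, z.2, z.1))) => //.
apply: (measurableT_comp mP); apply: measurable_fun_pair => //.
by apply: measurable_fun_pair => //; exact: measurable_cst.
Qed.

Lemma integral_rot1 (P : T3 -> \bar R) : measurable_fun setT P ->
  (forall z, 0 <= P z)%E ->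
  (\int[mu3]_z P (rot1 z) = \int[mu3]_z P z)%E.
Proof.
move=> mP P0; rewrite -(integral_rot2 mP P0).
rewrite (leb3_iter (measurableT_comp mP measurable_rot1))/=; last by move=> z; exact: P0.
have mP2 := measurableT_comp mP measurable_rot2.
rewrite (leb3_iter mP2)/=; last by move=> z; exact: P0.
rewrite /rot1 /rot2 /=.
transitivity (\int[mu]_c \int[mu]_b \int[mu]_d P (b, c, d))%E.
  apply: eq_integral => c _.
  apply: (@tonelli_swap (fun z => P (z.2, c, z.1))) => //.
  apply: (measurableT_comp mP); apply: measurable_fun_pair => //.
  by apply: measurable_fun_pair => //; exact: measurable_cst.
have m1 := measurable_fun_fubini_tonelli_F (m2 := mu) P mP P0.
have p1 x : (0 <= fubini_F mu P x)%E by exact: integral_ge0.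
transitivity (\int[mu]_b \int[mu]_c \int[mu]_d P (b, c, d))%E.
  apply: (@tonelli_swap (fun z => fubini_F mu P (z.2, z.1))) => //.
  by apply: (measurableT_comp m1); apply: measurable_fun_pair.
apply: eq_integral => b _; apply: (@tonelli_swap (fun z => P (b, z.1, z.2))) => //.
apply: (measurableT_comp mP); apply: measurable_fun_pair => //.
by apply: measurable_fun_pair => //; exact: measurable_cst.
Qed.

(** Raised to the fourth power, the hypothesis reads Y^4 <= (17 N Y)^3, and Y^3 is divided out. *)
Lemma pow_bound (Y N I : R) : 0 <= Y -> 0 <= N -> I = Num.sqrt (Y * (17%:R * N)) ->
  Y <= I * Num.sqrt I -> Y <= 17%:R ^+ 3 * N ^+ 3.
Proof.
move=> Y0 N0 IE YI; have I0 : 0 <= I by rewrite IE sqrtr_ge0.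
have I2 : I ^+ 2 = Y * (17%:R * N) by rewrite IE sqr_sqrtr// !mulr_ge0.
have Y4 : Y ^+ 4 <= (I ^+ 2) ^+ 3.
  have -> : (I ^+ 2) ^+ 3 = (I * Num.sqrt I) ^+ 4.
    have := sqr_sqrtr I0; move: (Num.sqrt I) => t <-; ring.
  by apply: lerXn2r => //; rewrite nnegrE ?mulr_ge0 ?sqrtr_ge0.
have [->|Yn] := eqVneq Y 0; first by rewrite mulr_ge0 ?exprn_ge0// ler0n.
have Yp : 0 < Y ^+ 3 by rewrite exprn_gt0// lt_neqAle eq_sym Yn.
rewrite -(ler_pM2l Yp) -exprSr; apply: le_trans Y4 _; rewrite I2.
by rewrite le_eqVlt; apply/orP; left; apply/eqP; ring.
Qed.

(** Gagliardo-Nirenberg argument applied to f^4: on the cube, f^4 is bounded by the integral of f^4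
    + 4 |f^3 f_i| along each axis. The square roots p_i of these integrals satisfy f^6 <= p_1 p_2
    p_3, and Loomis-Whitney closes an inequality for Y, the integral of f^6. *)
Lemma cube_sobolev (f f1 f2 f3 : T3 -> R) (M N : R) :
  [/\ measurable_fun setT f, measurable_fun setT f1, measurable_fun setT f2 &
      measurable_fun setT f3] ->
  (forall z, ch3 z != 0 -> [/\ `|f z| <= M, `|f1 z| <= M, `|f2 z| <= M & `|f3 z| <= M]) ->
  (forall c d, continuous (fun b => f1 (b, c, d)) /\
     forall b, is_derive b (1 : R) (fun b => f (b, c, d)) (f1 (b, c, d))) ->
  (forall b d, continuous (fun c => f2 (b, c, d)) /\
     forall c, is_derive c (1 : R) (fun c => f (b, c, d)) (f2 (b, c, d))) ->
  (forall b c, continuous (fun d => f3 (b, c, d)) /\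
     forall d, is_derive d (1 : R) (fun d => f (b, c, d)) (f3 (b, c, d))) ->
  0 <= N ->
  (\int[mu3]_z ((f z ^+ 2 + f1 z ^+ 2 + f2 z ^+ 2 + f3 z ^+ 2) * ch3 z)%:E <= N%:E)%E ->
  (\int[mu3]_z (f z ^+ 6 * ch3 z)%:E <= (17%:R ^+ 3 * N ^+ 3)%:E)%E.
Proof.
move=> [mf mf1 mf2 mf3] bd D1 D2 D3 N0 hN.
have [z0 z0n] : exists z : T3, ch3 z != 0.
  by exists (0, 0, 0); rewrite /ch3 /= !ch_in ?mulr1 ?oner_eq0//; lra.
have M0 : 0 <= M by have [h _ _ _] := bd _ z0n; exact: le_trans (normr_ge0 _) h.
pose P (h : T3 -> R) (z : T3) : R := (f z ^+ 4 + 4%:R * `|f z ^+ 3 * h z|) * ch3 z.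
pose K := 5%:R * M ^+ 4.
have K0 : 0 <= K by rewrite mulr_ge0// exprn_ge0.
have P0 h z : 0 <= P h z.
  by rewrite mulr_ge0 ?ch3_ge0// addr_ge0 ?exprn_even_ge0// mulr_ge0.
have mP h : measurable_fun setT h -> measurable_fun setT (P h).
  move=> mh; apply: measurable_funM; last exact: measurable_ch3.
  apply: measurable_funD; first exact: measurable_funX.
  apply: measurable_funM; first exact: measurable_cst.
  apply: measurableT_comp; first exact: normr_measurable.
  by apply: measurable_funM => //; exact: measurable_funX.
have PK h z : (ch3 z != 0 -> `|h z| <= M) -> P h z <= K * ch3 z.
  move=> hb; have [c0|cn] := eqVneq (ch3 z) 0; first by rewrite /P c0 !mulr0.
  have [fM _ _ _] := bd z cn; have hM := hb cn.
  rewrite /P ler_wpM2r ?ch3_ge0// /K normrM normrX.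
  have -> : f z ^+ 4 = `|f z| ^+ 4 by rewrite -normrX ger0_norm// exprn_even_ge0.
  have a4 : `|f z| ^+ 4 <= M ^+ 4 by apply: lerXn2r; rewrite ?nnegrE.
  have a3 : `|f z| ^+ 3 * `|h z| <= M ^+ 4.
    by rewrite [leRHS]exprSr ler_pM ?exprn_ge0//; apply: lerXn2r; rewrite ?nnegrE.
  by move: a4 a3; lra.
have b1 z : ch3 z != 0 -> `|f1 z| <= M by case/bd.
have b2 z : ch3 z != 0 -> `|f2 z| <= M by case/bd.
have b3 z : ch3 z != 0 -> `|f3 z| <= M by case/bd.
have mEP h : measurable_fun setT h -> measurable_fun setT (fun z => (P h z)%:E).
  by move=> mh; apply/measurable_EFinP; exact: mP.
have mEch (L : R) : measurable_fun setT (fun z => (L * ch3 z)%:E).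
  apply/measurable_EFinP; apply: measurable_funM; first exact: measurable_cst.
  exact: measurable_ch3.
have mu3ch (L : R) : 0 <= L -> (\int[mu3]_z (L * ch3 z)%:E = (8%:R * L)%:E)%E.
  move=> L0; rewrite (leb3_iter (mEch L)); last by move=> z; rewrite lee_fin mulr_ge0 ?ch3_ge0.
  rewrite /ch3 /=; under eq_integral => b _ do under eq_integral => c _ do
    (under eq_integral => d _ do rewrite mulrA; rewrite integral_ch).
  under eq_integral => b _ do (under eq_integral => c _ do rewrite !mulrA; rewrite integral_ch).
  under eq_integral => b _ do rewrite !mulrA.
  by rewrite integral_ch; congr (_%:E); ring.
have m6 : measurable_fun setT (fun z => (f z ^+ 6 * ch3 z)%:E).
  apply/measurable_EFinP; apply: measurable_funM; last exact: measurable_ch3.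
  exact: measurable_funX.
have p6 z : (0 <= (f z ^+ 6 * ch3 z)%:E)%E.
  by rewrite lee_fin mulr_ge0 ?ch3_ge0// exprn_even_ge0.
(* Y must be finite to be absorbed at the end; this is the role of the qualitative bound M. *)
have Yfin : (\int[mu3]_z (f z ^+ 6 * ch3 z)%:E)%E \is a fin_num.
  rewrite ge0_fin_numE; last by apply: integral_ge0 => z _; exact: p6.
  apply: le_lt_trans (ltry (8%:R * M ^+ 6)); rewrite -mu3ch ?exprn_ge0//.
  apply: ge0_le_integral => //; try by move=> z _; exact: p6.
  move=> z _; rewrite lee_fin; have [->|/bd[fM _ _ _]] := eqVneq (ch3 z) 0; first by rewrite !mulr0.
  rewrite ler_wpM2r ?ch3_ge0//; have -> : f z ^+ 6 = `|f z| ^+ 6.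
    by rewrite -normrX ger0_norm// exprn_even_ge0.
  by apply: lerXn2r; rewrite ?nnegrE.
pose Y := fine (\int[mu3]_z (f z ^+ 6 * ch3 z)%:E)%E.
have YE : (\int[mu3]_z (f z ^+ 6 * ch3 z)%:E = Y%:E)%E by rewrite fineK.
have Y0 : 0 <= Y by apply: fine_ge0; apply: integral_ge0 => z _; exact: p6.
pose I := Num.sqrt (Y * (17%:R * N)).
have I0 : 0 <= I by exact: sqrtr_ge0.
(* Cauchy-Schwarz for |f|^3 against |f| + 4 |h|; the constant is 17 = 1 + 4^2. *)
have PI (h : T3 -> R) : measurable_fun setT h ->
    (forall z, h z ^+ 2 <= f1 z ^+ 2 + f2 z ^+ 2 + f3 z ^+ 2) ->
    (\int[mu3]_z (P h z)%:E <= I%:E)%E.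
  move=> mh hh; pose u z := `|f z| ^+ 3 * ch3 z; pose v z := (`|f z| + 4%:R * `|h z|) * ch3 z.
  have mN (k : T3 -> R) : measurable_fun setT k -> measurable_fun setT (fun z => `|k z|).
    by move=> mk; apply: measurableT_comp => //; exact: normr_measurable.
  have mv : measurable_fun setT v.
    apply: measurable_funM; last exact: measurable_ch3.
    apply: measurable_funD; first exact: mN.
    by apply: measurable_funM; [exact: measurable_cst|exact: mN].
  have mu' : measurable_fun setT u.
    by apply: measurable_funM; [apply: measurable_funX; exact: mN|exact: measurable_ch3].
  have -> : (\int[mu3]_z (P h z)%:E = \int[mu3]_z (u z * v z)%:E)%E.
    apply: eq_integral => z _; congr (_%:E); rewrite /P /u /v normrM normrX.
    have -> : f z ^+ 4 = `|f z| ^+ 4 by rewrite -normrX ger0_norm// exprn_even_ge0.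
    have -> : `|f z| ^+ 3 * ch3 z * ((`|f z| + 4%:R * `|h z|) * ch3 z) =
      (`|f z| ^+ 4 + 4%:R * (`|f z| ^+ 3 * `|h z|)) * ch3 z ^+ 2 by ring.
    by rewrite ch3_sqr.
  apply: cs_integral => //.
  - by move=> z; rewrite mulr_ge0 ?ch3_ge0// exprn_ge0.
  - by move=> z; rewrite mulr_ge0 ?ch3_ge0// addr_ge0// mulr_ge0.
  - by rewrite mulr_ge0.
  - rewrite -YE le_eqVlt; apply/orP; left; apply/eqP; apply: eq_integral => z _.
    by rewrite /u exprMn ch3_sqr -exprM -normrX ger0_norm// exprn_even_ge0.
  - rewrite EFinM; apply: le_trans (lee_wpmul2l _ hN); last by rewrite lee_fin.
    rewrite -ge0_integralZl_EFin//; last first.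
      apply/measurable_EFinP; apply: measurable_funM; last exact: measurable_ch3.
      by do 3 (apply: measurable_funD; last exact: measurable_funX); exact: measurable_funX.
      by move=> z _; rewrite lee_fin mulr_ge0 ?ch3_ge0// !addr_ge0// sqr_ge0.
    apply: ge0_le_integral => //.
    + by move=> z _; rewrite lee_fin sqr_ge0.
    + by apply/measurable_EFinP; exact: measurable_funX.
    + apply: measurable_funeM; apply/measurable_EFinP; apply: measurable_funM; last exact: measurable_ch3.
      by do 3 (apply: measurable_funD; last exact: measurable_funX); exact: measurable_funX.
    + move=> z _; rewrite -EFinM lee_fin /v exprMn ch3_sqr [leRHS]mulrA ler_wpM2r ?ch3_ge0//.
      have e1 : `|f z| ^+ 2 = f z ^+ 2 by rewrite real_normK// num_real.
      have e2 : `|h z| ^+ 2 = h z ^+ 2 by rewrite real_normK// num_real.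
      have := sqr_ge0 (4%:R * `|f z| - `|h z|); have := hh z; rewrite -e1 -e2.
      by move: (`|f z|) (`|h z|) => s t h1 h2; nra.
pose p (Q : T3 -> R) (z : T1 * T1) : R := Num.sqrt (fine (\int[mu]_r (Q (z, r))%:E)%E).
have pfacts (Q : T3 -> R) : measurable_fun setT Q -> (forall z, 0 <= Q z) ->
    (forall z, Q z <= K * ch3 z) ->
    [/\ measurable_fun setT (p Q), forall z, 0 <= p Q z,
        forall z, (\int[mu]_r (Q (z, r))%:E = (p Q z ^+ 2)%:E)%E,
        forall b, (\int[mu]_d (p Q (b, d) ^+ 2)%:E <= (4%:R * K)%:E)%E &
        (\int[mu]_b \int[mu]_d (p Q (b, d) ^+ 2)%:E = \int[mu3]_z (Q z)%:E)%E].
  move=> mQ Q0 QK.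
  have mEQ : measurable_fun setT (fun z => (Q z)%:E) by apply/measurable_EFinP.
  have mA := measurable_fun_fubini_tonelli_F (m2 := mu) _ mEQ (fun z => Q0 z).
  have A0 z : (0 <= \int[mu]_r (Q (z, r))%:E)%E by apply: integral_ge0 => r _; rewrite lee_fin.
  have AK z : (\int[mu]_r (Q (z, r))%:E <= (2%:R * (K * ch z.1 * ch z.2))%:E)%E.
    rewrite -integral_ch; apply: ge0_le_integral => //.
    - by move=> r _; rewrite lee_fin.
    - exact: (measurableT_comp mEQ (pair1_measurable z)).
    - by apply/measurable_EFinP; apply: measurable_funM; [exact: measurable_cst|exact: measurable_ch].
    - by move=> r _; rewrite lee_fin -!mulrA; have := QK (z, r); rewrite /ch3 /= -!mulrA.
  have pE z : (\int[mu]_r (Q (z, r))%:E = (p Q z ^+ 2)%:E)%E.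
    rewrite sqr_sqrtr ?fine_ge0// fineK// ge0_fin_numE//.
    exact: le_lt_trans (AK z) (ltry _).
  have mp : measurable_fun setT (p Q).
    by apply: measurableT_comp; [exact: measurable_sqrtr|exact: measurableT_comp].
  split=> //.
  - by move=> z; exact: sqrtr_ge0.
  - move=> b; apply: (@le_trans _ _ (\int[mu]_d (2%:R * K * ch b * ch d)%:E)%E).
      apply: ge0_le_integral => //.
      + by move=> d _; rewrite lee_fin sqr_ge0.
      + apply/measurable_EFinP; apply: measurable_funX.
        exact: (measurableT_comp mp (pair1_measurable b)).
      + by apply/measurable_EFinP; apply: measurable_funM; [exact: measurable_cst|exact: measurable_ch].
      + by move=> d _; rewrite -pE; apply: le_trans (AK _) _; rewrite /= !mulrA.
    rewrite integral_ch lee_fin; have : ch b <= 1.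
      by rewrite /ch indicE; case: (_ \in _).
    by move=> cb; rewrite (_ : 4%:R * K = 2%:R * (2%:R * K) * 1) ?mulrA ?ler_wpM2l ?mulr_ge0//; ring.
  - rewrite (leb3_iter mEQ (fun z => Q0 z)).
    by apply: eq_integral => b _; apply: eq_integral => d _; rewrite pE.
have chr1 z : ch3 (rot1 z) = ch3 z by rewrite /ch3 /rot1 /=; ring.
have chr2 z : ch3 (rot2 z) = ch3 z by rewrite /ch3 /rot2 /=; ring.
have PKr1 z : P f1 (rot1 z) <= K * ch3 z by rewrite -chr1; exact: PK (b1 _).
have PKr2 z : P f2 (rot2 z) <= K * ch3 z by rewrite -chr2; exact: PK (b2 _).
have [mp1 q1 e1 B1 J1] := pfacts (P f1 \o rot1) (measurableT_comp (mP _ mf1) measurable_rot1)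
  (fun z => P0 _ _) (fun z => PKr1 z).
have [mp2 q2 e2 B2 J2] := pfacts (P f2 \o rot2) (measurableT_comp (mP _ mf2) measurable_rot2)
  (fun z => P0 _ _) (fun z => PKr2 z).
have [mp3 q3 e3 B3 J3] := pfacts (P f3) (mP _ mf3) (P0 f3) (fun z => PK f3 z (b3 z)).
have sq_le z : [/\ f1 z ^+ 2 <= f1 z ^+ 2 + f2 z ^+ 2 + f3 z ^+ 2,
   f2 z ^+ 2 <= f1 z ^+ 2 + f2 z ^+ 2 + f3 z ^+ 2 & f3 z ^+ 2 <= f1 z ^+ 2 + f2 z ^+ 2 + f3 z ^+ 2].
  split; first by rewrite -addrA lerDl addr_ge0 ?sqr_ge0.
    by rewrite addrAC lerDr addr_ge0 ?sqr_ge0.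
  by rewrite lerDr addr_ge0 ?sqr_ge0.
have J1' : (\int[mu]_b \int[mu]_d (p (P f1 \o rot1) (b, d) ^+ 2)%:E <= I%:E)%E.
  rewrite J1 (integral_rot1 (mEP _ mf1)); last by move=> z; rewrite lee_fin.
  by apply: PI => // z; case: (sq_le z).
have J2' : (\int[mu]_b \int[mu]_d (p (P f2 \o rot2) (b, d) ^+ 2)%:E <= I%:E)%E.
  rewrite J2 (integral_rot2 (mEP _ mf2)); last by move=> z; rewrite lee_fin.
  by apply: PI => // z; case: (sq_le z).
have J3' : (\int[mu]_b \int[mu]_d (p (P f3) (b, d) ^+ 2)%:E <= I%:E)%E.
  by rewrite J3; apply: PI => // z; case: (sq_le z).
have LW := loomis_whitney (And3 mp1 mp2 mp3) (And3 q1 q2 q3) (And3 I0 I0 I0) B2 B3 J1' J2' J3'.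
rewrite YE lee_fin; apply: (pow_bound Y0 N0 (erefl I)).
rewrite -lee_fin; have -> : I * Num.sqrt I = Num.sqrt (I * I) * Num.sqrt I.
  by rewrite -expr2 sqrtr_sqr ger0_norm.
apply: le_trans LW; rewrite -YE.
pose G (z : T3) : R := p (P f1 \o rot1) (z.1.2, z.2) *
  (p (P f2 \o rot2) (z.1.1, z.2) * p (P f3) (z.1.1, z.1.2)).
have mG : measurable_fun setT (fun z => (G z)%:E).
  apply/measurable_EFinP; apply: measurable_funM; last apply: measurable_funM.
  + by apply: (measurableT_comp mp1); apply: measurable_fun_pair => //; exact: measurableT_comp.
  + by apply: (measurableT_comp mp2); apply: measurable_fun_pair => //; exact: measurableT_comp.
  + by apply: (measurableT_comp mp3); apply: measurable_fun_pair => //; exact: measurableT_comp.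
have G0 z : (0 <= (G z)%:E)%E by rewrite lee_fin !mulr_ge0.
apply: (@le_trans _ _ (\int[mu3]_z (G z)%:E)%E); last by rewrite (leb3_iter mG G0).
apply: ge0_le_integral => //; try by move=> z _; exact: p6.
move=> [[b c] d] _; rewrite lee_fin /G /=.
have [->|cn] := eqVneq (ch3 (b, c, d)) 0; first by rewrite mulr0 !mulr_ge0.
have inI r : ch r != 0 -> -1 <= r <= 1.
  by move=> h; apply: contraNT h => h; rewrite ch_out.
move: (cn); rewrite /ch3 /= !mulf_eq0 !negb_or => /andP[/andP[/inI bI /inI cI] /inI dI].
have sq (t s : R) : 0 <= s -> t ^+ 4 <= s ^+ 2 -> t ^+ 2 <= s.
  by move=> s0 ts; rewrite -ler_sqr ?nnegrE ?sqr_ge0// -exprM.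
have [c1 d1] := D1 c d; have [c2 d2] := D2 b d; have [c3 d3] := D3 b c.
have s1 : f (b, c, d) ^+ 2 <= p (P f1 \o rot1) (c, d).
  apply: sq => //; rewrite -lee_fin -e1; apply: le_trans (slice_pow4 c1 d1 bI) _.
  rewrite le_eqVlt; apply/orP; left; apply/eqP; apply: eq_integral => r _.
  by rewrite /P /rot1 /ch3 /= (ch_in cI) (ch_in dI) !mulr1.
have s2 : f (b, c, d) ^+ 2 <= p (P f2 \o rot2) (b, d).
  apply: sq => //; rewrite -lee_fin -e2; apply: le_trans (slice_pow4 c2 d2 cI) _.
  rewrite le_eqVlt; apply/orP; left; apply/eqP; apply: eq_integral => r _.
  by rewrite /P /rot2 /ch3 /= (ch_in bI) (ch_in dI) mul1r !mulr1.
have s3 : f (b, c, d) ^+ 2 <= p (P f3) (b, c).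
  apply: sq => //; rewrite -lee_fin -e3; apply: le_trans (slice_pow4 c3 d3 dI) _.
  rewrite le_eqVlt; apply/orP; left; apply/eqP; apply: eq_integral => r _.
  by rewrite /P /ch3 /= (ch_in bI) (ch_in cI) !mul1r.
have -> : f (b, c, d) ^+ 6 * (ch b * ch c * ch d) =
   f (b, c, d) ^+ 2 * (f (b, c, d) ^+ 2 * f (b, c, d) ^+ 2).
  by rewrite (ch_in bI) (ch_in cI) (ch_in dI); ring.
exact: (ler_pM (sqr_ge0 _) (mulr_ge0 (sqr_ge0 _) (sqr_ge0 _)) s1
  (ler_pM (sqr_ge0 _) (sqr_ge0 _) s2 s3)).
Qed.

End CubeSobolev.

(** * From the cube to a cone in R^4 *)

Section ConeSobolev.
Context {R : realType}.
Local Notation V := 'rV[R]_4.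
Local Notation R4 := (coordsR4 R).
Local Notation T1 := (measurableTypeR R).
Local Notation T3 := (T1 * T1 * T1)%type.
Local Notation mu := (@lebesgue_measure R).
Implicit Types (f : V -> R).

Lemma smooth_pd i f : smooth f -> smooth (pd i f).
Proof.
move=> sf k; have h := Cinf_pd i sf k; apply: Ck_ext (Ck_mul (Cinf_enorm k) h) => x x0.
have e0 : 0 < enorm x by rewrite enorm_gt0.
rewrite /radial /= [in RHS]/sproj pdZ ?invr_gt0//.
by rewrite invrK.
Qed.

(** On the sphere this is f^2 plus the squared round gradient, since the 0-homogeneous extension has
    no radial derivative. *)
Definition energy f x : R := f x ^+ 2 + \sum_i pd i f x ^+ 2.

Lemma energy_ge0 f x : 0 <= energy f x.
Proof. by rewrite addr_ge0 ?sqr_ge0// sumr_ge0// => i _; exact: sqr_ge0. Qed.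

Lemma smooth_energy f : smooth f -> smooth (energy f).
Proof.
move=> sf; apply: smooth_ext (smoothD (smoothM sf sf) (smooth_sum (index_enum 'I_4)
  (fun i => smoothM (smooth_pd i sf) (smooth_pd i sf)))) => x _.
by rewrite /energy; congr (_ + _); apply: eq_bigr => i _; rewrite expr2.
Qed.

(** Gnomonic chart; the cube parametrizes the sector where the first coordinate is positive and
    dominates the others. *)
Definition gnom (z : T3) : R4 := (1, z.1.1, z.1.2, z.2).

Lemma gnom_nz z : pt4 (gnom z) != 0.
Proof.
apply/eqP => h; have [h0 _ _ _] := pt4_coord (gnom z).
by move: h0; rewrite h mxE /= => /eqP; rewrite eq_sym oner_eq0.
Qed.

Lemma enorm_gnom z : 1 <= enorm (pt4 (gnom z)).
Proof.
have [h0 _ _ _] := pt4_coord (gnom z); have := coord_le_enorm (pt4 (gnom z)) (inord 0).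
by rewrite h0 /= normr1.
Qed.

Lemma measurable_gnom f : (forall x, x != 0 -> {for x, continuous f}) ->
  measurable_fun setT (fun z => f (pt4 (gnom z))).
Proof.
move=> cf; apply: (@measurable_comp _ _ _ _ _ _ [set y : R4 | pt4 y != 0]
  (fun y => f (pt4 y)) setT gnom).
- exact: measurable_pt4_nz.
- by move=> _ [z _ <-]; exact: gnom_nz.
- by apply: measurable_off0 => //; exact: measurable_pt4_nz.
- apply: measurable_fun_pair => //; apply: measurable_fun_pair; last exact: measurableT_comp.
  by apply: measurable_fun_pair; [exact: measurable_cst|exact: measurableT_comp].
Qed.

Definition cone (r s : R) : set R4 := [set y | [/\ r < y.1.1.1 < s,
  `|y.1.1.2| <= y.1.1.1, `|y.1.2| <= y.1.1.1 & `|y.2| <= y.1.1.1]].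

Let mc0 : measurable_fun setT (fun y : R4 => y.1.1.1).
Proof. by apply: measurableT_comp => //; apply: measurableT_comp. Qed.
Let mc1 : measurable_fun setT (fun y : R4 => y.1.1.2).
Proof. by apply: measurableT_comp => //; apply: measurableT_comp. Qed.
Let mc2 : measurable_fun setT (fun y : R4 => y.1.2).
Proof. by apply: measurableT_comp. Qed.
Let mc3 : measurable_fun setT (fun y : R4 => y.2).
Proof. exact: measurable_snd. Qed.

Lemma measurable_cone r s : measurable (cone r s).
Proof.
have mN (c : R4 -> T1) : measurable_fun setT c ->
    measurable [set y | `|c y| <= y.1.1.1].
  move=> mc; rewrite -[X in measurable X]setTI.
  apply: measurable_fun_le => //.
  by apply: measurableT_comp => //; exact: normr_measurable.
have -> : cone r s = [set y | r < y.1.1.1 < s] `&` [set y | `|y.1.1.2| <= y.1.1.1]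
   `&` [set y | `|y.1.2| <= y.1.1.1] `&` [set y | `|y.2| <= y.1.1.1].
  by apply/seteqP; split=> y; [case=> *; split=> //; split|case=> -[[]]].
do 3 (apply: measurableI; last exact: mN).
rewrite -[X in measurable X]setTI.
have -> : [set y : R4 | r < y.1.1.1 < s] = (fun y : R4 => y.1.1.1) @^-1` `]r, s[%classic.
  by apply/seteqP; split => y /=; rewrite in_itv.
by apply: mc0 => //; exact: measurable_itv.
Qed.

Lemma pt4_scale (a b c d : R) : pt4 (a, a * b, a * c, a * d) = a *: pt4 (gnom (b, c, d)).
Proof.
apply/rowP; have [h0 h1 h2 h3] := pt4_coord (a, a * b, a * c, a * d).
have [k0 k1 k2 k3] := pt4_coord (gnom (b, c, d)).
by apply: ord4P; rewrite [RHS]mxE ?h0 ?h1 ?h2 ?h3 ?k0 ?k1 ?k2 ?k3 //= mulr1.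
Qed.

(** The substitution y = a (1, b, c, d) has Jacobian a^3, and the radial projection forgets a. *)
Lemma integral_cone (G : V -> R) (r s : R) : 0 <= r -> smooth G ->
  (forall x, S3 x -> 0 <= G x) ->
  (\int[leb4]_(y in cone r s) (G (sproj (pt4 y)))%:E =
   \int[mu]_(a in `]r, s[) ((a ^+ 3)%:E *
     \int[mu3]_z (G (sproj (pt4 (gnom z))) * ch3 z)%:E))%E.
Proof.
move=> r0 sG G0; have mC := measurable_cone r s.
have cnz (y : R4) : cone r s y -> 0 < y.1.1.1 by case=> /andP[/(le_lt_trans r0)].
have Cnz (y : R4) : cone r s y -> pt4 y != 0.
  move=> /cnz h; apply/eqP => y0; have [h0 _ _ _] := pt4_coord y.
  by move: h; rewrite -h0 y0 mxE ltxx.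
have mG : measurable_fun (cone r s) (fun y => (G (sproj (pt4 y)))%:E).
  apply/measurable_EFinP; apply: (measurable_off0 (F := radial G)) => //.
  exact: Ck_cont (sG 0%N).
have mG3 : measurable_fun setT (fun z : T3 => (G (sproj (pt4 (gnom z))) * ch3 z)%:E).
  apply/measurable_EFinP; apply: measurable_funM; last exact: measurable_ch3.
  exact: (measurable_gnom (f := radial G) (Ck_cont (sG 0%N))).
have G3 z : (0 <= (G (sproj (pt4 (gnom z))) * ch3 z)%:E)%E.
  by rewrite lee_fin mulr_ge0 ?ch3_ge0// G0//; exact/S3_sproj/gnom_nz.
rewrite [LHS]integral_mkcond [RHS]integral_mkcond.
pose H := (fun y => (G (sproj (pt4 y)))%:E) \_ (cone r s).
have mH : measurable_fun setT H by apply/(measurable_restrictT _ mC).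
have H0 y : (0 <= H y)%E.
  rewrite /H patchE; case: ifPn => // /set_mem yC.
  by rewrite lee_fin G0//; exact/S3_sproj/Cnz.
rewrite [LHS](leb4_iter mH H0); apply: eq_integral => a _.
rewrite patchE; case: ifPn => [|an]; last first.
  rewrite integral0_eq// => b _; rewrite integral0_eq// => c _; rewrite integral0_eq// => d _.
  rewrite /H patchE ifF//; apply/negP => /set_mem[] /= ab _ _ _.
  by move/negP: an; apply; rewrite inE/= in_itv.
rewrite inE/= in_itv/= => ars; have a0 : 0 < a by case/andP: ars => /(le_lt_trans r0).
have a0' : (0 <= a)%R by exact: ltW.
have mH3 b c : measurable_fun setT (fun d => H (a, b, c, d)).
  exact: (measurableT_comp mH (pair1_measurable ((a, b, c) : T3))).
have mF2 := measurable_fun_fubini_tonelli_F (m2 := mu) _ mH H0.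
have F20 z : (0 <= fubini_F mu H z)%E by exact: integral_ge0.
have mF2b (u v : T1) : measurable_fun setT (fun c : T1 => fubini_F mu H (u, v, c)).
  apply: (measurableT_comp mF2); apply: measurable_fun_pair; last exact: measurable_id.
  exact: measurable_cst.
have mF1 := measurable_fun_fubini_tonelli_F (m2 := mu) _ mF2 F20.
have F10 z : (0 <= fubini_F mu (fubini_F mu H) z)%E by exact: integral_ge0.
rewrite [LHS](ge0_integral_scale a0); last 2 first.
- exact: (measurableT_comp mF1 (pair1_measurable a)).
- by move=> b; exact: F10.
rewrite (leb3_iter mG3 G3) exprS expr2 !EFinM -!muleA; congr (_ * _)%E.
rewrite muleA -EFinM -ge0_integralZl_EFin ?mulr_ge0//; last 2 first.
- by move=> b _; do 2 (apply: integral_ge0 => ? _); exact: G3.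
- have m1 := measurable_fun_fubini_tonelli_F (m2 := mu) _ mG3 G3.
  have p1 x : (0 <= fubini_F mu (fun z => (G (sproj (pt4 (gnom z))) * ch3 z)%:E) x)%E.
    by exact: integral_ge0.
  exact: (measurable_fun_fubini_tonelli_F (m2 := mu) _ m1 p1).
apply: eq_integral => b _.
rewrite [LHS](ge0_integral_scale a0); last 2 first.
- exact: mF2b.
- by move=> c; exact: F20.
rewrite EFinM -muleA; congr (_ * _)%E.
rewrite -ge0_integralZl_EFin//; last 2 first.
- by move=> c _; apply: integral_ge0 => d _; exact: G3.
- have m1 := measurable_fun_fubini_tonelli_F (m2 := mu) _ mG3 G3.
  exact: (measurableT_comp m1 (pair1_measurable b)).
apply: eq_integral => c _.
rewrite [LHS](ge0_integral_scale a0)//; last by exact: mH3.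
congr (_ * _)%E; apply: eq_integral => d _; rewrite /H patchE.
have chE t : (`|a * t| <= a) = (-1 <= t <= 1).
  by rewrite normrM (gtr0_norm a0) -[X in _ <= X]mulr1 ler_pM2l// ler_norml.
rewrite pt4_scale sprojZ// /ch3 /=.
case: ifPn => [/set_mem[/= _ hb hc hd]|hn].
  by move: hb hc hd; rewrite !chE => hb hc hd; rewrite !ch_in ?mulr1.
suff -> : ch b * ch c * ch d = 0 by rewrite mulr0.
apply/eqP; apply: contraNT hn; rewrite !mulf_eq0 !negb_or => /andP[/andP[hb hc] hd].
have inI t : ch t != 0 -> -1 <= t <= 1.
  by move=> h; apply: contraNT h => h; rewrite ch_out.
by rewrite inE; split=> //=; rewrite chE; exact: inI.
Qed.

End ConeSobolev.

Section SphereSobolev.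
Context {R : realType}.
Local Notation V := 'rV[R]_4.
Local Notation R4 := (coordsR4 R).
Local Notation T1 := (measurableTypeR R).
Local Notation T3 := (T1 * T1 * T1)%type.
Local Notation mu := (@lebesgue_measure R).
Implicit Types (f : V -> R).

Lemma pd_line f i (z : V) : smooth f -> (forall t : R, t *: ei i + z != 0) ->
  continuous (fun t : R => pd i f (t *: ei i + z)) /\
  forall t, is_derive t (1 : R) (fun t => radial f (t *: ei i + z)) (pd i f (t *: ei i + z)).
Proof.
move=> sf nz; split=> t.
  apply: (@continuous_comp _ _ _ (fun t : R => t *: ei i + z) (pd i f)).
    by apply: cvgD; [apply: cvgZr_tmp; exact: cvg_id|exact: cvg_cst].
  exact: (Ck_cont (Cinf_pd i sf 0%N) (nz t)).
have [ex _] := radial_derive (ei i) sf (nz t).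
exact: line_derive ex.
Qed.

Lemma pd_sproj_le f i (x : V) : smooth f -> 1 <= enorm x ->
  pd i f x ^+ 2 <= pd i f (sproj x) ^+ 2.
Proof.
move=> sf x1; have e0 : 0 < enorm x by exact: lt_le_trans x1.
rewrite /sproj pdZ ?invr_gt0//; last by rewrite -enorm_gt0.
by rewrite invrK exprMn ler_peMl ?sqr_ge0// -(expr1n _ 2) lerXn2r ?nnegrE// ltW.
Qed.

Lemma gnom_bound f : smooth f -> exists M, forall z, ch3 z != 0 ->
  [/\ `|radial f (pt4 (gnom z))| <= M, `|pd (inord 1) f (pt4 (gnom z))| <= M,
      `|pd (inord 2) f (pt4 (gnom z))| <= M & `|pd (inord 3) f (pt4 (gnom z))| <= M].
Proof.
move=> sf; have [M0 M00 h0] := smooth_bounded sf.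
have b i := smooth_bounded (smooth_pd i sf).
have [M1 M10 h1] := b (inord 1); have [M2 M20 h2] := b (inord 2).
have [M3 M30 h3] := b (inord 3).
exists (M0 + M1 + M2 + M3) => z _; set x := pt4 (gnom z).
have xS : S3 (sproj x) by exact/S3_sproj/gnom_nz.
have pl i : `|pd i f x| <= `|pd i f (sproj x)|.
  rewrite -ler_sqr ?nnegrE// !real_normK ?num_real//.
  by apply: pd_sproj_le => //; exact: enorm_gnom.
have le (t u v s : R) : 0 < t -> 0 < u -> 0 < v -> 0 < s ->
    [/\ t <= t + u + v + s, u <= t + u + v + s, v <= t + u + v + s & s <= t + u + v + s].
  by move=> *; split; lra.
have [l0 l1 l2 l3] := le _ _ _ _ M00 M10 M20 M30; split.
- exact: le_trans (h0 _ xS) l0.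
- exact: le_trans (le_trans (pl _) (h1 _ xS)) l1.
- exact: le_trans (le_trans (pl _) (h2 _ xS)) l2.
- exact: le_trans (le_trans (pl _) (h3 _ xS)) l3.
Qed.

Local Notation Tn G := (\int[mu3]_z (G (sproj (pt4 (gnom z))) * ch3 z)%:E)%E.

Lemma gnom_line (z : T3) i : i != inord 0 :> 'I_4 ->
  forall t : R, t *: ei i + pt4 (gnom z) != 0.
Proof.
move=> i0 t; apply/eqP => /rowP /(_ (inord 0)).
have [h0 _ _ _] := pt4_coord (gnom z).
rewrite mxE h0 !mxE eqxx eq_sym (negbTE i0) /= mulr0 add0r => /eqP.
by rewrite oner_eq0.
Qed.

(** Integrals over cones are comparable with integrals over the gnomonic cube, where [cube_sobolev]
    applies; the derivatives along the chart axes are values of [pd] off the sphere, and these only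
    increase under projection ([pd_sproj_le]). *)
Lemma cone_sobolev f (N : R) : smooth f -> 0 <= N ->
  (\int[leb4]_(y in ball4) (energy f (sproj (pt4 y)))%:E <= N%:E)%E ->
  (\int[leb4]_(y in cone 0 1) (f (sproj (pt4 y)) ^+ 6)%:E
     <= (17%:R ^+ 3 * (256%:R * N) ^+ 3)%:E)%E.
Proof.
move=> sf N0 hN; have sE := smooth_energy sf.
have sf2 := smoothM sf sf; have sf6 := smoothM (smoothM sf2 sf2) sf2.
have s6 : smooth (fun x => f x ^+ 6) by apply: smooth_ext sf6 => x _; ring.
have mT G : smooth G -> measurable_fun setT (fun z : T3 => (G (sproj (pt4 (gnom z))) * ch3 z)%:E).
  move=> sG; apply/measurable_EFinP; apply: measurable_funM; last exact: measurable_ch3.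
  exact: (measurable_gnom (f := radial G) (Ck_cont (sG 0%N))).
have T0 (G : V -> R) : (forall x, 0 <= G x) -> (0 <= Tn G)%E.
  by move=> G0; apply: integral_ge0 => z _; rewrite lee_fin mulr_ge0 ?ch3_ge0.
have mI (r s : R) : measurable (`]r, s[%classic : set T1) by exact: measurable_itv.
have lenI (r s : R) : r < s -> mu (`]r, s[%classic) = (s - r)%:E.
  by move=> rs; rewrite lebesgue_measure_itv/= lte_fin rs EFinD.
have ma3 (r s : R) (c : \bar R) : measurable_fun `]r, s[%classic (fun a : T1 => (a ^+ 3)%:E * c)%E.
  apply: emeasurable_funM; last exact: measurable_cst.
  by apply/measurable_EFinP; apply: measurable_funX; exact: measurable_id.
have up : (\int[leb4]_(y in cone 0 1) (f (sproj (pt4 y)) ^+ 6)%:E <= Tn (fun x => (f x) ^+ 6))%E.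
  have p6 x : 0 <= f x ^+ 6 by rewrite exprn_even_ge0.
  rewrite (integral_cone (G := fun x => f x ^+ 6)) //.
  apply: (@le_trans _ _ (\int[mu]_(a in `]0%R, 1%R[) Tn (fun x => (f x) ^+ 6))%E).
    apply: ge0_le_integral; [exact: mI| |exact: ma3|exact: measurable_cst|].
    - move=> a; rewrite /= in_itv/= => /andP[/ltW a0 _].
      by apply: mule_ge0; [rewrite lee_fin exprn_ge0|exact: (T0 (fun x => f x ^+ 6))].
    - move=> a; rewrite /= in_itv/= => /andP[/ltW a0 /ltW a1].
      rewrite -[leRHS]mul1e; apply: lee_wpmul2r; first exact: (T0 (fun x => f x ^+ 6)).
      by rewrite lee_fin exprn_ile1.
  rewrite integral_cst//; rewrite [X in (_ * X)%E](_ : _ = (1 - 0)%:E); last first.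
    by apply: lenI.
  by rewrite subr0 mule1.
(* The cone between heights 1/4 and 1/2 lies in the unit ball; there the weight a^3 is at least 1/64
   and the height interval has length 1/4, whence 256. *)
have low : (Tn (energy f) <= (256%:R * N)%:E)%E.
  have e0 x : 0 <= energy f x by exact: energy_ge0.
  have q4 : (0 : R) <= 4%:R^-1 by rewrite invr_ge0.
  have q42 : (4%:R^-1 : R) < 2%:R^-1 by lra.
  have sub : cone 4%:R^-1 2%:R^-1 `<=` @ball4 R.
    move=> y [/andP[y1 y2] b1 b2 b3]; have [h0 h1 h2 h3] := pt4_coord y.
    have y0 : 0 < y.1.1.1 by exact: le_lt_trans y1.
    rewrite /ball4/=; apply/andP; split.
      by apply: lt_le_trans (coord_le_enorm _ (inord 0)); rewrite h0 normr_gt0 gt_eqF.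
    rewrite /enorm -sqrtr1 ltr_sqrt// dotE sum4E h0 h1 h2 h3.
    have sq t : `|t| <= y.1.1.1 -> t * t <= y.1.1.1 * y.1.1.1.
      by move=> h; rewrite -!expr2 -[t ^+ 2]real_normK ?num_real// lerXn2r ?nnegrE// ltW.
    move: (sq _ b1) (sq _ b2) (sq _ b3) y0 y2.
    by move: y.1.1.1 (y.1.1.2 * _) (y.1.2 * _) (y.2 * _) => a u v w ? ? ? ? ?; nra.
  have E := integral_cone 2%:R^-1 q4 sE (fun x _ => e0 x).
  have le1 : (\int[leb4]_(y in cone 4%:R^-1 2%:R^-1) (energy f (sproj (pt4 y)))%:E <= N%:E)%E.
    apply: le_trans hN; apply: ge0_subset_integral => //.
    - exact: measurable_cone.
    - exact: measurable_ball4.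
    - by apply/measurable_EFinP; exact: smooth_measurable.
    - by move=> y _; rewrite lee_fin.
  have le2 : ((64%:R^-1)%:E * Tn (energy f) * (2%:R^-1 - 4%:R^-1)%:E <= N%:E)%E.
    apply: le_trans le1; rewrite E -[X in (_ * X)%E](lenI _ _ q42).
    rewrite -integral_cst; last exact: mI.
    apply: ge0_le_integral; [exact: mI| |exact: measurable_cst|exact: ma3|].
    - by move=> a _; apply: mule_ge0; [rewrite lee_fin invr_ge0|exact: (T0 (energy f))].
    - move=> a; rewrite /= in_itv/= => /andP[/ltW a0 _].
      apply: lee_wpmul2r; first exact: (T0 (energy f)).
      rewrite lee_fin (_ : 64%:R^-1 = 4%:R^-1 ^+ 3) ?lerXn2r ?nnegrE ?(le_trans q4)//.
      by rewrite exprVn -natrX.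
  have := lee_wpmul2l (_ : 0 <= 256%:R%:E)%E le2; rewrite lee_fin ler0n => /(_ isT).
  rewrite EFinM; apply: le_trans; rewrite muleAC muleA -!EFinM.
  by rewrite (_ : _ * _ = 1) ?mul1e//; field.
have [M hM] := gnom_bound sf.
have D (i : 'I_4) (z : T3) (gz : R -> V) : i != inord 0 :> 'I_4 ->
    (forall t, gz t = t *: ei i + pt4 (gnom z)) ->
    continuous (fun t : R => pd i f (gz t)) /\
    forall t, is_derive t (1 : R) (fun t => radial f (gz t)) (pd i f (gz t)).
  move=> i0 hgz; have -> : gz = fun t => t *: ei i + pt4 (gnom z) by apply/funext.
  by apply: pd_line => // t; exact: gnom_line.
have n0 k : (0 < k < 4)%N -> (inord k : 'I_4) != inord 0.
  by move=> /andP[k0 k4]; rewrite -val_eqE/= !inordK//; case: k k0 {k4}.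
apply: (le_trans up).
have mpd i : measurable_fun setT (fun z : T3 => pd i f (pt4 (gnom z))).
  exact: (measurable_gnom (Ck_cont (Cinf_pd i sf 0%N))).
have := @cube_sobolev R (fun z => radial f (pt4 (gnom z)))
  (fun z => pd (inord 1) f (pt4 (gnom z))) (fun z => pd (inord 2) f (pt4 (gnom z)))
  (fun z => pd (inord 3) f (pt4 (gnom z))) M (256%:R * N); apply => //.
- by split=> //; exact: (measurable_gnom (Ck_cont (sf 0%N))).
- move=> c d; apply: (D _ (0, c, d) (fun b => pt4 (gnom (b, c, d)))); first exact: n0.
  move=> t; have [h0 h1 h2 h3] := pt4_coord (gnom (t, c, d)).
  have [k0 k1 k2 k3] := pt4_coord (gnom (0, c, d)).
  by apply/rowP; apply: ord4P; rewrite [RHS]mxE ?h0 ?h1 ?h2 ?h3 ?k0 ?k1 ?k2 ?k3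
    mxE mxE -?val_eqE /= ?inordK// ?mulr0 ?mulr1 ?add0r ?addr0.
- move=> b d; apply: (D _ (b, 0, d) (fun c => pt4 (gnom (b, c, d)))); first exact: n0.
  move=> t; have [h0 h1 h2 h3] := pt4_coord (gnom (b, t, d)).
  have [k0 k1 k2 k3] := pt4_coord (gnom (b, 0, d)).
  by apply/rowP; apply: ord4P; rewrite [RHS]mxE ?h0 ?h1 ?h2 ?h3 ?k0 ?k1 ?k2 ?k3
    mxE mxE -?val_eqE /= ?inordK// ?mulr0 ?mulr1 ?add0r ?addr0.
- move=> b c; apply: (D _ (b, c, 0) (fun d => pt4 (gnom (b, c, d)))); first exact: n0.
  move=> t; have [h0 h1 h2 h3] := pt4_coord (gnom (b, c, t)).
  have [k0 k1 k2 k3] := pt4_coord (gnom (b, c, 0)).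
  by apply/rowP; apply: ord4P; rewrite [RHS]mxE ?h0 ?h1 ?h2 ?h3 ?k0 ?k1 ?k2 ?k3
    mxE mxE -?val_eqE /= ?inordK// ?mulr0 ?mulr1 ?add0r ?addr0.
- by rewrite mulr_ge0 ?ler0n.
apply: le_trans low; apply: ge0_le_integral => //.
- by move=> z _; rewrite lee_fin mulr_ge0 ?ch3_ge0// !addr_ge0// sqr_ge0.
- apply/measurable_EFinP; apply: measurable_funM; last exact: measurable_ch3.
  do 3 (apply: measurable_funD; last by apply: measurable_funX; exact: mpd).
  by apply: measurable_funX; exact: (measurable_gnom (Ck_cont (sf 0%N))).
- exact: mT.
move=> z _; rewrite lee_fin ler_wpM2r ?ch3_ge0// /energy sum4E.
have x1 := enorm_gnom z.
have h1 := pd_sproj_le (inord 1) sf x1; have h2 := pd_sproj_le (inord 2) sf x1.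
have h3 := pd_sproj_le (inord 3) sf x1.
rewrite -!addrA; apply: lerD; first exact: lexx.
apply: (le_trans (lerD h1 (lerD h2 h3))); by rewrite lerDr sqr_ge0.
Qed.

End SphereSobolev.

(** * Sobolev inequality on the sphere *)

Section SphereSobolevInequality.
Context {R : realType}.
Local Notation V := 'rV[R]_4.
Local Notation R4 := (coordsR4 R).
Implicit Types (f : V -> R) (A : 'M[R]_4).

Lemma dot_orth A (u v : V) : A *m A^T = 1%:M -> dot (u *m A) (v *m A) = dot u v.
Proof. by move=> AA; rewrite /dot trmx_mul mulmxA -(mulmxA u) AA mulmx1. Qed.

Lemma enorm_orth A (u : V) : A *m A^T = 1%:M -> enorm (u *m A) = enorm u.
Proof. by move=> AA; rewrite /enorm dot_orth. Qed.

Lemma sproj_orth A (u : V) : A *m A^T = 1%:M -> sproj (u *m A) = sproj u *m A.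
Proof. by move=> AA; rewrite /sproj enorm_orth// scalemxAl. Qed.

Lemma radial_orth A f : A *m A^T = 1%:M ->
  radial (fun x => f (x *m A)) = (fun x => radial f (x *m A)).
Proof. by move=> AA; apply/funext => x; rewrite /radial /= sproj_orth. Qed.

Lemma derivable_mulmxr (F : V -> R) A (x v : V) :
  derivable F (x *m A) (v *m A) -> derivable (fun y => F (y *m A)) x v.
Proof.
rewrite /derivable.
suff -> : (fun h => h^-1 *: (((fun y => F (y *m A)) \o shift x) (h *: v) - F (x *m A))) =
  (fun h => h^-1 *: ((F \o shift (x *m A)) (h *: (v *m A)) - F (x *m A))) by [].
by apply/funext => h; rewrite /= mulmxDl -scalemxAl.
Qed.

Lemma derive_mulmxr (F : V -> R) A i (x : V) : A *m A^T = 1%:M -> Cinf F -> x != 0 ->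
  is_derive x (ei i) (fun y => F (y *m A)) (\sum_j A i j * 'D_(ei j) F (x *m A)).
Proof.
move=> AA cF x0; have xA0 : x *m A != 0 by rewrite -enorm_gt0 enorm_orth// enorm_gt0.
have [ex val] := C1_derive (ei i *m A) xA0 (Cinf_C1 cF).
split; first exact: derivable_mulmxr.
rewrite (derive_linear_comp F (mulmxr A)) /= val.
by apply: eq_bigr => j _; rewrite /ei -rowE mxE.
Qed.

Lemma mulmxr_continuous A : continuous (mulmxr A : V -> V).
Proof.
have -> : (mulmxr A : V -> V) = (fun x => \sum_(i <- index_enum 'I_4) x 0 i *: row i A).
  by apply/funext => x; rewrite /= mulmx_sum_row.
elim: (index_enum 'I_4) => [|i s IH] x.
  suff -> : (fun x : V => \sum_(i <- [::]) x 0 i *: row i A) = (fun=> 0) by exact: (@cst_continuous V V 0 x).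
  by apply/funext => y; rewrite big_nil.
suff -> : (fun x : V => \sum_(i <- i :: s) x 0 i *: row i A) =
    (fun x : V => x 0 i *: row i A + \sum_(i <- s) x 0 i *: row i A).
  apply: (@continuousD _ _ _ (fun x : V => x 0 i *: row i A)
    (fun x : V => \sum_(i <- s) x 0 i *: row i A)); last exact: IH.
  by apply: (@continuousZr_tmp R V V (fun y : V => y 0 i)); exact: coord_continuous.
by apply/funext => y; rewrite big_cons.
Qed.

Lemma Ck_mulmxr k (F : V -> R) A : A *m A^T = 1%:M -> Cinf F ->
  Ck_off0 k (fun x => F (x *m A)).
Proof.
move=> AA; elim: k F => [|k IH] F cF.
  split=> // x x0; have xA0 : x *m A != 0 by rewrite -enorm_gt0 enorm_orth// enorm_gt0.
  apply: (@continuous_comp _ _ _ (mulmxr A) F); last exact: (Ck_cont (cF 0%N)).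
  exact: mulmxr_continuous.
split.
  move=> x x0; have xA0 : x *m A != 0 by rewrite -enorm_gt0 enorm_orth// enorm_gt0.
  apply: (@continuous_comp _ _ _ (mulmxr A) F); last exact: (Ck_cont (cF 0%N)).
  exact: mulmxr_continuous.
move=> i; split=> [x x0|]; first by have [] := derive_mulmxr i AA cF x0.
have h : Ck_off0 k (fun x => \sum_j A i j * 'D_(ei j) F (x *m A)).
  elim: (index_enum 'I_4) => [|j s IHs].
    by apply: Ck_ext (Ck_cst k 0) => x _; rewrite big_nil.
  apply: Ck_ext (Ck_add (Ck_mul (Ck_cst k (A i j)) (IH _ (Cinf_derive j cF))) IHs) => x _.
  by rewrite big_cons.
by apply: Ck_ext h => x x0; have [_ ->] := derive_mulmxr i AA cF x0.
Qed.

Lemma smooth_orth A f : A *m A^T = 1%:M -> smooth f -> smooth (fun x => f (x *m A)).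
Proof. by move=> AA sf k; rewrite radial_orth//; exact: Ck_mulmxr. Qed.

Lemma energy_orth A f x : A *m A^T = 1%:M -> smooth f -> x != 0 ->
  energy (fun x => f (x *m A)) x = energy f (x *m A).
Proof.
move=> AA sf x0; rewrite /energy; congr (_ + _).
pose p : V := \row_j pd j f (x *m A).
have AA' : A^T *m (A^T)^T = 1%:M by rewrite trmxK; exact: mulmx1C.
transitivity (dot (p *m A^T) (p *m A^T)).
  rewrite dotE; apply: eq_bigr => i _; rewrite -expr2; congr (_ ^+ 2).
  rewrite /pd radial_orth//; have [_ ->] := derive_mulmxr i AA sf x0.
  by rewrite mxE; apply: eq_bigr => j _; rewrite !mxE mulrC.
by rewrite dot_orth// dotE; apply: eq_bigr => i _; rewrite mxE expr2.
Qed.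

Definition flipm : 'M[R]_4 := diag_mx (\row_i if i == 0 then -1 else 1).
(** An isometry bringing coordinate [p.1] to the front and, when [p.2] holds, changing its sign.
    With [p.1] the coordinate of largest modulus and [p.2] its sign, it moves a point of the ball
    into the cone. *)
Definition sector (p : 'I_4 * bool) : R4 -> R4 :=
  if p.2 then flip0 \o swap p.1 else swap p.1.
Definition sectorm (p : 'I_4 * bool) : 'M[R]_4 :=
  perm_mx (tperm 0 p.1) *m (if p.2 then flipm else 1%:M).

Lemma sectorm_orth p : sectorm p *m (sectorm p)^T = 1%:M.
Proof.
have f1 : flipm *m flipm^T = 1%:M.
  rewrite tr_diag_mx mulmx_diag -diag_const_mx; congr diag_mx; apply/rowP => i.
  by rewrite !mxE; case: ifP => _; rewrite ?mulrNN mulr1.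
rewrite /sectorm trmx_mul mulmxA -(mulmxA (perm_mx _)).
have -> : (if p.2 then flipm else 1%:M) *m (if p.2 then flipm else 1%:M)^T = 1%:M.
  by case: p.2; rewrite ?f1// trmx1 mulmx1.
by rewrite mulmx1 tr_perm_mx -perm_mxM mulgV perm_mx1.
Qed.

Lemma pt4_sector p y : pt4 (sector p y) = pt4 y *m sectorm p.
Proof.
have sw : pt4 (swap p.1 y) = pt4 y *m perm_mx (tperm 0 p.1).
  by rewrite pt4_swap col_permE tpermV.
rewrite /sector /sectorm; case: p.2; last by rewrite sw mulmx1.
rewrite -[pt4 _]/(pt4 (flip0 (swap p.1 y))) pt4_flip0 sw mulmxA; move: (_ *m perm_mx _) => x.
apply/rowP => i; rewrite mul_mx_diag !mxE.
by case: ifP => _; rewrite ?mulrN mulr1.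
Qed.

Lemma preserves_sector p : preserves (sector p).
Proof.
rewrite /sector; case: p.2; last exact: preserves_swap.
by apply: preserves_comp; [exact: preserves_flip0|exact: preserves_swap].
Qed.

Lemma sector_cover (y : R4) : ball4 y -> exists p, cone 0 1 (sector p y).
Proof.
move=> yB; have y0 := ball4_nz yB; have y1 : enorm (pt4 y) < 1 by case/andP: yB.
pose m (i : 'I_4) : R := `|pt4 y 0 i|.
have [k _ kmax] := @arg_maxP _ _ _ (0 : 'I_4) xpredT m isT.
have kM i : m i <= m k by exact: kmax.
have mk0 : 0 < m k.
  rewrite lt_neqAle normr_ge0 andbT eq_sym; apply: contra y0 => /eqP k0.
  apply/eqP/rowP => i; rewrite mxE; apply/eqP; rewrite -normr_le0.
  by rewrite -k0; exact: kM.
have mk1 : m k < 1 by apply: le_lt_trans (coord_le_enorm _ _) y1.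
have sw i : `|pt4 (swap k y) 0 i| <= m k by rewrite pt4_swap mxE; exact: kM.
have s0 : pt4 (swap k y) 0 0 = pt4 y 0 k by rewrite pt4_swap mxE tpermL.
have z0 : (0 : 'I_4) = inord 0 by apply: val_inj; rewrite /= inordK.
exists (k, pt4 y 0 k < 0); rewrite /sector [(_, _).1]/= [(_, _).2]/=; case: ltP => yk.
  have e i : `|pt4 (flip0 (swap k y)) 0 i| <= m k.
    by rewrite pt4_flip0 mxE; case: ifP => _; rewrite ?normrN.
  have := pt4_coord (flip0 (swap k y)); move=> [h0 h1 h2 h3].
  have E0 : (flip0 (swap k y)).1.1.1 = m k.
    by rewrite -h0 pt4_flip0 mxE -z0 eqxx s0 /m ltr0_norm.
  suff : cone 0 1 (flip0 (swap k y)) by [].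
  move: h0 h1 h2 h3 E0 e; move: (flip0 (swap k y)) => u h0 h1 h2 h3 E0 e.
  by split; rewrite ?E0 -?h1 -?h2 -?h3 ?mk0 ?mk1//; exact: e.
have [h0 h1 h2 h3] := pt4_coord (swap k y).
have E0 : (swap k y).1.1.1 = m k by rewrite -h0 -z0 s0 /m ger0_norm.
suff : cone 0 1 (swap k y) by [].
move: h0 h1 h2 h3 E0 sw; move: (swap k y) => u h0 h1 h2 h3 E0 e.
by split; rewrite ?E0 -?h1 -?h2 -?h3 ?mk0 ?mk1//; exact: e.
Qed.

(** Eight isometric images of the cone cover the punctured ball, and the measure, the ball and the
    energy are invariant under these isometries; hence the factor 8. *)
Lemma ball_sobolev f (N : R) : smooth f -> 0 <= N ->
  (\int[leb4]_(y in ball4) (energy f (sproj (pt4 y)))%:E <= N%:E)%E ->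
  (\int[leb4]_(y in ball4) (f (sproj (pt4 y)) ^+ 6)%:E
     <= (8%:R * (17%:R ^+ 3 * (256%:R * N) ^+ 3))%:E)%E.
Proof.
move=> sf N0 hN; have mB := @measurable_ball4 R; have mC := measurable_cone (0 : R) 1.
pose B p := (sectorm p)^T; have BB p : B p *m (B p)^T = 1%:M.
  by rewrite /B trmxK; apply: mulmx1C; exact: sectorm_orth.
pose F p x := f (x *m B p); have sF p : smooth (F p) by exact: smooth_orth.
have back p (y : R4) : sproj (pt4 (sector p y)) *m B p = sproj (pt4 y).
  by rewrite pt4_sector sproj_orth ?sectorm_orth// -mulmxA sectorm_orth mulmx1.
have ballS p y : ball4 (sector p y) = ball4 y.
  by rewrite /ball4 /= pt4_sector enorm_orth// sectorm_orth.
have patchm (D : set R4) (h : R4 -> \bar R) : measurable D -> measurable_fun D h ->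
    measurable_fun setT (h \_ D) by move=> mD mh; apply/(measurable_restrictT _ mD).
have eN p : (\int[leb4]_(y in ball4) (energy (F p) (sproj (pt4 y)))%:E <= N%:E)%E.
  apply: le_trans hN; rewrite integral_mkcond [leRHS]integral_mkcond.
  have [_ pr] := preserves_sector p; rewrite -pr; last 2 first.
  - apply: patchm => //; apply/measurable_EFinP; apply: smooth_measurable.
    exact: smooth_energy.
  - by move=> y; rewrite patchE; case: ifP => // _; rewrite lee_fin energy_ge0.
  rewrite le_eqVlt; apply/orP; left; apply/eqP; apply: eq_integral => y _.
  rewrite !patchE (_ : (sector p y \in ball4) = (y \in ball4)); last first.
    by apply/idP/idP; rewrite !inE ballS.
  case: ifPn => // /set_mem yB; rewrite energy_orth// ?back//.
  by apply: S3_nz; apply: S3_sproj; apply: ball4_nz; rewrite ballS.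
pose H p := (fun y => (F p (sproj (pt4 y)) ^+ 6)%:E) \_ (cone 0 1).
have cnz (y : R4) : cone 0 1 y -> pt4 y != 0.
  case=> /andP[h _] _ _ _; apply/eqP => y0; have [h0 _ _ _] := pt4_coord y.
  by move: h; rewrite -h0 y0 mxE ltxx.
have mH p : measurable_fun setT (H p).
  apply: patchm => //; apply/measurable_EFinP; apply: measurable_funX.
  by apply: (measurable_off0 (F := radial (F p))) => //; exact: Ck_cont (sF p 0%N).
have H0 p y : (0 <= H p y)%E.
  by rewrite /H patchE; case: ifP => // _; rewrite lee_fin exprn_even_ge0.
have HI p : (\int[leb4]_y H p (sector p y) <= (17%:R ^+ 3 * (256%:R * N) ^+ 3)%:E)%E.
  have [_ pr] := preserves_sector p; rewrite (pr (H p) (mH p) (H0 p)).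
  rewrite /H -integral_mkcond; exact: (cone_sobolev (sF p) N0 (eN p)).
have msec p : measurable_fun setT (H p \o sector p).
  by apply: measurableT_comp => //; have [] := preserves_sector p.
rewrite integral_mkcond.
apply: (@le_trans _ _ (\int[leb4]_y \sum_(p : 'I_4 * bool) H p (sector p y))%E).
  apply: ge0_le_integral => //.
  - by move=> y _; rewrite patchE; case: ifP => // _; rewrite lee_fin exprn_even_ge0.
  - apply: patchm => //; apply/measurable_EFinP; apply: measurable_funX.
    exact: smooth_measurable.
  - by apply: emeasurable_sum => p; exact: msec.
  - move=> y _; rewrite patchE; case: ifPn => [/set_mem yB|_]; last first.
      by apply: sume_ge0 => p _; exact: H0.
    have [p hp] := sector_cover yB; rewrite (bigD1 p)//=.
    rewrite -[leLHS]adde0; apply: leeD; last by apply: sume_ge0 => q _; exact: H0.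
    by rewrite /H patchE mem_set// /F back.
rewrite ge0_integral_sum//.
apply: le_trans (lee_sum _ (fun p _ => HI p)) _.
rewrite sumEFin lee_fin sumr_const card_prod card_ord card_bool.
by rewrite -[leLHS](mulr_natl _ 8).
Qed.

Variable g : V -> 'M[R]_4.
Hypothesis hg : riemannian_metric g.
Hypothesis hR : forall x, S3 x -> 0 < scalar_curvature g x.
Local Notation e := (frame g).

Lemma euler f (x : V) : smooth f -> x != 0 -> \sum_i x 0 i * pd i f x = 0.
Proof.
move=> sf x0; have [ex val] := radial_derive x sf x0; rewrite -val.
have nz t : 0 < t -> t *: x + 0 != 0 by move=> t0; rewrite addr0 scaler_eq0 negb_or gt_eqF.
have ex1 : derivable (radial f) (1 *: x + 0) x by rewrite scale1r addr0.
have [_ h] := line_derive ex1.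
have : 'D_1 (fun s : R => radial f (s *: x + 0)) 1 = 'D_1 (cst (radial f x)) (1 : R).
  apply: near_eq_derive; near=> t; rewrite addr0 /radial /= sprojZ//.
  by near: t; exact: lt_nbhsr.
by rewrite h derive_cst scale1r addr0.
Unshelve. all: by end_near. Qed.

Definition hnorm2 f : R := int_vol g (fun x => \sum_a dalong (e a) f x ^+ 2
  + scalar_curvature g x / 8%:R * f x ^+ 2).

(** The vector e_i - x_i x is the tangential projection of e_i; the normal part contributes nothing
    by Euler's identity. *)
Lemma pd_frame i f x : smooth f -> S3 x ->
  pd i f x = \sum_c gip g x (ei i - x 0 i *: x) (e c x) * dalong (e c) f x.
Proof.
move=> sf xS; have t0 : dot x (ei i - x 0 i *: x) = 0.
  rewrite dotBr dotZr S3_dot// mulr1 dotE (bigD1 i)//= big1 ?addr0.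
    by rewrite !mxE !eqxx mulr1 subrr.
  by move=> j ji; rewrite !mxE (negbTE ji) andbF mulr0.
rewrite -(dalong_comb (X := fun=> ei i - x 0 i *: x) sf xS (frame_expand hg xS t0)).
rewrite dalongE//; under eq_bigr => j _ do rewrite !mxE mulrBl.
rewrite sumrB (bigD1 i)//= big1 ?addr0.
  rewrite eqxx mul1r; under eq_bigr => j _ do rewrite -mulrA.
  by rewrite -mulr_sumr (euler sf (S3_nz xS)) mulr0 subr0.
by move=> j ji; rewrite (negbTE ji) mul0r.
Qed.

Lemma cs3 (s t : 'I_3 -> R) :
  (\sum_c s c * t c) ^+ 2 <= 3%:R * (\sum_c s c * s c) * \sum_c t c ^+ 2.
Proof.
rewrite !sum3E; move: (s 0) (s 1) (s 2%:R) (t 0) (t 1) (t 2%:R) => a b c u v w.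
rewrite -subr_ge0.
have -> : 3%:R * (a * a + b * b + c * c) * (u ^+ 2 + v ^+ 2 + w ^+ 2)
   - (a * u + b * v + c * w) ^+ 2 =
  2%:R * (a ^+ 2 + b ^+ 2 + c ^+ 2) * (u ^+ 2 + v ^+ 2 + w ^+ 2)
  + ((a * v - b * u) ^+ 2 + (a * w - c * u) ^+ 2 + (b * w - c * v) ^+ 2) by ring.
by rewrite addr_ge0 ?mulr_ge0 ?addr_ge0 ?sqr_ge0.
Qed.

Lemma energy_bound : exists2 C, 0 < C & forall f x, smooth f -> S3 x ->
  energy f x <= C * (\sum_a dalong (e a) f x ^+ 2 + scalar_curvature g x / 8%:R * f x ^+ 2).
Proof.
have [m m0 hm] := smooth_pos_bound (smooth_scalar_curvature hg) hR.
pose co i c x := gip g x (ei i - x 0 i *: x) (e c x).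
have sco i c : smooth (co i c).
  apply: (smooth_ip hg (X := fun x => ei i - x 0 i *: x)); last exact: smooth_frame.
  apply: smooth_fieldB; first by move=> j; exact: smooth_cst.
  by apply: smooth_fieldZ; [exact: smooth_coord|exact: smooth_coord].
have [A A0 hA] := smooth_bounded (smooth_sum (index_enum 'I_4) (fun i =>
  smooth_sum (index_enum 'I_3) (fun c => smoothM (sco i c) (sco i c)))).
exists (3%:R * A + 8%:R / m) => [|f x sf xS].
  by rewrite addr_gt0 ?mulr_gt0 ?invr_gt0.
pose D := \sum_a dalong (e a) f x ^+ 2; have D0 : 0 <= D.
  by apply: sumr_ge0 => a _; exact: sqr_ge0.
have h1 : \sum_i pd i f x ^+ 2 <= 3%:R * A * D.
  have hi i : pd i f x ^+ 2 <= 3%:R * (\sum_c co i c x * co i c x) * D.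
    by rewrite (pd_frame i sf xS); exact: (cs3 (fun c => co i c x)).
  apply: le_trans (ler_sum _ (fun i _ => hi i)) _.
  rewrite -mulr_suml -mulr_sumr ler_wpM2r// ler_wpM2l//.
  exact: le_trans (ler_norm _) (hA x xS).
have h2 : f x ^+ 2 <= 8%:R / m * (scalar_curvature g x / 8%:R * f x ^+ 2).
  have -> : 8%:R / m * (scalar_curvature g x / 8%:R * f x ^+ 2) =
    scalar_curvature g x / m * f x ^+ 2 by field; rewrite gt_eqF.
  by rewrite ler_peMl ?sqr_ge0// ler_pdivlMr// mul1r hm.
have h3 : 0 <= scalar_curvature g x / 8%:R * f x ^+ 2.
  by rewrite mulr_ge0 ?sqr_ge0// divr_ge0// ltW// hR.
rewrite /energy -/D; apply: le_trans (lerD h2 h1) _.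
rewrite [leRHS]mulrDl [leRHS]addrC; apply: lerD.
  by rewrite ler_wpM2l ?lerDr// divr_ge0// ltW.
by rewrite ler_wpM2l ?lerDl// !mulr_ge0// ltW.
Qed.

(** By compactness of the sphere the round energy is bounded by the g-energy ([energy_bound]), and
    the volume density lies between positive constants, so [ball_sobolev] transfers to g. *)
Theorem sobolev : exists2 C, 0 < C & forall f, smooth f ->
  int_vol g (fun x => f x ^+ 6) <= C * hnorm2 f ^+ 3.
Proof.
have sw := smooth_vol_density hg; have w0 := vol_density_gt0 hg.
have [Ce Ce0 hCe] := energy_bound.
have [W W0 hW] := smooth_bounded sw; have [m m0 hm] := smooth_pos_bound sw w0.
pose K : R := (Ce / m / 4%:R).
have K0 : 0 < K by rewrite !divr_gt0.
exists (4%:R * (W * (8%:R * (17%:R ^+ 3 * (256%:R * K) ^+ 3)))).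
  exact: mulr_gt0 (ltr0Sn _ _) (mulr_gt0 W0 (mulr_gt0 (ltr0Sn _ _)
    (mulr_gt0 (exprn_gt0 _ (ltr0Sn _ _)) (exprn_gt0 _ (mulr_gt0 (ltr0Sn _ _) K0))))).
move=> f sf.
pose q x := \sum_a dalong (e a) f x ^+ 2 + scalar_curvature g x / 8%:R * f x ^+ 2.
have sq : smooth q.
  apply: smoothD; last apply: smoothM.
  - apply: smooth_sum => a; apply: smooth_ext (smoothM (smooth_dalong (smooth_frame hg a) sf)
      (smooth_dalong (smooth_frame hg a) sf)) => x _; exact: expr2.
  - by apply: smoothM; [exact: smooth_scalar_curvature|exact: smooth_cst].
  - by apply: smooth_ext (smoothM sf sf) => x _; rewrite expr2.
have q0 x : S3 x -> 0 <= q x.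
  move=> xS; rewrite addr_ge0 ?sumr_ge0//; first by move=> a _; exact: sqr_ge0.
  by rewrite mulr_ge0 ?sqr_ge0// divr_ge0// ltW// hR.
have Q0 : 0 <= hnorm2 f by apply: int_vol_ge0.
have hN : (\int[leb4]_(y in ball4) (energy f (sproj (pt4 y)))%:E <= (K * hnorm2 f)%:E)%E.
  have Jq := smooth_integrable_vol sw sq.
  have -> : K * hnorm2 f = Ce / m * (hnorm2 f / 4%:R) by rewrite /K; field; rewrite gt_eqF.
  rewrite EFinM -[X in (_ * X)%E](int_vol_EFin Jq).
  have mq : measurable_fun ball4 (fun y => (q (sproj (pt4 y)) * vol_density g (sproj (pt4 y)))%:E).
    by apply: measurable_wt => //; exact: smooth_measurable.
  have Km0 : 0 <= Ce / m by rewrite divr_ge0 ?ltW.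
  have mB := @measurable_ball4 R.
  have nn y : ball4 y -> (0 <= (q (sproj (pt4 y)) * vol_density g (sproj (pt4 y)))%:E)%E.
    by move=> /ball4_S3 yS; rewrite lee_fin mulr_ge0 ?q0// ltW// w0.
  rewrite -ge0_integralZl_EFin//; apply: ge0_le_integral => //.
  - by move=> y _; rewrite lee_fin energy_ge0.
  - by apply/measurable_EFinP; apply: smooth_measurable; exact: smooth_energy.
  - exact: measurable_funeM.
  - move=> y /ball4_S3; move: (sproj _) => x xS; rewrite -EFinM lee_fin.
    apply: le_trans (hCe f x sf xS) _.
    have -> : Ce / m * (q x * vol_density g x) = Ce * q x * (vol_density g x / m).
      by field; rewrite gt_eqF.
    rewrite ler_peMr//; first by rewrite mulr_ge0 ?q0// ltW.
    by rewrite ler_pdivlMr// mul1r hm.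
have h6 := ball_sobolev sf (mulr_ge0 (ltW K0) Q0) hN.
have m6 : measurable_S3 (fun x => f x ^+ 6) by apply: measurable_S3X; exact: smooth_measurable.
have mB := @measurable_ball4 R.
have nn y : ball4 y -> (0 <= (f (sproj (pt4 y)) ^+ 6)%:E)%E.
  by move=> _; rewrite lee_fin exprn_even_ge0.
have mE6 : measurable_fun ball4 (fun y => (f (sproj (pt4 y)) ^+ 6)%:E).
  exact/measurable_EFinP.
set b := (8%:R * _) in h6.
have key : (\int[leb4]_(y in ball4) (f (sproj (pt4 y)) ^+ 6 * vol_density g (sproj (pt4 y)))%:E
    <= (4%:R * (W * b) / 4%:R)%:E)%E.
  have -> : 4%:R * (W * b) / 4%:R = W * b by rewrite mulrAC mulfV ?mul1r.
  rewrite EFinM; apply: le_trans (lee_wpmul2l _ h6); last by rewrite lee_fin ltW.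
  have W0' := ltW W0; rewrite -ge0_integralZl_EFin//; apply: ge0_le_integral => //.
  - by move=> y /ball4_S3 yS; rewrite lee_fin mulr_ge0 ?exprn_even_ge0// ltW// w0.
  - exact: (measurable_wt sw m6).
  - exact: measurable_funeM.
  - move=> y /ball4_S3 yS; rewrite -EFinM lee_fin mulrC ler_wpM2r ?exprn_even_ge0//.
    exact: le_trans (ler_norm _) (hW _ yS).
have p6 x : S3 x -> 0 <= f x ^+ 6 by move=> _; rewrite exprn_even_ge0.
have [_ h] := ge0_integrable_vol sw w0 m6 p6 key.
apply: (le_trans h); rewrite /b le_eqVlt; apply/orP; left; apply/eqP.
move: (hnorm2 f) => t; rewrite [(256%:R * (K * t)) ^+ 3]exprMn [(K * t) ^+ 3]exprMn.
by rewrite [(256%:R * K) ^+ 3]exprMn !mulrA.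
Qed.

End SphereSobolevInequality.

                                            

(** * Spinors in real components and symmetry of the Dirac operator *)

Section RealSpinors.
Context {R : realType}.
Local Notation V := 'rV[R]_4.
Local Notation spinor := (V -> 'cV[R[i]]_2).
Implicit Types (s t : 'cV[R[i]]_2).

Definition scmp s (j : nat) : R :=
  match j with
  | 0 => complex.Re (s 0 0) | 1 => complex.Im (s 0 0)
  | 2 => complex.Re (s 1 0) | _ => complex.Im (s 1 0)
  end.

Definition cmp (psi : spinor) (j : nat) : V -> R := fun x => scmp (psi x) j.

Lemma sum2E (A : nmodType) (f : 'I_2 -> A) : \sum_a f a = f 0 + f 1.
Proof.
by rewrite !big_ord_recr big_ord0/= add0r; congr (f _ + f _); apply: val_inj.
Qed.

Lemma ReD (a b : R[i]) : complex.Re (a + b) = complex.Re a + complex.Re b.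
Proof. by case: a; case: b. Qed.
Lemma ImD (a b : R[i]) : complex.Im (a + b) = complex.Im a + complex.Im b.
Proof. by case: a; case: b. Qed.
Lemma ReM (a b : R[i]) : complex.Re (a * b) =
  complex.Re a * complex.Re b - complex.Im a * complex.Im b.
Proof. by case: a; case: b. Qed.
Lemma ImM (a b : R[i]) : complex.Im (a * b) =
  complex.Re a * complex.Im b + complex.Im a * complex.Re b.
Proof. by case: a => ? ?; case: b. Qed.

Lemma Re_herm s t : complex.Re (herm s t) = dt (scmp s) (scmp t).
Proof.
rewrite /herm sum2E ReD !ReM /dt /scmp.
by case: (t 0 0) => a b; case: (t 1 0) => c d /=; ring.
Qed.

Lemma Im_herm s t : complex.Im (herm s t) = dt (scmp s) (scmp ('i%C *: t)).
Proof.
rewrite /herm sum2E ImD !ImM /dt /scmp !mxE !ReM !ImM.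
by case: (t 0 0) => a b; case: (t 1 0) => c d /=; ring.
Qed.

Lemma sqnormE s : sqnorm s = dt (scmp s) (scmp s).
Proof. exact: Re_herm. Qed.

Lemma scmpD s t j : scmp (s + t) j = scmp s j + scmp t j.
Proof. by case: j => [|[|[|j]]]; rewrite /scmp mxE ?ReD ?ImD. Qed.

Lemma scmpZ (a : R) s j : scmp (a%:C%C *: s) j = a * scmp s j.
Proof. by case: j => [|[|[|j]]]; rewrite /scmp mxE ?ReM ?ImM /= mul0r ?subr0 ?addr0. Qed.

Lemma scmpN s j : scmp (- s) j = - scmp s j.
Proof.
have -> : - s = (-1)%:C%C *: s by rewrite rmorphN1 scaleN1r.
by rewrite scmpZ mulN1r.
Qed.

Lemma scmpB s t j : scmp (s - t) j = scmp s j - scmp t j.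
Proof. by rewrite scmpD scmpN. Qed.

Lemma scmp0 j : scmp 0 j = 0.
Proof. by rewrite -(scale0r 0) -[0]/(0%:C%C) scmpZ mul0r. Qed.

Lemma scmp_sum (T : Type) (r : seq T) (F : T -> 'cV[R[i]]_2) j :
  scmp (\sum_(i <- r) F i) j = \sum_(i <- r) scmp (F i) j.
Proof. by elim/big_rec2: _ => [|i y z _ <-]; rewrite ?scmp0 ?scmpD. Qed.

Lemma scmp_cliff (n : nat) s j : (n < 3)%N ->
  scmp (cliff (i3 n) *m s) j = qg n (scmp s) j.
Proof.
have e0 (A : 'M[R[i]]_2) i : (A *m s) i 0 = A i 0 * s 0 0 + A i 1 * s 1 0.
  by rewrite mxE sum2E.
case: n => [|[|[|//]]] _; case: j => [|[|[|j]]];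
  rewrite /scmp /= e0 !mxE /= ?ReD ?ImD !(ReM, ImM) /=; ring.
Qed.

Variable g : V -> 'M[R]_4.
Hypothesis hg : riemannian_metric g.
Local Notation e := (frame g).
Local Notation I := (int_vol g).
Local Notation dirac := Defs.dirac.
Let sw := smooth_vol_density hg.
Let w0 := vol_density_gt0 hg.

Lemma cmp_smooth (phi : spinor) : smooth_spinor phi -> forall j, smooth (cmp phi j).
Proof.
move=> sp j; have [r0 m0] := sp 0; have [r1 m1] := sp 1.
by case: j => [|[|[|j]]].
Qed.

Lemma cmp_sdalong (X : V -> V) (phi : spinor) x j :
  scmp (sdalong X phi x) j = dalong X (cmp phi j) x.
Proof. by case: j => [|[|[|j]]]; rewrite /scmp mxE. Qed.

(** Skewness removes the diagonal terms, and e_b e_c is plus or minus the third unit for distinct b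
    and c. *)
Lemma spin_algebra (o : nat -> nat -> R) (s : nat -> R) j :
  (forall b c, o b c = - o c b) ->
  4%:R^-1 * sm3 (fun b => sm3 (fun c => o b c * qg b (qg c s) j)) =
  cconn (fun k => match k with 0 => o 1 2 | 1 => o 2 0 | _ => o 0 1 end)%N s j.
Proof.
move=> oA; have o0 b : o b b = 0 by have := oA b b; lra.
rewrite /cconn /sm3 !o0 (oA 1 0)%N (oA 2 1)%N (oA 0 2)%N.
by case: j => [|[|[|j]]] /=; field.
Qed.

Lemma spin_nablaE (n : nat) (phi : spinor) x j : (n < 3)%N -> S3 x ->
  scmp (spin_nabla g (e (i3 n)) phi x) j = nabs g (cmp phi) n j x.
Proof.
move=> n3 xS; rewrite /spin_nabla scmpD cmp_sdalong /nabs; congr (_ + _).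
have -> : (4%:R^-1 : R[i]) = (4%:R^-1 : R)%:C%C by rewrite fmorphV rmorph_nat.
rewrite scmpZ scmp_sum sum_sm3.
apply: etrans (spin_algebra (o := fun b c => om g (i3 n) (i3 b) (i3 c) x) _ _
  (fun b c => om_anti g (i3 n) (i3 b) (i3 c) x)).
congr (_ * _); apply: sm3_eq => b b3; rewrite scmp_sum sum_sm3; apply: sm3_eq => c c3.
rewrite scmpZ -mulmxA scmp_cliff//; congr (_ * _); first exact: levi_civita_frame_gip.
by congr qg; apply/funext => i; exact: scmp_cliff.
Qed.

Lemma cmp_dirac (phi : spinor) j x : S3 x ->
  cmp (dirac g phi) j x = dirs g (cmp phi) j x.
Proof.
move=> xS; rewrite /cmp /dirac scmp_sum sum_sm3 /dirs /cdir; apply: sm3_eq => n n3.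
rewrite scmp_cliff//; congr qg; apply/funext => i; exact: spin_nablaE.
Qed.

Lemma smooth_dirac (phi : spinor) : smooth_spinor phi ->
  forall j, smooth (cmp (dirac g phi) j).
Proof.
move=> sp j; apply: smooth_ext (smooth_dirs hg j (cmp_smooth sp)) => x xS.
by rewrite cmp_dirac.
Qed.

(** The connection terms of both sides combine into the divergence of the frame, the missing
    zeroth-order part of an exact divergence. *)
Lemma dirac_skew (F H : nat -> nat -> R) (f h : nat -> R) (b : nat -> nat -> R) :
  let N P q a i := P a i + cconn (b a) q i in
  let c i j k := oab b i j k - oab b j i k in
  dt (cdir (N F f)) h - dt f (cdir (N H h)) =
  sm3 (fun a => dt (qg a (F a)) h + dt (qg a f) (H a)
                + sm3 (fun k => c k a k) * dt (qg a f) h).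
Proof. by rewrite /= /cdir /cconn /dt /oab /sm3 /=; field. Qed.

(** The difference of the two integrands is the divergence of the field with components <e_a . phi,
    chi>. *)
Lemma dirac_symmetric (phi chi : spinor) : smooth_spinor phi -> smooth_spinor chi ->
  I (fun x => dt (scmp (dirac g phi x)) (scmp (chi x))) =
  I (fun x => dt (scmp (phi x)) (scmp (dirac g chi x))).
Proof.
move=> sp sc; have sp' := cmp_smooth sp; have sc' := cmp_smooth sc.
have J f : smooth f -> integrable_vol g f by exact: smooth_integrable_vol.
have s1 := smooth_dt (smooth_dirac sp) sc'; have s2 := smooth_dt sp' (smooth_dirac sc).
apply/eqP; rewrite -subr_eq0; apply/eqP.
apply: etrans (esym (int_volB (J _ s1) (J _ s2))) _.
pose Z a x := dt (fun i => qg a ((cmp phi)^~ x) i) ((cmp chi)^~ x).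
have sZ a : smooth (Z a).
  by apply: (@smooth_dt _ (fun i x => qg a ((cmp phi)^~ x) i)) => // j; exact: smooth_qg.
pose W a x := dalong (e (i3 a)) (Z a) x + fdiv g (i3 a) x * Z a x.
have sW a : smooth (W a).
  apply: smoothD; first by apply: smooth_dalong => //; exact: smooth_frame.
  by apply: smoothM => //; exact: smooth_fdiv.
have -> : I (fun x => dt (fun j => cmp (dirac g phi) j x) ((cmp chi)^~ x)
    - dt ((cmp phi)^~ x) (fun j => cmp (dirac g chi) j x)) =
    I (fun x => W 0%N x + W 1%N x + W 2%N x).
  apply: int_vol_ext => x xS.
  have -> : (fun j => cmp (dirac g phi) j x) = (dirs g (cmp phi))^~ x.
    by apply/funext => j; exact: cmp_dirac.
  have -> : (fun j => cmp (dirac g chi) j x) = (dirs g (cmp chi))^~ x.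
    by apply/funext => j; exact: cmp_dirac.
  apply: (etrans (dirac_skew (fun a i => dalong (e (i3 a)) (cmp phi i) x)
    (fun a i => dalong (e (i3 a)) (cmp chi i) x) ((cmp phi)^~ x) ((cmp chi)^~ x)
    (fun a k => bet g a k x))).
  apply: (@sm3_eq _ _ (W^~ x)) => a a3; rewrite /W /Z.
  rewrite (dalong_dt (e (i3 a)) (F := fun i x => qg a ((cmp phi)^~ x) i))//; last first.
    by move=> j; exact: smooth_qg.
  congr (dt _ _ + _ + _ * _).
    by apply/funext => i; rewrite dalong_qg.
  rewrite /fdiv sum_sm3; apply: sm3_eq => k k3.
  by rewrite !oab_bet// om_torsion.
have z b : I (W b) = 0 by exact: frame_divergence.
have s01 := smoothD (sW 0%N) (sW 1%N).
have e1 : I (fun x => W 0%N x + W 1%N x) = 0 :=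
  etrans (int_volD (J _ (sW 0%N)) (J _ (sW 1%N)))
    (etrans (congr2 +%R (z 0%N) (z 1%N)) (addr0 0)).
exact: etrans (int_volD (J _ s01) (J _ (sW 2%N)))
  (etrans (congr2 +%R e1 (z 2%N)) (addr0 0)).
Qed.

End RealSpinors.

(** * Spectral gap and product estimate for the Dirac operator *)

Section DiracEstimates.
Context {R : realType}.
Local Notation V := 'rV[R]_4.
Local Notation spinor := (V -> 'cV[R[i]]_2).
Implicit Types (f h : V -> R).

(** With C = B / t, the difference of the two sides is a nonnegative multiple of (A - C)^2 (2 A +
    C). With a suitable t this serves as Hölder's inequality with exponents 3/2 and 3. *)
Lemma young3 (A B t : R) : 0 <= A -> 0 <= B -> 0 < t ->
  A ^+ 2 * B <= (2%:R * t * A ^+ 3 + t ^- 2 * B ^+ 3) / 3%:R.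
Proof.
move=> A0 B0 t0; pose C := B / t; have C0 : 0 <= C by rewrite divr_ge0// ltW.
have -> : B = C * t by rewrite /C divfK// gt_eqF.
rewrite -subr_ge0; have -> : (2%:R * t * A ^+ 3 + t ^- 2 * (C * t) ^+ 3) / 3%:R
  - A ^+ 2 * (C * t) = t * ((A - C) ^+ 2 * (2%:R * A + C)) / 3%:R.
  by field; rewrite gt_eqF.
have h : 0 <= 2%:R * A + C by rewrite addr_ge0// mulr_ge0.
exact: divr_ge0 (mulr_ge0 (ltW t0) (mulr_ge0 (sqr_ge0 _) h)) (ler0n _ _).
Qed.

Variable g : V -> 'M[R]_4.
Hypothesis hg : riemannian_metric g.
Hypothesis hR : forall x, S3 x -> 0 < scalar_curvature g x.
Local Notation e := (frame g).
Local Notation I := (int_vol g).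
Local Notation J := (integrable_vol g).
Local Notation dirac := Defs.dirac.
Let sw := smooth_vol_density hg.
Let w0 := vol_density_gt0 hg.

Definition nrm (psi : spinor) : R := I (fun x => dt (scmp (psi x)) (scmp (psi x))).

Lemma dt_ge0 (s : nat -> R) : 0 <= dt s s.
Proof. by rewrite /dt !addr_ge0// -expr2 sqr_ge0. Qed.

(** [young3] with t = b / a makes the two L^6 contributions two thirds and one third of a^2 b. *)
Lemma sobolev_product : exists2 C, 0 < C & forall f h (a b : R), smooth f -> smooth h ->
  0 < a -> 0 < b -> hnorm2 g f <= a -> hnorm2 g h <= b ->
  I (fun x => f x ^+ 4 * h x ^+ 2) <= C * (a ^+ 2 * b).
Proof.
have [C C0 hC] := sobolev hg hR; exists C => // f h a b sf sh a0 b0 fa hb.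
have sX (k : V -> R) n : smooth k -> smooth (fun x => k x ^+ n).
  move=> sk; elim: n => [|n IH]; first by apply: smooth_ext (smooth_cst 1) => x _; rewrite expr0.
  by apply: smooth_ext (smoothM sk IH) => x _; rewrite exprS.
have Jf := smooth_integrable_vol sw (sX _ 6%N sf).
have Jh := smooth_integrable_vol sw (sX _ 6%N sh).
pose t := b / a; have t0 : 0 < t by rewrite divr_gt0.
have H0 k : 0 <= hnorm2 g k.
  apply: int_vol_ge0 => // x xS; rewrite addr_ge0 ?sumr_ge0// => [c _|]; first exact: sqr_ge0.
  by rewrite mulr_ge0 ?sqr_ge0// divr_ge0// ltW// hR.
have lef : I (fun x => f x ^+ 6) <= C * a ^+ 3.
  apply: le_trans (hC f sf) _; rewrite ler_wpM2l ?(ltW C0)//.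
  by apply: lerXn2r => //; rewrite nnegrE ?H0// ltW.
have leh : I (fun x => h x ^+ 6) <= C * b ^+ 3.
  apply: le_trans (hC h sh) _; rewrite ler_wpM2l ?(ltW C0)//.
  by apply: lerXn2r => //; rewrite nnegrE ?H0// ltW.
have c1 : 0 <= 2%:R * t / 3%:R by rewrite divr_ge0// mulr_ge0// ltW.
have c2 : 0 <= t ^- 2 / 3%:R by rewrite divr_ge0// invr_ge0 sqr_ge0.
have J1 := integrable_volZ (2%:R * t / 3%:R) Jf.
have J2 := integrable_volZ (t ^- 2 / 3%:R) Jh.
apply: (@le_trans _ _ (I (fun x => 2%:R * t / 3%:R * f x ^+ 6 + t ^- 2 / 3%:R * h x ^+ 6))).
  apply: int_vol_le => //.
  - by apply: smooth_integrable_vol => //; apply: smoothM; exact: sX.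
  - exact: integrable_volD.
  - move=> x _; have := young3 (sqr_ge0 (f x)) (sqr_ge0 (h x)) t0.
    by rewrite -!exprM => /le_trans; apply; rewrite le_eqVlt; apply/orP; left; apply/eqP; ring.
rewrite (int_volD J1 J2) (int_volZ _ Jf) (int_volZ _ Jh).
apply: le_trans (lerD (ler_wpM2l c1 lef) (ler_wpM2l c2 leh)) _.
rewrite le_eqVlt; apply/orP; left; apply/eqP; rewrite /t.
by field; rewrite !gt_eqF.
Qed.

Definition hn4 (phi : spinor) : R := hnorm2 g (cmp phi 0) + hnorm2 g (cmp phi 1)
  + hnorm2 g (cmp phi 2) + hnorm2 g (cmp phi 3).

Lemma cconn_sqr (b s : nat -> R) : dt (cconn b s) (cconn b s) =
  (b 0%N ^+ 2 + b 1%N ^+ 2 + b 2%N ^+ 2) / 4%:R * dt s s.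
Proof. by rewrite /cconn /sm3 /dt /=; field. Qed.

Lemma shift_young (N b s : nat -> R) :
  dt (fun j => N j - cconn b s j) (fun j => N j - cconn b s j) <=
  2%:R * dt N N + (b 0%N ^+ 2 + b 1%N ^+ 2 + b 2%N ^+ 2) / 2%:R * dt s s.
Proof.
pose c := cconn b s; have -> : (b 0%N ^+ 2 + b 1%N ^+ 2 + b 2%N ^+ 2) / 2%:R * dt s s
  = 2%:R * dt c c by rewrite cconn_sqr; field.
rewrite -subr_ge0; have -> : 2%:R * dt N N + 2%:R * dt c c
  - dt (fun j => N j - c j) (fun j => N j - c j) =
  dt (fun j => N j + c j) (fun j => N j + c j) by rewrite /dt; ring.
exact: dt_ge0.
Qed.

Lemma sum_young (p0 p1 p2 n0 n1 n2 b0 b1 b2 F B : R) :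
  p0 <= 2%:R * n0 + b0 / 2%:R * F -> p1 <= 2%:R * n1 + b1 / 2%:R * F ->
  p2 <= 2%:R * n2 + b2 / 2%:R * F -> b0 + b1 + b2 <= B -> 0 <= F ->
  p0 + p1 + p2 <= 2%:R * (n0 + n1 + n2) + B / 2%:R * F.
Proof.
move=> h0 h1 h2 hb F0; apply: le_trans (lerD (lerD h0 h1) h2) _.
rewrite -subr_ge0; have -> : 2%:R * (n0 + n1 + n2) + B / 2%:R * F -
  (2%:R * n0 + b0 / 2%:R * F + (2%:R * n1 + b1 / 2%:R * F) + (2%:R * n2 + b2 / 2%:R * F))
  = (B - (b0 + b1 + b2)) / 2%:R * F by ring.
by rewrite mulr_ge0// divr_ge0// subr_ge0.
Qed.

Lemma combine_bounds (p a r bf v C : R) : p <= 2%:R * a + bf -> bf <= v * r ->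
  0 <= a -> 0 <= r -> 3%:R <= C -> v + 2^-1 <= C -> p + r / 2%:R <= C * (a + r).
Proof.
move=> h1 h2 a0 r0 h3 h4.
have l1 : 3%:R * a <= C * a by rewrite ler_wpM2r.
have l2 : v * r + r / 2%:R <= C * r.
  have -> : v * r + r / 2%:R = (v + 2^-1) * r by ring.
  by rewrite ler_wpM2r.
have -> : C * (a + r) = C * a + C * r by ring.
by move: l1 l2 h1 h2; move: (C * a) (C * r) (v * r) => x y z l1 l2 h1 h2; lra.
Qed.

Lemma nrm_dirac (phi : spinor) : smooth_spinor phi ->
  nrm (dirac g phi) = I (fun x => sm3 (fun a => dt ((nabs g (cmp phi) a)^~ x)
     ((nabs g (cmp phi) a)^~ x)) + scalar_curvature g x / 4%:R * dt (scmp (phi x)) (scmp (phi x))).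
Proof.
move=> sp; apply: etrans (lichnerowicz hg (cmp_smooth sp)); apply: int_vol_ext => x xS.
by congr (dt _ _); apply/funext => j; exact: cmp_dirac.
Qed.

(** Positive curvature is bounded below on the compact sphere, so the Lichnerowicz formula controls
    both |phi|^2 and |nabla phi|^2. Passing from nabla to frame derivatives of components costs a
    bounded connection term, absorbed by the curvature term. *)
Lemma dirac_lower : exists2 C, 0 < C & forall phi : spinor, smooth_spinor phi ->
  nrm phi <= C * nrm (dirac g phi) /\ hn4 phi <= C * nrm (dirac g phi).
Proof.
have sR := smooth_scalar_curvature hg.
have [m m0 hm] := smooth_pos_bound sR hR.
have sb2 a k : smooth (fun x => bet g a k x ^+ 2).
  by apply: smooth_ext (smoothM (smooth_bet hg a k) (smooth_bet hg a k)) => x _; rewrite expr2.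
pose bb a x := bet g a 0%N x ^+ 2 + bet g a 1%N x ^+ 2 + bet g a 2%N x ^+ 2.
have sbb a : smooth (bb a) by do 2 (apply: smoothD => //).
have bb0 a x : 0 <= bb a x by rewrite !addr_ge0 ?sqr_ge0.
have [B B0 hB] := smooth_bounded (smoothD (smoothD (sbb 0%N) (sbb 1%N)) (sbb 2%N)).
pose C := 4%:R / m + 3%:R + B * 2%:R / m.
have C1 : 3%:R <= C.
  by rewrite /C addrAC lerDr addr_ge0// divr_ge0// ?mulr_ge0// ltW.
have C2 : 4%:R / m <= C.
  by rewrite /C -addrA lerDl addr_ge0// divr_ge0// ?mulr_ge0// ltW.
have C0 : 0 < C by apply: lt_le_trans C1.
exists C => // phi sp; have sc := cmp_smooth sp.
have J' f : smooth f -> J f by exact: smooth_integrable_vol.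
pose F x := dt (scmp (phi x)) (scmp (phi x)).
pose A x := sm3 (fun a => dt ((nabs g (cmp phi) a)^~ x) ((nabs g (cmp phi) a)^~ x)).
have sF : smooth F by exact: (smooth_dt sc sc).
have sA : smooth A.
  apply: (@smooth_sm3 _ (fun a x => dt ((nabs g (cmp phi) a)^~ x) ((nabs g (cmp phi) a)^~ x))) => a.
  by apply: smooth_dt => j; exact: smooth_nabs.
have A0 x : 0 <= A x by apply: addr_ge0; [apply: addr_ge0|]; exact: dt_ge0.
have F0 x : 0 <= F x by exact: dt_ge0.
have sR4 : smooth (fun x => scalar_curvature g x / 4%:R * F x).
  by apply: smoothM => //; apply: smoothM => //; exact: smooth_cst.
have sT := smoothD sA sR4.
have FR x : S3 x -> F x <= 4%:R / m * (scalar_curvature g x / 4%:R * F x).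
  move=> xS; have -> : 4%:R / m * (scalar_curvature g x / 4%:R * F x) =
    scalar_curvature g x / m * F x by field; rewrite gt_eqF.
  by rewrite ler_peMl// ler_pdivlMr// mul1r hm.
have R0 x : S3 x -> 0 <= scalar_curvature g x / 4%:R * F x.
  by move=> xS; rewrite mulr_ge0// divr_ge0// ltW// hR.
rewrite (nrm_dirac sp) -(int_volZ C (J' _ sT)); split.
  apply: int_vol_le => //; [exact: J'|exact/integrable_volZ/J'|move=> x xS].
  apply: le_trans (FR x xS) _; apply: le_trans (ler_wpM2r (R0 x xS) C2) _.
  by rewrite ler_wpM2l ?(ltW C0)// lerDr.
have sq f : smooth f -> smooth (fun x => \sum_a dalong (e a) f x ^+ 2
    + scalar_curvature g x / 8%:R * f x ^+ 2).
  move=> sf; apply: smoothD; last apply: smoothM.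
  - apply: smooth_sum => a; apply: smooth_ext (smoothM (smooth_dalong (smooth_frame hg a) sf)
      (smooth_dalong (smooth_frame hg a) sf)) => x _; exact: expr2.
  - by apply: smoothM => //; exact: smooth_cst.
  - by apply: smooth_ext (smoothM sf sf) => x _; rewrite expr2.
pose q j x := \sum_a dalong (e a) (cmp phi j) x ^+ 2
    + scalar_curvature g x / 8%:R * cmp phi j x ^+ 2.
have sqj j : smooth (q j) := sq _ (sc j).
have s01 := smoothD (sqj 0%N) (sqj 1%N); have s02 := smoothD s01 (sqj 2%N).
have -> : hn4 phi = I (fun x => q 0%N x + q 1%N x + q 2%N x + q 3%N x).
  rewrite /hn4; apply: esym.
  apply: etrans (int_volD (J' _ s02) (J' _ (sqj 3%N))) _; congr (_ + _).
  apply: etrans (int_volD (J' _ s01) (J' _ (sqj 2%N))) _; congr (_ + _).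
  exact: (int_volD (J' _ (sqj 0%N)) (J' _ (sqj 1%N))).
apply: int_vol_le => //; [exact/J'/smoothD|exact/integrable_volZ/J'|move=> x xS].
pose P a j := dalong (e (i3 a)) (cmp phi j) x.
have -> : q 0%N x + q 1%N x + q 2%N x + q 3%N x =
    sm3 (fun a => dt (P a) (P a)) + scalar_curvature g x / 8%:R * F x.
  rewrite /q !sum3E /sm3 /dt /P /F /dt /cmp /i3.
  move: (scmp (phi x)) => s.
  have al (a0 a1 a2 b0 b1 b2 c0 c1 c2 d0 d1 d2 r s0 s1 s2 s3 : R) :
    a0 ^+ 2 + a1 ^+ 2 + a2 ^+ 2 + r * s0 ^+ 2 + (b0 ^+ 2 + b1 ^+ 2 + b2 ^+ 2 + r * s1 ^+ 2)
    + (c0 ^+ 2 + c1 ^+ 2 + c2 ^+ 2 + r * s2 ^+ 2) + (d0 ^+ 2 + d1 ^+ 2 + d2 ^+ 2 + r * s3 ^+ 2) =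
    (a0 * a0 + b0 * b0 + c0 * c0 + d0 * d0) + (a1 * a1 + b1 * b1 + c1 * c1 + d1 * d1)
    + (a2 * a2 + b2 * b2 + c2 * c2 + d2 * d2) + r * (s0 * s0 + s1 * s1 + s2 * s2 + s3 * s3) by ring.
  exact: al.
have Pa a : dt (P a) (P a) <= 2%:R * dt ((nabs g (cmp phi) a)^~ x) ((nabs g (cmp phi) a)^~ x)
    + bb a x / 2%:R * F x.
  have -> : P a = fun j => nabs g (cmp phi) a j x - cconn ((bet g a)^~ x) ((cmp phi)^~ x) j.
    by apply/funext => j; rewrite /nabs addrK.
  exact: shift_young.
have hBx : bb 0%N x + bb 1%N x + bb 2%N x <= B by exact: le_trans (ler_norm _) (hB x xS).
have hP' : sm3 (fun a => dt (P a) (P a)) <= 2%:R * A x + B / 2%:R * F x.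
  exact: sum_young (Pa 0%N) (Pa 1%N) (Pa 2%N) hBx (F0 x).
have hF : B / 2%:R * F x <= B * 2%:R / m * (scalar_curvature g x / 4%:R * F x).
  have -> : B * 2%:R / m = B / 2%:R * (4%:R / m) by field; rewrite gt_eqF.
  by rewrite -[leRHS]mulrA ler_wpM2l ?FR// divr_ge0// ltW.
have -> : scalar_curvature g x / 8%:R * F x = (scalar_curvature g x / 4%:R * F x) / 2%:R by field.
have C3 : B * 2%:R / m + 2^-1 <= C.
  rewrite /C; have : 0 <= 4%:R / m by rewrite divr_ge0// ltW.
  by move: (4%:R / m) (B * 2%:R / m) => u v u0; lra.
exact: combine_bounds hP' hF (A0 x) (R0 x xS) C1 C3.
Qed.

(** [sobolev_product] applied to each real component of phi, whose H^1 norms [dirac_lower] bounds by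
    the norm of D phi. *)
Theorem dirac_product : exists2 K, 0 < K & forall f (phi : spinor) (a : R), smooth f ->
  smooth_spinor phi -> 0 < a -> hnorm2 g f <= a ->
  I (fun x => f x ^+ 4 * dt (scmp (phi x)) (scmp (phi x))) <= K * a ^+ 2 * nrm (dirac g phi).
Proof.
have [C C0 hC] := sobolev_product; have [D D0 hD] := dirac_lower.
exists (4%:R * C * D) => [|f phi a sf sp a0 fa]; first by rewrite !mulr_gt0.
have sc := cmp_smooth sp; have [_ hD4] := hD _ sp.
have J' k : smooth k -> J k by exact: smooth_integrable_vol.
have s4 j : smooth (fun x => f x ^+ 4 * cmp phi j x ^+ 2).
  apply: smooth_ext (smoothM (smoothM (smoothM sf sf) (smoothM sf sf)) (smoothM (sc j) (sc j))) => x _.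
  by ring.
have H0 k : 0 <= hnorm2 g k.
  apply: int_vol_ge0 => // x xS; rewrite addr_ge0 ?sumr_ge0// => [c _|]; first exact: sqr_ge0.
  by rewrite mulr_ge0 ?sqr_ge0// divr_ge0// ltW// hR.
have h0 : 0 <= hn4 phi by rewrite !addr_ge0.
have each b : 0 < b -> hn4 phi <= b ->
    I (fun x => f x ^+ 4 * dt (scmp (phi x)) (scmp (phi x))) <= 4%:R * (C * (a ^+ 2 * b)).
  move=> b0 hb; have hj j : (j < 4)%N -> hnorm2 g (cmp phi j) <= b.
    move=> j4; apply: le_trans hb; rewrite /hn4.
    have := H0 (cmp phi 0%N); have := H0 (cmp phi 1%N); have := H0 (cmp phi 2%N).
    have := H0 (cmp phi 3%N).
    case: j j4 => [|[|[|[|//]]]] _;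
      move: (hnorm2 g (cmp phi 0%N)) (hnorm2 g (cmp phi 1%N))
        (hnorm2 g (cmp phi 2%N)) (hnorm2 g (cmp phi 3%N)) => *; lra.
  have Ij j : (j < 4)%N -> I (fun x => f x ^+ 4 * cmp phi j x ^+ 2) <= C * (a ^+ 2 * b).
    by move=> j4; apply: hC => //; exact: hj.
  have s01 := smoothD (s4 0%N) (s4 1%N); have s02 := smoothD s01 (s4 2%N).
  have -> : I (fun x => f x ^+ 4 * dt (scmp (phi x)) (scmp (phi x))) =
      I (fun x => f x ^+ 4 * cmp phi 0%N x ^+ 2 + f x ^+ 4 * cmp phi 1%N x ^+ 2
        + f x ^+ 4 * cmp phi 2%N x ^+ 2 + f x ^+ 4 * cmp phi 3%N x ^+ 2).
    by apply: int_vol_ext => x _; rewrite /dt /cmp !mulrDr -!expr2.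
  rewrite (int_volD (J' _ s02) (J' _ (s4 3%N))) (int_volD (J' _ s01) (J' _ (s4 2%N))).
  rewrite (int_volD (J' _ (s4 0%N)) (J' _ (s4 1%N))).
  have := lerD (lerD (lerD (Ij 0%N isT) (Ij 1%N isT)) (Ij 2%N isT)) (Ij 3%N isT).
  move/le_trans; apply; rewrite le_eqVlt; apply/orP; left; apply/eqP; ring.
have K1 : 0 < 4%:R * (C * a ^+ 2) by rewrite !mulr_gt0// exprn_gt0.
apply/ler_addgt0Pr => d d0.
(* [hn4 phi] may vanish, whereas [sobolev_product] asks for a positive bound; the excess contributes
   exactly d. *)
pose b := hn4 phi + d / (4%:R * (C * a ^+ 2)).
have b0 : 0 < b by rewrite ltr_wpDl// divr_gt0.
apply: le_trans (each b b0 _) _; first by rewrite lerDl divr_ge0// ltW.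
have -> : 4%:R * (C * (a ^+ 2 * b)) = 4%:R * (C * a ^+ 2) * hn4 phi + d.
  by rewrite /b; field; rewrite !gt_eqF.
rewrite lerD2r; apply: le_trans (ler_wpM2l (ltW K1) hD4) _.
by rewrite le_eqVlt; apply/orP; left; apply/eqP; ring.
Qed.

End DiracEstimates.

                                        

(** * The real Hilbert space of square-integrable spinors *)

Section SpinorL2.
Context {R : realType}.
Local Notation V := 'rV[R]_4.
Local Notation spinor := (V -> 'cV[R[i]]_2).
Implicit Types (s t : 'cV[R[i]]_2) (psi phi chi : spinor).

Lemma dtC (s t : nat -> R) : dt s t = dt t s.
Proof. rewrite /dt; ring. Qed.

Lemma dtBl (s t u : nat -> R) : dt (fun j => s j - t j) u = dt s u - dt t u.
Proof. rewrite /dt; ring. Qed.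

Lemma dtZl (a : R) (s u : nat -> R) : dt (fun j => a * s j) u = a * dt s u.
Proof. rewrite /dt; ring. Qed.

Lemma dt_abs (s t : nat -> R) : `|dt s t| <= dt s s + dt t t.
Proof.
have h1 := dt_ge0 (fun j => s j + t j); have h2 := dt_ge0 (fun j => s j - t j).
have p1 := dt_ge0 s; have p2 := dt_ge0 t.
have e1 : dt (fun j => s j + t j) (fun j => s j + t j) = dt s s + dt t t + 2%:R * dt s t.
  by rewrite /dt; ring.
have e2 : dt (fun j => s j - t j) (fun j => s j - t j) = dt s s + dt t t - 2%:R * dt s t.
  by rewrite /dt; ring.
move: h1 h2 p1 p2; rewrite e1 e2 ler_norml; move: (dt s s) (dt t t) (dt s t) => *.
by apply/andP; split; lra.
Qed.

Lemma dtB_le (s t : nat -> R) :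
  dt (fun j => s j - t j) (fun j => s j - t j) <= 2%:R * (dt s s + dt t t).
Proof.
have h := dt_ge0 (fun j => s j + t j); rewrite -subr_ge0.
by have -> : 2%:R * (dt s s + dt t t) - dt (fun j => s j - t j) (fun j => s j - t j)
  = dt (fun j => s j + t j) (fun j => s j + t j) by rewrite /dt; ring.
Qed.

Lemma scmpBE s t : scmp (s - t) = fun j => scmp s j - scmp t j.
Proof. by apply/funext => j; exact: scmpB. Qed.

Lemma scmpZE (a : R) s : scmp (a%:C%C *: s) = fun j => a * scmp s j.
Proof. by apply/funext => j; exact: scmpZ. Qed.

Lemma dt_iskew s t : dt (scmp ('i%C *: s)) (scmp t) = - dt (scmp s) (scmp ('i%C *: t)).
Proof. by rewrite /dt /scmp !mxE !ReM !ImM /=; ring. Qed.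

Lemma dt_iiso s t : dt (scmp ('i%C *: s)) (scmp ('i%C *: t)) = dt (scmp s) (scmp t).
Proof. by rewrite /dt /scmp !mxE !ReM !ImM /=; ring. Qed.

Variable g : V -> 'M[R]_4.
Hypothesis hg : riemannian_metric g.
Local Notation I := (int_vol g).
Local Notation J := (integrable_vol g).
Local Notation L := (L2spinor g).
Local Notation dirac := Defs.dirac.
Let sw := smooth_vol_density hg.
Let w0 := vol_density_gt0 hg.

Definition ipr phi psi : R := I (fun x => dt (scmp (phi x)) (scmp (psi x))).

Lemma L2P psi : L psi <-> (forall j, measurable_S3 (cmp psi j)) /\
  J (fun x => dt (scmp (psi x)) (scmp (psi x))).
Proof.
have E : (fun x => sqnorm (psi x)) = (fun x => dt (scmp (psi x)) (scmp (psi x))).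
  by apply/funext => x; exact: sqnormE.
rewrite /L2spinor E; split=> -[m j]; split=> //.
  have [a b] := m 0; have [c d] := m 1.
  by case=> [|[|[|k]]].
move=> k; have [->|->] : k = 0 \/ k = 1.
- by case: k => -[|[|//]] p; [left|right]; exact: val_inj.
- by split; [exact: (m 0%N)|exact: (m 1%N)].
- by split; [exact: (m 2%N)|exact: (m 3%N)].
Qed.

Lemma measurable_dt phi psi : (forall j, measurable_S3 (cmp phi j)) ->
  (forall j, measurable_S3 (cmp psi j)) ->
  measurable_S3 (fun x => dt (scmp (phi x)) (scmp (psi x))).
Proof.
move=> mp mq; do 3 (apply: measurable_S3D; last by apply: measurable_S3M; [exact: mp|exact: mq]).
by apply: measurable_S3M; [exact: mp|exact: mq].
Qed.

Lemma integrable_dt phi psi : L phi -> L psi -> J (fun x => dt (scmp (phi x)) (scmp (psi x))).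
Proof.
move=> /L2P[mp jp] /L2P[mq jq].
apply: (integrable_vol_le sw _ _ (integrable_volD jp jq)).
  exact: measurable_dt.
by move=> x _; exact: dt_abs.
Qed.

Lemma L2_dom phi (h : V -> R) : (forall j, measurable_S3 (cmp phi j)) -> J h ->
  (forall x, S3 x -> dt (scmp (phi x)) (scmp (phi x)) <= h x) -> L phi.
Proof.
move=> mp jh le; apply/L2P; split=> //; apply: (integrable_vol_le sw _ _ jh).
  exact: measurable_dt.
by move=> x xS; rewrite ger0_norm ?dt_ge0// le.
Qed.

Lemma L2_0 : L 0.
Proof.
apply: (L2_dom (h := fun=> 0)) => [j| |x _].
- have -> : cmp 0 j = (fun _ : V => 0 : R) by apply/funext => x; exact: scmp0.
  exact: measurable_S3_cst.
- exact: integrable_vol0.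
- by rewrite /dt -[(0 : spinor) x]/0 !scmp0 !mulr0 !addr0.
Qed.

Lemma L2_B phi psi : L phi -> L psi -> L (phi - psi).
Proof.
move=> lp lq; have [mp jp] := (L2P phi).1 lp; have [mq jq] := (L2P psi).1 lq.
apply: (L2_dom _ (integrable_volZ 2%:R (integrable_volD jp jq))) => [j|x _].
  have -> : cmp (phi - psi) j = (fun x => cmp phi j x - cmp psi j x).
    by apply/funext => x; exact: scmpB.
  by apply: measurable_S3B; [exact: mp|exact: mq].
by rewrite -[(phi - psi) x]/(phi x - psi x) scmpBE; exact: dtB_le.
Qed.

Definition mulw (w : V -> R) psi : spinor := fun x => (w x)%:C%C *: psi x.

Lemma L2_mulw w psi (C : R) : measurable_S3 w -> (forall x, S3 x -> `|w x| <= C) ->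
  L psi -> L (mulw w psi).
Proof.
move=> mw wC lp; have [mp jp] := (L2P psi).1 lp.
apply: (L2_dom _ (integrable_volZ (C ^+ 2) jp)) => [j|x xS].
  have -> : cmp (mulw w psi) j = (fun x => w x * cmp psi j x).
    by apply/funext => x; exact: scmpZ.
  by apply: measurable_S3M => //; exact: mp.
rewrite /mulw scmpZE dtZl dtC dtZl mulrA -expr2 ler_wpM2r ?dt_ge0//.
rewrite -[w x ^+ 2]real_normK ?num_real//; apply: lerXn2r; rewrite ?nnegrE ?wC//.
exact: le_trans (normr_ge0 _) (wC _ xS).
Qed.

Lemma L2_Z (t : R) psi : L psi -> L (t%:C%C *: psi).
Proof.
by apply: (@L2_mulw (fun=> t) psi `|t|) => //; exact: measurable_S3_cst.
Qed.

Lemma L2_i psi : L psi -> L ('i%C *: psi).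
Proof.
move=> lp; have [mp jp] := (L2P psi).1 lp.
apply: (L2_dom _ jp) => [j|x _]; last by rewrite -[('i%C *: psi) x]/('i%C *: psi x) dt_iiso.
have mN k : measurable_S3 (fun x => - cmp psi k x).
  apply: measurable_S3_ext (measurable_S3B (measurable_S3_cst 0) (mp k)) => x _.
  by rewrite sub0r.
have -> : cmp ('i%C *: psi) j = match j with 0 => fun x => - cmp psi 1 x
    | 1 => cmp psi 0 | 2 => fun x => - cmp psi 3 x | _ => cmp psi 2 end%N.
  apply/funext => x; rewrite /cmp -[('i%C *: psi) x]/('i%C *: psi x).
  by case: j => [|[|[|j]]]; rewrite /scmp mxE ?ReM ?ImM /= ?mul0r ?mul1r ?sub0r ?add0r.
by case: j => [|[|[|j]]].
Qed.

Lemma iprBl x y z : L x -> L y -> L z -> ipr (x - y) z = ipr x z - ipr y z.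
Proof.
move=> lx ly lz; rewrite -(int_volB (integrable_dt lx lz) (integrable_dt ly lz)).
by apply: int_vol_ext => v _; rewrite -[(x - y) v]/(x v - y v) scmpBE dtBl.
Qed.

Lemma iprZl (t : R) x y : L x -> L y -> ipr (t%:C%C *: x) y = t * ipr x y.
Proof.
move=> lx ly; rewrite -(int_volZ t (integrable_dt lx ly)).
by apply: int_vol_ext => v _; rewrite -[(t%:C%C *: x) v]/(t%:C%C *: x v) scmpZE dtZl.
Qed.

Lemma iprC x y : ipr x y = ipr y x.
Proof. by apply: int_vol_ext => v _; exact: dtC. Qed.

Lemma ipr_ge0 x : 0 <= ipr x x.
Proof. by apply: int_vol_ge0 => // v _; exact: dt_ge0. Qed.

(** Along a subsequence with squared increments below 8^(-k), the quantitative Riesz-Fischer theorem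
    applies to each of the four real components. *)
Lemma L2_complete (u : nat -> spinor) : (forall n, L (u n)) ->
  (forall e, 0 < e -> exists n0, forall n m, (n0 <= n)%N -> (n0 <= m)%N ->
     ipr (u n - u m) (u n - u m) < e) ->
  exists2 l, L l & forall e, 0 < e -> exists n0, forall n, (n0 <= n)%N ->
     ipr (u n - l) (u n - l) < e.
Proof.
move=> lu cu.
have ex k : exists n, forall m p, (n <= m)%N -> (n <= p)%N ->
    ipr (u m - u p) (u m - u p) < (8%:R ^+ k)^-1.
  by apply: cu; rewrite invr_gt0 exprn_gt0.
pose a k := xget 0%N [set n | forall m p, (n <= m)%N -> (n <= p)%N ->
    ipr (u m - u p) (u m - u p) < (8%:R ^+ k)^-1].
have aP k : forall m p, (a k <= m)%N -> (a k <= p)%N ->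
    ipr (u m - u p) (u m - u p) < (8%:R ^+ k)^-1.
  by have [n hn] := ex k; exact: (@xgetPex _ 0%N [set n | _] (ex k)).
(* The running maximum makes the extracted indices nondecreasing. *)
pose b k := \max_(i < k.+1) a i.
have ab k : (a k <= b k)%N by exact: (@leq_bigmax_cond _ xpredT (fun i : 'I_k.+1 => a i) ord_max).
have bS k : (b k <= b k.+1)%N by rewrite /b [leqRHS]big_ord_recr leq_maxl.
pose F j k := cmp (u (b k)) j.
have mF j k : measurable_S3 (F j k) by have [m _] := (L2P _).1 (lu (b k)); exact: m.
have cle s t j : (j < 4)%N -> (scmp s j - scmp t j) ^+ 2 <= dt (scmp (s - t)) (scmp (s - t)).
  move=> j4; rewrite scmpBE /dt -!expr2.
  have := sqr_ge0 (scmp s 0%N - scmp t 0%N); have := sqr_ge0 (scmp s 1%N - scmp t 1%N).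
  have := sqr_ge0 (scmp s 2%N - scmp t 2%N); have := sqr_ge0 (scmp s 3%N - scmp t 3%N).
  case: j j4 => [|[|[|[|//]]]] _;
   move: ((scmp s 0%N - scmp t 0%N) ^+ 2) ((scmp s 1%N - scmp t 1%N) ^+ 2)
    ((scmp s 2%N - scmp t 2%N) ^+ 2) ((scmp s 3%N - scmp t 3%N) ^+ 2) => *; lra.
have JF j k : (j < 4)%N -> J (fun x => (F j k.+1 x - F j k x) ^+ 2).
  move=> j4; have lB := L2_B (lu (b k.+1)) (lu (b k)).
  apply: (integrable_vol_le sw _ _ (integrable_dt lB lB)).
    by apply: measurable_S3X; exact: measurable_S3B.
  by move=> x _; rewrite ger0_norm ?sqr_ge0//; exact: cle.
have IF j k : (j < 4)%N -> I (fun x => (F j k.+1 x - F j k x) ^+ 2) <= (8%:R ^+ k)^-1.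
  move=> j4; have lB := L2_B (lu (b k.+1)) (lu (b k)).
  apply: (@le_trans _ _ (ipr (u (b k.+1) - u (b k)) (u (b k.+1) - u (b k)))).
    apply: int_vol_le => //; [exact: JF|exact: integrable_dt|].
    by move=> x _; exact: cle.
  by apply/ltW/aP; [exact: leq_trans (ab k) (bS k)|exact: ab].
have V j (j4 : (j < 4)%N) := vol_lim_L2 sw w0 (mF j) (fun k => JF j k j4) (fun k => IF j k j4).
pose v j := vol_lim g (F j).
pose l : spinor := fun x => \col_(k < 2) (if k == 0 then (v 0%N x +i* v 1%N x)%C
   else (v 2%N x +i* v 3%N x)%C).
have lE j x : (j < 4)%N -> scmp (l x) j = v j x.
  by case: j => [|[|[|[|//]]]] _; rewrite /scmp mxE.
have lE4 x k : dt (scmp (u (b k) x - l x)) (scmp (u (b k) x - l x)) =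
   (F 0 k x - v 0 x) ^+ 2 + (F 1 k x - v 1 x) ^+ 2 + (F 2 k x - v 2 x) ^+ 2
   + (F 3 k x - v 3 x) ^+ 2.
  by rewrite scmpBE /dt !lE// !expr2.
have ml j : measurable_S3 (cmp l j).
  have h k (k4 : (k < 4)%N) : measurable_S3 (cmp l k).
    have [mv _] := V k k4; apply: measurable_S3_ext mv => x _; exact/esym/lE.
  by case: j => [|[|[|j]]]; [exact: h|exact: h|exact: h|exact: (h 3%N)].
have Jd j k (j4 : (j < 4)%N) : J (fun x => (F j k x - v j x) ^+ 2).
  by have [_ /(_ k)[]] := V j j4.
have Id j k (j4 : (j < 4)%N) : I (fun x => (F j k x - v j x) ^+ 2) <= 32%:R / 4%:R ^+ k.
  by have [_ /(_ k)[]] := V j j4.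
have J4 k := integrable_volD (integrable_volD (integrable_volD (Jd 0%N k isT) (Jd 1%N k isT))
  (Jd 2%N k isT)) (Jd 3%N k isT).
have ldiff k : L (u (b k) - l).
  apply: (L2_dom _ (J4 k)) => [j|x _]; last by rewrite -[(_ - l) x]/(u (b k) x - l x) lE4.
  have -> : cmp (u (b k) - l) j = (fun x => cmp (u (b k)) j x - cmp l j x).
    by apply/funext => x; exact: scmpB.
  by apply: measurable_S3B => //; exact: mF.
have Ll : L l.
  have -> : l = u (b 0%N) - (u (b 0%N) - l) by rewrite opprB addrC subrK.
  exact: L2_B.
have Nk k : ipr (u (b k) - l) (u (b k) - l) <= 128%:R / 4%:R ^+ k.
  have -> : ipr (u (b k) - l) (u (b k) - l) = I (fun x => (F 0 k x - v 0 x) ^+ 2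
     + (F 1 k x - v 1 x) ^+ 2 + (F 2 k x - v 2 x) ^+ 2 + (F 3 k x - v 3 x) ^+ 2).
    by apply: int_vol_ext => x _; rewrite -[(_ - l) x]/(u (b k) x - l x) lE4.
  have J2 := integrable_volD (Jd 0%N k isT) (Jd 1%N k isT).
  have J3 := integrable_volD J2 (Jd 2%N k isT).
  rewrite (int_volD J3 (Jd 3%N k isT)) (int_volD J2 (Jd 2%N k isT)).
  rewrite (int_volD (Jd 0%N k isT) (Jd 1%N k isT)).
  have := lerD (lerD (lerD (Id 0%N k isT) (Id 1%N k isT)) (Id 2%N k isT)) (Id 3%N k isT).
  move/le_trans; apply; rewrite le_eqVlt; apply/orP; left; apply/eqP.
  by rewrite -!mulrDl -!natrD.
exists l => // d d0.
have [k hk] : exists k, (128%:R : R) / 4%:R ^+ k < d / 4%:R /\ (8%:R ^+ k)^-1 < d / 4%:R.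
  have c (q : R) (A : R) : `|q| < 1 -> A * q ^+ n @[n --> \oo] --> (0 : R).
    by move=> q1; rewrite -[X in _ --> X](mulr0 A); apply: cvgM; [exact: cvg_cst|exact: cvg_expr].
  have c1 := @c 4%:R^-1 128%:R; have c2 := @c 8%:R^-1 1.
  have q1 : `|4%:R^-1 : R| < 1 by rewrite ger0_norm ?invr_ge0// invf_lt1// ltr1n.
  have q2 : `|8%:R^-1 : R| < 1 by rewrite ger0_norm ?invr_ge0// invf_lt1// ltr1n.
  have d4 : 0 < d / 4%:R by rewrite divr_gt0.
  have [n1 _ h1] := (cvgrPdist_lt _ _).1 (c1 q1) _ d4.
  have [n2 _ h2] := (cvgrPdist_lt _ _).1 (c2 q2) _ d4.
  exists (maxn n1 n2); split.
    have := h1 (maxn n1 n2) (leq_maxl _ _).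
    by rewrite /= sub0r normrN ger0_norm ?mulr_ge0 ?exprn_ge0 ?invr_ge0// exprVn.
  have := h2 (maxn n1 n2) (leq_maxr _ _).
  by rewrite /= sub0r normrN ger0_norm ?mulr_ge0 ?exprn_ge0 ?invr_ge0// mul1r exprVn.
case: hk => hk1 hk2; exists (b k) => n bn.
have lx := L2_B (lu n) (lu (b k)); have ly := ldiff k; have lz := L2_B (lu n) Ll.
have h1 : ipr (u n - u (b k)) (u n - u (b k)) < d / 4%:R.
  by apply: lt_trans hk2; apply: aP; [exact: leq_trans (ab k) bn|exact: ab].
have h2 : ipr (u (b k) - l) (u (b k) - l) < d / 4%:R by exact: le_lt_trans (Nk k) hk1.
apply: (@le_lt_trans _ _ (2%:R * (ipr (u n - u (b k)) (u n - u (b k)) + ipr (u (b k) - l) (u (b k) - l)))).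
  rewrite -(int_volD (integrable_dt lx lx) (integrable_dt ly ly)) -int_volZ; last first.
    by apply: integrable_volD; exact: integrable_dt.
  apply: int_vol_le => //; first exact: integrable_dt.
    by apply: integrable_volZ; apply: integrable_volD; exact: integrable_dt.
  move=> x _; have -> : (u n - l) x = (u n - u (b k)) x - - (u (b k) - l) x.
    by rewrite opprK -[RHS]/(u n x - u (b k) x + (u (b k) x - l x)) addrA subrK.
  rewrite scmpBE; apply: le_trans (dtB_le _ _) _.
  rewrite ler_wpM2l// lerD2l /dt !scmpN !mulrNN.
  exact: lexx.
by move: h1 h2; move: (ipr _ _) (ipr _ _) => p q; lra.
Qed.

Lemma multiplier_mulw w (C : R) : measurable_S3 w -> (forall x, S3 x -> 0 <= w x <= C) ->
  multiplier L ipr (mulw w).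
Proof.
move=> mw wC; have wC' x : S3 x -> `|w x| <= C.
  by move=> /wC/andP[w1 w2]; rewrite ger0_norm.
split.
- by move=> x lx; exact: L2_mulw wC' lx.
- move=> x y lx ly; apply: int_vol_ext => v _; rewrite /mulw !scmpZE dtZl.
  by rewrite [RHS]dtC dtZl dtC.
- move=> x lx; apply: int_vol_ge0 => // v vS; rewrite /mulw scmpZE dtZl mulr_ge0 ?dt_ge0//.
  by case/andP: (wC _ vS).
- exists (C ^+ 2); first exact: sqr_ge0.
  move=> x lx; have lM := L2_mulw mw wC' lx.
  rewrite -(int_volZ _ (integrable_dt lx lx)); apply: int_vol_le => //.
  + exact: integrable_dt.
  + exact/integrable_volZ/integrable_dt.
  + move=> v vS; rewrite /mulw scmpZE dtZl dtC dtZl mulrA -expr2 ler_wpM2r ?dt_ge0//.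
    by have /andP[w1 w2] := wC _ vS; apply: lerXn2r; rewrite ?nnegrE// (le_trans w1).
Qed.

Lemma Re_L2dot phi psi : complex.Re (L2dot g phi psi) = ipr phi psi.
Proof. by apply: int_vol_ext => x _; exact: Re_herm. Qed.

Lemma Im_L2dot phi psi : complex.Im (L2dot g phi psi) = ipr phi ('i%C *: psi).
Proof. by apply: int_vol_ext => x _; exact: Im_herm. Qed.

Lemma L2sqnormE psi : L2sqnorm g psi = ipr psi psi.
Proof. by apply: int_vol_ext => x _; exact: sqnormE. Qed.

Lemma ipr_iskew phi psi : L phi -> L psi -> ipr ('i%C *: phi) psi = - ipr phi ('i%C *: psi).
Proof.
move=> lp lq; rewrite -[RHS]mulN1r -(int_volZ _ (integrable_dt lp (L2_i lq))).
by apply: int_vol_ext => x _; rewrite mulN1r; exact: dt_iskew.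
Qed.

Lemma ipr_iiso phi psi : ipr ('i%C *: phi) ('i%C *: psi) = ipr phi psi.
Proof. by apply: int_vol_ext => x _; exact: dt_iiso. Qed.

Lemma L2dot_eq phi psi phi' psi' : ipr phi psi = ipr phi' psi' ->
  ipr phi ('i%C *: psi) = ipr phi' ('i%C *: psi') -> L2dot g phi psi = L2dot g phi' psi'.
Proof.
by move=> h1 h2; apply/eqP; rewrite eq_complex !Re_L2dot !Im_L2dot h1 h2 !eqxx.
Qed.

(** The imaginary part of a complex pairing with x' is the real pairing with i x'. The graph is
    stable under multiplication by i, so real symmetry against the whole graph implies complex
    symmetry. *)
Lemma selfadjoint_real A : self_adjoint g A -> selfadjoint L ipr A /\ dense_domain L ipr A.
Proof.
move=> [dA sA]; split; last first.
  move=> x e lx e0; have [x' [y' [h1 h2]]] := dA x e lx e0.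
  by exists x', y'; split=> //; move: h2; rewrite L2sqnormE.
have AL x y : A x y -> L x /\ L y by case/sA.
have Ai x y : A x y -> A ('i%C *: x) ('i%C *: y).
  move=> Axy; have [lx ly hxy] := (sA x y).1 Axy; apply/sA; split; [exact: L2_i|exact: L2_i|].
  move=> x' y' Axy'; have [lx' ly'] := AL _ _ Axy'; have E := hxy _ _ Axy'.
  apply: L2dot_eq; last by rewrite !ipr_iiso -!Re_L2dot E.
  by rewrite !ipr_iskew// -!Im_L2dot E.
move=> x y; split=> [Axy|[lx ly hxy]].
  have [lx ly hxy] := (sA x y).1 Axy; split=> // x' y' Axy'.
  by rewrite -!Re_L2dot (hxy _ _ Axy').
apply/sA; split=> // x' y' Axy'.
by apply: L2dot_eq; [exact: hxy|exact/hxy/Ai].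
Qed.

End SpinorL2.

(** * Closure of the Dirac operator and unbounded weights *)

Section SequenceBounds.
Context {R : realType}.

Lemma cvg0_lt (f : nat -> R) (d : R) : f n @[n --> \oo] --> (0 : R) -> 0 < d ->
  exists n0, forall n, (n0 <= n)%N -> f n < d.
Proof.
move=> cf d0; have [n0 _ h] := (cvgrPdist_lt _ _).1 cf _ d0.
exists n0 => n /h /=; rewrite sub0r normrN; exact/le_lt_trans/ler_norm.
Qed.

Lemma cvg0_le (f h : nat -> R) : (forall n, `|f n| <= h n) ->
  h n @[n --> \oo] --> (0 : R) -> f n @[n --> \oo] --> (0 : R).
Proof.
move=> fh ch; apply: (@squeeze_cvgr _ _ _ _ (fun n => - h n) h) => //.
  by apply: nearW => n; rewrite -ler_norml.
by rewrite -oppr0; exact: cvgN.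
Qed.

Lemma cvg0_comb (f h : nat -> R) (a b : R) : f n @[n --> \oo] --> (0 : R) ->
  h n @[n --> \oo] --> (0 : R) -> a * f n + b * h n @[n --> \oo] --> (0 : R).
Proof.
move=> cf ch; have -> : (0 : R) = a * 0 + b * 0 by rewrite !mulr0 addr0.
by apply: cvgD; apply: cvgM => //; exact: cvg_cst.
Qed.

Lemma cvg0D (f h : nat -> R) : f n @[n --> \oo] --> (0 : R) ->
  h n @[n --> \oo] --> (0 : R) -> f n + h n @[n --> \oo] --> (0 : R).
Proof. by move=> cf ch; have -> : (0 : R) = 0 + 0; [rewrite addr0|exact: cvgD]. Qed.

Lemma cvg0M (f h : nat -> R) : f n @[n --> \oo] --> (0 : R) ->
  h n @[n --> \oo] --> (0 : R) -> f n * h n @[n --> \oo] --> (0 : R).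
Proof. by move=> cf ch; have -> : (0 : R) = 0 * 0; [rewrite mulr0|exact: cvgM]. Qed.

Lemma le_small (A B C : R) : 0 <= C ->
  (forall d, 0 < d -> exists2 t, t < d & A <= B + C * t) -> A <= B.
Proof.
move=> C0 h; apply/ler_addgt0Pr => d d0.
have C1 : 0 < C + 1 by rewrite ltr_wpDl.
have [t td le] := h (d / (C + 1)) (divr_gt0 d0 C1).
apply: le_trans le _; rewrite lerD2l; apply: le_trans (ler_wpM2l C0 (ltW td)) _.
by rewrite mulrCA ler_piMr ?(ltW d0)// ler_pdivrMr// mul1r lerDl.
Qed.

(** With A the truncation of |v|, A^4 - |f|^4 factors through A - |f|, which is at most |f - v|, and
    t <= d + t^2 / d makes this error quadratic. It is then controlled by L^2 convergence of f to v
    alone. *)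
Lemma min4_le (v f N d : R) : 0 <= N -> 0 < d ->
  Num.min `|v| N ^+ 4 <= f ^+ 4 + 4%:R * N ^+ 3 * (d + (f - v) ^+ 2 / d).
Proof.
move=> N0 d0; have A0 : 0 <= Num.min `|v| N by rewrite le_min normr_ge0.
have AN : Num.min `|v| N <= N by rewrite ge_min lexx orbT.
have Av : Num.min `|v| N <= `|v| by rewrite ge_min lexx.
have f4 : `|f| ^+ 4 = f ^+ 4 by rewrite -normrX ger0_norm// exprn_even_ge0.
have N3 : 0 <= N ^+ 3 by rewrite exprn_ge0.
have q0 : 0 <= (f - v) ^+ 2 / d by rewrite divr_ge0 ?sqr_ge0// ltW.
move: A0 AN Av; move: (Num.min _ _) => A A0 AN Av; rewrite -f4.
have [Af|fA] := leP A `|f|.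
  apply: (@le_trans _ _ (`|f| ^+ 4)); first by apply: lerXn2r; rewrite ?nnegrE.
  by rewrite lerDl mulr_ge0 ?mulr_ge0// addr_ge0// ltW.
have hd : A - `|f| <= d + (f - v) ^+ 2 / d.
  have h1 : A - `|f| <= `|f - v|.
    by rewrite distrC; apply: le_trans (lerB Av (lexx _)) _; exact: lerB_dist.
  apply: le_trans h1 _; rewrite -[(f - v) ^+ 2]real_normK ?num_real//.
  have := normr_ge0 (f - v); move: `|f - v| => h h0.
  have [hd|dh] := leP h d; first by rewrite ler_wpDr// divr_ge0 ?sqr_ge0// ltW.
  rewrite ler_wpDl ?(ltW d0)// expr2 -mulrA ler_peMr// ler_pdivlMr// mul1r.
  exact: ltW.
have fN : `|f| <= N by exact: le_trans (ltW fA) AN.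
have pw (i j : nat) : (i + j)%N = 3%N -> A ^+ i * `|f| ^+ j <= N ^+ 3.
  move=> <-; rewrite exprD; apply: ler_pM; rewrite ?exprn_ge0//.
    by apply: lerXn2r; rewrite ?nnegrE.
  by apply: lerXn2r; rewrite ?nnegrE.
have h4 : A ^+ 3 + A ^+ 2 * `|f| + A * `|f| ^+ 2 + `|f| ^+ 3 <= 4%:R * N ^+ 3.
  have := pw 3%N 0%N erefl; have := pw 2%N 1%N erefl.
  have := pw 1%N 2%N erefl; have := pw 0%N 3%N erefl.
  rewrite !expr0 !expr1 mulr1 mul1r; lra.
have p0 : 0 <= A - `|f| by rewrite subr_ge0 ltW.
have -> : A ^+ 4 = `|f| ^+ 4 + (A ^+ 3 + A ^+ 2 * `|f| + A * `|f| ^+ 2 + `|f| ^+ 3)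
   * (A - `|f|) by ring.
rewrite lerD2l; apply: ler_pM => //.
by rewrite !addr_ge0 ?mulr_ge0 ?exprn_ge0.
Qed.

End SequenceBounds.

Lemma subr_subACA (W : zmodType) (a b c d : W) : a - b - (c - d) = (a - c) - (b - d).
Proof. by rewrite !opprB addrACA [RHS]addrACA [- c - b]addrC. Qed.

Section DiracClosure.
Context {R : realType}.
Local Notation V := 'rV[R]_4.
Local Notation spinor := (V -> 'cV[R[i]]_2).
Implicit Types (phi psi chi : spinor).

Lemma cconnB (b s t : nat -> R) i :
  cconn b (fun j => s j - t j) i = cconn b s i - cconn b t i.
Proof. by rewrite /cconn /sm3; case: i => [|[|[|i]]] /=; field. Qed.

Lemma cdirB (N N' : nat -> nat -> R) i :
  cdir (fun a j => N a j - N' a j) i = cdir N i - cdir N' i.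
Proof. by rewrite /cdir /sm3; case: i => [|[|[|i]]] /=; ring. Qed.

Lemma smooth_spinorB phi chi : smooth_spinor phi -> smooth_spinor chi ->
  smooth_spinor (phi - chi).
Proof.
move=> sp sc k; have [a b] := sp k; have [c d] := sc k; split.
  apply: smooth_ext (smoothB a c) => x _; rewrite /re_comp -[(phi - chi) x]/(phi x - chi x).
  by rewrite !mxE; case: (phi x k 0) (chi x k 0) => ? ? [].
apply: smooth_ext (smoothB b d) => x _; rewrite /im_comp -[(phi - chi) x]/(phi x - chi x).
by rewrite !mxE; case: (phi x k 0) (chi x k 0) => ? ? [].
Qed.

Variable g : V -> 'M[R]_4.
Hypothesis hg : riemannian_metric g.
Local Notation I := (int_vol g).
Local Notation J := (integrable_vol g).
Local Notation L := (L2spinor g).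
Local Notation ip := (ipr g).
Local Notation dirac := Defs.dirac.
Local Notation Dbar := (dirac_closure g).
Let sw := smooth_vol_density hg.
Let w0 := vol_density_gt0 hg.
Let LB := L2_B hg.
Let ip_ge0 x := ipr_ge0 hg x.
Let ipC := iprC g.

Lemma scmp_diracB phi chi x j : smooth_spinor phi -> smooth_spinor chi -> S3 x ->
  scmp (dirac g (phi - chi) x) j = scmp (dirac g phi x) j - scmp (dirac g chi x) j.
Proof.
move=> sp sc xS; have sp' := cmp_smooth sp; have sc' := cmp_smooth sc.
have D f : scmp (dirac g f x) j = dirs g (cmp f) j x by exact: (cmp_dirac hg).
apply: etrans (D _) _; apply: esym.
apply: etrans (congr2 (fun a b => a - b) (D phi) (D chi)) _; apply: esym.
rewrite /dirs -cdirB; congr (cdir _ j); apply/funext => a; apply/funext => i; rewrite /nabs.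
have E k y : cmp (phi - chi) k y = cmp phi k y - cmp chi k y by exact: scmpB.
have -> : dalong (frame g (i3 a)) (cmp (phi - chi) i) x =
    dalong (frame g (i3 a)) (fun y => cmp phi i y - cmp chi i y) x.
  by congr (dalong _ _ x); apply/funext => y.
rewrite (dalongB _ (sp' i) (sc' i) xS).
have -> : (fun k => cmp (phi - chi) k x) = (fun k => cmp phi k x - cmp chi k x).
  by apply/funext => k.
by rewrite cconnB; move: (dalong _ _ _) (dalong _ _ _) (cconn _ _ _) (cconn _ _ _) => *; ring.
Qed.

Lemma smooth_L2 psi : (forall j, smooth (cmp psi j)) -> L psi.
Proof.
move=> sp; apply/L2P; split=> [j|]; first exact: (smooth_measurable (sp j)).
apply: (smooth_integrable_vol sw); do 3 (apply: smoothD; last by apply: smoothM; exact: sp).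
by apply: smoothM; exact: sp.
Qed.

Lemma L2_smooth phi : smooth_spinor phi -> L phi.
Proof. by move=> sp; exact/smooth_L2/cmp_smooth. Qed.

Lemma L2_dirac phi : smooth_spinor phi -> L (dirac g phi).
Proof. by move=> sp; exact/smooth_L2/(smooth_dirac hg). Qed.

Lemma iprB_le a b : L a -> L b -> ip (a - b) (a - b) <= 2%:R * (ip a a + ip b b).
Proof.
move=> la lb; have j1 := integrable_dt hg la la; have j2 := integrable_dt hg lb lb.
rewrite -(int_volD j1 j2) -(int_volZ _ (integrable_volD j1 j2)).
apply: int_vol_le => //; first by apply: integrable_dt => //; exact: LB.
  exact/integrable_volZ/integrable_volD.
by move=> x _; rewrite -[(a - b) x]/(a x - b x) scmpBE; exact: dtB_le.
Qed.

Lemma ipr_cs a b : L a -> L b -> ip a b ^+ 2 <= ip a a * ip b b.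
Proof.
exact: (ip_cauchy_schwarz (L2_0 hg) LB (L2_Z hg) (iprBl hg) (iprZl hg)
  (fun x y _ _ => ipC x y) (fun x _ => ip_ge0 x)).
Qed.

Lemma ipr_abs a b : L a -> L b -> `|ip a b| <= Num.sqrt (ip a a) * Num.sqrt (ip b b).
Proof.
move=> la lb; rewrite -(sqrtrM (ip b b) (ip_ge0 a)) -sqrtr_sqr.
by rewrite ler_sqrt ?(mulr_ge0 (ip_ge0 a) (ip_ge0 b))//; exact: ipr_cs.
Qed.

Lemma ipr_cvg (a b : nat -> spinor) a0 b0 : (forall n, L (a n)) -> (forall n, L (b n)) ->
  L a0 -> L b0 -> ip (a n - a0) (a n - a0) @[n --> \oo] --> (0 : R) ->
  ip (b n - b0) (b n - b0) @[n --> \oo] --> (0 : R) ->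
  ip (a n) (b n) @[n --> \oo] --> ip a0 b0.
Proof.
move=> la lb la0 lb0 ca cb.
have sq (f : nat -> R) : f n @[n --> \oo] --> (0 : R) -> Num.sqrt (f n) @[n --> \oo] --> (0 : R).
  move=> cf; rewrite -[X in _ --> X]sqrtr0.
  exact: (cvg_comp _ _ cf (@sqrt_continuous R 0)).
have ca' := sq _ ca; have cb' := sq _ cb.
have E n : ip (a n) (b n) = ip (a n - a0) (b n - b0) + ip (a n - a0) b0 + ip a0 (b n - b0)
   + ip a0 b0.
  have h1 := LB (la n) la0; have h2 := LB (lb n) lb0.
  rewrite !(iprBl hg)// ![ip _ (b n - b0)]ipC !(iprBl hg)//.
  rewrite ![ip b0 _]ipC ![ip (b n) _]ipC.
  by move: (ip _ _) (ip _ _) (ip _ _) (ip _ _) => *; ring.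
have -> : (fun n => ip (a n) (b n)) = (fun n => (ip (a n - a0) (b n - b0)
   + ip (a n - a0) b0 + ip a0 (b n - b0)) + ip a0 b0) by apply/funext => n; exact: E.
rewrite -[X in _ --> X]add0r; apply: cvgD; last exact: cvg_cst.
apply: (@cvg0_le R _ (fun n => Num.sqrt (ip (a n - a0) (a n - a0)) * Num.sqrt (ip (b n - b0) (b n - b0))
   + (Num.sqrt (ip b0 b0) * Num.sqrt (ip (a n - a0) (a n - a0)) +
   Num.sqrt (ip a0 a0) * Num.sqrt (ip (b n - b0) (b n - b0))))) => [n|].
  have h1 := LB (la n) la0; have h2 := LB (lb n) lb0.
  rewrite -addrA; apply: le_trans (ler_normD _ _) _; apply: lerD; first exact: ipr_abs.
  apply: le_trans (ler_normD _ _) _; apply: lerD; last exact: ipr_abs.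
  by rewrite mulrC; exact: ipr_abs.
exact: (cvg0D (cvg0M ca' cb') (cvg0_comb (Num.sqrt (ip b0 b0)) (Num.sqrt (ip a0 a0)) ca' cb')).
Qed.

Lemma closureP x y : Dbar x y -> [/\ L x, L y & exists phi : nat -> spinor,
  [/\ forall n, smooth_spinor (phi n), ip (phi n - x) (phi n - x) @[n --> \oo] --> (0 : R) &
      ip (dirac g (phi n) - y) (dirac g (phi n) - y) @[n --> \oo] --> (0 : R)]].
Proof.
move=> [lx ly [phi [sp c1 c2]]]; split=> //; exists phi; split=> //.
  by move: c1; under eq_fun do rewrite L2sqnormE.
by move: c2; under eq_fun do rewrite L2sqnormE.
Qed.

Lemma closure_sym x y x' y' : Dbar x y -> Dbar x' y' -> ip y x' = ip x y'.
Proof.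
move=> /closureP[lx ly [p [sp c1 c2]]] /closureP[lx' ly' [p' [sp' c1' c2']]].
have h1 := ipr_cvg (fun n => L2_dirac (sp n)) (fun n => L2_smooth (sp' n)) ly lx' c2 c1'.
have h2 := ipr_cvg (fun n => L2_smooth (sp n)) (fun n => L2_dirac (sp' n)) lx ly' c1 c2'.
have E : (fun n => ip (p n) (dirac g (p' n))) = (fun n => ip (dirac g (p n)) (p' n)).
  by apply/funext => n; apply/esym/dirac_symmetric.
by move: h2; rewrite E => h2; exact: (cvg_unique (@Rhausdorff R) h1 h2).
Qed.

Lemma smooth_closure phi : smooth_spinor phi -> Dbar phi (dirac g phi).
Proof.
have Z c : L2sqnorm g (c \- c) = 0.
  rewrite L2sqnormE -[RHS](int_vol0 g); apply: int_vol_ext => x _.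
  by rewrite -[(c \- c) x]/(c x - c x) subrr /dt !scmp0 !mul0r !addr0.
move=> sp; split; [exact: L2_smooth|exact: L2_dirac|exists (fun=> phi); split=> //].
  by rewrite (Z phi); exact: cvg_cst.
by rewrite (Z (dirac g phi)); exact: cvg_cst.
Qed.

Lemma closureB x y x' y' : Dbar x y -> Dbar x' y' -> Dbar (x - x') (y - y').
Proof.
move=> /closureP[lx ly [p [sp c1 c2]]] /closureP[lx' ly' [p' [sp' c1' c2']]].
split; [exact: LB|exact: LB|exists (fun n => p n - p' n); split=> [n| |]].
- exact: smooth_spinorB.
- apply: (cvg0_le _ (cvg0_comb 2%:R 2%:R c1 c1')) => n.
  have E : L2sqnorm g ((p n - p' n) \- (x - x')) =
      ip ((p n - x) - (p' n - x')) ((p n - x) - (p' n - x')).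
    rewrite L2sqnormE; have -> : (p n - p' n) \- (x - x') = (p n - x) - (p' n - x') => //.
    exact: subr_subACA.
  rewrite E (ger0_norm (ip_ge0 _)) -mulrDr.
  by apply: iprB_le; apply: LB => //; exact: L2_smooth.
- apply: (cvg0_le _ (cvg0_comb 2%:R 2%:R c2 c2')) => n.
  have E : L2sqnorm g (dirac g (p n - p' n) \- (y - y')) =
      ip ((dirac g (p n) - y) - (dirac g (p' n) - y')) ((dirac g (p n) - y) - (dirac g (p' n) - y')).
    rewrite L2sqnormE; apply: int_vol_ext => v vS.
    suff -> : scmp ((dirac g (p n - p' n) \- (y - y')) v) =
      scmp (((dirac g (p n) - y) - (dirac g (p' n) - y')) v) by [].
    apply/funext => j; apply: etrans (scmpB (dirac g (p n - p' n) v) (y v - y' v) j) _.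
    apply: esym; apply: etrans (scmpB (dirac g (p n) v - y v) (dirac g (p' n) v - y' v) j) _.
    rewrite (scmpB (y v)) (scmpB (dirac g (p n) v)) (scmpB (dirac g (p' n) v)).
    apply: esym; apply: etrans (congr1 (fun t => t - (scmp (y v) j - scmp (y' v) j))
      (scmp_diracB j (sp n) (sp' n) vS)) _.
    exact: subr_subACA.
  rewrite E (ger0_norm (ip_ge0 _)) -mulrDr.
  by apply: iprB_le; apply: LB => //; exact: L2_dirac.
Qed.

(** Smooth spinors approximate in graph norm, and M is bounded, so [form_limit] applies to M^2 and
    to k times the identity. *)
Lemma closure_bound (M : spinor -> spinor) (k : R) : multiplier L ip M -> 0 <= k ->
  (forall phi, smooth_spinor phi -> ip (M phi) (M phi) <= k * ip (dirac g phi) (dirac g phi)) ->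
  forall x y, Dbar x y -> ip (M x) (M x) <= k * ip y y.
Proof.
move=> mM k0 h x y /closureP[lx ly [p [sp c1 c2]]].
have [lM symM _ _] := mM.
rewrite -(symM _ _ (lM _ lx) lx) -(iprZl hg k ly ly).
apply: (form_limit LB (L2_Z hg) (iprBl hg) (iprZl hg) (fun x y _ _ => ipC x y)
  (fun x _ => ip_ge0 x) (M1 := M \o M) (M2 := fun z => k%:C%C *: z)) => //.
- exact: (multiplier_comp (fun x _ => ip_ge0 x)).
- apply: (multiplierZ (L2_Z hg) (iprZl hg) (fun x y _ _ => ipC x y) k0).
  exact: (multiplier_id (fun x _ => ip_ge0 x)).
move=> d d0; have [n1 h1] := cvg0_lt c1 d0; have [n2 h2] := cvg0_lt c2 d0.
have lp := L2_smooth (sp (maxn n1 n2)); have ld := L2_dirac (sp (maxn n1 n2)).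
exists (p (maxn n1 n2)), (dirac g (p (maxn n1 n2))); split=> //.
- by apply: h1; exact: leq_maxl.
- by apply: h2; exact: leq_maxr.
- by rewrite /= (symM _ _ (lM _ lp) lp) (iprZl hg)//; exact: h.
Qed.

(** An H^1 bound carried by the approximants alone, so that it applies to u and to differences f n -
    u in the same way. *)
Definition approx (v : V -> R) (a : R) := measurable_S3 v /\ exists f : nat -> V -> R,
  [/\ forall n, smooth (f n), forall n, J (fun x => (f n x - v x) ^+ 2),
      I (fun x => (f n x - v x) ^+ 2) @[n --> \oo] --> (0 : R) &
      forall n, hnorm2 g (f n) <= a].

(** What Heinz's inequality says of a spinor with |D|^(1/2)-energy at most N0. Stated this way it
    covers psi, the approximate sign(D) psi, and spinors in the domain of the closure. *)
Definition dominated psi (N0 : R) := L psi /\ forall M k, multiplier L ip M -> 0 <= k ->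
  (forall x y, Dbar x y -> ip (M x) (M x) <= k ^+ 2 * ip y y) -> ip (M psi) psi <= k * N0.

Lemma closure_dominated x y : Dbar x y -> dominated x (ip y y + ip x x).
Proof.
move=> Dxy; have [lx ly _] := Dxy; split=> // M k mM k0 h.
have [lM _ Mp _] := mM; have p1 := ip_ge0 x; have p2 := ip_ge0 y.
rewrite -ler_sqr ?nnegrE; [|exact: Mp|by rewrite mulr_ge0 ?addr_ge0].
apply: le_trans (ipr_cs (lM _ lx) lx) _; apply: le_trans (ler_wpM2r p1 (h _ _ Dxy)) _.
rewrite exprMn -mulrA ler_wpM2l ?sqr_ge0//; move: p1 p2; move: (ip x x) (ip y y) => a b a0 b0.
have := mulr_ge0 a0 b0; have := sqr_ge0 a; have := sqr_ge0 b; lra.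
Qed.

Variable K0 : R.
Hypothesis K00 : 0 < K0.
Hypothesis hK0 : forall (f : V -> R) phi (a : R), smooth f -> smooth_spinor phi -> 0 < a ->
  hnorm2 g f <= a -> I (fun x => f x ^+ 4 * dt (scmp (phi x)) (scmp (phi x)))
    <= K0 * a ^+ 2 * nrm g (dirac g phi).

(** [min4_le] compares the truncated weight with the smooth approximants, for which [hK0] holds. The
    error vanishes as n tends to infinity and then d to 0. *)
Lemma truncated_product v a phi (N : R) : approx v a -> 0 < a -> 0 <= N -> smooth_spinor phi ->
  J (fun x => Num.min `|v x| N ^+ 4 * dt (scmp (phi x)) (scmp (phi x))) /\
  I (fun x => Num.min `|v x| N ^+ 4 * dt (scmp (phi x)) (scmp (phi x)))
    <= K0 * a ^+ 2 * nrm g (dirac g phi).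
Proof.
move=> [mv [f [sf jf cf fa]]] a0 N0 sp.
have sdt : smooth (fun x => dt (scmp (phi x)) (scmp (phi x))).
  by do 3 (apply: smoothD; last by apply: smoothM; exact: (cmp_smooth sp));
    apply: smoothM; exact: (cmp_smooth sp).
have [B B0 hB] := smooth_bounded sdt.
have dB x : S3 x -> dt (scmp (phi x)) (scmp (phi x)) <= B.
  by move=> xS; apply: le_trans (ler_norm _) (hB x xS).
have lphi := L2_smooth sp.
have Jl : J (fun x => Num.min `|v x| N ^+ 4 * dt (scmp (phi x)) (scmp (phi x))).
  apply: (integrable_vol_le sw _ _ (integrable_volZ (N ^+ 4) (integrable_dt hg lphi lphi))).
    apply: measurable_S3M; last exact: smooth_measurable.
    exact: (measurable_S3X _ (measurable_S3_min (measurable_S3_norm mv) (measurable_S3_cst _))).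
  move=> x _; rewrite ger0_norm ?mulr_ge0 ?dt_ge0 ?exprn_ge0 ?le_min ?normr_ge0//.
  rewrite ler_wpM2r ?dt_ge0//; apply: lerXn2r; rewrite ?nnegrE ?le_min ?normr_ge0//.
  by rewrite ge_min lexx orbT.
split=> //.
have J1 : J (fun=> 1) by exact: (smooth_integrable_vol sw (smooth_cst 1)).
have W0 : 0 <= I (fun=> 1) by exact: int_vol_ge0.
pose c := 4%:R * N ^+ 3 * B.
have c0 : 0 <= c by rewrite !mulr_ge0 ?exprn_ge0 ?(ltW B0).
have step n d : 0 < d -> I (fun x => Num.min `|v x| N ^+ 4 * dt (scmp (phi x)) (scmp (phi x))) <=
    K0 * a ^+ 2 * nrm g (dirac g phi) + c * (I (fun=> 1) * d + I (fun x => (f n x - v x) ^+ 2) / d).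
  move=> d0.
  have sX m : smooth (fun x => f n x ^+ m).
    elim: m => [|m IH]; first by apply: smooth_ext (smooth_cst 1) => x _; rewrite expr0.
    by apply: smooth_ext (smoothM (sf n) IH) => x _; rewrite exprS.
  have j4 := smooth_integrable_vol sw (smoothM (sX 4%N) sdt).
  have j5 := integrable_volD (integrable_volZ d J1) (integrable_volZ d^-1 (jf n)).
  have j6 := integrable_volZ c j5.
  apply: (@le_trans _ _ (I (fun x => f n x ^+ 4 * dt (scmp (phi x)) (scmp (phi x)) +
     c * (d * 1 + d^-1 * (f n x - v x) ^+ 2)))).
    apply: int_vol_le => //; first exact: integrable_volD.
    move=> x xS; have p := dt_ge0 (scmp (phi x)); have q := dB x xS.
    apply: le_trans (ler_wpM2r p (min4_le (v x) (f n x) N0 d0)) _.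
    rewrite mulrDl lerD2l /c mulr1 [d^-1 * _]mulrC [leRHS]mulrAC ler_wpM2l//.
    rewrite !mulr_ge0 ?exprn_ge0// addr_ge0 ?(ltW d0)// divr_ge0 ?sqr_ge0// ltW//.
  rewrite (int_volD j4 j6) (int_volZ c j5) (int_volD (integrable_volZ d J1) (integrable_volZ d^-1 (jf n))).
  rewrite (int_volZ d J1) (int_volZ d^-1 (jf n)) [d * _]mulrC [d^-1 * _]mulrC lerD2r.
  exact: hK0.
apply: (@le_small _ _ _ (c * I (fun=> 1))) => [|d d0]; first exact: mulr_ge0.
have d2 : 0 < d / 2%:R by rewrite divr_gt0.
exists (d / 2%:R); first by rewrite ltr_pdivrMr// ltr_pMr// ltr1n.
apply: (@le_small _ _ _ (c / (d / 2%:R))) => [|t t0]; first by rewrite divr_ge0// ltW.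
have [n hn] := cvg0_lt cf t0; exists (I (fun x => (f n x - v x) ^+ 2)); first exact: hn.
have alg (A W q s : R) : A + c * (W * q + s / q) <= A + c * W * q + c / q * s.
  by rewrite mulrDr addrA !mulrA -[c / q * s]mulrA [q^-1 * s]mulrC mulrA.
exact: le_trans (step n _ d2) (alg _ _ _ _).
Qed.

Lemma truncated_bound v a (N : R) : approx v a -> 0 < a -> 0 <= N ->
  let M := mulw (fun x => Num.min `|v x| N ^+ 2) in
  multiplier L ip M /\
  forall x y, Dbar x y -> ip (M x) (M x) <= (Num.sqrt K0 * a) ^+ 2 * ip y y.
Proof.
move=> av a0 N0 M; have [mv _] := av.
have mM : multiplier L ip M.
  apply: (multiplier_mulw hg (C := N ^+ 2)).
    exact: (measurable_S3X _ (measurable_S3_min (measurable_S3_norm mv) (measurable_S3_cst _))).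
  move=> x _; rewrite sqr_ge0/=; apply: lerXn2r; rewrite ?nnegrE ?le_min ?normr_ge0//.
  by rewrite ge_min lexx orbT.
split=> //; apply: closure_bound => //; first exact: sqr_ge0.
move=> phi sp; rewrite exprMn sqr_sqrtr ?(ltW K00)//.
have [_ h] := truncated_product av a0 N0 sp; apply: le_trans h.
rewrite le_eqVlt; apply/orP; left; apply/eqP; apply: int_vol_ext => x _.
by rewrite /M /mulw scmpZE dtZl dtC dtZl mulrA -exprD.
Qed.

(** Domination applied to the truncations of v^2 gives a uniform bound for the integral of v^2
    |psi|^2, and monotone convergence removes the truncation. *)
Lemma dominated_product psi N0 v a : dominated psi N0 -> approx v a -> 0 < a ->
  L (mulw v psi) /\ ip (mulw v psi) (mulw v psi) <= Num.sqrt K0 * a * N0.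
Proof.
move=> [lp dp] av a0; have [mv _] := av; have [mp jp] := (L2P g psi).1 lp.
pose F (n : nat) x := Num.min `|v x| n%:R ^+ 2 * dt (scmp (psi x)) (scmp (psi x)).
have Fp n x : 0 <= Num.min `|v x| n%:R :> R by rewrite le_min normr_ge0 ler0n.
have EM n x : dt (scmp (mulw (fun x => Num.min `|v x| n%:R ^+ 2) psi x)) (scmp (psi x)) = F n x.
  by rewrite /mulw scmpZE dtZl.
have tb n := truncated_bound av a0 (ler0n R n).
have JF n : J (F n).
  have [[lM _ _ _] _] := tb n.
  by apply: integrable_vol_ext (integrable_dt hg (lM _ lp) lp) => x _; exact: EM.
have IF n : I (F n) <= Num.sqrt K0 * a * N0.
  have [mM hM] := tb n; apply: le_trans (dp _ _ mM _ hM); last by rewrite mulr_ge0 ?sqrtr_ge0 ?ltW.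
  by rewrite le_eqVlt; apply/orP; left; apply/eqP; apply: int_vol_ext => x _; rewrite EM.
have md : measurable_S3 (fun x => dt (scmp (psi x)) (scmp (psi x))) by exact: measurable_dt.
have [Jv Iv] : J (fun x => v x ^+ 2 * dt (scmp (psi x)) (scmp (psi x))) /\
    I (fun x => v x ^+ 2 * dt (scmp (psi x)) (scmp (psi x))) <= Num.sqrt K0 * a * N0.
  apply: (int_vol_mct sw w0 (F := F)) => // [n| |n x _|x _ n m nm|x _].
  - apply: measurable_S3M => //.
    exact: (measurable_S3X _ (measurable_S3_min (measurable_S3_norm mv) (measurable_S3_cst _))).
  - by apply: measurable_S3M => //; exact: measurable_S3X.
  - by rewrite mulr_ge0 ?sqr_ge0 ?dt_ge0.
  - rewrite /F ler_wpM2r ?dt_ge0//; apply: lerXn2r; rewrite ?nnegrE//.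
    by rewrite le_min !ge_min lexx/= ler_nat nm orbT.
  (* At each point the truncations are eventually equal to |v x|. *)
  - apply: cvg_near_cst; exists (Num.truncn `|v x|).+1 => // n /= hn.
    have vn : `|v x| <= n%:R.
      by apply: le_trans (ltW (truncnS_gt _)) _; rewrite ler_nat.
    by rewrite /F min_l// real_normK ?num_real.
have E x : dt (scmp (mulw v psi x)) (scmp (mulw v psi x)) =
    v x ^+ 2 * dt (scmp (psi x)) (scmp (psi x)).
  by rewrite /mulw scmpZE dtZl dtC dtZl mulrA -expr2.
split; last by apply: le_trans Iv; rewrite le_eqVlt; apply/orP; left; apply/eqP; apply: int_vol_ext.
apply: (L2_dom hg _ Jv) => [j|x _]; last by rewrite E.
apply: measurable_S3_ext (measurable_S3M mv (mp j)) => x _.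
by rewrite /cmp /mulw scmpZ.
Qed.

End DiracClosure.

                                 

(** * The operator |D|^(1/2) *)

Section SqrtAbsDirac.
Context {R : realType}.
Local Notation V := 'rV[R]_4.
Local Notation spinor := (V -> 'cV[R[i]]_2).
Variable g : V -> 'M[R]_4.
Hypothesis hg : riemannian_metric g.
Local Notation L := (L2spinor g).
Local Notation ip := (ipr g).
Local Notation Dbar := (dirac_closure g).

Lemma nonneg_real A : nonneg_self_adjoint g A -> [/\ selfadjoint L ip A,
  dense_domain L ip A & forall x y, A x y -> 0 <= ip y x].
Proof.
move=> [sa pos]; have [h1 h2] := selfadjoint_real hg sa; split=> // x y /pos.
by rewrite lecE => /andP[_]; rewrite Re_L2dot.
Qed.

Variable d : R.
Hypothesis d0 : 0 < d.
Hypothesis gap : forall x y, Dbar x y -> d * ip x x <= ip y y.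

(** The abstract theorems apply once a single root B of D^2 with S^2 = B is isolated. *)
Lemma sqrt_abs_dirac_facts psi chi : sqrt_abs_dirac g psi chi ->
  [/\ L psi, dominated g psi (ip chi chi) & forall e, 0 < e -> exists u v,
    [/\ Dbar u v, `|ip psi v - ip chi chi| <= e & dominated g u (ip chi chi + e)]].
Proof.
move=> [S [nS SS Spc]]; have [saS dS posS] := nonneg_real nS.
have S00 : S 0 0 := sa0 (L2_0 hg) (iprBl hg) saS.
(* [op_sqrt] quantifies over the root separately at each pair, so one root is extracted from the
   pair (0, 0). *)
have [B [nB DDB _]] : abs_dirac g 0 0 by apply/SS; exists 0.
have [saB dB posB] := nonneg_real nB.
have LBx x y : B x y -> L x /\ L y by move=> /saB[].
have LS x y : S x y -> L x /\ L y by move=> /saS[].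
have symS x y x' y' : S x y -> S x' y' -> ip y x' = ip x y'.
  by move=> /saS[_ _ h] /h.
have abs_of_B x y : B x y -> exists2 z, S x z & S z y.
  by move=> Bxy; apply/SS; exists B.
(* [abs_dirac], which equals S^2, contains every root and so contains B. Conversely S^2 is
   symmetric, and a symmetric extension of a self-adjoint B coincides with B. *)
have SSB x y : B x y <-> exists2 z, S x z & S z y.
  split=> [|[z Sxz Szy]]; first exact: abs_of_B.
  have [lx _] := LS _ _ Sxz; have [_ ly] := LS _ _ Szy.
  apply/saB; split=> // x' y' /abs_of_B[z' Sxz' Szy'].
  by rewrite (symS _ _ _ _ Szy Sxz') (symS _ _ _ _ Sxz Szy').
have BBDD x y : (exists2 z, B x z & B z y) <-> (exists2 z, Dbar x z & Dbar z y).
  by split=> [h|h]; [apply/DDB|apply/DDB].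
have LD x y : Dbar x y -> L x /\ L y by case.
have Cs := fun (x y : spinor) (_ : L x) (_ : L y) => iprC g x y.
have ps := fun (x : spinor) (_ : L x) => ipr_ge0 hg x.
have fb := sqrt_form_bound (L2_0 hg) (L2_B hg) (L2_Z hg) (iprBl hg) (iprZl hg) Cs ps
  (L2_complete hg) (closure_sym hg) d0 gap saB dB posB saS dS posS SSB BBDD.
have st := sqrt_sign_test (L2_0 hg) (L2_B hg) (L2_Z hg) (iprBl hg) (iprZl hg) Cs ps
  (L2_complete hg) LD (closure_sym hg) (closureB hg) d0 gap saB dB posB saS dS posS SSB BBDD.
have [lp lc] := LS _ _ Spc; split=> //.
  by split=> // M k mM k0 h; exact: fb Spc.
move=> e e0; have [u [v [Duv h1 h2]]] := st _ _ _ Spc e0.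
by exists u, v; split=> //; split; [exact: (LD _ _ Duv).1|exact: h2].
Qed.

End SqrtAbsDirac.

(** * H^1 of the sphere inside the space of spinors *)

Section WeightedSobolev.
Context {R : realType}.
Local Notation V := 'rV[R]_4.
Local Notation spinor := (V -> 'cV[R[i]]_2).
Variable g : V -> 'M[R]_4.
Hypothesis hg : riemannian_metric g.
Hypothesis hR : forall x, S3 x -> 0 < scalar_curvature g x.
Local Notation I := (int_vol g).
Local Notation J := (integrable_vol g).
Local Notation L := (L2spinor g).
Local Notation ip2 := (ipr g).
Local Notation rho := (scalar_curvature g).
Let sw := smooth_vol_density hg.
Let w0 := vol_density_gt0 hg.
Implicit Types (u v f h : V -> R) (X Y : V -> V).

Definition fld X (n : nat) x : R := gip g x (X x) (frame g (i3 n) x).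

                                                                              
                                                                       
(** The frame components of X and sqrt(R_g / 8) u, packed as the four real components of a spinor:
    the H^1 product becomes the L^2 product of spinors, and the L^2 results apply to it. *)
Definition enc u X : spinor := fun x => \col_(k < 2)
  (if k == 0 then (fld X 0 x +i* fld X 1 x)%C
   else (fld X 2 x +i* (Num.sqrt (rho x / 8%:R) * u x))%C).

Let rho_sq x : S3 x -> Num.sqrt (rho x / 8%:R) * Num.sqrt (rho x / 8%:R) = rho x / 8%:R.
Proof. by move=> xS; rewrite -expr2 sqr_sqrtr// divr_ge0// ltW// hR. Qed.

Lemma dt_enc u X v Y x : S3 x -> dt (scmp (enc u X x)) (scmp (enc v Y x)) =
  sm3 (fun n => fld X n x * fld Y n x) + rho x / 8%:R * (u x * v x).
Proof.
have alg (a b c a' b' c' s p q : R) : a * a' + b * b' + c * c' + s * p * (s * q) =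
  a * a' + b * b' + c * c' + s * s * (p * q) by ring.
by move=> xS; rewrite /dt /scmp !mxE /=; apply: etrans (alg _ _ _ _ _ _ _ _ _) _; rewrite rho_sq.
Qed.

Lemma dt_encB u X v Y x : S3 x ->
  dt (scmp (enc u X x - enc v Y x)) (scmp (enc u X x - enc v Y x)) =
  sm3 (fun n => (fld X n x - fld Y n x) ^+ 2) + rho x / 8%:R * (u x - v x) ^+ 2.
Proof.
have alg (a b c a' b' c' s p q : R) : (a - a') * (a - a') + (b - b') * (b - b') +
  (c - c') * (c - c') + (s * p - s * q) * (s * p - s * q) =
  (a - a') ^+ 2 + (b - b') ^+ 2 + (c - c') ^+ 2 + s * s * (p - q) ^+ 2 by ring.
move=> xS; rewrite scmpBE /dt /scmp ![enc _ _ _ _ _]mxE /=.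
by apply: etrans (alg _ _ _ _ _ _ _ _ _) _; rewrite rho_sq.
Qed.

Lemma ip_fld X Y x : S3 x -> dot x (Y x) = 0 ->
  ip g X Y x = sm3 (fun n => fld X n x * fld Y n x).
Proof.
move=> xS tY; rewrite -[LHS]/(gip g x (X x) (Y x)) {1}(frame_expand hg xS tY).
rewrite (gip_sumr hg)// sum_sm3; apply: sm3_eq => n _.
by rewrite gipZr mulrC.
Qed.

Lemma tangent_gradient f : tangent (gradient g f).
Proof.
move=> x xS; rewrite dot_sumr big1// => a _.
by rewrite dotZr (tangent_frame hg a xS) mulr0.
Qed.

Lemma fld_gradient f n x : S3 x -> fld (gradient g f) n x = dalong (frame g (i3 n)) f x.
Proof. by move=> xS; exact: (gip_frame_sum hg (fun a => dalong (frame g a) f x) (i3 n) xS). Qed.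

Lemma fldB X Y n x : fld (X \- Y) n x = fld X n x - fld Y n x.
Proof. exact: gipBl. Qed.

Lemma hnorm2E f : hnorm2 g f = ip2 (enc f (gradient g f)) (enc f (gradient g f)).
Proof.
apply: int_vol_ext => x xS; rewrite dt_enc// -expr2 sum_sm3; congr (_ + _).
by apply: sm3_eq => n _; rewrite fld_gradient// expr2.
Qed.

Lemma hnorm2B f h : smooth f -> smooth h -> hnorm2 g (fun x => f x - h x) =
  ip2 (enc f (gradient g f) - enc h (gradient g h)) (enc f (gradient g f) - enc h (gradient g h)).
Proof.
move=> sf sh; apply: int_vol_ext => x xS.
apply: etrans (esym (dt_encB f (gradient g f) h (gradient g h) xS)).
rewrite sum_sm3; congr (_ + _); apply: sm3_eq => n _.
by rewrite !fld_gradient// dalongB.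
Qed.

Lemma ip2_enc u X v Y : tangent Y -> ip2 (enc u X) (enc v Y) =
  I (fun x => ip g X Y x + rho x / 8%:R * u x * v x).
Proof.
move=> tY; apply: int_vol_ext => x xS.
by rewrite dt_enc// (ip_fld _ xS (tY x xS)) mulrA.
Qed.

Lemma L2_enc u X : L2fun g u -> L2field g X -> L (enc u X).
Proof.
move=> [mu ju] [tX mX jX]; have srho := smooth_scalar_curvature hg.
have [M M0 hM] := smooth_bounded srho.
have mr := smooth_measurable srho.
have [sg _ _] := hg.
have mf n : measurable_S3 (fld X n).
  have h : measurable_S3 (fun x => \sum_j (\sum_i X x 0 i * g x i j) * frame g (i3 n) x 0 j).
    apply: measurable_S3_sum => j; apply: measurable_S3M; last first.
      exact: (smooth_measurable (smooth_frame hg (i3 n) j)).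
    apply: measurable_S3_sum => i; apply: measurable_S3M; first exact: mX.
    exact: (smooth_measurable (sg i j)).
  apply: measurable_S3_ext h => x _; rewrite /fld /gip mxE; apply: eq_bigr => j _.
  by rewrite !mxE.
have j8 : J (fun x => rho x / 8%:R * (u x * u x)).
  apply: (integrable_vol_le sw _ _ (integrable_volZ (M / 8%:R) ju)).
    apply: measurable_S3M; last exact: measurable_S3M.
    by apply: measurable_S3M => //; exact: measurable_S3_cst.
  move=> x xS; rewrite -expr2 normrM [`|u x ^+ 2|]ger0_norm ?sqr_ge0//.
  rewrite ler_wpM2r ?sqr_ge0// normrM [`|8%:R^-1|]ger0_norm ?invr_ge0//.
  by rewrite ler_wpM2r ?invr_ge0//; exact: hM.
apply/L2P; split=> [j|]; last first.
  apply: integrable_vol_ext (integrable_volD jX j8) => x xS.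
  by rewrite dt_enc// (ip_fld _ xS (tX x xS)).
have m3 : measurable_S3 (fun x => Num.sqrt (rho x / 8%:R) * u x).
  apply: measurable_S3M => //; have h := measurable_S3M mr (measurable_S3_cst 8%:R^-1).
  have ms : measurable_fun setT (@Num.sqrt R).
    by apply: continuous_measurable_fun; exact: sqrt_continuous.
  exact: (measurableT_comp ms h).
case: j => [|[|[|j]]].
- by apply: measurable_S3_ext (mf 0%N) => x _; rewrite /cmp /scmp mxE.
- by apply: measurable_S3_ext (mf 1%N) => x _; rewrite /cmp /scmp mxE.
- by apply: measurable_S3_ext (mf 2%N) => x _; rewrite /cmp /scmp mxE.
- by apply: measurable_S3_ext m3 => x _; rewrite /cmp /scmp mxE.
Qed.

Lemma smooth_L2fun f : smooth f -> L2fun g f.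
Proof.
move=> sf; split; first exact: smooth_measurable.
apply: (smooth_integrable_vol sw); apply: smooth_ext (smoothM sf sf) => x _; exact: expr2.
Qed.

Lemma L2_enc_smooth f : smooth f -> L (enc f (gradient g f)).
Proof.
move=> sf; apply: L2_enc; first exact: smooth_L2fun.
have sd a := smooth_dalong (smooth_frame hg a) sf.
split=> [|i|]; first exact: tangent_gradient.
  apply: measurable_S3_ext (measurable_S3_sum (index_enum 'I_3)
    (fun a => measurable_S3M (smooth_measurable (sd a)) (smooth_measurable (smooth_frame hg a i)))) => x _.
  by rewrite summxE; apply: eq_bigr => a _; rewrite mxE.
apply: (smooth_integrable_vol sw).
apply: smooth_ext (smooth_sum (index_enum 'I_3) (fun a => smoothM (sd a) (sd a))) => x xS.
by rewrite gradient_ip.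
Qed.

(** R_g is bounded, so L^2 convergence of functions and of gradients is convergence of the
    encodings. *)
Lemma h1_approximation u X : h1_gradient g u X -> [/\ measurable_S3 u, L (enc u X) &
  exists f : nat -> V -> R, [/\ forall n, smooth (f n),
    forall n, J (fun x => (f n x - u x) ^+ 2),
    I (fun x => (f n x - u x) ^+ 2) @[n --> \oo] --> (0 : R) &
    ip2 (enc (f n) (gradient g (f n)) - enc u X) (enc (f n) (gradient g (f n)) - enc u X)
      @[n --> \oo] --> (0 : R)]].
Proof.
move=> [lu lX [f [sf c1 c2]]]; have [mu ju] := lu; have [tX mX jX] := lX.
have [M M0 hM] := smooth_bounded (smooth_scalar_curvature hg).
have le := L2_enc lu lX; split=> //; exists f.
have jd n : J (fun x => (f n x - u x) ^+ 2).
  have [mf jf] := smooth_L2fun (sf n).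
  apply: (integrable_vol_le sw _ _ (integrable_volZ 2%:R (integrable_volD jf ju))).
    exact: (measurable_S3X _ (measurable_S3B mf mu)).
  move=> x _; rewrite ger0_norm ?sqr_ge0//; have := sqr_ge0 (f n x + u x).
  by move: (f n x) (u x) => a b; lra.
split=> //; apply: (cvg0_le _ (cvg0_comb (M / 8%:R) 1 c1 c2)) => n.
rewrite (ger0_norm (ipr_ge0 hg _)) mul1r.
have lB := L2_B hg (L2_enc_smooth (sf n)) le.
have jB := integrable_dt hg lB lB.
have E x : S3 x -> dt (scmp ((enc (f n) (gradient g (f n)) - enc u X) x))
    (scmp ((enc (f n) (gradient g (f n)) - enc u X) x)) =
    ip g (gradient g (f n) \- X) (gradient g (f n) \- X) x + rho x / 8%:R * (f n x - u x) ^+ 2.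
  move=> xS; apply: etrans (dt_encB (f n) (gradient g (f n)) u X xS) _; congr (_ + _).
  rewrite (ip_fld _ xS); last first.
    by apply: etrans (dotBr _ _ _) _; rewrite tangent_gradient// tX// subrr.
  by apply: sm3_eq => k _; rewrite fldB expr2.
have r0 x : S3 x -> 0 <= rho x / 8%:R * (f n x - u x) ^+ 2.
  by move=> xS; rewrite mulr_ge0 ?sqr_ge0// divr_ge0// ltW// hR.
have rM x : S3 x -> rho x / 8%:R * (f n x - u x) ^+ 2 <= M / 8%:R * (f n x - u x) ^+ 2.
  move=> xS; rewrite ler_wpM2r ?sqr_ge0// ler_wpM2r ?invr_ge0//.
  exact: le_trans (ler_norm _) (hM x xS).
have jr : J (fun x => rho x / 8%:R * (f n x - u x) ^+ 2).
  apply: (integrable_vol_le sw _ _ (integrable_volZ (M / 8%:R) (jd n))).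
    apply: measurable_S3M; last first.
      by apply: measurable_S3X; apply: measurable_S3B => //; exact: smooth_measurable.
    apply: measurable_S3M; last exact: measurable_S3_cst.
    exact: (smooth_measurable (smooth_scalar_curvature hg)).
  by move=> x xS; rewrite ger0_norm ?r0// rM.
have ji : J (let Y := gradient g (f n) \- X in ip g Y Y).
  by apply: integrable_vol_ext (integrable_volB jB jr) => x xS; rewrite E// addrK.
rewrite -(int_volZ _ (jd n)) -(int_volD (integrable_volZ _ (jd n)) ji).
apply: int_vol_le => //; first by apply: integrable_volD => //; exact: integrable_volZ.
by move=> x xS; rewrite E// addrC lerD2r rM.
Qed.

End WeightedSobolev.

(** * Estimates for solutions *)

Lemma final_arithmetic (R : realType) (A1 A2 G : R) : 0 < A1 -> 0 < A2 -> 0 < G ->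
  exists c C : R, [/\ 0 < c, 0 < C & forall h p : R, 0 <= h -> 0 <= p ->
    1 <= A1 * p ^+ 2 -> p ^+ 2 <= G * (A2 * h ^+ 4) -> 1 <= A1 * (A2 * h ^+ 4) ->
    [/\ c <= h, c <= p, c / h <= p & p <= C * h ^+ 2]].
Proof.
move=> a1 a2 g0; have sq (x y : R) : 0 <= x -> 0 <= y -> x ^+ 2 <= y ^+ 2 -> x <= y.
  by move=> x0 y0; rewrite ler_sqr ?nnegrE.
pose q := Num.sqrt A1^-1; pose r := Num.sqrt (Num.sqrt (A1 * A2)^-1).
have q2 : q ^+ 2 = A1^-1 by rewrite sqr_sqrtr// invr_ge0 ltW.
have r4 : r ^+ 2 ^+ 2 = (A1 * A2)^-1.
  by rewrite !sqr_sqrtr ?sqrtr_ge0// invr_ge0 ltW// mulr_gt0.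
have q0 : 0 < q by rewrite sqrtr_gt0 invr_gt0.
have r0 : 0 < r by rewrite !sqrtr_gt0 invr_gt0 mulr_gt0.
(* q and r are the lower bounds for p and h; the entry q * r gives c / h <= q <= p, because r <=
   h. *)
exists (Num.min (Num.min q r) (q * r)), (Num.sqrt (G * A2)); split.
- by rewrite !lt_min q0 r0 mulr_gt0.
- by rewrite sqrtr_gt0 mulr_gt0.
move=> h p h0 p0 e1 e2 e3.
have rh : r <= h.
  apply: (sq) => //; first exact: ltW.
  apply: (sq); rewrite ?sqr_ge0// r4 -exprM -[_^-1]mul1r ler_pdivrMr ?mulr_gt0//.
  by rewrite mulrC -mulrA.
have qp : q <= p.
  apply: (sq) => //; first exact: ltW.
  by rewrite q2 -[_^-1]mul1r ler_pdivrMr// mulrC.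
have hp : 0 < h by exact: lt_le_trans r0 rh.
split.
- by rewrite !ge_min rh orbT.
- by rewrite !ge_min qp.
- rewrite ler_pdivrMr//; apply: (@le_trans _ _ (q * r)); first by rewrite ge_min lexx orbT.
  by apply: ler_pM => //; exact: ltW.
- apply: (sq) => //; first by rewrite mulr_ge0 ?sqrtr_ge0 ?sqr_ge0.
  rewrite exprMn sqr_sqrtr; last by apply: mulr_ge0; exact: ltW.
  by rewrite -(exprM h 2 2) -mulrA.
Qed.

Lemma ae_S3_S2 (R : realType) (P Q S : 'rV[R]_4 -> Prop) :
  (forall x, S3 x -> P x -> Q x -> S x) -> ae_S3 P -> ae_S3 Q -> ae_S3 S.
Proof.
rewrite /ae_S3 => h; apply: filterS2 => y p q yB.
by apply: h; [exact: ball4_S3|exact: p|exact: q].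
Qed.

Section Solutions.
Context {R : realType}.
Local Notation V := 'rV[R]_4.
Local Notation spinor := (V -> 'cV[R[i]]_2).
Variable g : V -> 'M[R]_4.
Hypothesis hg : riemannian_metric g.
Hypothesis hR : forall x, S3 x -> 0 < scalar_curvature g x.
Local Notation I := (int_vol g).
Local Notation J := (integrable_vol g).
Local Notation L := (L2spinor g).
Local Notation ip := (ipr g).
Local Notation rho := (scalar_curvature g).
Local Notation Dbar := (dirac_closure g).
Local Notation dirac := Defs.dirac.
Let sw := smooth_vol_density hg.
Let w0 := vol_density_gt0 hg.
Variable K0 : R.
Hypothesis K00 : 0 < K0.
Hypothesis hK0 : forall (f : V -> R) (phi : spinor) (a : R), smooth f -> smooth_spinor phi ->
  0 < a -> hnorm2 g f <= a -> I (fun x => f x ^+ 4 * dt (scmp (phi x)) (scmp (phi x)))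
    <= K0 * a ^+ 2 * nrm g (dirac g phi).
Let k0 := Num.sqrt K0.
Let k00 : 0 < k0. Proof. by rewrite sqrtr_gt0. Qed.

Lemma dt_mulw (v w : V -> R) (psi phi : spinor) x :
  dt (scmp (mulw v psi x)) (scmp (mulw w phi x)) = v x * w x * dt (scmp (psi x)) (scmp (phi x)).
Proof. by rewrite /mulw !scmpZE dtZl dtC dtZl dtC mulrA. Qed.

Lemma mulwB (v w : V -> R) (psi : spinor) :
  mulw v psi - mulw w psi = mulw (fun x => v x - w x) psi.
Proof.
apply/funext => x; rewrite -[LHS]/((v x)%:C%C *: psi x - (w x)%:C%C *: psi x).
by rewrite -scalerBl -rmorphB.
Qed.

Lemma mulwBr (v : V -> R) (psi phi : spinor) :
  mulw v psi - mulw v phi = mulw v (psi - phi).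
Proof.
by apply/funext => x; exact: esym (scalerBr _ _ _).
Qed.

(** Multiplication by u is bounded from the graph norm of D to L^2, by [closure_dominated] and
    [dominated_product]. *)
Lemma mulw_closure_cvg u a (x y : spinor) (phi : nat -> spinor) : approx g u a -> 0 < a ->
  Dbar x y -> (forall n, smooth_spinor (phi n)) ->
  ip (phi n - x) (phi n - x) @[n --> \oo] --> (0 : R) ->
  ip (dirac g (phi n) - y) (dirac g (phi n) - y) @[n --> \oo] --> (0 : R) ->
  (forall n, L (mulw u (phi n))) /\
  ip (mulw u (phi n) - mulw u x) (mulw u (phi n) - mulw u x) @[n --> \oo] --> (0 : R).
Proof.
move=> au a0 Dxy sp c1 c2.
have Dp n := smooth_closure hg (sp n).
split=> [n|].
  exact: (dominated_product hg K00 hK0 (closure_dominated hg (Dp n)) au a0).1.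
apply: (cvg0_le _ (cvg0_comb (k0 * a) (k0 * a) c2 c1)) => n.
rewrite (ger0_norm (ipr_ge0 hg _)) -mulrDr mulwBr.
have DB := closureB hg (Dp n) Dxy.
exact: (dominated_product hg K00 hK0 (closure_dominated hg DB) au a0).2.
Qed.

(** The H^1 norms of f n converge to that of u, so their squares are eventually at most twice the
    limit. The differences f n - f m approximate f n - u and have small norm. *)
Lemma approx_h1 u X (f : nat -> V -> R) : measurable_S3 u -> L (enc g u X) ->
  (forall n, smooth (f n)) -> (forall n, J (fun x => (f n x - u x) ^+ 2)) ->
  I (fun x => (f n x - u x) ^+ 2) @[n --> \oo] --> (0 : R) ->
  ip (enc g (f n) (gradient g (f n)) - enc g u X) (enc g (f n) (gradient g (f n)) - enc g u X)
      @[n --> \oo] --> (0 : R) ->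
  (0 < ip (enc g u X) (enc g u X) -> approx g u (2%:R * ip (enc g u X) (enc g u X))) /\
  forall e, 0 < e -> exists n0, forall n, (n0 <= n)%N -> approx g (fun x => f n x - u x) e.
Proof.
move=> mu lP sf jf c1 c2; pose P n := enc g (f n) (gradient g (f n)).
have lPn n : L (P n) by exact: (L2_enc_smooth hg hR (sf n)).
pose Q0 := enc g u X; have lB n := L2_B hg (lPn n) lP.
have cP : ip (P n) (P n) @[n --> \oo] --> ip Q0 Q0.
  exact: (ipr_cvg hg lPn lPn lP lP c2 c2).
split=> [Q1|e e0].
  have Q2 : ip Q0 Q0 < 2%:R * ip Q0 Q0 by rewrite ltr_pMl// ltr1n.
  have [n0 _ hn] := cvgr_lt _ cP _ Q2.
  split=> //; exists (fun n => f (n + n0)%N); split=> //.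
    by rewrite (cvg_shiftn n0 (fun n => I (fun x => (f n x - u x) ^+ 2))).
  by move=> n; rewrite (hnorm2E hg hR); apply/ltW/hn; exact: leq_addl.
have e4 : 0 < e / 4%:R by rewrite divr_gt0.
have [n0 hn] := cvg0_lt c2 e4; exists n0 => n nn; split.
  by apply: measurable_S3B => //; exact: (smooth_measurable (sf n)).
have E m x : (f n x - f (m + n0)%N x - (f n x - u x)) ^+ 2 = (f (m + n0)%N x - u x) ^+ 2.
  by ring.
exists (fun m x => f n x - f (m + n0)%N x); split=> [m|m| |m].
- exact: smoothB.
- by apply: integrable_vol_ext (jf (m + n0)%N) => x _; rewrite E.
- have -> : (fun m => I (fun x => (f n x - f (m + n0)%N x - (f n x - u x)) ^+ 2)) =
      (fun m => I (fun x => (f (m + n0)%N x - u x) ^+ 2)).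
    by apply/funext => m; apply: int_vol_ext => x _; exact: E.
  by rewrite (cvg_shiftn n0 (fun n => I (fun x => (f n x - u x) ^+ 2))).
- rewrite (hnorm2B hg hR)//.
  have -> : enc g (f n) (gradient g (f n)) - enc g (f (m + n0)%N) (gradient g (f (m + n0)%N)) =
     (P n - Q0) - (P (m + n0)%N - Q0) by rewrite -subr_subACA subrr subr0.
  apply: le_trans (iprB_le hg (lB n) (lB (m + n0)%N)) _.
  have h1 := hn n nn; have h2 := hn (m + n0)%N (leq_addl _ _).
  move: h1 h2; rewrite -/(P n) -/(P (m + n0)%N) -/Q0; move: (ip _ _) (ip _ _) => s t; lra.
Qed.

Variables (K : V -> R) (Km : R).
Hypothesis mK : measurable_S3 K.
Hypothesis Km0 : 0 < Km.
Hypothesis hKm : forall x, S3 x -> 0 < K x <= Km.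
Variable d : R.
Hypothesis d0 : 0 < d.
Hypothesis gap : forall x y, Dbar x y -> d * ip x x <= ip y y.

Lemma ip_mulwK (A : spinor) : L A ->
  ip (mulw K A) A <= Km * ip A A /\ ip (mulw K A) (mulw K A) <= Km * ip (mulw K A) A.
Proof.
move=> lA; have KC x : S3 x -> `|K x| <= Km.
  by move=> /hKm/andP[h1 h2]; rewrite gtr0_norm.
have lK := L2_mulw hg mK KC lA; have p x := dt_ge0 (scmp (A x)).
have j1 := integrable_dt hg lA lA; have j2 := integrable_dt hg lK lA.
rewrite -(int_volZ Km j1) -(int_volZ Km j2); split; apply: int_vol_le => //.
- exact: integrable_volZ.
- move=> x /hKm/andP[h1 h2]; rewrite /mulw scmpZE dtZl ler_wpM2r//.
- exact: integrable_dt.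
- exact: integrable_volZ.
- move=> x /hKm/andP[h1 h2]; rewrite /mulw !scmpZE dtZl [dt (scmp (A x)) _]dtC.
  by rewrite ler_wpM2r// dtZl mulr_ge0// ltW.
Qed.

Lemma solution_bounds (u : V -> R) (psi : spinor) :
  H1 g u -> H12 g psi -> ae_S3 (fun x => 0 < u x) ->
  weak_scalar_eq g K u psi -> weak_dirac_eq g K u psi ->
  ~ (ae_S3 (fun x => u x = 0) /\ ae_S3 (fun x => psi x = 0)) ->
  [/\ 1 <= 2%:R * Km * k0 * H12norm g psi ^+ 2,
      H12norm g psi ^+ 2 <= (1 + Num.sqrt d^-1) * (12%:R * Km * k0 * H1norm g u ^+ 4) &
      1 <= 2%:R * Km * k0 * (12%:R * Km * k0 * H1norm g u ^+ 4)].
Proof.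
move=> h1u h12 upos eqS eqD nontriv.
have hX : h1_gradient g u (wgrad g u) by exact: xgetPex h1u.
have hchi : sqrt_abs_dirac g psi (xget 0 (sqrt_abs_dirac g psi)) by exact: xgetPex h12.
rewrite /H12norm /H1norm L2sqnormE; move: hX eqS hchi.
set X := wgrad g u; set chi := xget 0 _ => hX eqS hchi.
have [lpsi dpsi sgn] := sqrt_abs_dirac_facts hg d0 gap hchi.
have [mu lP [f [sf jf c1 c2]]] := h1_approximation hg hR hX.
have [au adiff] := approx_h1 mu lP sf jf c1 c2.
have [_ [tX _ _] _] := hX.
rewrite L2sqnormE; move: dpsi sgn; set N0 := ip chi chi => dpsi sgn.
have HQ : I (fun x => Defs.ip g X X x + rho x / 8%:R * u x ^+ 2) = ip (enc g u X) (enc g u X).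
  rewrite (ip2_enc hg hR u X u tX); apply: int_vol_ext => x _.
  by rewrite expr2 mulrA.
rewrite HQ; move: lP c2 au; set P := enc g u X => lP c2 au.
(* A zero norm makes u vanish almost everywhere; as u is also positive almost everywhere, every
   property holds almost everywhere, including the vanishing of both fields, which is excluded. *)
have Q0 : 0 < ip P P.
  rewrite lt_neqAle (ipr_ge0 hg P) andbT; apply/eqP => /esym Qz; apply: nontriv.
  have ae0 := int_vol_eq0 w0 (integrable_dt hg lP lP) (fun x _ => dt_ge0 (scmp (P x))) Qz.
  have F : ae_S3 (fun _ : V => False).
    apply: (ae_S3_S2 _ upos ae0) => x xS ux; rewrite /P dt_enc// => E.
    have p1 : 0 < rho x / 8%:R * (u x * u x) by rewrite mulr_gt0 ?mulr_gt0 ?invr_gt0// hR.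
    have p2 : 0 <= sm3 (fun n => fld g X n x * fld g X n x).
      by rewrite /sm3 !addr_ge0// -expr2 sqr_ge0.
    by have := ltr_wpDl p2 p1; rewrite E ltxx.
  by split; apply: (ae_S3_S2 _ F F) => x _ [].
have a0 : 0 < 2%:R * ip P P by rewrite mulr_gt0.
have {}au := au Q0.
pose A := mulw u psi.
have [lA bA] := dominated_product hg K00 hK0 dpsi au a0.
rewrite -/A -/k0 in lA bA.
have KC x : S3 x -> `|K x| <= Km by move=> /hKm/andP[h1 h2]; rewrite gtr0_norm.
have lK : L (mulw K A) := L2_mulw hg mK KC lA.
have [b1 b2] := ip_mulwK lA.
have cstc z : ip (z - z) (z - z) @[n --> \oo] --> (0 : R).
  have -> : ip (z - z) (z - z) = 0.
    by rewrite subrr -[RHS](int_vol0 g); apply: int_vol_ext => x _; rewrite /dt !scmp0 !mul0r !addr0.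
  exact: cvg_cst.
have N00 : 0 <= N0 := ipr_ge0 hg chi.
(* The scalar equation tested with u itself, as the limit of smooth test functions f n. *)
have E2 : ip P P = ip (mulw K A) A.
  have lf n : L (mulw (f n) psi).
    have [B _ hB] := smooth_bounded (sf n).
    exact: (L2_mulw hg (smooth_measurable (sf n)) hB lpsi).
  (* [dominated_product] with the weight f n - u, whose H^1 bound tends to 0. *)
  have cA : ip (mulw (f n) psi - A) (mulw (f n) psi - A) @[n --> \oo] --> (0 : R).
    apply/cvgrPdist_lt => e e0; have kN : 0 < k0 * N0 + 1 by rewrite ltr_wpDl// mulr_ge0// ltW.
    have e'0 : 0 < e / (k0 * N0 + 1) by rewrite divr_gt0.
    have [n0 hn] := adiff _ e'0; exists n0 => // n /= nn.
    rewrite sub0r normrN (ger0_norm (ipr_ge0 hg _)) mulwB.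
    apply: le_lt_trans (dominated_product hg K00 hK0 dpsi (hn n nn) e'0).2 _.
    rewrite mulrAC mulrA ltr_pdivrMr// mulrC ltr_pM2l//.
    by rewrite -/k0 ltrDl.
  have h1 := ipr_cvg hg (fun=> lP) (fun n => L2_enc_smooth hg hR (sf n)) lP lP (cstc P) c2.
  have h2 := ipr_cvg hg (fun=> lK) lf lK lA (cstc (mulw K A)) cA.
  have E : (fun n => ip P (enc g (f n) (gradient g (f n)))) = (fun n => ip (mulw K A) (mulw (f n) psi)).
    apply/funext => n; rewrite (ip2_enc hg hR u X (f n) (tangent_gradient hg (f n))) eqS//.
    apply: int_vol_ext => x _; rewrite dt_mulw /A sqnormE {1}/mulw scmpZE dtZl.
    by move: (dt _ _) => t; ring.
  by move: h1; rewrite E => h1; exact: (cvg_unique (@Rhausdorff R) h1 h2).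
(* Bound the right side of [E2] by Km k0 (2 h^2) N0 and divide by h^2 = [ip P P]. *)
have B1 : 1 <= 2%:R * Km * k0 * N0.
  rewrite -(ler_pM2r Q0) mul1r {1}E2; apply: le_trans b1 _.
  apply: le_trans (ler_wpM2l (ltW Km0) bA) _; rewrite le_eqVlt; apply/orP; left; apply/eqP.
  by move: (ip P P) => q; ring.
have N0p : 0 < N0.
  rewrite lt_neqAle N00 andbT; apply/eqP => z; move: B1; rewrite -z mulr0.
  by rewrite leNgt ltr01.
(* The test spinor is close to sign(D) psi with error N0 / 2: <psi, D phi> is at least N0 / 2 and
   the energy of phi at most 3 N0 / 2. Squaring Cauchy-Schwarz gives N0^2 / 4 <= 3 Km k0 h^4 N0. *)
have B2 : N0 <= 12%:R * Km * k0 * ip P P ^+ 2.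
  have e0 : 0 < N0 / 2%:R by rewrite divr_gt0.
  have [phi [th [Dpt cl dphi]]] := sgn _ e0.
  have [lphi lth [p [sp d1 d2]]] := closureP Dpt.
  have [lup cup] := mulw_closure_cvg au a0 Dpt sp d1 d2.
  have [lu bu] := dominated_product hg K00 hK0 dphi au a0.
  (* The Dirac equation, extended from smooth test spinors to the domain of the closure. *)
  have E3 : ip psi th = ip (mulw K A) (mulw u phi).
    have h1 := ipr_cvg hg (fun=> lpsi) (fun n => L2_dirac hg (sp n)) lpsi lth (cstc psi) d2.
    have h2 := ipr_cvg hg (fun=> lK) lup lK lu (cstc (mulw K A)) cup.
    have E : (fun n => ip psi (dirac g (p n))) = (fun n => ip (mulw K A) (mulw u (p n))).
      apply/funext => n; rewrite -Re_L2dot (eqD _ (sp n)); apply: int_vol_ext => x _.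
      rewrite ReM /= mul0r subr0 Re_herm dt_mulw /A {1}/mulw scmpZE dtZl.
      by move: (dt _ _) => t; ring.
    by move: h1; rewrite E => h1; exact: (cvg_unique (@Rhausdorff R) h1 h2).
  have cs := ipr_cs hg lK lu; rewrite -E3 in cs.
  rewrite -E2 in b2; rewrite -/k0 in bu.
  have cs2 := le_trans cs (ler_pM (ipr_ge0 hg _) (ipr_ge0 hg _) b2 bu).
  have low : N0 / 2%:R <= ip psi th by move: cl; rewrite ler_norml => /andP[+ _]; lra.
  have low2 : (N0 / 2%:R) ^+ 2 <= ip psi th ^+ 2.
    by apply: lerXn2r; rewrite ?nnegrE ?(le_trans (ltW e0) low)// ltW.
  have := le_trans low2 cs2; rewrite -(ler_pM2r N0p).
  have -> : (N0 / 2%:R) ^+ 2 = N0 * (N0 / 4%:R) by field.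
  have -> : Km * ip P P * (k0 * (2%:R * ip P P) * (N0 + N0 / 2%:R)) =
    N0 * (3%:R * Km * k0 * ip P P ^+ 2) by field.
  rewrite ![_ * N0]mulrC !(ler_pM2l N0p).
  by move: (Km * k0); move: (ip P P ^+ 2) => q s; move: (Km) (k0) => r t; lra.
(* Domination with the identity as multiplier, whose constant comes from the spectral gap. *)
have B3 : ip psi psi <= Num.sqrt d^-1 * N0.
  have [_ h] := dpsi; apply: (h id) => //.
    exact: (multiplier_id (fun x _ => ipr_ge0 hg x)).
  move=> x y Dxy; rewrite sqr_sqrtr ?invr_ge0 ?(ltW d0)// mulrC ler_pdivlMr// mulrC.
  exact: gap.
have s1 : Num.sqrt (ip psi psi + N0) ^+ 2 = ip psi psi + N0.
  by rewrite sqr_sqrtr// addr_ge0// (ipr_ge0 hg).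
have s2 : Num.sqrt (ip P P) ^+ 4 = ip P P ^+ 2.
  by rewrite -[4%N]/(2 * 2)%N exprM sqr_sqrtr// (ipr_ge0 hg).
have g0 : 0 <= 2%:R * Km * k0 by rewrite !mulr_ge0 ?ltW.
rewrite s1 s2; split.
- apply: le_trans B1 _; rewrite ler_wpM2l// lerDr; exact: (ipr_ge0 hg).
- apply: (@le_trans _ _ ((1 + Num.sqrt d^-1) * N0)); first by rewrite mulrDl mul1r addrC lerD2l.
  by rewrite ler_wpM2l// addr_ge0// sqrtr_ge0.
- by apply: le_trans B1 _; rewrite ler_wpM2l.
Qed.

End Solutions.

Theorem theorem1p6 (R : realType) (g : 'rV[R]_4 -> 'M[R]_4)
    (K : 'rV[R]_4 -> R)
    (hg : riemannian_metric g)
    (hRs : smooth (scalar_curvature g))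
    (hR : forall x, S3 x -> 0 < scalar_curvature g x)
    (hKs : smooth K)
    (hK : forall x, S3 x -> 0 < K x) :
  exists c C : R,
    [/\ 0 < c, 0 < C &
      forall (u : 'rV[R]_4 -> R) (psi : 'rV[R]_4 -> 'cV[R[i]]_2),
        H1 g u -> H12 g psi -> ae_S3 (fun x => 0 < u x) ->
        weak_scalar_eq g K u psi -> weak_dirac_eq g K u psi ->
        ~ (ae_S3 (fun x => u x = 0) /\ ae_S3 (fun x => psi x = 0)) ->
        [/\ c <= H1norm g u, c <= H12norm g psi,
            c / H1norm g u <= H12norm g psi &
            H12norm g psi <= C * H1norm g u ^+ 2]].
Proof.
have [K0 K00 hK0] := dirac_product hg hR.
have [G G0 hG] := dirac_lower hg hR.
have [Km Km0 hKm] := smooth_bounded hKs.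
have KC x : S3 x -> 0 < K x <= Km.
  by move=> xS; rewrite hK//=; exact: le_trans (ler_norm _) (hKm x xS).
have d0 : 0 < G^-1 by rewrite invr_gt0.
(* The gap of [dirac_lower] on smooth spinors, extended to the closure with the identity as
   multiplier. *)
have gap x y : dirac_closure g x y -> G^-1 * ipr g x x <= ipr g y y.
  move=> Dxy; rewrite mulrC ler_pdivrMr// mulrC.
  apply: (closure_bound hg (multiplier_id (fun x _ => ipr_ge0 hg x)) (ltW G0)) Dxy => phi sp.
  exact: (hG phi sp).1.
have s0 : 0 < Num.sqrt K0 by rewrite sqrtr_gt0.
have a1 : 0 < 2%:R * Km * Num.sqrt K0 by rewrite !mulr_gt0.
have a2 : 0 < 12%:R * Km * Num.sqrt K0 by rewrite !mulr_gt0.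
have g0 : 0 < 1 + Num.sqrt G^-1^-1 by rewrite ltr_wpDr ?sqrtr_ge0.
have [c [C [c0 C0 h]]] := final_arithmetic a1 a2 g0.
exists c, C; split=> // u psi h1 h2 upos eqS eqD nontriv.
have [b1 b2 b3] := solution_bounds hg hR K00 hK0 (smooth_measurable hKs) Km0 KC d0 gap
  h1 h2 upos eqS eqD nontriv.
by apply: h => //; exact: sqrtr_ge0.
Qed.
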